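(* Let $\mathbb H=\{(z_1,z_2)\in\mathbb C^2:|z_1|<|z_2|<1\}$. There exists a solution operator $T$, defined on $\bar\partial$-closed $(0,1)$ forms on $\mathbb H$ that lie in $L^p(\mathbb H)$ for some $4\le p<\infty$, such that for every $p$ with $4\le p<\infty$ and every $\bar\partial$-closed $(0,1)$ form $\mathbf f\in L^p(\mathbb H)$, the function $T\mathbf f$ belongs to $L^p(\mathbb H)$ and $u=T\mathbf f$ solves $\bar\partial u=\mathbf f$ on $\mathbb H$. Moreover, for each such $p$ there exists a constant $C$ depending only on $p$ such that for every $\bar\partial$-closed $(0,1)$ form $\mathbf f\in L^p(\mathbb H)$, $$\|T\mathbf f\|_{L^p(\mathbb H)}\le C\,\|\mathbf f\|_{L^p(\mathbb H)}.$$
   Context: $L^p(\mathbb H)$ is taken with respect to Lebesgue measure. A $(0,1)$ form $\mathbf f=f_1\,d\bar z_1+f_2\,d\bar z_2$ is in $L^p(\mathbb H)$ if $f_1,f_2\in L^p(\mathbb H)$, with $\|\mathbf f\|_{L^p(\mathbb H)}^p=\|f_1\|_{L^p(\mathbb H)}^p+\|f_2\|_{L^p(\mathbb H)}^p$. Both $\bar\partial$-closedness of $\mathbf f$ and the equation $\bar\partial u=\mathbf f$ are understood in the sense of distributions on $\mathbb H$. *)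

(* Defs.v *)
From HB Require Import structures.
From mathcomp Require Import all_boot all_order all_algebra.
From mathcomp Require Import all_classical all_reals all_analysis.
From mathcomp Require Import complex.

Set Implicit Arguments.
Unset Strict Implicit.
Unset Printing Implicit Defensive.
Import Order.TTheory GRing.Theory Num.Theory.
Import numFieldNormedType.Exports.
Import ComplexField.Normc.

Local Open Scope classical_set_scope.
Local Open Scope ring_scope.
Local Open Scope complex_scope.

(* ((x1, y1), (x2, y2)) stands for (z1, z2) = (x1 + i y1, x2 + i y2).  The real
   coordinates provide the normed module structure over R used for partial
   derivatives. *)
Notation C2 R := ((R * R) * (R * R))%type.

Definition cplx (R : realType) (w : R * R) : R[i] := w.1 +i* w.2.

Definition hartogs (R : realType) : set (C2 R) :=
  [set z | normc (cplx z.1) < normc (cplx z.2) /\ normc (cplx z.2) < 1].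

(* [measurableTypeR R] is the alias of R on whose Borel sigma-algebra
   [lebesgue_measure] is defined. *)
Notation mC R := (measurableTypeR R * measurableTypeR R)%type.
Notation mC2 R := (mC R * mC R)%type.

(* The library's sigma-finiteness instance for products is shadowed by the one
   for products of subprobabilities, hence the instances below. *)
Lemma sigma_finite_product (d1 d2 : measure_display) (T1 : measurableType d1)
    (T2 : measurableType d2) (R : realType)
    (m1 : {sigma_finite_measure set T1 -> \bar R})
    (m2 : {sigma_finite_measure set T2 -> \bar R}) :
  sigma_finite [set: T1 * T2] (m1 \x m2)%E.
Proof.
have /sigma_finiteP[F [TF ndF Foo]] := sigma_finiteT m1.
have /sigma_finiteP[G [TG ndG Goo]] := sigma_finiteT m2.
exists (fun n => F n `*` G n).
  rewrite -setXTT TF TG predeqE => -[x y]; split.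
    move=> [/= [n _ Fnx] [k _ Gky]]; exists (maxn n k) => //; split.
    - by move: x Fnx; exact/subsetPset/ndF/leq_maxl.
    - by move: y Gky; exact/subsetPset/ndG/leq_maxr.
  by move=> [n _ []/= ? ?]; split; exists n.
move=> k; have [? ?] := Foo k; have [? ?] := Goo k.
split; first exact: measurableX.
by rewrite product_measure1E// lte_mul_pinfty// ge0_fin_numE.
Qed.

Definition lebesgueC (R : realType) : set (mC R) -> \bar R :=
  (@lebesgue_measure R \x @lebesgue_measure R)%E.

HB.instance Definition _ (R : realType) := Measure.on (@lebesgueC R).
HB.instance Definition _ (R : realType) :=
  Measure_isSigmaFinite.Build _ _ _ (@lebesgueC R)
    (sigma_finite_product (@lebesgue_measure R) (@lebesgue_measure R)).

Definition lebesgueC2 (R : realType) : set (mC2 R) -> \bar R :=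
  (@lebesgueC R \x @lebesgueC R)%E.

HB.instance Definition _ (R : realType) := Measure.on (@lebesgueC2 R).
HB.instance Definition _ (R : realType) :=
  Measure_isSigmaFinite.Build _ _ _ (@lebesgueC2 R)
    (sigma_finite_product (@lebesgueC R) (@lebesgueC R)).

(* Functions are total on C^2, but only their values on [hartogs] matter.
   Measurability is Borel measurability on [hartogs]; every Lebesgue measurable
   function has such a representative. *)

Definition LpnormH (R : realType) (p : R) (u : C2 R -> R[i]) : \bar R :=
  'N[@lebesgueC2 R]_(p%:E)[(fun z => (normc (u z))%:E) \_ (@hartogs R)]%E.

Definition inLpH (R : realType) (p : R) (u : C2 R -> R[i]) : Prop :=
  [/\ measurable_fun (@hartogs R : set (mC2 R)) (fun z => complex.Re (u z)),
      measurable_fun (@hartogs R : set (mC2 R)) (fun z => complex.Im (u z)) &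
      (LpnormH p u < +oo)%E].

Definition ae_eqH (R : realType) (u v : C2 R -> R[i]) : Prop :=
  ae_eq (@lebesgueC2 R) (@hartogs R) u v.

(* The form f 0 dzbar_1 + f 1 dzbar_2. *)
Definition form01 (R : realType) : Type := 'I_2 -> C2 R -> R[i].

Definition inLpH_form (R : realType) (p : R) (f : form01 R) : Prop :=
  forall j, inLpH p (f j).

Definition LpnormH_form (R : realType) (p : R) (f : form01 R) : \bar R :=
  ((\sum_(j < 2) LpnormH p (f j) `^ p) `^ p^-1)%E.

Definition ae_eqH_form (R : realType) (f g : form01 R) : Prop :=
  forall j, ae_eqH (f j) (g j).

Definition xdir (R : realType) (j : 'I_2) : C2 R :=
  if j == 0 then ((1, 0), (0, 0)) else ((0, 0), (1, 0)).

Definition ydir (R : realType) (j : 'I_2) : C2 R :=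
  if j == 0 then ((0, 1), (0, 0)) else ((0, 0), (0, 1)).

Fixpoint Ck (R : realType) (k : nat) (g : C2 R -> R) : Prop :=
  if k is k'.+1 then
    continuous g /\
    forall j, [/\ forall z, derivable g z (xdir R j),
                  forall z, derivable g z (ydir R j),
                  Ck k' (fun z => 'D_(xdir R j) g z) &
                  Ck k' (fun z => 'D_(ydir R j) g z)]
  else continuous g.

Definition smooth (R : realType) (phi : C2 R -> R[i]) : Prop :=
  forall k, Ck k (fun z => complex.Re (phi z)) /\
            Ck k (fun z => complex.Im (phi z)).

Definition support (R : realType) (phi : C2 R -> R[i]) : set (C2 R) :=
  closure [set z | phi z != 0].

Definition test_funH (R : realType) (phi : C2 R -> R[i]) : Prop :=
  [/\ smooth phi, compact (support phi) & support phi `<=` @hartogs R].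

Definition cderive (R : realType) (v : C2 R) (phi : C2 R -> R[i]) :
    C2 R -> R[i] := fun z =>
  'D_v (fun w => complex.Re (phi w)) z +i* 'D_v (fun w => complex.Im (phi w)) z.

(* The Wirtinger operator d/dzbar_j = (d/dx_j + i d/dy_j) / 2. *)
Definition dzbar (R : realType) (j : 'I_2) (phi : C2 R -> R[i]) :
    C2 R -> R[i] := fun z =>
  (cderive (xdir R j) phi z + 'i * cderive (ydir R j) phi z) / 2.

Definition integralH (R : realType) (u : C2 R -> R[i]) : R[i] :=
  (\int[@lebesgueC2 R]_(z in @hartogs R) complex.Re (u z))%R +i*
  (\int[@lebesgueC2 R]_(z in @hartogs R) complex.Im (u z))%R.

(* A distribution on the Hartogs triangle is represented by the functional it
   induces; only its values at test functions matter, see [distr_eq]. *)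
Definition distr (R : realType) : Type := (C2 R -> R[i]) -> R[i].

Definition distr_of (R : realType) (u : C2 R -> R[i]) : distr R :=
  fun phi => integralH (fun z => u z * phi z).

Definition distr_dzbar (R : realType) (j : 'I_2) (L : distr R) : distr R :=
  fun phi => - L (dzbar j phi).

Definition distr_eq (R : realType) (L M : distr R) : Prop :=
  forall phi, test_funH phi -> L phi = M phi.

(* d f_2 / dzbar_1 = d f_1 / dzbar_2, with f_1 = f 0 and f_2 = f 1. *)
Definition dbar_closed (R : realType) (f : form01 R) : Prop :=
  distr_eq (distr_dzbar 0 (distr_of (f 1))) (distr_dzbar 1 (distr_of (f 0))).

Definition dbar_solution (R : realType) (u : C2 R -> R[i]) (f : form01 R) :
    Prop :=
  forall j, distr_eq (distr_dzbar j (distr_of u)) (distr_of (f j)).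

Definition closedLpH_form (R : realType) (p : R) (f : form01 R) : Prop :=
  inLpH_form p f /\ dbar_closed f.

(* Main.v *)
(** In the coordinates [shear (w1, w2) = (w1 w2, w2)] the Hartogs triangle becomes
    the product of the disc and the punctured disc, Lebesgue measure acquires
    the weight [|w2|^2], and the equation becomes [dbar v = g] with
    [g1 = conj w2 f1] and [g2 = conj w1 f1 + f2].  It is solved by
    [v = (K g1 + P (W g2)) / pi], where [W] is the Cauchy transform in [w2],
    [P] is [pi] times the weighted Bergman projection in [w1], with kernel
    [2 (1 - |x|^2) / (1 - w conj x)^3], and [K], with kernel
    [((1 - |x|^2) / (1 - w conj x))^2 / (w - x)], satisfies
    [K (dv/dconj w1) = pi v - P v].  Schur's test bounds [K] and [P] on [L^p]
    of the disc and, once the weight [|w2|^(2/p)] is absorbed into its kernel,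
    [W] on [L^p(|w2|^2)].

    To verify [dbar v = g] weakly, [K] and [P] are moved onto the test
    function.  This destroys compactness of the support in [w1], so that the
    closedness of [f] does not apply directly: [1 - |x|^2] is first replaced by
    the positive part of [e - |x|^2] with [e < 1], the resulting functions are
    mollified, and [e] tends to [1]. *)
Require Import Defs.
From HB Require Import structures.
From mathcomp Require Import all_boot all_order all_algebra.
From mathcomp Require Import all_classical all_reals all_analysis.
From mathcomp Require Import complex ring lra.
Set Implicit Arguments.
Unset Strict Implicit.
Unset Printing Implicit Defensive.
Import Order.TTheory GRing.Theory Num.Theory.
Import numFieldNormedType.Exports.
Import ComplexField.Normc.
Local Open Scope classical_set_scope.
Local Open Scope ring_scope.
Local Open Scope complex_scope.
Import measurable_realfun.

(** * Affine changes of variable on the line *)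

Section affine_line.
Context {R : realType}.
Local Notation mu := (@lebesgue_measure R).
Local Open Scope ereal_scope.

(** The factor $(1-|x|^2)^2$ makes the kernel of $K$ vanish on the unit circle, so the
    Cauchy-Pompeiu formula leaves no boundary term. Its price is the derivative of the factor in
    $\bar x$, which is divisible by $w-x$ and becomes the kernel of $P$. With $\partial_j$ for the
    derivative in $\bar w_j$, the equation in $w_1$ holds since $\partial_1 K=\pi$ and $P$ takes
    values in holomorphic functions. Closedness enters in the equation in $w_2$: formally
    $\partial_2 Kg_1=K\partial_2 g_1=K\partial_1 g_2=\pi g_2-Pg_2$, and $\partial_2 P(Wg_2)=Pg_2$
    restores the lost term. The exchange $\partial_2 g_1=\partial_1 g_2$ is only available against
    test functions supported in the Hartogs triangle, which is what forces the cutoffs.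

    The range of $p$ enters twice: Schur's test for $W$ meets singularities of order $1+2/(p-1)$,
    which must be below 2, and $p\ge 4$ makes the sheared form integrable without weight, so that
    all duality arguments take place in $L^1$. Planar estimates are reduced to products of line
    integrals instead of polar coordinates. The formula for the solution does not involve $p$, hence
    one operator for all exponents. *)

Lemma lebesgue_measure_affine (a b : R) (A : set (measurableTypeR R)) :
  a != 0%R -> measurable A ->
  mu A = `|a|%:E * mu ((fun x : measurableTypeR R => a * x + b)%R @^-1` A).
Proof.
move=> a0 mA.
have mf : measurable_fun [set: measurableTypeR R]
    (fun x : measurableTypeR R => (a * x + b)%R : measurableTypeR R).
  by apply: measurable_funD => //; apply: measurable_funM.
pose nu : {measure set (measurableTypeR R) -> \bar R} :=
  mscale (NngNum (normr_ge0 a)) (pushforward mu (fun x : measurableTypeR R => (a * x + b)%R : measurableTypeR R)).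
(* Uniqueness of Lebesgue measure reduces the claim to intervals []u, v]]; for [a < 0] the preimage
   is closed on the other side, which leaves its length unchanged. *)
rewrite (@lebesgue_measure_unique R (nu mf)) // => _ [] [u v] _ <-.
rewrite [RHS](_ : _ = `|a|%:E * mu ((fun x => a * x + b)%R @^-1` `]u, v])) //.
have na : `|a|%R != 0%R by rewrite normr_eq0.
case: (ltgtP a 0%R) a0 => // a0 _.
- have -> : (fun x => (a * x + b)%R) @^-1` `]u, v] = `[((v - b) / a)%R, ((u - b) / a)%R[%classic.
    apply/seteqP; split => x; rewrite /= !in_itv/= => /andP[].
      by rewrite ltr_ndivlMr// ler_ndivrMr// => h1 h2; apply/andP; split; nra.
    by rewrite ltr_ndivlMr// ler_ndivrMr// => h1 h2; apply/andP; split; nra.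
  rewrite !lebesgue_measure_itv/= !lte_fin ltr_ndivrMr// divfK ?lt_eqF//.
  rewrite ltrD2r; case: ifP => _; last by rewrite mule0.
  rewrite ltr0_norm// -!EFinB -EFinM; congr (_%:E); field; by rewrite lt_eqF.
- have -> : (fun x => (a * x + b)%R) @^-1` `]u, v] = `]((u - b) / a)%R, ((v - b) / a)%R]%classic.
    apply/seteqP; split => x; rewrite /= !in_itv/= => /andP[].
      by rewrite ltr_pdivrMr// ler_pdivlMr// => h1 h2; apply/andP; split; nra.
    by rewrite ltr_pdivrMr// ler_pdivlMr// => h1 h2; apply/andP; split; nra.
  rewrite !lebesgue_measure_itv/= !lte_fin ltr_pdivrMr// divfK ?gt_eqF//.
  rewrite ltrD2r; case: ifP => _; last by rewrite mule0.
  rewrite gtr0_norm// -!EFinB -EFinM; congr (_%:E); field; by rewrite gt_eqF.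
Qed.
End affine_line.

Lemma integral_affine {R : realType} (a b : R) (f : measurableTypeR R -> \bar R) :
  a != 0%R -> measurable_fun setT f -> (forall x, 0 <= f x)%E ->
  (\int[@lebesgue_measure R]_x f x = `|a|%:E * \int[@lebesgue_measure R]_x f (a * x + b)%R)%E.
Proof.
move=> a0 mf f0.
have mt : measurable_fun [set: measurableTypeR R]
    (fun x : measurableTypeR R => (a * x + b)%R : measurableTypeR R).
  by apply: measurable_funD => //; apply: measurable_funM.
pose nu : {measure set (measurableTypeR R) -> \bar R} :=
  mscale (NngNum (normr_ge0 a)) (pushforward (@lebesgue_measure R) (fun x : measurableTypeR R => (a * x + b)%R : measurableTypeR R)).
rewrite (@eq_measure_integral _ _ _ _ (nu mt)); last first.
  by move=> A mA _; exact: (lebesgue_measure_affine b a0 mA).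
rewrite ge0_integral_mscale//= ge0_integral_pushforward//.
Qed.

(** * Measurability of continuous functions on products *)

Lemma measurable_fun_caratheodory d (T : measurableType d) {R : realType}
    (f : T * measurableTypeR R -> R) :
  (forall y, measurable_fun setT (fun x => f (x, y))) ->
  (forall x, continuous (fun y : R => f (x, y))) ->
  measurable_fun setT f.
Proof.
move=> mf cf.
(* [r n] rounds down to the grid of mesh [1 / n.+1]. Preimages under [f (x, r n y)] are countable
   unions of rectangles, and [f] is the limit of these functions by continuity in [y]. *)
pose r (n : nat) (y : R) : R := ((Num.floor (y * n.+1%:R))%:~R / n.+1%:R)%R.
apply: (@measurable_fun_cvg _ _ _ _ (fun n xy => f (xy.1, r n xy.2))).
  move=> n _ Y mY.
  rewrite [X in measurable X](_ : _ = \bigcup_(k : int)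
    (((fun x => f (x, k%:~R / n.+1%:R)%R) @^-1` Y) `*`
     ([set y | k%:~R <= y * n.+1%:R < (k + 1)%:~R]%R : set (measurableTypeR R)))).
    apply: countable_bigcupT_measurable => [|k]; [exact: countableP|apply: measurableX].
      by rewrite -[X in measurable X]setTI; exact: mf.
    have := @measurable_itv R `[(k%:~R / n.+1%:R)%R, ((k + 1)%:~R / n.+1%:R)%R[.
    congr (measurable _); apply/seteqP; split => y/=;
      by rewrite in_itv/= ler_pdivrMr// ltr_pdivlMr.
  apply/seteqP; split => -[x y]/=.
    move=> [_ Yf]; exists (Num.floor (y * n.+1%:R)) => //; split => //=.
    by rewrite floor_le_tmp floorD1_gt.
  move=> [k _ [/= h /andP[h1 h2]]]; split => //.
  by rewrite /r (@floor_def _ _ k) // h1 h2.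
move=> [x y] _ /=.
have : r n y @[n --> \oo] --> y.
  apply/cvgrPdist_le => e e0; near=> n.
  have n0 : (0 < n.+1%:R :> R)%R by [].
  have -> : (y - r n y = (y * n.+1%:R - (Num.floor (y * n.+1%:R))%:~R) / n.+1%:R)%R.
    by rewrite /r mulrBl mulfK ?gt_eqF.
  rewrite normrM (ger0_norm (x := _^-1)) ?invr_ge0 ?ler0n//.
  have h1 := floor_le_tmp (y * n.+1%:R); have h2 := floorD1_gt (y * n.+1%:R).
  rewrite ger0_norm ?subr_ge0// ler_pdivrMr//.
  apply: (@le_trans _ _ 1%R); first by move: h2; rewrite intrD; lra.
  rewrite -ler_pdivrMl// mulr1.
  near: n; exists (Num.bound e^-1) => // m /= hm.
  apply: (@le_trans _ _ (Num.bound e^-1)%:R).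
    by rewrite ltW// archi_boundP// invr_ge0 ltW.
  by rewrite ler_nat (leq_trans hm).
move=> h; exact: (@cvg_comp _ _ _ (fun n => r n y) (fun y : R => f (x, y)) _ _ _ h (cf x y)).
Unshelve. all: end_near. Qed.

Lemma continuous_pair (T U V : topologicalType) (f : T -> U) (g : T -> V) :
  continuous f -> continuous g -> continuous (fun x => (f x, g x)).
Proof. by move=> cf cg x; apply: (@cvg_pair _ _ _ _ (nbhs (f x)) (nbhs (g x)) _ _ _ f g (cf x) (cg x)). Qed.

Lemma continuous_compT (T U V : topologicalType) (f : T -> U) (g : U -> V) :
  continuous f -> continuous g -> continuous (fun x => g (f x)).
Proof. by move=> cf cg x; apply: continuous_comp; [exact: cf|exact: cg]. Qed.

(** The sigma-algebra of [mC R] is the product one; the slicewise criterion connects it with the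
    topology. *)
Lemma measurable_continuousC {R : realType} (f : R * R -> R) :
  continuous f -> measurable_fun [set: mC R] (f : mC R -> R).
Proof.
move=> cf; apply: measurable_fun_caratheodory => [y|x].
  apply: continuous_measurable_fun.
  apply: (@continuous_compT R (R * R)%type R (fun x => (x, y)) f) => //.
  by apply: continuous_pair => x; [exact: cvg_id|exact: cvg_cst].
apply: (@continuous_compT R (R * R)%type R (fun y => (x, y)) f) => //.
by apply: continuous_pair => y; [exact: cvg_cst|exact: cvg_id].
Qed.

Lemma measurable_continuousC2 {R : realType} (f : C2 R -> R) :
  continuous f -> measurable_fun [set: mC2 R] (f : mC2 R -> R).
Proof.
move=> cf.
(* Left-nested pairs allow the real variables to be split off one at a time. *)
pose g (x : mC R * measurableTypeR R * measurableTypeR R) : R :=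
  f (x.1.1, (x.1.2, x.2)).
have cid (T : topologicalType) : continuous (fun x : T => x) by move=> x; exact: cvg_id.
have ccst (T U : topologicalType) (y : U) : continuous (fun x : T => y) by move=> x; exact: cvg_cst.
have mg : measurable_fun setT g.
  apply: measurable_fun_caratheodory => [y4|[x y3]]; last first.
    apply: (@continuous_compT R (C2 R) R (fun y => (x, (y3, y)) : C2 R) f) => //.
    by do 2!apply: continuous_pair => //.
  apply: (@measurable_fun_caratheodory _ _ _ (fun x => g (x, y4))) => [y3|x]; last first.
    apply: (@continuous_compT R (C2 R) R (fun y => (x, (y, y4)) : C2 R) f) => //.
    by do 2!apply: continuous_pair => //.
  apply: (@measurable_continuousC _ (fun x => g (x, y3, y4))).
  apply: (@continuous_compT (R * R)%type (C2 R) R (fun y => (y, (y3, y4)) : C2 R) f) => //.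
  by apply: continuous_pair.
rewrite [X in measurable_fun _ X](_ : _ = g \o (fun z : mC2 R => (z.1, z.2.1, z.2.2))).
  apply: measurableT_comp => //.
  apply: measurable_fun_pair; last exact: measurableT_comp.
  by apply: measurable_fun_pair => //; exact: measurableT_comp.
by apply/funext => -[[? ?] [? ?]].
Qed.

(** * Real and imaginary parts, conjugation and the modulus *)

Definition ofc {R : realType} (x : R[i]) : R * R := (complex.Re x, complex.Im x).

Arguments ofc {R} x%_ring_scope.

Lemma ofcK {R : realType} (x : R[i]) : cplx (ofc x) = x. Proof. by case: x. Qed.
Lemma cplxK {R : realType} (w : R * R) : ofc (cplx w) = w. Proof. by case: w. Qed.
Lemma ReM {R : realType} (x y : R[i]) : complex.Re (x * y) = complex.Re x * complex.Re y - complex.Im x * complex.Im y.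
Proof. by case: x y => ? ? []. Qed.
Lemma ImM {R : realType} (x y : R[i]) : complex.Im (x * y) = complex.Re x * complex.Im y + complex.Im x * complex.Re y.
Proof. by case: x y => ? ? []. Qed.
Lemma ReD {R : realType} (x y : R[i]) : complex.Re (x + y) = complex.Re x + complex.Re y.
Proof. by case: x y => ? ? []. Qed.
Lemma ImD {R : realType} (x y : R[i]) : complex.Im (x + y) = complex.Im x + complex.Im y.
Proof. by case: x y => ? ? []. Qed.
Lemma ReN {R : realType} (x : R[i]) : complex.Re (- x) = - complex.Re x.
Proof. by case: x. Qed.
Lemma ImN {R : realType} (x : R[i]) : complex.Im (- x) = - complex.Im x.
Proof. by case: x. Qed.
Lemma ReV {R : realType} (x : R[i]) :
  complex.Re x^-1 = complex.Re x / (complex.Re x ^+ 2 + complex.Im x ^+ 2).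
Proof. by case: x. Qed.
Lemma ImV {R : realType} (x : R[i]) :
  complex.Im x^-1 = - complex.Im x / (complex.Re x ^+ 2 + complex.Im x ^+ 2).
Proof. by case: x => a b /=; rewrite mulNr. Qed.
Lemma ReJ {R : realType} (x : R[i]) : complex.Re (x^*) = complex.Re x.
Proof. by case: x. Qed.
Lemma ImJ {R : realType} (x : R[i]) : complex.Im (x^*) = - complex.Im x.
Proof. by case: x. Qed.
Lemma complexRI {R : realType} (x y : R[i]) :
  complex.Re x = complex.Re y -> complex.Im x = complex.Im y -> x = y.
Proof. by case: x y => ? ? [? ?] /= -> ->. Qed.

Lemma normcE2 {R : realType} (x : R[i]) : normc x = Num.sqrt (complex.Re x ^+ 2 + complex.Im x ^+ 2).
Proof. by case: x. Qed.
Lemma sqr_normcE {R : realType} (x : R[i]) : normc x ^+ 2 = complex.Re x ^+ 2 + complex.Im x ^+ 2.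
Proof. by rewrite normcE2 sqr_sqrtr// addr_ge0// sqr_ge0. Qed.
Lemma normc_ge0 {R : realType} (x : R[i]) : 0 <= normc x.
Proof. by rewrite normcE2 sqrtr_ge0. Qed.
Lemma normc_eq0 {R : realType} (x : R[i]) : (normc x == 0) = (x == 0).
Proof. by apply/eqP/eqP => [/eq0_normc//|->]; rewrite normc0. Qed.
Lemma normc_gt0 {R : realType} (x : R[i]) : (0 < normc x) = (x != 0).
Proof. by rewrite lt_def normc_ge0 andbT normc_eq0. Qed.
Lemma normcJE {R : realType} (x : R[i]) : normc (x^*) = normc x.
Proof. by rewrite !normcE2 ReJ ImJ sqrrN. Qed.
Lemma normc_real {R : realType} (x : R) : normc x%:C = `|x|.
Proof. by rewrite normcE2 /= expr0n addr0 sqrtr_sqr. Qed.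
Lemma normcX {R : realType} (x : R[i]) n : normc (x ^+ n) = normc x ^+ n.
Proof. by elim: n => [|n IH]; rewrite ?normc1// !exprS normcM IH. Qed.
Lemma ler_Re_normc {R : realType} (x : R[i]) : `|complex.Re x| <= normc x.
Proof. by rewrite -sqrtr_sqr normcE2 ler_wsqrtr// lerDl sqr_ge0. Qed.
Lemma ler_Im_normc {R : realType} (x : R[i]) : `|complex.Im x| <= normc x.
Proof. by rewrite -sqrtr_sqr normcE2 ler_wsqrtr// lerDr sqr_ge0. Qed.
Lemma ler_normc_ReIm {R : realType} (x : R[i]) :
  normc x <= `|complex.Re x| + `|complex.Im x|.
Proof.
rewrite -(@ler_pXn2r _ 2) ?nnegrE ?normc_ge0 ?addr_ge0//.
by rewrite sqr_normcE sqrrD !real_normK ?num_real// lerD2r lerDl mulrn_wge0// mulr_ge0.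
Qed.
Lemma normcB {R : realType} (x y : R[i]) : normc (x - y) = normc (y - x).
Proof. by rewrite -normcN opprB. Qed.
Lemma ler_normcB {R : realType} (x y : R[i]) : normc x - normc y <= normc (x - y).
Proof. by rewrite lerBlDr (le_trans _ (le_normcD _ _))// subrK. Qed.
Lemma mulcJ {R : realType} (x : R[i]) : x * x^* = (normc x ^+ 2)%:C.
Proof. by rewrite sqr_normcE; apply: complexRI; rewrite ?ReM ?ImM ReJ ImJ/=; ring. Qed.

Lemma measurable_funVr {R : realType} d (T : measurableType d) (f : T -> R) :
  measurable_fun setT f -> measurable_fun setT (fun x => (f x)^-1).
Proof.
move=> mf; apply: (@measurableT_comp _ _ _ _ _ _ (fun x : R => x^-1)) mf.
(* The value at 0 is the convention [0^-1 = 0]; it is split off because inversion is continuous only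
   elsewhere. *)
rewrite (_ : (fun x : R => x^-1) = (fun x => if x == 0 then 0 else x^-1)); last first.
  by apply/funext => x; case: eqP => // ->; rewrite invr0.
apply: measurable_fun_if => //; first exact: measurable_fun_eqr.
rewrite setTI; apply: open_continuous_measurable_fun.
  rewrite (_ : _ @^-1` _ = ~` [set 0 : R]); last first.
    by apply/seteqP; split => x /= => [/negbT/eqP|/eqP/negbTE].
  by rewrite openC; exact: closed_eq.
by move=> x; rewrite inE /= => /negbT x0; exact: inv_continuous.
Qed.

(** * Measurable complex functions, componentwise as in [inLpH] *)

Definition cmeas {R : realType} d (T : measurableType d) (f : T -> R[i]) :=
  measurable_fun setT (fun x => complex.Re (f x)) /\
  measurable_fun setT (fun x => complex.Im (f x)).

Section cmeas_theory.
Context {R : realType} d (T : measurableType d).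
Implicit Types f g : T -> R[i].

Lemma cmeas_cst (c : R[i]) : cmeas (fun _ : T => c).
Proof. by split; exact: measurable_cst. Qed.
Lemma cmeasD f g : cmeas f -> cmeas g -> cmeas (fun x => f x + g x).
Proof.
move=> [f1 f2] [g1 g2]; split.
  by under eq_fun do rewrite ReD; exact: measurable_funD.
by under eq_fun do rewrite ImD; exact: measurable_funD.
Qed.
Lemma cmeasN f : cmeas f -> cmeas (fun x => - f x).
Proof.
move=> [f1 f2]; split.
  by under eq_fun do rewrite ReN; exact: measurable_funN.
by under eq_fun do rewrite ImN; exact: measurable_funN.
Qed.
Lemma cmeasB f g : cmeas f -> cmeas g -> cmeas (fun x => f x - g x).
Proof. by move=> mf mg; apply: cmeasD => //; exact: cmeasN. Qed.
Lemma cmeasM f g : cmeas f -> cmeas g -> cmeas (fun x => f x * g x).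
Proof.
move=> [f1 f2] [g1 g2]; split.
  by under eq_fun do rewrite ReM; apply: measurable_funB; exact: measurable_funM.
by under eq_fun do rewrite ImM; apply: measurable_funD; exact: measurable_funM.
Qed.
Lemma cmeasJ f : cmeas f -> cmeas (fun x => (f x)^*).
Proof.
move=> [f1 f2]; split; first by under eq_fun do rewrite ReJ.
by under eq_fun do rewrite ImJ; exact: measurable_funN.
Qed.
Lemma cmeasV f : cmeas f -> cmeas (fun x => (f x)^-1).
Proof.
move=> [f1 f2]; have h : measurable_fun setT (fun x => (complex.Re (f x) ^+ 2 + complex.Im (f x) ^+ 2)^-1).
  by apply: measurable_funVr; apply: measurable_funD; exact: measurable_funX.
split; first by under eq_fun do rewrite ReV; exact: measurable_funM.
under eq_fun do rewrite ImV; apply: measurable_funM => //; exact: measurable_funN.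
Qed.
Lemma cmeasX f n : cmeas f -> cmeas (fun x => f x ^+ n).
Proof.
move=> mf; elim: n => [|n IH]; first exact: cmeas_cst.
by under eq_fun do rewrite exprS; exact: cmeasM.
Qed.
Lemma cmeas_real (h : T -> R) : measurable_fun setT h -> cmeas (fun x => (h x)%:C).
Proof. by move=> mh; split => //; exact: measurable_cst. Qed.
Lemma measurable_normc f : cmeas f -> measurable_fun setT (fun x => normc (f x)).
Proof.
move=> [f1 f2]; under eq_fun do rewrite normcE2.
apply: (@measurableT_comp _ _ _ _ _ _ (@Num.sqrt R)).
  by apply: continuous_measurable_fun; exact: sqrt_continuous.
by apply: measurable_funD; exact: measurable_funX.
Qed.
Lemma measurable_ofc f : cmeas f -> measurable_fun setT (fun x => ofc (f x) : mC R).
Proof. by move=> [f1 f2]; exact: measurable_fun_pair. Qed.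
Lemma cmeas_if (b : T -> bool) f g : measurable_fun setT b -> cmeas f -> cmeas g ->
  cmeas (fun x => if b x then f x else g x).
Proof.
move=> mb [f1 f2] [g1 g2]; split.
  by under eq_fun do rewrite (fun_if (@complex.Re R)); exact: measurable_fun_ifT.
by under eq_fun do rewrite (fun_if (@complex.Im R)); exact: measurable_fun_ifT.
Qed.
Lemma cmeas_cplx (h : T -> mC R) : measurable_fun setT h -> cmeas (fun x => cplx (h x)).
Proof. by move=> mh; split; [exact: (measurableT_comp (@measurable_fst _ _ _ _) mh)|exact: (measurableT_comp (@measurable_snd _ _ _ _) mh)]. Qed.
End cmeas_theory.

Lemma cmeas_comp {R : realType} d d' (T : measurableType d) (T' : measurableType d')
    (f : T' -> R[i]) (h : T -> T') :
  cmeas f -> measurable_fun setT h -> cmeas (fun x => f (h x)).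
Proof.
by move=> [f1 f2] mh; split; [exact: (measurableT_comp f1 mh)|exact: (measurableT_comp f2 mh)].
Qed.

(** * Tonelli's theorem and changes of variable in the complex plane *)

Section change_of_variables.
Context {R : realType}.
Local Notation mu := (@lebesgue_measure R).
Local Notation muC := (@lebesgueC R).
Local Notation muC2 := (@lebesgueC2 R).
Local Open Scope ereal_scope.

Lemma tonelliC (f : mC R -> \bar R) : measurable_fun setT f -> (forall x, 0 <= f x) ->
  \int[muC]_z f z = \int[mu]_x \int[mu]_y f (x, y).
Proof. by move=> mf f0; exact: (@fubini_tonelli1 _ _ _ _ _ mu mu f mf f0). Qed.
Lemma tonelliC' (f : mC R -> \bar R) : measurable_fun setT f -> (forall x, 0 <= f x) ->
  \int[muC]_z f z = \int[mu]_y \int[mu]_x f (x, y).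
Proof. by move=> mf f0; exact: (@fubini_tonelli2 _ _ _ _ _ mu mu f mf f0). Qed.
Lemma tonelliC2 (f : mC2 R -> \bar R) : measurable_fun setT f -> (forall x, 0 <= f x) ->
  \int[muC2]_z f z = \int[muC]_x \int[muC]_y f (x, y).
Proof. by move=> mf f0; exact: (@fubini_tonelli1 _ _ _ _ _ muC muC f mf f0). Qed.
Lemma tonelliC2' (f : mC2 R -> \bar R) : measurable_fun setT f -> (forall x, 0 <= f x) ->
  \int[muC2]_z f z = \int[muC]_y \int[muC]_x f (x, y).
Proof. by move=> mf f0; exact: (@fubini_tonelli2 _ _ _ _ _ muC muC f mf f0). Qed.

Lemma measurable_int1 d1 d2 (T1 : measurableType d1) (T2 : measurableType d2)
  (m2 : {sigma_finite_measure set T2 -> \bar R}) (f : T1 * T2 -> \bar R) :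
  measurable_fun setT f -> (forall x, 0 <= f x) -> measurable_fun setT (fun x => \int[m2]_y f (x, y)).
Proof. by move=> mf f0; exact: (@measurable_fun_fubini_tonelli_F _ _ _ _ _ m2 f mf f0). Qed.
Lemma measurable_int2 d1 d2 (T1 : measurableType d1) (T2 : measurableType d2)
  (m1 : {sigma_finite_measure set T1 -> \bar R}) (f : T1 * T2 -> \bar R) :
  measurable_fun setT f -> (forall x, 0 <= f x) -> measurable_fun setT (fun y => \int[m1]_x f (x, y)).
Proof. by move=> mf f0; exact: (@measurable_fun_fubini_tonelli_G _ _ _ _ _ m1 f mf f0). Qed.

Lemma integral_translationC (b : mC R) (f : mC R -> \bar R) :
  measurable_fun setT f -> (forall x, 0 <= f x) ->
  \int[muC]_z f z = \int[muC]_z f (z.1 + b.1, z.2 + b.2)%R.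
Proof.
move=> mf f0.
have mb : measurable_fun setT (fun z : mC R => (z.1 + b.1, z.2 + b.2)%R : mC R).
  by apply: measurable_fun_pair; apply: measurable_funD => //; apply: measurable_cst.
rewrite (tonelliC mf f0) [RHS](tonelliC (measurableT_comp mf mb) (fun x => f0 _)).
rewrite (@integral_affine _ 1 b.1)//;
  [|exact: (measurable_int1 mu mf f0)|by move=> x; exact: integral_ge0].
rewrite normr1 mul1e; apply: eq_integral => x _.
rewrite (@integral_affine _ 1 b.2)//; last exact: (measurable_fun_pair2 _ mf).
by rewrite normr1 mul1e mul1r; under eq_integral do rewrite mul1r.
Qed.
End change_of_variables.

Section multiplication.
Context {R : realType}.
Local Notation mu := (@lebesgue_measure R).
Local Notation muC := (@lebesgueC R).
Local Open Scope ereal_scope.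

Lemma measurable_mulC (a : R[i]) : measurable_fun setT (fun w : mC R => ofc (a * cplx w) : mC R).
Proof. by apply: measurable_ofc; apply: cmeasM; [exact: cmeas_cst|exact: cmeas_cplx]. Qed.

(** Multiplication by [al + i be] is factored into two maps, each affine in one real variable, with
    slopes [al] and [n / al] for [n = al^2 + be^2]; the Jacobian is the product [n]. The slope [al]
    must not vanish. *)
Let integral_mulC_Re (a : R[i]) (f : mC R -> \bar R) : complex.Re a != 0%R ->
  measurable_fun setT f -> (forall x, 0 <= f x) ->
  \int[muC]_z f z = (normc a ^+ 2)%:E * \int[muC]_w f (ofc (a * cplx w)).
Proof.
case: a => al be /= al0 mf f0.
have n0 : (al ^+ 2 + be ^+ 2 != 0)%R.
  by rewrite gt_eqF// ltr_pwDl// ?sqr_ge0// lt_def sqrf_eq0 al0 sqr_ge0.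
have m1 := measurableT_comp mf (measurable_mulC (al +i* be)%C).
rewrite [X in _ * X](tonelliC' m1 (fun x => f0 _)) /=.
pose n := (al ^+ 2 + be ^+ 2)%R.
(* [G] expresses the integrand through the first coordinate [u = al x - be y] of the product and
   through [y]: the second coordinate [be x + al y] equals [(be u + n y) / al]. *)
pose G (z : mC R) : \bar R := f (z.1, (be * z.1 + n * z.2) / al)%R.
have mg : measurable_fun setT (fun z : mC R => (z.1, (be * z.1 + n * z.2) / al)%R : mC R).
  apply: measurable_fun_pair => //; apply: measurable_funM; last exact: measurable_cst.
  by apply: measurable_funD; apply: measurable_funM => //; exact: measurable_cst.
have mG : measurable_fun setT G by exact: (measurableT_comp mf mg).
have G0 z : 0 <= G z by exact: f0.
have -> : \int[mu]_y \int[mu]_x f (ofc ((al +i* be)%C * cplx (x, y))%R) =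
   \int[mu]_y (`|al|^-1%:E * \int[mu]_x G (x, y)).
  apply: eq_integral => y _.
  rewrite (@integral_affine _ al (- be * y)%R (fun x => G (x, y)))//; last first.
    exact: (measurable_fun_pair1 _ mG).
  rewrite muleA -EFinM mulVf ?normr_eq0// mul1e; apply: eq_integral => x _.
  by rewrite /G /ofc /cplx ReM ImM/=; congr (f (_, _)); rewrite ?/n; field.
rewrite ge0_integralZl//; [|exact: (measurable_int2 mu mG G0)|by move=> y _; exact: integral_ge0].
rewrite -(tonelliC' mG G0) (tonelliC mG G0).
have -> : \int[mu]_x \int[mu]_y G (x, y) = \int[mu]_x ((`|al| / n)%:E * \int[mu]_y f (x, y)).
  apply: eq_integral => x _.
  rewrite (@integral_affine _ (n / al)%R (be * x / al)%R (fun y => f (x, y)))//; last 2 first.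
  - by rewrite mulf_neq0// invr_eq0.
  - exact: (measurable_fun_pair2 _ mf).
  have n1 : (0 <= n)%R by rewrite addr_ge0// sqr_ge0.
  rewrite muleA -EFinM (_ : (`|al| / n * `|n / al|)%R = 1%R); last first.
    by rewrite normrM normfV (ger0_norm n1); field; rewrite normr_eq0 al0 n0.
  rewrite mul1e; apply: eq_integral => y _.
  by rewrite /G/=; congr (f (_, _)); field.
rewrite ge0_integralZl//; [|exact: (measurable_int1 mu mf f0)|by move=> y _; exact: integral_ge0|by rewrite lee_fin divr_ge0// addr_ge0// sqr_ge0].
rewrite -(tonelliC mf f0) !muleA -!EFinM [X in X%:E * _](_ : _ = 1%R) ?mul1e//.
rewrite sqr_sqrtr ?addr_ge0 ?sqr_ge0// -/n.
by field; rewrite normr_eq0 al0 n0.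
Qed.

Lemma integral_mulC (a : R[i]) (f : mC R -> \bar R) : a != 0%R ->
  measurable_fun setT f -> (forall x, 0 <= f x) ->
  \int[muC]_z f z = (normc a ^+ 2)%:E * \int[muC]_w f (ofc (a * cplx w)).
Proof.
move=> a0 mf f0; have [ra|] := eqVneq (complex.Re a) 0%R; last first.
  by move=> h; exact: integral_mulC_Re.
(* For purely imaginary [a], both [1 + i] and [a / (1 + i)] have nonzero real part, and the previous
   case applies to each factor. *)
pose b : R[i] := (1%R +i* 1%R)%C.
have ib : complex.Im a != 0%R.
  apply: contra_neq a0 => ia; exact: complexRI.
have b0 : b != 0%R by apply/negP => /eqP []/eqP; rewrite oner_eq0.
have mf' : measurable_fun setT (fun z : mC R => f (ofc (b * cplx z))) by exact: (measurableT_comp mf (measurable_mulC b)).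
have rb : complex.Re b != 0%R by rewrite /b/= oner_eq0.
rewrite (@integral_mulC_Re b)//.
rewrite (@integral_mulC_Re (a / b)%R)//; last first.
  by rewrite ReM ReV ImV/= ra mul0r sub0r !mulNr mulrN opprK mulf_neq0// mulf_neq0 ?oner_eq0// invr_eq0 expr1n (_ : 1 + 1 = 2%:R)%R ?pnatr_eq0.
rewrite muleA -EFinM -exprMn -normcM mulrC divfK//.
congr (_ * _); apply: eq_integral => w _; congr f.
by rewrite ofcK mulrA (mulrC b) divfK.
Qed.
End multiplication.

Lemma squeeze_cvg0 {R : realType} (u v : nat -> R) : (forall n, 0 <= u n <= v n) ->
  v n @[n --> \oo] --> 0 -> u n @[n --> \oo] --> 0.
Proof.
move=> uv v0; apply: (@squeeze_cvgr _ _ _ _ (fun=> 0) _ _ _ _ _ v0); last exact: cvg_cst.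
exact: nearW.
Qed.

(** * The complex-valued integral *)

Definition cint {R : realType} d (T : measurableType d) (mu : {measure set T -> \bar R}) (f : T -> R[i]) : R[i] :=
  (\int[mu]_x complex.Re (f x))%R +i* (\int[mu]_x complex.Im (f x))%R.

Definition cintegrable {R : realType} d (T : measurableType d) (mu : {measure set T -> \bar R}) (f : T -> R[i]) :=
  mu.-integrable setT (fun x => (complex.Re (f x))%:E) /\
  mu.-integrable setT (fun x => (complex.Im (f x))%:E).

Section cint_theory.
Context {R : realType} d (T : measurableType d) (mu : {measure set T -> \bar R}).
Implicit Types f g : T -> R[i].

Lemma cintegrable_cmeas f : cintegrable mu f -> cmeas f.
Proof. by move=> [/measurable_int/measurable_EFinP ? /measurable_int/measurable_EFinP ?]. Qed.

Lemma cintegrable_le f (g : T -> R) : cmeas f -> (forall x, normc (f x) <= g x) ->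
  mu.-integrable setT (EFin \o g) -> cintegrable mu f.
Proof.
move=> [f1 f2] fg ig; split; apply: (le_integrable _ _ _ ig) => //; try exact/measurable_EFinP.
- by move=> x _; rewrite lee_fin (le_trans (ler_Re_normc _))// (le_trans (fg x))// ler_norm.
- by move=> x _; rewrite lee_fin (le_trans (ler_Im_normc _))// (le_trans (fg x))// ler_norm.
Qed.

Lemma cintegrable_lty f : cmeas f -> (\int[mu]_x (normc (f x))%:E < +oo)%E -> cintegrable mu f.
Proof.
move=> mf h; apply: (@cintegrable_le f (fun x => normc (f x))) => //.
apply/integrableP; split; first by apply/measurable_EFinP; exact: measurable_normc.
by under eq_integral do rewrite /= ger0_norm ?normc_ge0//.
Qed.

Lemma integrable_normc f : cintegrable mu f -> mu.-integrable setT (fun x => (normc (f x))%:E).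
Proof.
move=> /[dup] cf [f1 f2].
apply: (@le_integrable _ _ _ _ _ _ _ (fun x => (`|complex.Re (f x)| + `|complex.Im (f x)|)%:E)) => //.
- by apply/measurable_EFinP/measurable_normc/cintegrable_cmeas.
- by move=> x _; rewrite lee_fin (ger0_norm (normc_ge0 _)) (le_trans (ler_normc_ReIm _))// ler_norm.
- under eq_fun do rewrite EFinD.
  by apply: integrableD => //; [exact: (integrable_abse f1)|exact: (integrable_abse f2)].
Qed.

Lemma cintegrable_normc_lty f : cintegrable mu f -> (\int[mu]_x (normc (f x))%:E < +oo)%E.
Proof.
move=> /integrable_normc/integrableP[_]; congr (_ < _)%E; apply: eq_integral => x _.
by rewrite gee0_abs// lee_fin normc_ge0.
Qed.

Lemma cintegrableD f g : cintegrable mu f -> cintegrable mu g -> cintegrable mu (fun x => f x + g x).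
Proof.
move=> [f1 f2] [g1 g2]; split.
  by under eq_fun do rewrite ReD EFinD; exact: integrableD.
by under eq_fun do rewrite ImD EFinD; exact: integrableD.
Qed.

Lemma cintD f g : cintegrable mu f -> cintegrable mu g ->
  cint mu (fun x => f x + g x) = cint mu f + cint mu g.
Proof.
move=> [f1 f2] [g1 g2]; apply: complexRI => /=.
  by rewrite -RintegralD//; apply: eq_Rintegral => x _; rewrite ReD.
by rewrite -RintegralD//; apply: eq_Rintegral => x _; rewrite ImD.
Qed.

Lemma cintegrableZ (c : R[i]) f : cintegrable mu f -> cintegrable mu (fun x => c * f x).
Proof.
move=> cf; apply: (@cintegrable_le _ (fun x => normc c * normc (f x))).
- by apply: cmeasM; [exact: cmeas_cst|exact: cintegrable_cmeas].
- by move=> x; rewrite normcM.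
- by have := integrableZl measurableT (normc c) (integrable_normc cf).
Qed.

Lemma cintZ (c : R[i]) f : cintegrable mu f -> cint mu (fun x => c * f x) = c * cint mu f.
Proof.
move=> [f1 f2]; apply: complexRI.
  rewrite ReM/= -!RintegralZl// -RintegralB//; [|exact: (integrableZl measurableT _ f1)|exact: (integrableZl measurableT _ f2)].
  by apply: eq_Rintegral => x _; rewrite ReM.
rewrite ImM/= -!RintegralZl// -RintegralD//; [|exact: (integrableZl measurableT _ f2)|exact: (integrableZl measurableT _ f1)].
by apply: eq_Rintegral => x _; rewrite ImM.
Qed.

Lemma cintN f : cintegrable mu f -> cint mu (fun x => - f x) = - cint mu f.
Proof. by move=> cf; rewrite -mulN1r -cintZ//; congr (cint _ _); apply/funext => x; rewrite mulN1r. Qed.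

Lemma cintegrableN f : cintegrable mu f -> cintegrable mu (fun x => - f x).
Proof. by move=> /(cintegrableZ (-1)); under eq_fun do rewrite mulN1r. Qed.

Lemma cintegrableB f g : cintegrable mu f -> cintegrable mu g -> cintegrable mu (fun x => f x - g x).
Proof. by move=> cf cg; apply: cintegrableD => //; exact: cintegrableN. Qed.

Lemma cintB f g : cintegrable mu f -> cintegrable mu g ->
  cint mu (fun x => f x - g x) = cint mu f - cint mu g.
Proof. by move=> cf cg; rewrite -cintN// -cintD//; exact: cintegrableN. Qed.

Lemma cint0 : cint mu (fun _ => 0) = 0.
Proof. by apply: complexRI; rewrite /= Rintegral_cst// mul0r. Qed.

Lemma cint_ae_eq f g : cmeas f -> cmeas g -> ae_eq mu setT f g -> cint mu f = cint mu g.
Proof.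
move=> [f1 f2] [g1 g2] fg; apply: complexRI; rewrite /= /Rintegral; congr fine;
  apply: ae_eq_integral => //; try exact/measurable_EFinP;
  by move: fg; apply: filterS => x /= /(_ I) ->.
Qed.

Lemma cintegrable_ae_eq f g : cmeas g -> ae_eq mu setT f g -> cintegrable mu f -> cintegrable mu g.
Proof.
move=> mg fg cf; apply: cintegrable_lty => //.
rewrite (@ae_eq_integral _ _ _ mu setT (fun x => (normc (f x))%:E)).
- exact: cintegrable_normc_lty.
- by [].
- by apply/measurable_EFinP/measurable_normc.
- by apply/measurable_EFinP/measurable_normc; exact: cintegrable_cmeas cf.
- by move: fg; apply: filterS => x /= /(_ I) ->.
Qed.

(** Real and imaginary parts are bounded separately, whence the factor 2, which only affects
    constants. The bound also covers functions with an infinite integral: [fine] then returns 0. *)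
Lemma ler_normc_cint f : cmeas f ->
  ((normc (cint mu f))%:E <= 2%:E * \int[mu]_x (normc (f x))%:E)%E.
Proof.
move=> /[dup] mf [f1 f2].
have le1 (h : T -> R) : measurable_fun setT h -> (forall x, `|h x| <= normc (f x)) ->
    (`|\int[mu]_x h x|%:E <= \int[mu]_x (normc (f x))%:E)%E.
  move=> mh hf; apply: (@le_trans _ _ (\int[mu]_x `|(h x)%:E|)%E).
    apply: (@le_trans _ _ (`|\int[mu]_x (h x)%:E|)%E).
      rewrite /Rintegral; case: (\int[mu]_x (h x)%:E)%E => [r| |] //=; rewrite ?normr0 ?leey//.
    by apply: le_abse_integral => //; exact/measurable_EFinP.
  apply: ge0_le_integral => //.
  - by apply/measurable_EFinP; exact: measurableT_comp.
  - by apply/measurable_EFinP; exact: measurable_normc.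
  - by move=> x _; rewrite lee_fin.
rewrite (_ : 2%:E = 1 + 1)%E ?ge0_muleDl// !mul1e.
apply: (@le_trans _ _ (`|complex.Re (cint mu f)| + `|complex.Im (cint mu f)|)%:E).
  by rewrite lee_fin ler_normc_ReIm.
rewrite EFinD leeD//; apply: le1 => // x; [exact: ler_Re_normc|exact: ler_Im_normc].
Qed.

Lemma cint_dominated (f_ : nat -> T -> R[i]) f (g : T -> R) :
  (forall n, cmeas (f_ n)) -> cmeas f -> mu.-integrable setT (EFin \o g) ->
  (forall n x, normc (f_ n x) <= g x) ->
  {ae mu, forall x, normc (f_ n x - f x) @[n --> \oo] --> 0} ->
  normc (cint mu (f_ n) - cint mu f) @[n --> \oo] --> 0.
Proof.
move=> mf_ mf ig fg fx.
have main (h_ : nat -> T -> R) (h : T -> R) :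
   (forall n, measurable_fun setT (h_ n)) -> measurable_fun setT h ->
   (forall n x, `|h_ n x| <= normc (f_ n x)) ->
   (forall n x, `|h_ n x - h x| <= normc (f_ n x - f x)) ->
   \int[mu]_x h_ n x @[n --> \oo] --> \int[mu]_x h x.
  move=> mh_ mh hf hfx.
  have [|||||ih _] := @dominated_convergence _ _ _ mu setT measurableT (fun n => EFin \o h_ n) (EFin \o h) (EFin \o g).
  - by move=> n; exact/measurable_EFinP.
  - exact/measurable_EFinP.
  - move: fx; apply: filterS => x fx _; apply: cvg_EFin; first exact: nearW.
    apply/subr_cvg0; apply: norm_cvg0.
    apply: (@squeeze_cvgr _ _ _ _ (fun=> 0) _ _ _ _ _ fx); last exact: cvg_cst.
    by apply: nearW => n; rewrite normr_ge0/=; exact: hfx.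
  - by [].
  - by apply: aeW => x n _ /=; rewrite lee_fin (le_trans (hf n x)).
  by rewrite -(fineK (integrable_fin_num measurableT ih)) => /fine_cvg.
have c1 := main _ _ (fun n => (mf_ n).1) mf.1 (fun n x => ler_Re_normc _)
  (fun n x => ltac:(rewrite -ReN -ReD; exact: ler_Re_normc)).
have c2 := main _ _ (fun n => (mf_ n).2) mf.2 (fun n x => ler_Im_normc _)
  (fun n x => ltac:(rewrite -ImN -ImD; exact: ler_Im_normc)).
have c3 : `|complex.Re (cint mu (f_ n)) - complex.Re (cint mu f)| +
          `|complex.Im (cint mu (f_ n)) - complex.Im (cint mu f)| @[n --> \oo] --> 0.
  rewrite -[0 in X in _ --> X]addr0; apply: cvgD; rewrite -(normr0 R);
    apply: cvg_norm; exact/subr_cvg0.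
apply: (squeeze_cvg0 _ c3) => n; by rewrite normc_ge0 andTb (le_trans (ler_normc_ReIm _))//.
Qed.
End cint_theory.

Lemma normc_cvg_unique {R : realType} (u : nat -> R[i]) (l l' : R[i]) :
  normc (u n - l) @[n --> \oo] --> 0 -> normc (u n - l') @[n --> \oo] --> 0 -> l = l'.
Proof.
move=> h1 h2; apply/eqP; rewrite -subr_eq0 -normc_eq0; apply/eqP.
have h : normc (u n - l) + normc (u n - l') @[n --> \oo] --> (0 : R).
  by rewrite -[X in _ --> X]addr0; exact: cvgD h1 h2.
have h0 : (fun _ : nat => normc (l - l')) n @[n --> \oo] --> 0.
  apply: (squeeze_cvg0 _ h) => n; rewrite normc_ge0 andTb normcB.
  by rewrite (_ : l' - l = (u n - l) - (u n - l')) ?(le_trans (le_normcD _ _)) ?normcN//; ring.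
exact: (cvg_unique _ (cvg_cst (normc (l - l'))) h0).
Qed.

Lemma normc_cvgM {R : realType} (u v : nat -> R[i]) (l l' : R[i]) :
  normc (u n - l) @[n --> \oo] --> 0 -> normc (v n - l') @[n --> \oo] --> 0 ->
  normc (u n * v n - l * l') @[n --> \oo] --> 0.
Proof.
move=> h1 h2.
have h : normc (u n - l) * normc (v n - l') + normc l * normc (v n - l') + normc l' * normc (u n - l)
    @[n --> \oo] --> 0 * 0 + normc l * 0 + normc l' * 0.
  by apply: cvgD; [apply: cvgD; [exact: cvgM|apply: cvgM => //; exact: cvg_cst]|apply: cvgM => //; exact: cvg_cst].
rewrite !mulr0 !addr0 in h.
apply: (squeeze_cvg0 _ h) => n; rewrite normc_ge0 andTb -!normcM.
rewrite (_ : _ - _ = (u n - l) * (v n - l') + l * (v n - l') + l' * (u n - l)); last by ring.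
by rewrite (le_trans (le_normcD _ _))// lerD2r le_normcD.
Qed.

Lemma normc_cvgD {R : realType} (u v : nat -> R[i]) (l l' : R[i]) :
  normc (u n - l) @[n --> \oo] --> 0 -> normc (v n - l') @[n --> \oo] --> 0 ->
  normc (u n + v n - (l + l')) @[n --> \oo] --> 0.
Proof.
move=> h1 h2.
have h : normc (u n - l) + normc (v n - l') @[n --> \oo] --> (0 : R).
  by rewrite -[X in _ --> X]addr0; exact: cvgD h1 h2.
apply: (squeeze_cvg0 _ h) => n; rewrite normc_ge0 andTb.
by rewrite (_ : u n + v n - _ = (u n - l) + (v n - l')) ?le_normcD//; ring.
Qed.

Lemma normc_cvg_cst {R : realType} (l : R[i]) :
  normc ((fun _ : nat => l) n - l) @[n --> \oo] --> 0.
Proof. by under eq_fun do rewrite subrr normc0; exact: cvg_cst. Qed.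

Lemma ae_eqT {R : realType} d (T : measurableType d) (mu : {measure set T -> \bar R}) (U : Type) (f g : T -> U) :
  {ae mu, forall x, f x = g x} -> ae_eq mu setT f g.
Proof. by apply: filterS => x /= ->. Qed.

(** * Fubini's theorem for complex integrands *)

Section cint_fubini.
Context {R : realType} d1 d2 (T1 : measurableType d1) (T2 : measurableType d2).
Variables (m1 : {sigma_finite_measure set T1 -> \bar R}) (m2 : {sigma_finite_measure set T2 -> \bar R}).
Implicit Types F : T1 * T2 -> R[i].

Let measurable_Rint1 (h : T1 * T2 -> R) : measurable_fun setT h ->
  measurable_fun setT (fun x => \int[m2]_y h (x, y)).
Proof.
move=> mh; rewrite /Rintegral; apply: measurableT_comp => //.
rewrite [X in measurable_fun _ X](_ : _ = (fun x => \int[m2]_y ((EFin \o h)^\+ (x, y)) - \int[m2]_y ((EFin \o h)^\- (x, y))))%E; last first.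
  by apply/funext => x; rewrite [LHS]integralE; congr (_ - _)%E; apply: eq_integral => y _; rewrite ?funeposE ?funenegE.
by apply: emeasurable_funB; apply: measurable_int1;
  do ?[exact: measurable_funepos|exact: measurable_funeneg];
  [apply/measurable_funepos/measurable_EFinP|by move=> x; exact: funepos_ge0
  |apply/measurable_funeneg/measurable_EFinP|by move=> x; exact: funeneg_ge0].
Qed.

Lemma cmeas_pair1 F x : cmeas F -> cmeas (fun y => F (x, y)).
Proof. by move=> [F1 F2]; split; [exact: (measurable_fun_pair2 _ F1)|exact: (measurable_fun_pair2 _ F2)]. Qed.
Lemma cmeas_pair2 F y : cmeas F -> cmeas (fun x => F (x, y)).
Proof. by move=> [F1 F2]; split; [exact: (measurable_fun_pair1 _ F1)|exact: (measurable_fun_pair1 _ F2)]. Qed.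

Lemma cmeas_cint F : cmeas F -> cmeas (fun x => cint m2 (fun y => F (x, y))).
Proof. by move=> [F1 F2]; split; [exact: (measurable_Rint1 F1)|exact: (measurable_Rint1 F2)]. Qed.

Lemma cintegrable_prod F : cmeas F ->
  (\int[m1]_x \int[m2]_y (normc (F (x, y)))%:E < +oo)%E -> cintegrable (m1 \x m2)%E F.
Proof.
move=> mF h; apply: cintegrable_lty => //.
rewrite fubini_tonelli1//; first exact/measurable_EFinP/measurable_normc.
by move=> x; rewrite lee_fin normc_ge0.
Qed.

Lemma ae_cintegrable1 F : cintegrable (m1 \x m2)%E F ->
  {ae m1, forall x, cintegrable m2 (fun y => F (x, y))}.
Proof.
move=> [F1 F2].
by apply: filterS2 (ae_integrable1 F1) (ae_integrable1 F2) => x.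
Qed.

Lemma cint_prod F : cintegrable (m1 \x m2)%E F ->
  cint (m1 \x m2)%E F = cint m1 (fun x => cint m2 (fun y => F (x, y))).
Proof.
move=> /[dup] /cintegrable_cmeas mF [F1 F2].
have H (h : T1 * T2 -> R) : (m1 \x m2)%E.-integrable setT (EFin \o h) ->
    \int[(m1 \x m2)%E]_z h z = \int[m1]_x \int[m2]_y h (x, y).
  move=> ih; rewrite {1 2}/Rintegral -integral12_prod_meas1//; congr fine.
  have mh : measurable_fun setT h by have /measurable_int/measurable_EFinP := ih.
  apply: ae_eq_integral => //.
  - exact: (measurable_fubini_F ih).
  - by apply/measurable_EFinP; exact: measurable_Rint1.
  (* On the null set of non-integrable slices the inner integral is a default value, so the two
     iterated forms agree only almost everywhere. *)
  - move: (ae_integrable1 ih); apply: filterS => x ix _.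
    by rewrite /Rintegral fineK//; exact: integrable_fin_num.
by apply: complexRI; exact: H.
Qed.

Let measurable_Rint2 (h : T1 * T2 -> R) : measurable_fun setT h ->
  measurable_fun setT (fun y => \int[m1]_x h (x, y)).
Proof.
move=> mh; rewrite /Rintegral; apply: measurableT_comp => //.
rewrite [X in measurable_fun _ X](_ : _ = (fun y => \int[m1]_x ((EFin \o h)^\+ (x, y)) - \int[m1]_x ((EFin \o h)^\- (x, y))))%E; last first.
  by apply/funext => y; rewrite [LHS]integralE; congr (_ - _)%E; apply: eq_integral => x _; rewrite ?funeposE ?funenegE.
by apply: emeasurable_funB; apply: measurable_int2;
  [apply/measurable_funepos/measurable_EFinP|by move=> x; exact: funepos_ge0
  |apply/measurable_funeneg/measurable_EFinP|by move=> x; exact: funeneg_ge0].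
Qed.

Lemma cmeas_cint2 F : cmeas F -> cmeas (fun y => cint m1 (fun x => F (x, y))).
Proof. by move=> [F1 F2]; split; [exact: (measurable_Rint2 F1)|exact: (measurable_Rint2 F2)]. Qed.

Lemma cint_prod2 F : cintegrable (m1 \x m2)%E F ->
  cint (m1 \x m2)%E F = cint m2 (fun y => cint m1 (fun x => F (x, y))).
Proof.
move=> /[dup] /cintegrable_cmeas mF [F1 F2].
have H (h : T1 * T2 -> R) : (m1 \x m2)%E.-integrable setT (EFin \o h) ->
    \int[(m1 \x m2)%E]_z h z = \int[m2]_y \int[m1]_x h (x, y).
  move=> ih; rewrite {1 2}/Rintegral -integral21_prod_meas1//; congr fine.
  have mh : measurable_fun setT h by have /measurable_int/measurable_EFinP := ih.
  apply: ae_eq_integral => //.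
  - exact: (measurable_fubini_G ih).
  - by apply/measurable_EFinP; exact: measurable_Rint2.
  - move: (ae_integrable2 ih); apply: filterS => x ix _.
    by rewrite /Rintegral fineK//; exact: integrable_fin_num.
by apply: complexRI; exact: H.
Qed.

Lemma cint_fubini F : cmeas F ->
  (\int[m1]_x \int[m2]_y (normc (F (x, y)))%:E < +oo)%E ->
  cint m1 (fun x => cint m2 (fun y => F (x, y))) = cint m2 (fun y => cint m1 (fun x => F (x, y))).
Proof. by move=> mF /(cintegrable_prod mF) iF; rewrite -cint_prod// -cint_prod2. Qed.

Lemma cintegrable_cint F : cintegrable (m1 \x m2)%E F ->
  cintegrable m1 (fun x => cint m2 (fun y => F (x, y))).
Proof.
move=> iF; have mF := cintegrable_cmeas iF.
have mn : measurable_fun setT (fun x => (normc (F x))%:E) by exact/measurable_EFinP/measurable_normc.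
have n0 x : (0 <= (normc (F x))%:E)%E by rewrite lee_fin normc_ge0.
apply: cintegrable_lty; first exact: cmeas_cint.
apply: (@le_lt_trans _ _ (\int[m1]_x (2%:E * \int[m2]_y (normc (F (x, y)))%:E))%E).
  apply: ge0_le_integral => //.
  - by move=> x _; rewrite lee_fin normc_ge0.
  - by apply/measurable_EFinP/measurable_normc/cmeas_cint.
  - by apply: measurable_funeM; exact: (measurable_int1 m2 mn n0).
  - by move=> x _; apply: ler_normc_cint; exact: cmeas_pair1.
rewrite ge0_integralZl//; [|exact: (measurable_int1 m2 mn n0)|by move=> x _; exact: integral_ge0].
have := cintegrable_normc_lty iF; rewrite fubini_tonelli1// => h.
by rewrite lte_mul_pinfty// ge0_fin_numE// integral_ge0// => x _; exact: integral_ge0.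
Qed.
End cint_fubini.

(** Positive and negative parts carry a change of variables [tau] with Jacobian [k], known for
    nonnegative integrands, over to complex ones. It serves the shear, translations and complex
    multiplication. *)
Lemma cint_transfer {R : realType} d1 d2 (T1 : measurableType d1) (T2 : measurableType d2)
    (m1 : {measure set T1 -> \bar R}) (m2 : {measure set T2 -> \bar R})
    (k : T2 -> R) (tau : T2 -> T1) :
  measurable_fun setT k -> (forall x, 0 <= k x) -> measurable_fun setT tau ->
  (forall f : T1 -> \bar R, measurable_fun setT f -> (forall x, 0 <= f x)%E ->
     \int[m1]_x f x = \int[m2]_x ((k x)%:E * f (tau x)))%E ->
  forall f, cintegrable m1 f ->
   cintegrable m2 (fun x => (k x)%:C * f (tau x)) /\
   cint m1 f = cint m2 (fun x => (k x)%:C * f (tau x)).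
Proof.
move=> mk k0 mt H f cf; have mf := cintegrable_cmeas cf.
split.
  apply: cintegrable_lty; first by apply: cmeasM; [exact: cmeas_real|exact: cmeas_comp].
  have := cintegrable_normc_lty cf; rewrite H; last 2 first.
  - exact/measurable_EFinP/measurable_normc.
  - by move=> x; rewrite lee_fin normc_ge0.
  by congr (_ < _)%E; apply: eq_integral => x _; rewrite normcM normc_real ger0_norm.
have main (h : T1 -> R) : measurable_fun setT h ->
    \int[m1]_x h x = \int[m2]_x (k x * h (tau x)).
  move=> mh; rewrite /Rintegral; congr fine; rewrite integralE [RHS]integralE.
  have mh' : measurable_fun setT (EFin \o h) by exact/measurable_EFinP.
  congr (_ - _)%E.
    rewrite (H _ (measurable_funepos mh') (funepos_ge0 _)); apply: eq_integral => x _.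
    by rewrite !funeposE /= EFinM; rewrite maxe_pMr ?mule0// lee_fin.
  rewrite (H _ (measurable_funeneg mh') (funeneg_ge0 _)); apply: eq_integral => x _.
  by rewrite !funenegE [in RHS]EFinM -muleN maxe_pMr ?mule0// lee_fin.
apply: complexRI => /=; rewrite main; [|exact: mf.1| |exact: mf.2];
  apply: eq_Rintegral => x _; rewrite ?ReM ?ImM /= mul0r ?subr0 ?addr0//.
Qed.

Lemma ae_impl {R : realType} d (T : measurableType d) (mu : {measure set T -> \bar R}) (P Q : T -> Prop) :
  (forall x, P x -> Q x) -> {ae mu, forall x, P x} -> {ae mu, forall x, Q x}.
Proof. by move=> PQ; apply: filterS. Qed.

Lemma ae_impl2 {R : realType} d (T : measurableType d) (mu : {measure set T -> \bar R}) (P Q S : T -> Prop) :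
  (forall x, P x -> Q x -> S x) -> {ae mu, forall x, P x} -> {ae mu, forall x, Q x} -> {ae mu, forall x, S x}.
Proof. by move=> PQ; apply: filterS2. Qed.

(** * The shear and its Jacobian *)

Definition shear {R : realType} (w : C2 R) : C2 R := (ofc (cplx w.1 * cplx w.2), w.2).
Definition unshear {R : realType} (z : C2 R) : C2 R := (ofc (cplx z.1 / cplx z.2), z.2).

Section shear_measure.
Context {R : realType}.
Local Notation mu := (@lebesgue_measure R).
Local Notation muC := (@lebesgueC R).
Local Notation muC2 := (@lebesgueC2 R).

Lemma cplx_eq0 (w : R * R) : (cplx w == 0) = (w == 0).
Proof. by case: w => a b; apply/eqP/eqP => [[-> ->]|[-> ->]]. Qed.

Lemma measurable_shear : measurable_fun [set: mC2 R] (@shear R : mC2 R -> mC2 R).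
Proof.
apply: measurable_fun_pair => //; apply: measurable_ofc; apply: cmeasM; exact: cmeas_cplx.
Qed.
Lemma measurable_unshear : measurable_fun [set: mC2 R] (@unshear R : mC2 R -> mC2 R).
Proof.
apply: measurable_fun_pair => //; apply: measurable_ofc; apply: cmeasM; first exact: cmeas_cplx.
by apply: cmeasV; exact: cmeas_cplx.
Qed.

Lemma unshearK (w : C2 R) : cplx w.2 != 0 -> unshear (shear w) = w.
Proof. by case: w => a b /= b0; rewrite /unshear/= ofcK mulfK// cplxK. Qed.
Lemma lebesgueC_set0 : muC [set 0] = 0%E.
Proof.
rewrite (_ : [set 0] = [set (0 : R)] `*` [set (0 : R)]); last first.
  by apply/seteqP; split => -[a b] /= [-> ->].
transitivity (mu [set 0%R] * mu [set 0%R])%E; first exact: product_measure1E.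
by rewrite -[RHS](mul0e (mu [set 0%R])); congr (_ * _)%E; exact: lebesgue_measure_set1.
Qed.

Lemma ae_cplx_neq0 : {ae muC, forall w, cplx w != 0}.
Proof.
exists [set 0]; split; first by rewrite (_ : [set 0] = [set (0 : R)] `*` [set (0 : R)]);
  [exact: measurableX|apply/seteqP; split => -[a b] /= [-> ->]].
- exact: lebesgueC_set0.
- by move=> w /= /negP; rewrite negbK cplx_eq0 => /eqP.
Qed.

(** For fixed [w2] the shear is multiplication by [w2] in the first variable, with real Jacobian
    $|w_2|^2$; the value [w2 = 0], where it degenerates, is negligible. *)
Lemma integral_shear (f : mC2 R -> \bar R) : measurable_fun setT f -> (forall z, 0 <= f z)%E ->
  (\int[muC2]_z f z = \int[muC2]_w ((normc (cplx w.2) ^+ 2)%:E * f (shear w)))%E.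
Proof.
move=> mf f0.
have mfs : measurable_fun setT (fun w => f (shear w)) by exact: (measurableT_comp mf measurable_shear).
have mk : measurable_fun setT (fun w : mC2 R => ((normc (cplx w.2) ^+ 2)%:E)).
  by apply/measurable_EFinP; apply: measurable_funX; apply: measurable_normc; exact: cmeas_cplx.
have mg : measurable_fun setT (fun w => ((normc (cplx w.2) ^+ 2)%:E * f (shear w)))%E by exact: emeasurable_funM.
have g0 w : (0 <= ((normc (cplx w.2) ^+ 2)%:E * f (shear w)))%E by rewrite mule_ge0// lee_fin sqr_ge0.
rewrite (tonelliC2' mf f0) (tonelliC2' mg g0); apply: ae_eq_integral => //.
- exact: (measurable_int2 muC mf f0).
- exact: (measurable_int2 muC mg g0).
- apply: (ae_impl _ ae_cplx_neq0) => y y0 _.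
  have mfy : measurable_fun setT (fun x => f (x, y)) by exact: (measurable_fun_pair1 _ mf).
  rewrite (integral_mulC y0)// -ge0_integralZl//.
  + by apply: eq_integral => x _; rewrite /shear/= mulrC.
  + exact: (measurableT_comp mfy (measurable_mulC _)).
  + by rewrite lee_fin sqr_ge0.
Qed.

Lemma cint_shear (f : mC2 R -> R[i]) : cintegrable muC2 f ->
  cintegrable muC2 (fun w => (normc (cplx w.2) ^+ 2)%:C * f (shear w)) /\
  cint muC2 f = cint muC2 (fun w => (normc (cplx w.2) ^+ 2)%:C * f (shear w)).
Proof.
move=> cf; apply: (@cint_transfer _ _ _ _ _ muC2 muC2 (fun w : mC2 R => normc (cplx w.2) ^+ 2) (@shear R)) => //.
- by apply: measurable_funX; apply: measurable_normc; exact: cmeas_cplx.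
- by move=> x; rewrite sqr_ge0.
- exact: measurable_shear.
- exact: integral_shear.
Qed.

Lemma cint_translation (b : mC R) (f : mC R -> R[i]) : cintegrable muC f ->
  cintegrable muC (fun w => f (w.1 + b.1, w.2 + b.2)) /\
  cint muC f = cint muC (fun w => f (w.1 + b.1, w.2 + b.2)).
Proof.
move=> cf.
have := @cint_transfer _ _ _ _ _ muC muC (fun => 1) (fun w : mC R => (w.1 + b.1, w.2 + b.2) : mC R).
case/(_ _ _ _ _ _ cf) => //.
- by apply: measurable_fun_pair; apply: measurable_funD => //; exact: measurable_cst.
- by move=> h mh h0; rewrite (integral_translationC b)//; apply: eq_integral => x _; rewrite mul1e.
- by rewrite (_ : (fun x => _ * _) = (fun w : mC R => f (w.1 + b.1, w.2 + b.2))) //; apply/funext => x; rewrite mul1r.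
Qed.

Lemma cint_mulC (a : R[i]) (f : mC R -> R[i]) : a != 0 -> cintegrable muC f ->
  cintegrable muC (fun w => f (ofc (a * cplx w))) /\
  cint muC f = (normc a ^+ 2)%:C * cint muC (fun w => f (ofc (a * cplx w))).
Proof.
move=> a0 cf.
have [] := @cint_transfer _ _ _ _ _ muC muC (fun => normc a ^+ 2) (fun w : mC R => ofc (a * cplx w) : mC R) _ _ _ _ _ cf.
- by [].
- by move=> _; rewrite sqr_ge0.
- exact: measurable_mulC.
- move=> h mh h0; rewrite (integral_mulC a0)// ge0_integralZl//; [exact: (measurableT_comp mh (measurable_mulC _))|by rewrite lee_fin sqr_ge0].
- move=> h ->.
  have i1 : cintegrable muC (fun w => f (ofc (a * cplx w))).
    have := cintegrableZ (normc a ^+ 2)%:C^-1 h.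
    rewrite (_ : (fun x => _ * _) = (fun w : mC R => f (ofc (a * cplx w)))) //.
    apply/funext => w; rewrite mulrA mulVf ?mul1r//.
    by apply/negP => /eqP []/eqP; rewrite sqrf_eq0 normc_eq0 (negPf a0).
  by rewrite cintZ.
Qed.

End shear_measure.

(** * Schur's test *)

Lemma integralZl_ge0 {R : realType} d (T : measurableType d) (mu : {measure set T -> \bar R}) (c : R) (f : T -> R) :
  0 <= c -> measurable_fun setT f -> (forall x, 0 <= f x) ->
  (\int[mu]_x (c * f x)%:E = c%:E * \int[mu]_x (f x)%:E)%E.
Proof.
move=> c0 mf f0; rewrite -ge0_integralZl//; first exact/measurable_EFinP.
by move=> x _; rewrite lee_fin.
Qed.

(** The integrand is factored as $kF=[(kb)^{1/p}F]\,[k^{1/q}b^{-1/p}]$. Hölder's inequality in [y]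
    and the row bound give the weight [a], and Tonelli's theorem with the column bound finishes. The
    weight [b] may vanish only where the kernel does, since there both factors have to be 0. *)
Lemma schur_test {R : realType} d1 d2 (X : measurableType d1) (Y : measurableType d2)
    (mu : {sigma_finite_measure set X -> \bar R}) (nu : {sigma_finite_measure set Y -> \bar R})
    (p q A B : R) (k : X * Y -> R) (a : X -> R) (b F : Y -> R) :
  0 < p -> 0 < q -> p^-1 + q^-1 = 1 -> 0 <= A -> 0 <= B ->
  measurable_fun setT k -> measurable_fun setT a -> measurable_fun setT b -> measurable_fun setT F ->
  (forall z, 0 <= k z) -> (forall x, 0 <= a x) -> (forall y, 0 <= b y) -> (forall y, 0 <= F y) ->
  (forall x y, k (x, y) != 0 -> b y != 0) ->
  (forall x, (\int[nu]_y (k (x, y) * b y `^ (- (q / p)))%:E) `^ (p / q) <= (A * a x)%:E)%E ->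
  (forall y, (b y)%:E * \int[mu]_x (a x * k (x, y))%:E <= B%:E)%E ->
  (\int[mu]_x (\int[nu]_y (k (x, y) * F y)%:E) `^ p <= (A * B)%:E * \int[nu]_y (F y `^ p)%:E)%E.
Proof.
move=> p0 q0 pq A0 B0 mk ma mb mF k0 a0 b0 F0 kb hA hB.
have mkx x : measurable_fun setT (fun y => k (x, y)) by exact: (measurable_fun_pair2 _ mk).
have mky y : measurable_fun setT (fun x => k (x, y)) by exact: (measurable_fun_pair1 _ mk).
have mFp : measurable_fun setT (fun y => F y `^ p) by exact: (measurableT_comp (measurable_powR p)).
have pn0 : p != 0 by rewrite gt_eqF. have qn0 : q != 0 by rewrite gt_eqF.
have step x : ((\int[nu]_y (k (x, y) * F y)%:E) `^ p <=
   (A * a x)%:E * \int[nu]_y (k (x, y) * b y * F y `^ p)%:E)%E.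
  pose f1 y := (k (x, y) * b y) `^ p^-1 * F y.
  pose f2 y := k (x, y) `^ q^-1 * b y `^ (- p^-1).
  have mkb : measurable_fun setT (fun y => k (x, y) * b y) by exact: measurable_funM.
  have mf1 : measurable_fun setT f1.
    by apply: measurable_funM => //; exact: (measurableT_comp (measurable_powR _)).
  have mf2 : measurable_fun setT f2.
    by apply: measurable_funM; exact: (measurableT_comp (measurable_powR _)).
  have f12 y : f1 y * f2 y = k (x, y) * F y.
    rewrite /f1 /f2; have [->|kn0] := eqVneq (k (x, y)) 0.
      have e0 : (0 : R) `^ p^-1 = 0 by rewrite powR0// invr_eq0.
      by rewrite mul0r e0 !mul0r.
    have bn0 := kb _ _ kn0.
    rewrite powRM// (_ : _ * _ * F y * _ = (k (x, y) `^ p^-1 * k (x, y) `^ q^-1) * (b y `^ p^-1 * b y `^ (- p^-1)) * F y); last by ring.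
    rewrite -!powRD ?kn0 ?bn0 ?implybT// pq subrr powRr1// powRr0 mulr1//.
  have e1 : ((\int[nu]_y (k (x, y) * F y)%:E) = 'N[nu]_1[EFin \o (f1 \* f2)%R])%E.
    rewrite Lnorm1; apply: eq_integral => y _ /=; rewrite f12 ger0_norm// mulr_ge0//.
  have e2 : ('N[nu]_p%:E[EFin \o f1] `^ p = \int[nu]_y (k (x, y) * b y * F y `^ p)%:E)%E.
    rewrite powR_Lnorm//; apply: eq_integral => y _ /=.
    rewrite ger0_norm ?mulr_ge0 ?powR_ge0// powRM ?powR_ge0//.
    by rewrite -powRrM mulVf// powRr1// mulr_ge0.
  have e3 : ('N[nu]_q%:E[EFin \o f2] `^ q = \int[nu]_y (k (x, y) * b y `^ (- (q / p)))%:E)%E.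
    rewrite (powR_Lnorm _ _ qn0); apply: eq_integral => y _ /=.
    rewrite ger0_norm ?mulr_ge0 ?powR_ge0// powRM ?powR_ge0//.
    by rewrite -!powRrM mulVf// powRr1// mulNr (mulrC p^-1).
  have N2 : ('N[nu]_q%:E[EFin \o f2] `^ p <= (A * a x)%:E)%E.
    by rewrite -(mulfVK qn0 p) (mulrC (p / q)) poweRrM ?e3//.
  rewrite e1 -e2.
  apply: (@le_trans _ _ (('N[nu]_p%:E[EFin \o f1] * 'N[nu]_q%:E[EFin \o f2]) `^ p)%E).
    apply: gt0_ler_poweR; [exact: ltW|by rewrite in_itv/= leey andbT Lnorm_ge0
      |by rewrite in_itv/= leey andbT mule_ge0// Lnorm_ge0|exact: hoelder].
  by rewrite poweRM ?Lnorm_ge0 ?(ltW p0)// muleC lee_wpmul2r// poweR_ge0.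
have mK : measurable_fun setT (fun z : X * Y => k z * b z.2 * F z.2 `^ p).
  apply: measurable_funM; first by apply: measurable_funM => //; exact: (measurableT_comp mb).
  exact: (measurableT_comp mFp).
have mK' : measurable_fun setT (fun z : X * Y => (a z.1 * (k z * b z.2 * F z.2 `^ p))%:E).
  by apply/measurable_EFinP; apply: measurable_funM => //; exact: (measurableT_comp ma).
have K0' z : (0 <= (a z.1 * (k z * b z.2 * F z.2 `^ p))%:E)%E by rewrite lee_fin !mulr_ge0// powR_ge0.
have mkF : measurable_fun setT (fun z : X * Y => (k z * F z.2)%:E).
  by apply/measurable_EFinP; apply: measurable_funM => //; exact: (measurableT_comp mF).
have kF0 z : (0 <= (k z * F z.2)%:E)%E by rewrite lee_fin mulr_ge0.
apply: (@le_trans _ _ (\int[mu]_x (A%:E * \int[nu]_y (a x * (k (x, y) * b y * F y `^ p))%:E))%E).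
  apply: ge0_le_integral => //.
  - by move=> x _; exact: poweR_ge0.
  - by apply: (measurableT_comp (measurable_poweR p)); exact: (measurable_int1 nu mkF kF0).
  - by apply: measurable_funeM; exact: (measurable_int1 nu mK' K0').
  - move=> x _; apply: (le_trans (step x)); rewrite EFinM -muleA lee_wpmul2l//.
    rewrite integralZl_ge0//; first exact: (measurable_fun_pair2 _ mK).
    by move=> y; rewrite !mulr_ge0// powR_ge0.
rewrite ge0_integralZl//; [|exact: (measurable_int1 nu mK' K0')|by move=> x _; apply: integral_ge0 => y _; exact: (K0' (x, y))].
rewrite EFinM -muleA lee_wpmul2l//.
rewrite -[X in (X <= _)%E](@fubini_tonelli1 _ _ _ _ _ mu nu (fun z => (a z.1 * (k z * b z.2 * F z.2 `^ p))%:E))// fubini_tonelli2//.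
rewrite -ge0_integralZl//; last 2 first.
- by apply/measurable_EFinP.
- by move=> y _; rewrite lee_fin powR_ge0.
apply: ge0_le_integral => //.
- by move=> y _; apply: integral_ge0 => x _; exact: (K0' (x, y)).
- exact: (measurable_int2 mu mK' K0').
- by apply: measurable_funeM; exact/measurable_EFinP.
move=> y _; rewrite /fubini_G.
apply: (@le_trans _ _ ((F y `^ p)%:E * ((b y)%:E * \int[mu]_x (a x * k (x, y))%:E))%E); last first.
  by rewrite muleC lee_wpmul2r// lee_fin powR_ge0.
have mak : measurable_fun setT (fun x => a x * k (x, y)) by exact: measurable_funM.
rewrite -[X in (_ * X)%E](integralZl_ge0 _ (b0 y) mak); last by move=> x; rewrite mulr_ge0.
rewrite -integralZl_ge0 ?powR_ge0//; last 2 first.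
- by apply: measurable_funM => //; exact: measurable_cst.
- by move=> x; rewrite !mulr_ge0.
rewrite le_eqVlt; apply/orP; left; apply/eqP; apply: eq_integral => x _ /=; congr EFin; ring.
Qed.

(** * Integrals of powers on the line *)

Section line_integrals.
Context {R : realType}.
Local Notation mu := (@lebesgue_measure R).

Lemma integral_powR_itv (u v c : R) : 0 < u -> u < v -> c != 0 ->
  (\int[mu]_(x in `[u, v]) (x `^ (c - 1))%:E = ((v `^ c - u `^ c) / c)%:E)%E.
Proof.
move=> u0 uv c0.
have dF (x : R) : 0 < x -> is_derive x 1 (fun x : R => c^-1 * x `^ c) (x `^ (c - 1)).
  move=> x0; have /(is_deriveZ c^-1) := is_derive1_powR c x0.
  by rewrite /GRing.scale/= mulrA mulVf// mul1r.
have cF (x : R) : 0 < x -> {for x, continuous (fun x : R => c^-1 * x `^ c)}.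
  by move=> x0; apply/differentiable_continuous/derivable1_diffP; have [] := dF x x0.
have cf (x : R) : 0 < x -> {for x, continuous (fun x : R => x `^ (c - 1))}.
  move=> x0; apply/differentiable_continuous/derivable1_diffP.
  by have [] := is_derive1_powR (c - 1) x0.
rewrite (@continuous_FTC2 _ _ (fun x : R => c^-1 * x `^ c))//.
- by rewrite -EFinB -mulrBr mulrC.
- apply: continuous_subspaceW; last first.
    by apply: continuous_in_subspaceT => x; rewrite inE /=; exact: (cf x).
  by move=> x /=; rewrite in_itv/= => /andP[ux _]; rewrite (lt_le_trans u0).
- split.
  + by move=> x; rewrite in_itv/= => /andP[ux _]; have [] := dF x (lt_trans u0 ux).
  + exact/cvg_at_right_filter/cF.
  + by apply/cvg_at_left_filter/cF; rewrite (lt_trans u0).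
- move=> x; rewrite in_itv/= => /andP[ux _].
  by rewrite derive1E; have [_ ->] := dF x (lt_trans u0 ux).
Qed.

Lemma le_integral_exhaust (f : R -> \bar R) (F : nat -> set (measurableTypeR R)) (K : \bar R) :
  measurable_fun setT f -> (forall x, 0 <= f x)%E -> {homo F : n m / (n <= m)%N >-> (n <= m)%O} ->
  (forall i, measurable (F i)) ->
  (forall i, \int[mu]_(x in F i) f x <= K)%E -> (\int[mu]_(x in \bigcup_i F i) f x <= K)%E.
Proof.
move=> mf f0 Fmono mF FK.
have h := @ge0_nondecreasing_set_cvg_integral _ _ _ F f mu Fmono mF (fun i => measurable_funTS mf) (fun i x _ => f0 x).
rewrite -(cvg_lim _ h)//; apply: lime_le; first by apply/cvg_ex; eexists; exact: h.
exact: nearW.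
Qed.

Lemma integral_powR_near0 (c d : R) : 0 < c -> 0 < d ->
  (\int[mu]_(x in `]0%R, d]) (x `^ (c - 1))%:E <= (d `^ c / c)%:E)%E.
Proof.
move=> c0 d0; have mp : measurable_fun setT (fun x : measurableTypeR R => (x `^ (c - 1))%:E).
  by apply/measurable_EFinP; exact: measurable_powR.
(* The denominators start at 2 so that every interval is nondegenerate, as the primitive formula
   requires. *)
rewrite (_ : `]0, d] = \bigcup_(i : nat) `[d / i.+2%:R, d])%classic; last first.
  apply/seteqP; split => x /=; rewrite in_itv/=.
    move=> /andP[x0 xd]; exists (Num.bound (d / x)) => //=; rewrite in_itv/= xd andbT.
    rewrite ler_pdivrMr// mulrC -ler_pdivrMr//; apply: (@le_trans _ _ (Num.bound (d / x))%:R).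
      by rewrite ltW// archi_boundP// divr_ge0 ?ltW.
    by rewrite ler_nat leqW.
  by move=> [i _] /=; rewrite in_itv/= => /andP[h ->]; rewrite andbT (lt_le_trans _ h)// divr_gt0.
apply: le_integral_exhaust => //.
- by move=> x; rewrite lee_fin powR_ge0.
- move=> n m nm; apply/subsetPset => x /=; rewrite !in_itv/= => /andP[h ->]; rewrite andbT (le_trans _ h)//.
  by rewrite ler_pM2l// lef_pV2 ?posrE// ler_nat.
- move=> i; rewrite integral_powR_itv ?gt_eqF ?divr_gt0//.
    by rewrite lee_fin ler_pM2r ?invr_gt0// gerBl powR_ge0.
  by rewrite ltr_pdivrMr// ltr_pMr// ltr1n.
Qed.

Lemma integral_powR_infty (c d : R) : c < 0 -> 0 < d ->
  (\int[mu]_(x in `[d, +oo[) (x `^ (c - 1))%:E <= (d `^ c / - c)%:E)%E.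
Proof.
move=> c0 d0; have mp : measurable_fun setT (fun x : measurableTypeR R => (x `^ (c - 1))%:E).
  by apply/measurable_EFinP; exact: measurable_powR.
rewrite (_ : `[d, +oo[ = \bigcup_(i : nat) `[d, d + i.+1%:R])%classic; last first.
  apply/seteqP; split => x /=; rewrite in_itv/= ?andbT.
    move=> dx; exists (Num.bound (x - d)) => //=; rewrite in_itv/= dx -lerBlDl/=.
    by apply: (@le_trans _ _ (Num.bound (x - d))%:R);
      [rewrite ltW// archi_boundP// subr_ge0|rewrite ler_nat].
  by move=> [i _] /=; rewrite in_itv/= => /andP[].
apply: le_integral_exhaust => //.
- by move=> x; rewrite lee_fin powR_ge0.
- move=> n m nm; apply/subsetPset => x /=; rewrite !in_itv/= => /andP[-> h] /=; rewrite (le_trans h)//.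
  by rewrite lerD2l ler_nat.
- move=> i; rewrite integral_powR_itv ?lt_eqF//; last by rewrite ltrDl.
  by rewrite lee_fin invrN mulrN -mulNr ler_nM2r ?invr_lt0// lerDr powR_ge0.
Qed.

(** After centring, [h |x|] is at most [g x + g (- x)] with [g] the restriction of [h] to the
    half-line; an inequality suffices and absorbs the double count at 0. *)
Lemma integral_even_le (h : R -> R) (xi K : R) : measurable_fun setT h -> (forall x, 0 <= h x) ->
  (\int[mu]_x (if 0 <= x then h x else 0)%:E <= K%:E)%E ->
  (\int[mu]_x (h `|x - xi|)%:E <= (2 * K)%:E)%E.
Proof.
move=> mh h0 hK.
pose g (x : measurableTypeR R) := if 0 <= x then h x else 0.
have mg : measurable_fun setT g.
  by apply: measurable_fun_ifT => //; apply: measurable_fun_ler => //; exact: measurable_cst.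
have g0 x : 0 <= g x by rewrite /g; case: ifP.
have mN : measurable_fun setT (fun x : measurableTypeR R => - x : measurableTypeR R) by exact: measurable_funN.
have mgN : measurable_fun setT (fun x : measurableTypeR R => g (- x)) by exact: (measurableT_comp mg mN).
have mx : measurable_fun setT (fun x : measurableTypeR R => (h `|x - xi|)%:E).
  apply/measurable_EFinP; apply: measurableT_comp => //; apply: measurableT_comp => //.
  by apply: measurable_funB => //; exact: measurable_cst.
rewrite (@integral_affine _ 1 xi)//; last by move=> x; rewrite lee_fin.
rewrite normr1 mul1e.
apply: (@le_trans _ _ (\int[mu]_x ((g x)%:E + (g (- x))%:E))%E).
  apply: ge0_le_integral => //.
  - by move=> x _; rewrite lee_fin.
  - apply/measurable_EFinP; apply: measurableT_comp => //; apply: measurableT_comp => //.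
    apply: measurable_funB; last exact: measurable_cst.
    by apply: measurable_funD; [apply: measurable_funM => //; exact: measurable_cst|exact: measurable_cst].
  - by apply: emeasurable_funD; exact/measurable_EFinP.
  - move=> x _; rewrite mul1r addrK -EFinD lee_fin.
    have [x0|x0] := leP 0 x; first by rewrite ger0_norm// /g x0 lerDl -/(g (- x)).
    by rewrite ltr0_norm// [in g (- x)]/g oppr_ge0 (ltW x0) lerDr.
rewrite ge0_integralD//; try exact/measurable_EFinP; try by move=> x _; rewrite lee_fin.
rewrite [X in (_ + X)%E](_ : _ = \int[mu]_x (g x)%:E)%E.
  by rewrite mulrDl mul1r EFinD leeD.
have m1 : (-1 : R) != 0 by rewrite oppr_eq0 oner_eq0.
have meg : measurable_fun setT (fun x => (g x)%:E) by exact/measurable_EFinP.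
rewrite [RHS](integral_affine 0 m1 meg); last by move=> x; rewrite lee_fin.
by rewrite normrN1 mul1e; apply: eq_integral => x _; rewrite mulN1r addr0.
Qed.

Lemma integral_powR_local (c d xi : R) : 0 < c -> c != 1 -> 0 < d ->
  (\int[mu]_x (if `|x - xi| <= d then `|x - xi| `^ (c - 1) else 0)%:E <= (2 * (d `^ c / c))%:E)%E.
Proof.
move=> c0 c1 d0.
apply: (@integral_even_le (fun t => if t <= d then t `^ (c - 1) else 0)).
- apply: measurable_fun_ifT; [apply: measurable_fun_ler => //; exact: measurable_cst|exact: measurable_powR|exact: measurable_cst].
- by move=> x; case: ifP => // _; exact: powR_ge0.
apply: le_trans (integral_powR_near0 c0 d0).
rewrite [leRHS]integral_mkcond le_eqVlt; apply/orP; left; apply/eqP; apply: eq_integral => x _.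
rewrite patchE.
have -> : (x \in `]0, d]%classic) = (0 < x <= d) by apply/idP/idP; rewrite inE/= in_itv.
(* As [c != 1], the power of 0 is 0 by convention, which matches the open end of the interval. *)
have [->|] := eqVneq x 0.
  by rewrite ltxx/= lexx (ltW d0) powR0// subr_eq0.
by rewrite le_eqVlt eq_sym => /negPf ->/=; case: (0 < x) => //=; case: (x <= d).
Qed.

Lemma integral_powR_tail (c d xi : R) : c < 0 -> 0 < d ->
  (\int[mu]_x ((d + `|x - xi|) `^ (c - 1))%:E <= (2 * (d `^ c / - c))%:E)%E.
Proof.
move=> c0 d0.
have md : measurable_fun setT (fun t : measurableTypeR R => (d + t) `^ (c - 1)).
  apply: (measurableT_comp (measurable_powR _)).
  by apply: measurable_funD => //; exact: measurable_cst.
apply: (@integral_even_le (fun t => (d + t) `^ (c - 1))) => //.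
- by move=> x; exact: powR_ge0.
apply: le_trans (integral_powR_infty c0 d0).
rewrite [leRHS]integral_mkcond [leRHS](@integral_affine _ 1 d)//; last 2 first.
- apply/(measurable_restrictT _ _).1 => //; apply: measurable_funTS.
  by apply/measurable_EFinP; exact: measurable_powR.
- by move=> x; rewrite patchE; case: ifP => // _; rewrite lee_fin powR_ge0.
rewrite normr1 mul1e le_eqVlt; apply/orP; left; apply/eqP; apply: eq_integral => x _.
rewrite patchE mul1r (addrC x).
have -> : (d + x \in `[d, +oo[%classic) = (0 <= x).
  by apply/idP/idP; rewrite inE/= in_itv/= andbT lerDl.
by case: ifP.
Qed.
End line_integrals.

(** * Singular and tail integrals in the plane *)

Section plane_integrals.
Context {R : realType}.
Local Notation mu := (@lebesgue_measure R).
Local Notation muC := (@lebesgueC R).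

Lemma le_powRN (x y r : R) : 0 < x -> x <= y -> 0 <= r -> y `^ (- r) <= x `^ (- r).
Proof.
move=> x0 xy r0; rewrite !powRN lef_pV2 ?posrE ?powR_gt0 ?(lt_le_trans x0)//.
by rewrite ge0_ler_powR// nnegrE ltW// (lt_le_trans x0).
Qed.

Lemma integral_tensor_le (f g : R -> R) (A B : R) :
  measurable_fun setT f -> measurable_fun setT g -> (forall x, 0 <= f x) -> (forall x, 0 <= g x) ->
  0 <= B ->
  (\int[mu]_x (f x)%:E <= A%:E)%E -> (\int[mu]_x (g x)%:E <= B%:E)%E ->
  (\int[muC]_z (f z.1 * g z.2)%:E <= (A * B)%:E)%E.
Proof.
move=> mf mg f0 g0 B0 fA gB.
have m1 : measurable_fun setT (fun z : mC R => (f z.1 * g z.2)%:E).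
  by apply/measurable_EFinP; apply: measurable_funM;
    [exact: (measurableT_comp mf)|exact: (measurableT_comp mg)].
rewrite (tonelliC m1); last by move=> z; rewrite lee_fin mulr_ge0.
rewrite (_ : (fun x => _) = (fun x => (f x)%:E * \int[mu]_y (g y)%:E)%E); last first.
  by apply/funext => x; rewrite -(integralZl_ge0 mu (f0 x) mg g0).
rewrite ge0_integralZr//; last 3 first.
- exact/measurable_EFinP.
- by move=> x _; rewrite lee_fin.
- by apply: integral_ge0 => x _; rewrite lee_fin.
rewrite EFinM lee_pmul//; apply: integral_ge0 => x _; by rewrite lee_fin.
Qed.

Lemma ae_coord_neq (w : R * R) : {ae muC, forall z, (z.1 != w.1) && (z.2 != w.2)}.
Proof.
have mX (A B : set (measurableTypeR R)) : measurable A -> measurable B -> mu A = 0%E \/ mu B = 0%E ->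
    measurable (A `*` B : set (mC R)) /\ muC (A `*` B) = 0%E.
  move=> mA mB AB; split; first exact: measurableX.
  transitivity (mu A * mu B)%E; first exact: product_measure1E.
  by case: AB => ->; rewrite ?mul0e ?mule0.
have [m1 e1] := mX [set w.1] setT (measurable_set1 _) measurableT (or_introl (lebesgue_measure_set1 w.1)).
have [m2 e2] := mX setT [set w.2] measurableT (measurable_set1 _) (or_intror (lebesgue_measure_set1 w.2)).
have n1 : muC.-negligible ([set w.1] `*` [set: measurableTypeR R]).
  by exists ([set w.1] `*` [set: measurableTypeR R]); split.
have n2 : muC.-negligible ([set: measurableTypeR R] `*` [set w.2]).
  by exists ([set: measurableTypeR R] `*` [set w.2]); split.
apply: negligibleS (negligibleU n1 n2) => z /= /negP; rewrite negb_and !negbK => /orP[/eqP h|/eqP h]; [left|right] => //.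
Qed.

Lemma normc_coord (x y : R * R) : `|x.1 - y.1| <= normc (cplx x - cplx y) /\ `|x.2 - y.2| <= normc (cplx x - cplx y).
Proof. by split; [have := ler_Re_normc (cplx x - cplx y)|have := ler_Im_normc (cplx x - cplx y)]; rewrite ?ReD ?ReN ?ImD ?ImN. Qed.

(** A negative power of a quantity that dominates two others splits into a product of their powers.
    Applied to a modulus and its two coordinates, it reduces planar estimates to line integrals. *)
Lemma powR_split (t x y r : R) : 0 < x -> 0 < y -> 0 <= r -> x <= t -> y <= t ->
  t `^ (- (r + r)) <= x `^ (- r) * y `^ (- r).
Proof.
move=> x0 y0 r0 xt yt; rewrite opprD powRD; last by rewrite (gt_eqF (lt_le_trans x0 xt)) implybT.
by rewrite ler_pM ?powR_ge0// le_powRN.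
Qed.

Lemma measurable_normcB (w : R * R) : measurable_fun setT (fun z : mC R => normc (cplx w - cplx z)).
Proof. by apply: measurable_normc; apply: cmeasB; [exact: cmeas_cst|exact: cmeas_cplx]. Qed.

(** Each coordinate difference receives half of the exponent, and [a / 2 < 1] makes the line
    integrals converge. On the coordinate lines through [w] the split bound fails, because 0 to a
    nonzero power is 0 by convention; hence the comparison almost everywhere. *)
Lemma integral_riesz (a M : R) (w : R * R) : 0 < a -> a < 2 -> 0 < M ->
  (\int[muC]_z (if normc (cplx w - cplx z) <= M then normc (cplx w - cplx z) `^ (- a) else 0)%:E
    <= ((2 * (M `^ (1 - a / 2) / (1 - a / 2))) ^+ 2)%:E)%E.
Proof.
move=> a0 a2 M0; set c := 1 - a / 2; have c0 : 0 < c by rewrite /c; lra.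
have c1 : c != 1 by rewrite lt_eqF// /c; lra.
pose g (xi x : R) := if `|x - xi| <= M then `|x - xi| `^ (c - 1) else 0.
have mn xi : measurable_fun setT (fun x : measurableTypeR R => `|x - xi|).
  by apply: measurableT_comp => //; apply: measurable_funB => //; exact: measurable_cst.
have mg xi : measurable_fun [set: measurableTypeR R] (g xi).
  apply: measurable_fun_ifT; [|exact: (measurableT_comp (measurable_powR _) (mn xi))|exact: measurable_cst].
  by apply: measurable_fun_ler => //; exact: measurable_cst.
have g0 xi x : 0 <= g xi x by rewrite /g; case: ifP => // _; exact: powR_ge0.
have gK xi := integral_powR_local xi c0 c1 M0.
have K0 : 0 <= 2 * (M `^ c / c) by rewrite mulr_ge0// divr_ge0 ?powR_ge0// ltW.
rewrite expr2; apply: le_trans (integral_tensor_le (mg w.1) (mg w.2) (g0 _) (g0 _) K0 (gK _) (gK _)).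
have mnn := measurable_normcB w.
apply: ae_ge0_le_integral => //.
- by move=> x _; rewrite lee_fin; case: ifP => // _; exact: powR_ge0.
- apply/measurable_EFinP; apply: measurable_fun_ifT; [|exact: (measurableT_comp (measurable_powR _) mnn)|exact: measurable_cst].
  by apply: measurable_fun_ler => //; exact: measurable_cst.
- by move=> x _; rewrite lee_fin mulr_ge0.
- by apply/measurable_EFinP; apply: measurable_funM; [exact: (measurableT_comp (mg _))|exact: (measurableT_comp (mg _))].
- apply: (ae_impl _ (ae_coord_neq w)) => z /andP[z1 z2] _; rewrite lee_fin /g.
  have [] := normc_coord z w; rewrite normcB; set t := normc _ => h1 h2.
  case: ifP => tM; last by rewrite mulr_ge0//; case: ifP => // _; exact: powR_ge0.
  rewrite !(le_trans _ tM)//.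
  have -> : - a = - (a / 2 + a / 2) by field.
  have -> : c - 1 = - (a / 2) by rewrite /c; ring.
  by apply: powR_split => //; rewrite ?normr_gt0 ?subr_eq0// divr_ge0 ?ltW.
Qed.

(** The exponent [2 + g] splits into twice [1 + g / 2], so each line tail has the integrable
    exponent needed and contributes $d^{-g/2}$. *)
Lemma integral_tail2 (g d : R) (w : R * R) : 0 < g -> 0 < d ->
  (\int[muC]_z ((d + normc (cplx w - cplx z)) `^ (- (2 + g)))%:E <= (16 / g ^+ 2 * d `^ (- g))%:E)%E.
Proof.
move=> g0 d0; have c0 : - (g / 2) < 0 by rewrite oppr_lt0; lra.
have md xi : measurable_fun setT (fun x : measurableTypeR R => (d + `|x - xi|) `^ (- (g / 2) - 1)).
  apply: (measurableT_comp (measurable_powR _)); apply: measurable_funD; first exact: measurable_cst.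
  by apply: measurableT_comp => //; apply: measurable_funB => //; exact: measurable_cst.
have K xi := integral_powR_tail xi c0 d0.
rewrite opprK in K.
have K0 : 0 <= 2 * (d `^ (- (g / 2)) / (g / 2)) by rewrite mulr_ge0// divr_ge0 ?powR_ge0// divr_ge0// ltW.
rewrite (_ : 16 / _ * _ = 2 * (d `^ (- (g / 2)) / (g / 2)) * (2 * (d `^ (- (g / 2)) / (g / 2)))); last first.
  rewrite (_ : - g = - (g / 2) + - (g / 2)); last by field.
  rewrite (@powRD _ d (- (g / 2)) (- (g / 2))); last by rewrite (gt_eqF d0) implybT.
  by set e := d `^ _; field; rewrite gt_eqF.
apply: le_trans (integral_tensor_le (md w.1) (md w.2) (fun=> powR_ge0 _ _) (fun=> powR_ge0 _ _) K0 (K _) (K _)).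
apply: ge0_le_integral => //.
- by move=> x _; rewrite lee_fin powR_ge0.
- apply/measurable_EFinP; apply: (measurableT_comp (measurable_powR _)).
  by apply: measurable_funD; [exact: measurable_cst|exact: measurable_normcB].
- by apply/measurable_EFinP; apply: measurable_funM; [exact: (measurableT_comp (md _))|exact: (measurableT_comp (md _))].
- move=> z _; rewrite lee_fin.
  have [] := normc_coord z w; rewrite normcB => h1 h2.
  have -> : - (2 + g) = - ((g / 2 + 1) + (g / 2 + 1)) by field.
  have -> : - (g / 2) - 1 = - (g / 2 + 1) by ring.
  by apply: powR_split; rewrite ?lerD2l ?ltr_wpDr// addr_ge0// divr_ge0// ltW.
Qed.
End plane_integrals.

(** * Line and plane integrals with a singularity along a curve *)

Section boundary_weight.
Context {R : realType}.
Local Notation mu := (@lebesgue_measure R).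
Local Notation muC := (@lebesgueC R).
Local Notation h := (2^-1 : R).

Let h0 : 0 < h. Proof. by rewrite invr_gt0. Qed.
Let h1 : h < 1. Proof. by rewrite invf_lt1// ltr1n. Qed.

Let measurable_absB (c : R) : measurable_fun setT (fun x : measurableTypeR R => `|x - c|).
Proof. by apply: measurableT_comp => //; apply: measurable_funB => //; exact: measurable_cst. Qed.

Let measurable_dabs (d c r : R) : measurable_fun setT (fun x : measurableTypeR R => (d + `|x - c|) `^ r).
Proof.
apply: (measurableT_comp (measurable_powR _)); apply: measurable_funD; last exact: measurable_absB.
exact: measurable_cst.
Qed.

(** Where [|x - c| <= d] the second factor is at most $d^{-3/2}$ and the first is integrable;
    elsewhere the first factor is at most $d^{-1/2}$ and the second is an integrable tail. Both
    pieces contribute [4 / d]. *)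
Lemma integral_two_singularities (c xi d : R) : 0 < d ->
  (\int[mu]_x (`|x - c| `^ (h - 1) * (d + `|x - xi|) `^ (- h - 1))%:E <= (8 / d)%:E)%E.
Proof.
move=> d0.
pose f x := if `|x - c| <= d then `|x - c| `^ (h - 1) else 0.
have mf : measurable_fun [set: measurableTypeR R] f.
  apply: measurable_fun_ifT; [|exact: (measurableT_comp (measurable_powR _) (measurable_absB c))|exact: measurable_cst].
  by apply: measurable_fun_ler; [exact: measurable_absB|exact: measurable_cst].
have f0 x : 0 <= f x by rewrite /f; case: ifP => // _; exact: powR_ge0.
have fK := integral_powR_local c h0 (negbT (lt_eqF h1)) d0.
have hn : - h < 0 by rewrite oppr_lt0.
have tK := integral_powR_tail xi hn d0; rewrite opprK in tK.
apply: (@le_trans _ _ (\int[mu]_x ((d `^ (- h - 1) * f x)%:E + (d `^ (- h) * (d + `|x - xi|) `^ (- h - 1))%:E))%E).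
  apply: ge0_le_integral => //.
  - by move=> x _; rewrite lee_fin mulr_ge0// powR_ge0.
  - apply/measurable_EFinP; apply: measurable_funM; last exact: measurable_dabs.
    exact: (measurableT_comp (measurable_powR _) (measurable_absB c)).
  - by apply: emeasurable_funD; apply/measurable_EFinP; apply: measurable_funM; by [exact: measurable_cst|exact: mf|exact: measurable_dabs].
  - move=> x _; rewrite -EFinD lee_fin /f; case: ifP => [xd|/negbT].
      rewrite (le_trans (y := d `^ (- h - 1) * `|x - c| `^ (h - 1)))//; last first.
        by rewrite lerDl mulr_ge0 ?powR_ge0.
      rewrite mulrC ler_wpM2r ?powR_ge0//.
      have -> : - h - 1 = - (h + 1) by ring.
      by apply: le_powRN; rewrite ?lerDl// addr_ge0// ltW.
    rewrite -ltNge => xd; rewrite mulr0 add0r ler_wpM2r ?powR_ge0//.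
    have -> : h - 1 = - h by field.
    by apply: le_powRN; rewrite ?ltW.
rewrite ge0_integralD//; last 4 first.
- by move=> x _; rewrite lee_fin mulr_ge0// powR_ge0.
- by apply/measurable_EFinP; apply: measurable_funM => //; exact: measurable_cst.
- by move=> x _; rewrite lee_fin mulr_ge0// powR_ge0.
- by apply/measurable_EFinP; apply: measurable_funM; [exact: measurable_cst|exact: measurable_dabs].
rewrite (integralZl_ge0 mu (powR_ge0 _ _) mf f0).
rewrite (integralZl_ge0 mu (powR_ge0 _ _) (measurable_dabs d xi _) (fun=> powR_ge0 _ _)).
have d1 : d `^ (- h - 1) * d `^ h = d^-1.
  rewrite -powRD ?(gt_eqF d0) ?implybT// (_ : _ + _ = -1); last by ring.
  by rewrite powR_inv1// ltW.
have d2 : d `^ (- h) * d `^ (- h) = d^-1.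
  rewrite -powRD ?(gt_eqF d0) ?implybT// (_ : _ + _ = -1); last by field.
  by rewrite powR_inv1// ltW.
apply: (@le_trans _ _ ((d `^ (- h - 1))%:E * (2 * (d `^ h / h))%:E + (d `^ (- h))%:E * (2 * (d `^ (- h) / h))%:E)%E).
  by apply: leeD; apply: lee_wpmul2l => //; rewrite lee_fin powR_ge0.
rewrite -!EFinM -EFinD lee_fin.
rewrite (_ : _ + _ = 4 * (d `^ (- h - 1) * d `^ h) + 4 * (d `^ (- h) * d `^ (- h))); last by field.
by rewrite d1 d2 -mulrDl -natrD.
Qed.

(** The variable in which the curve is a graph over the other is integrated first, giving [8 / d]
    whatever the point [sg] of the curve; the remaining tail contributes $4d^{-1/2}$. *)
Lemma integral_curve_singularity (sg : R -> R) (xi eta d : R) : 0 < d -> measurable_fun [set: measurableTypeR R] sg ->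
  (\int[muC]_z (`|z.1 - sg z.2| `^ (h - 1) * (d + `|z.1 - xi|) `^ (- h - 1) * (d + `|z.2 - eta|) `^ (- h - 1))%:E
     <= (32 * d `^ (- (h + 1)))%:E)%E /\
  (\int[muC]_z (`|z.2 - sg z.1| `^ (h - 1) * (d + `|z.2 - eta|) `^ (- h - 1) * (d + `|z.1 - xi|) `^ (- h - 1))%:E
     <= (32 * d `^ (- (h + 1)))%:E)%E.
Proof.
move=> d0 ms.
pose G (x y c xi : R) := `|x - c| `^ (h - 1) * (d + `|x - xi|) `^ (- h - 1).
have G0 x y c x' : 0 <= G x y c x' by rewrite mulr_ge0 ?powR_ge0.
have md i (p : mC R -> measurableTypeR R) : measurable_fun setT p ->
    measurable_fun setT (fun z : mC R => (d + `|p z - i|) `^ (- h - 1)).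
  by move=> mp; exact: (measurableT_comp (measurable_dabs d i _) mp).
have ma (p q : mC R -> measurableTypeR R) : measurable_fun setT p -> measurable_fun setT q ->
    measurable_fun setT (fun z : mC R => `|p z - sg (q z)| `^ (h - 1)).
  move=> mp mq; apply: (measurableT_comp (measurable_powR _)); apply: measurableT_comp => //.
  by apply: measurable_funB => //; exact: measurableT_comp.
have bnd (xi' eta' : R) : (\int[mu]_y ((8 / d) * (d + `|y - eta'|) `^ (- h - 1))%:E <= (32 * d `^ (- (h + 1)))%:E)%E.
  have d8 : 0 <= 8 / d by rewrite divr_ge0// ltW.
  rewrite (integralZl_ge0 mu d8 (measurable_dabs d eta' _) (fun=> powR_ge0 _ _)).
  have hn : - h < 0 by rewrite oppr_lt0.
  have tK := integral_powR_tail eta' hn d0; rewrite opprK in tK.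
  apply: (@le_trans _ _ ((8 / d)%:E * (2 * (d `^ (- h) / h))%:E)%E); first exact: lee_wpmul2l.
  rewrite -EFinM lee_fin le_eqVlt; apply/orP; left; apply/eqP.
  rewrite (_ : - (h + 1) = - h + -1); last by ring.
  rewrite powRD ?(gt_eqF d0) ?implybT// powR_inv1 ?ltW//; by set e := d `^ _; field; rewrite gt_eqF.
split.
  rewrite tonelliC'; last 2 first.
  - by apply/measurable_EFinP; apply: measurable_funM; [apply: measurable_funM|]; [exact: ma|exact: md|exact: md].
  - by move=> z; rewrite lee_fin !mulr_ge0 ?powR_ge0.
  apply: le_trans (bnd xi eta); apply: ge0_le_integral => //.
  - by move=> y _; apply: integral_ge0 => x _; rewrite lee_fin !mulr_ge0 ?powR_ge0.
  - apply: (@measurable_int2 _ _ _ _ _ mu (fun z => (`|z.1 - sg z.2| `^ (h - 1) * (d + `|z.1 - xi|) `^ (- h - 1) * (d + `|z.2 - eta|) `^ (- h - 1))%:E)).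
      by apply/measurable_EFinP; apply: measurable_funM; [apply: measurable_funM|]; [exact: ma|exact: md|exact: md].
    by move=> z; rewrite lee_fin !mulr_ge0 ?powR_ge0.
  - by apply/measurable_EFinP; apply: measurable_funM; [exact: measurable_cst|exact: measurable_dabs].
  - move=> y _ /=.
    rewrite (_ : (fun x => _) = (fun x => ((d + `|y - eta|) `^ (- h - 1) * G x y (sg y) xi)%:E)); last first.
      by apply/funext => x; rewrite /G [in RHS]mulrC.
    rewrite integralZl_ge0 ?powR_ge0//; last first.
      apply: measurable_funM; last exact: measurable_dabs.
      exact: (measurableT_comp (measurable_powR _) (measurable_absB _)).
    rewrite [in leRHS]mulrC EFinM lee_wpmul2l ?lee_fin ?powR_ge0//.
    exact: integral_two_singularities.
rewrite tonelliC; last 2 first.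
- by apply/measurable_EFinP; apply: measurable_funM; [apply: measurable_funM|]; [exact: ma|exact: md|exact: md].
- by move=> z; rewrite lee_fin !mulr_ge0 ?powR_ge0.
apply: le_trans (bnd eta xi); apply: ge0_le_integral => //.
- by move=> y _; apply: integral_ge0 => x _; rewrite lee_fin !mulr_ge0 ?powR_ge0.
- apply: (@measurable_int1 _ _ _ _ _ mu (fun z => (`|z.2 - sg z.1| `^ (h - 1) * (d + `|z.2 - eta|) `^ (- h - 1) * (d + `|z.1 - xi|) `^ (- h - 1))%:E)).
    by apply/measurable_EFinP; apply: measurable_funM; [apply: measurable_funM|]; [exact: ma|exact: md|exact: md].
  by move=> z; rewrite lee_fin !mulr_ge0 ?powR_ge0.
- by apply/measurable_EFinP; apply: measurable_funM; [exact: measurable_cst|exact: measurable_dabs].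
- move=> x _ /=.
  rewrite (_ : (fun y => _) = (fun y => ((d + `|x - xi|) `^ (- h - 1) * G y x (sg x) eta)%:E)); last first.
    by apply/funext => y; rewrite /G [in RHS]mulrC.
  rewrite integralZl_ge0 ?powR_ge0//; last first.
    apply: measurable_funM; last exact: measurable_dabs.
    exact: (measurableT_comp (measurable_powR _) (measurable_absB _)).
  rewrite [in leRHS]mulrC EFinM lee_wpmul2l ?lee_fin ?powR_ge0//.
  exact: integral_two_singularities.
Qed.

End boundary_weight.

(** * Boundary weights on the unit disc *)

Definition disc {R : realType} (w : R * R) : bool := normc (cplx w) < 1.
Definition dist1 {R : realType} (w : R * R) : R := 1 - normc (cplx w) ^+ 2.

Section disc_weights.
Context {R : realType}.
Local Notation mu := (@lebesgue_measure R).
Local Notation muC := (@lebesgueC R).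
Local Notation h := (2^-1 : R).

Lemma measurable_disc : measurable_fun setT (@disc R : mC R -> bool).
Proof.
apply: measurable_fun_ltr; last exact: measurable_cst.
by apply: measurable_normc; exact: cmeas_cplx.
Qed.
Lemma measurable_dist1 : measurable_fun setT (@dist1 R : mC R -> R).
Proof.
apply: measurable_funB; first exact: measurable_cst.
by apply: measurable_funX; apply: measurable_normc; exact: cmeas_cplx.
Qed.
Lemma dist1_gt0 (w : R * R) : disc w -> 0 < dist1 w.
Proof. by rewrite /disc /dist1 => w1; rewrite subr_gt0 expr_lt1// normc_ge0. Qed.
Lemma dist1_le (w : R * R) : disc w -> 1 - normc (cplx w) <= dist1 w <= 2 * (1 - normc (cplx w)).
Proof. by rewrite /disc /dist1 => w1; have := normc_ge0 (cplx w); set t := normc _ in w1 *; move=> t0; apply/andP; split; nra. Qed.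

(** With $S=\sqrt{1-y^2}$ one has $1-x^2-y^2=(S-|x|)(S+|x|)$. If $|x|\ge|y|$ then $y^2\le 1/2$ and
    $S\ge 1/2$, so this is at least $(S-|x|)/2$. The singularity on the circle is thus spread over
    four graphs, two over each axis, to which the curve estimates apply. *)
Lemma dist1_sqrt_bound (w : R * R) : disc w ->
  dist1 w `^ (h - 1) <= 2 *
   ((`|w.1 - Num.sqrt (1 - w.2 ^+ 2)| `^ (h - 1) + `|w.1 - - Num.sqrt (1 - w.2 ^+ 2)| `^ (h - 1)) +
    (`|w.2 - Num.sqrt (1 - w.1 ^+ 2)| `^ (h - 1) + `|w.2 - - Num.sqrt (1 - w.1 ^+ 2)| `^ (h - 1))).
Proof.
have main (x y : R) : y ^+ 2 <= x ^+ 2 -> x ^+ 2 + y ^+ 2 < 1 ->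
    (1 - (x ^+ 2 + y ^+ 2)) `^ (h - 1) <= 2 * (`|x - Num.sqrt (1 - y ^+ 2)| `^ (h - 1) + `|x - - Num.sqrt (1 - y ^+ 2)| `^ (h - 1)).
  move=> yx xy1; set S := Num.sqrt _.
  have S2 : S ^+ 2 = 1 - y ^+ 2 by rewrite sqr_sqrtr//; nra.
  have S0 : 0 <= S by exact: sqrtr_ge0.
  have Sh : h <= S by rewrite -(@ler_pXn2r _ 2)// ?nnegrE ?invr_ge0// S2; lra.
  have xS : `|x| < S by rewrite -(@ltr_pXn2r _ 2)// ?nnegrE// real_normK ?num_real//; nra.
  have e1 : h - 1 = - h by field.
  have key : (1 - (x ^+ 2 + y ^+ 2)) `^ (h - 1) <= 2 * (S - `|x|) `^ (h - 1).
    have p1 : 0 < (S - `|x|) / 2 by rewrite divr_gt0// subr_gt0.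
    rewrite e1; apply: (@le_trans _ _ (((S - `|x|) / 2) `^ (- h))).
      apply: le_powRN => //; rewrite ?invr_ge0//.
      have := real_normK (num_real x); have := normr_ge0 x; set t := `|x| in xS *; move=> t0 tx.
      by rewrite -tx; nra.
    have SX0 : 0 <= S - `|x| by rewrite subr_ge0 ltW.
    rewrite powRM ?invr_ge0// [leLHS]mulrC ler_wpM2r ?powR_ge0//.
    have -> : (h `^ (- h) = 2 `^ h :> R) by rewrite -{1}(powR_inv1 (ler0n R 2)) -powRrM mulN1r opprK.
    rewrite -[leRHS]powRr1//.
    by apply: ler_powR; rewrite ?ler1n// invf_le1// ler1n.
  apply: (le_trans key); rewrite ler_pM2l//.
  have [x0|x0] := leP 0 x.
    rewrite (_ : S - `|x| = `|x - S|) ?lerDl ?powR_ge0//.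
    by rewrite (ger0_norm x0) distrC ger0_norm// subr_ge0; move: xS; rewrite (ger0_norm x0) => /ltW.
  rewrite (_ : S - `|x| = `|x - - S|) ?lerDr ?powR_ge0//.
  by rewrite opprK (ltr0_norm x0) opprK addrC ger0_norm//; move: xS; rewrite (ltr0_norm x0); lra.
rewrite /disc => w1.
have E : normc (cplx w) ^+ 2 = w.1 ^+ 2 + w.2 ^+ 2 by rewrite sqr_normcE.
have w2 : w.1 ^+ 2 + w.2 ^+ 2 < 1 by rewrite -E expr_lt1// normc_ge0.
rewrite /dist1 E; case: (leP (w.2 ^+ 2) (w.1 ^+ 2)) => c.
  apply: (le_trans (main _ _ c w2)); rewrite ler_pM2l// lerDl.
  by rewrite addr_ge0// powR_ge0.
rewrite addrC in w2 *; apply: (le_trans (main _ _ (ltW c) w2)); rewrite ler_pM2l// lerDr.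
by rewrite addr_ge0// powR_ge0.
Qed.

(** A Forelli-Rudin type estimate. The factor of exponent 3 is split between the two coordinates,
    the weight is bounded by four graph singularities, and $256=2\cdot 4\cdot 32$. *)
Lemma integral_boundary_weight (x : R * R) (d : R) : 0 < d ->
  (\int[muC]_w (if disc w then dist1 w `^ (- h) * (d + normc (cplx w - cplx x)) `^ (- 3) else 0)%:E
     <= (256 * d `^ (- (h + 1)))%:E)%E.
Proof.
move=> d0.
pose sg (y : R) := Num.sqrt (1 - y ^+ 2).
have msg : measurable_fun [set: measurableTypeR R] sg.
  apply: (@measurableT_comp _ _ _ _ _ _ (@Num.sqrt R)).
    by apply: continuous_measurable_fun; exact: sqrt_continuous.
  by apply: measurable_funB; [exact: measurable_cst|exact: measurable_funX].
have msgN : measurable_fun [set: measurableTypeR R] (fun y => - sg y) by exact: measurable_funN.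
have [B1 B3] := integral_curve_singularity x.1 x.2 d0 msg.
have [B2 B4] := integral_curve_singularity x.1 x.2 d0 msgN.
have md i (p : mC R -> measurableTypeR R) : measurable_fun setT p ->
    measurable_fun setT (fun z : mC R => (d + `|p z - i|) `^ (- h - 1)).
  move=> mp; apply: (measurableT_comp (measurable_powR _)); apply: measurable_funD; first exact: measurable_cst.
  by apply: measurableT_comp => //; apply: measurable_funB => //; exact: measurable_cst.
have ma (s : measurableTypeR R -> R) (p q : mC R -> measurableTypeR R) : measurable_fun setT s ->
    measurable_fun setT p -> measurable_fun setT q ->
    measurable_fun setT (fun z : mC R => `|p z - s (q z)| `^ (h - 1)).
  move=> ms mp mq; apply: (measurableT_comp (measurable_powR _)); apply: measurableT_comp => //.
  by apply: measurable_funB => //; exact: (measurableT_comp ms mq).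
pose t1 (s : R -> R) (z : mC R) := `|z.1 - s z.2| `^ (h - 1) * (d + `|z.1 - x.1|) `^ (- h - 1) * (d + `|z.2 - x.2|) `^ (- h - 1).
pose t2 (s : R -> R) (z : mC R) := `|z.2 - s z.1| `^ (h - 1) * (d + `|z.2 - x.2|) `^ (- h - 1) * (d + `|z.1 - x.1|) `^ (- h - 1).
have mt1 s : measurable_fun [set: measurableTypeR R] s -> measurable_fun setT (t1 s).
  by move=> ms; apply: measurable_funM; [apply: measurable_funM|]; [exact: ma|exact: md|exact: md].
have mt2 s : measurable_fun [set: measurableTypeR R] s -> measurable_fun setT (t2 s).
  by move=> ms; apply: measurable_funM; [apply: measurable_funM|]; [exact: ma|exact: md|exact: md].
have t10 s z : 0 <= t1 s z by rewrite !mulr_ge0 ?powR_ge0.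
have t20 s z : 0 <= t2 s z by rewrite !mulr_ge0 ?powR_ge0.
pose T z := (t1 sg z + t1 (fun y => - sg y) z) + (t2 sg z + t2 (fun y => - sg y) z).
have mT : measurable_fun setT T.
  exact: (measurable_funD (measurable_funD (mt1 _ msg) (mt1 _ msgN)) (measurable_funD (mt2 _ msg) (mt2 _ msgN))).
have T0 z : 0 <= T z by rewrite !addr_ge0.
have mdw : measurable_fun setT (fun w : mC R => (d + normc (cplx w - cplx x)) `^ (- 3)).
  apply: (measurableT_comp (measurable_powR _)); apply: measurable_funD; first exact: measurable_cst.
  by apply: measurable_normc; apply: cmeasB; [exact: cmeas_cplx|exact: cmeas_cst].
apply: (@le_trans _ _ (\int[muC]_w (2 * T w)%:E)%E).
  apply: ge0_le_integral => //.
  - by move=> w _; rewrite lee_fin; case: ifP => // _; rewrite mulr_ge0 ?powR_ge0.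
  - apply/measurable_EFinP; apply: measurable_fun_ifT; [exact: measurable_disc| |exact: measurable_cst].
    by apply: measurable_funM => //; apply: (measurableT_comp (measurable_powR _)); exact: measurable_dist1.
  - by apply/measurable_EFinP; apply: measurable_funM => //; exact: measurable_cst.
  - move=> w _; rewrite lee_fin; case: ifP => wd; last by rewrite mulr_ge0.
    have [n1 n2] := normc_coord w x.
    have e1 : - h = h - 1 by field.
    have e3 : - 3 = - ((h + 1) + (h + 1)) :> R by field.
    rewrite {1}e1 {1}e3; apply: (@le_trans _ _ (dist1 w `^ (h - 1) * ((d + `|w.1 - x.1|) `^ (- (h + 1)) * (d + `|w.2 - x.2|) `^ (- (h + 1))))).
      rewrite ler_wpM2l ?powR_ge0//; apply: powR_split; rewrite ?ltr_wpDr ?lerD2l//.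
    apply: (le_trans (ler_wpM2r _ (dist1_sqrt_bound wd))); first by rewrite mulr_ge0 ?powR_ge0.
    rewrite le_eqVlt; apply/orP; left; apply/eqP.
    rewrite /T /t1 /t2 -/(sg w.2) -/(sg w.1) (_ : - (h + 1) = - h - 1); last by ring.
    set a1 := `|w.1 - sg _| `^ _; set a2 := `|w.1 - - sg _| `^ _; set a3 := `|w.2 - sg _| `^ _; set a4 := `|w.2 - - sg _| `^ _.
    by set u := (d + `|w.1 - _|) `^ _; set v := (d + `|w.2 - _|) `^ _; ring.
rewrite integralZl_ge0// /T.
have mE f : measurable_fun setT f -> measurable_fun setT (fun z : mC R => (f z)%:E) by move=> mf; exact/measurable_EFinP.
under eq_integral do rewrite !EFinD.
rewrite ge0_integralD//; [|by move=> z _; rewrite adde_ge0// lee_fin|by apply: emeasurable_funD; apply: mE; exact: mt1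
  |by move=> z _; rewrite adde_ge0// lee_fin|by apply: emeasurable_funD; apply: mE; exact: mt2].
rewrite ge0_integralD//; [|by move=> z _; rewrite lee_fin|by apply: mE; exact: mt1
  |by move=> z _; rewrite lee_fin|by apply: mE; exact: mt1].
rewrite ge0_integralD//; [|by move=> z _; rewrite lee_fin|by apply: mE; exact: mt2
  |by move=> z _; rewrite lee_fin|by apply: mE; exact: mt2].
set K := 32 * _ in B1 B2 B3 B4.
rewrite (_ : 256 * _ = 2 * ((K + K) + (K + K))); last by rewrite /K; ring.
rewrite EFinM; apply: lee_wpmul2l; first by rewrite lee_fin.
by rewrite !EFinD; exact: (leeD (leeD B1 B2) (leeD B3 B4)).
Qed.

(** The identity $|1-w\bar x|^2-|w-x|^2=(1-|w|^2)(1-|x|^2)$ gives $|w-x|\le|1-w\bar x|$, and the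
    triangle inequality gives the bounds by $1-|w|$ and $1-|x|$. *)
Lemma normc_1subMJ (w x : R[i]) : normc w < 1 -> normc x < 1 ->
  normc (w - x) + (1 - normc w) <= 2 * normc (1 - w * x^*) /\
  normc (w - x) + (1 - normc x) <= 2 * normc (1 - w * x^*).
Proof.
move=> w1 x1.
have h1 : normc (w - x) <= normc (1 - w * x^*).
  rewrite -(@ler_pXn2r _ 2) ?nnegrE ?normc_ge0//.
  have : 0 <= (1 - normc w ^+ 2) * (1 - normc x ^+ 2).
    by rewrite mulr_ge0// subr_ge0 exprn_ile1 ?normc_ge0 ?ltW.
  rewrite !sqr_normcE !(ReD, ImD, ReN, ImN, ReM, ImM, ReJ, ImJ)/=.
  by rewrite -subr_ge0 => H; rewrite -subr_ge0; apply: le_trans H _; rewrite le_eqVlt; apply/orP; left; apply/eqP; ring.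
have wx : normc (w * x^*) = normc w * normc x by rewrite normcM normcJE.
have h2 : 1 - normc w <= normc (1 - w * x^*).
  have := ler_normcB 1 (w * x^*); rewrite normc1 wx; apply: le_trans.
  by rewrite lerD2l lerN2 ler_piMr ?normc_ge0// ltW.
have h3 : 1 - normc x <= normc (1 - w * x^*).
  have := ler_normcB 1 (w * x^*); rewrite normc1 wx; apply: le_trans.
  by rewrite lerD2l lerN2 ler_piMl ?normc_ge0// ltW.
by split; rewrite mulr2n mulrDl mul1r lerD.
Qed.
End disc_weights.

(** * Kernels on the disc *)
Arguments normc : simpl never.
Arguments cplx : simpl never.
(** Equal to 1 on the diagonal inside $|x|^2<e$ and vanishing to second order on the circle
    $|x|^2=e$. The order two keeps the function of class $C^1$ once it is cut off there. *)
Definition chi {R : realType} (e : R) (w x : R[i]) : R[i] :=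
  ((e - normc x ^+ 2)%:C / (e%:C - w * x^*)) ^+ 2.
Definition kerK {R : realType} (e : R) (w x : R[i]) : R[i] := chi e w x / (w - x).
(** The quotient by [w - x] of the derivative of [chi e w x] in $\bar x$; for [e = 1] a multiple of
    the weighted Bergman kernel. *)
Definition kerP {R : realType} (e : R) (w x : R[i]) : R[i] :=
  (2 * e * (e - normc x ^+ 2))%:C / (e%:C - w * x^*) ^+ 3.

Arguments chi : simpl never.
Arguments kerK : simpl never.
Arguments kerP : simpl never.

Section kernels_Lp.
Context {R : realType}.
Local Notation mu := (@lebesgue_measure R).
Local Notation muC := (@lebesgueC R).
Local Notation h := (2^-1 : R).

Section measurability.
Context d (T : measurableType d) (f g : T -> R[i]) (e : R).
Hypotheses (mf : cmeas f) (mg : cmeas g).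

Let m1 : cmeas (fun t => (e - normc (g t) ^+ 2)%:C).
Proof.
apply: cmeas_real; apply: measurable_funB; first exact: measurable_cst.
by apply: measurable_funX; exact: measurable_normc.
Qed.
Let m2 : cmeas (fun t => e%:C - f t * (g t)^*).
Proof. by apply: cmeasB; [exact: cmeas_cst|apply: cmeasM => //; exact: cmeasJ]. Qed.
Lemma cmeas_chi : cmeas (fun t => chi e (f t) (g t)).
Proof. by apply: cmeasX; apply: cmeasM => //; exact: cmeasV. Qed.
Lemma cmeas_kerK : cmeas (fun t => kerK e (f t) (g t)).
Proof. by apply: cmeasM; [exact: cmeas_chi|apply: cmeasV; exact: cmeasB]. Qed.
Lemma cmeas_kerP : cmeas (fun t => kerP e (f t) (g t)).
Proof.
rewrite /kerP; apply: cmeasM; last by apply: cmeasV; exact: cmeasX.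
apply: cmeas_real; apply: measurable_funM; first exact: measurable_cst.
apply: measurable_funB; first exact: measurable_cst.
by apply: measurable_funX; exact: measurable_normc.
Qed.
End measurability.

(** The quotient squared in [chi] has modulus at most 2, because $1-|x|^2\le 2(1-|x|)\le 2|1-w\bar
    x|$; so the kernel is a Cauchy kernel up to the factor 4. *)
Lemma normc_kerK_le (w x : R * R) : disc w -> disc x ->
  normc (kerK 1 (cplx w) (cplx x)) <= 4 * normc (cplx w - cplx x) `^ (-1).
Proof.
move=> wd xd; have [n1 n2] := normc_1subMJ wd xd.
rewrite /kerK /chi normcM normcV powR_inv1 ?normc_ge0// ler_wpM2r ?invr_ge0 ?normc_ge0//.
rewrite normcX (_ : 4 = 2 ^+ 2); last by rewrite expr2 -natrM.
rewrite lerXn2r ?nnegrE ?normc_ge0// normcM normcV normc_real.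
have /andP[d1 d2] := dist1_le xd; rewrite -/(dist1 x) (gtr0_norm (dist1_gt0 xd)).
have p0 : 0 < 1 - normc (cplx x) by rewrite subr_gt0.
have pm : 0 < normc (1 - cplx w * (cplx x)^*).
  have := normc_ge0 (cplx w - cplx x); move: n2 p0; lra.
rewrite ler_pdivrMr//; apply: (le_trans d2); rewrite ler_pM2l//.
have := ler_normcB 1 (cplx w * (cplx x)^*); rewrite normc1 normcM normcJE; apply: le_trans.
by rewrite lerD2l lerN2 ler_piMl ?normc_ge0// ltW.
Qed.

Lemma normc_kerP_le (w x : R * R) : disc w -> disc x ->
  normc (kerP 1 (cplx w) (cplx x)) =
    2 * dist1 x * normc (1 - cplx w * (cplx x)^*) `^ (- 3) /\
  0 < normc (1 - cplx w * (cplx x)^*) /\ dist1 x <= 2 * normc (1 - cplx w * (cplx x)^*).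
Proof.
move=> wd xd; have [n1 n2] := normc_1subMJ wd xd.
have /andP[d1 d2] := dist1_le xd.
have p0 : 0 < 1 - normc (cplx x) by rewrite subr_gt0.
have pm : 0 < normc (1 - cplx w * (cplx x)^*).
  have := normc_ge0 (cplx w - cplx x); move: n2 p0; lra.
split; last split => //.
  rewrite /kerP normcM normcV normcX normc_real -/(dist1 x) powR_invn ?normc_ge0//.
  by rewrite ger0_norm ?mulr1// mulr_ge0// ltW// dist1_gt0.
apply: (le_trans d2); rewrite ler_pM2l//.
have := ler_normcB 1 (cplx w * (cplx x)^*); rewrite normc1 normcM normcJE; apply: le_trans.
by rewrite lerD2l lerN2 ler_piMl ?normc_ge0// ltW.
Qed.

Lemma measurable_if_disc2 (k : R * R -> R * R -> R) :
  measurable_fun setT (fun z : mC2 R => k z.1 z.2) ->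
  measurable_fun setT (fun z : mC2 R => if disc z.1 && disc z.2 then k z.1 z.2 else 0).
Proof.
move=> mk; apply: measurable_fun_ifT; [|exact: mk|exact: measurable_cst].
by apply: measurable_and; [exact: (measurableT_comp measurable_disc measurable_fst)|exact: (measurableT_comp measurable_disc measurable_snd)].
Qed.

Definition absK (z : C2 R) : R := if disc z.1 && disc z.2 then normc (kerK 1 (cplx z.1) (cplx z.2)) else 0.
Definition absP (z : C2 R) : R := if disc z.1 && disc z.2 then normc (kerP 1 (cplx z.1) (cplx z.2)) else 0.

Lemma measurable_absK : measurable_fun setT (absK : mC2 R -> R).
Proof.
apply: (measurable_if_disc2 (k := fun w x => normc (kerK 1 (cplx w) (cplx x)))).
by apply: measurable_normc; apply: cmeas_kerK; exact: cmeas_cplx.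
Qed.
Lemma measurable_absP : measurable_fun setT (absP : mC2 R -> R).
Proof.
apply: (measurable_if_disc2 (k := fun w x => normc (kerP 1 (cplx w) (cplx x)))).
by apply: measurable_normc; apply: cmeas_kerP; exact: cmeas_cplx.
Qed.

Lemma disc_normcB (w x : R * R) : disc w -> disc x -> normc (cplx w - cplx x) <= 2.
Proof.
by move=> wd xd; rewrite (le_trans (le_normcD _ _))// normcN mulr2n lerD// ltW.
Qed.

Lemma integral_disc_riesz (a : R) (w : R * R) : 0 < a -> a < 2 -> disc w ->
  (\int[muC]_x (if disc x then normc (cplx w - cplx x) `^ (- a) else 0)%:E
    <= ((2 * (2 `^ (1 - a / 2) / (1 - a / 2))) ^+ 2)%:E)%E.
Proof.
move=> a0 a2 wd; apply: le_trans (integral_riesz w a0 a2 (ltr0Sn R 1)).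
have mn : measurable_fun setT (fun z : mC R => normc (cplx w - cplx z) `^ (- a)).
  by apply: (measurableT_comp (measurable_powR _)); exact: measurable_normcB.
apply: ge0_le_integral => //.
- by move=> x _; rewrite lee_fin; case: ifP => // _; exact: powR_ge0.
- by apply/measurable_EFinP; apply: measurable_fun_ifT; [exact: measurable_disc|exact: mn|exact: measurable_cst].
- apply/measurable_EFinP; apply: measurable_fun_ifT; [|exact: mn|exact: measurable_cst].
  by apply: measurable_fun_ler; [exact: measurable_normcB|exact: measurable_cst].
- move=> x _; rewrite lee_fin; case: ifP => xd; last by case: ifP => // _; exact: powR_ge0.
  by rewrite disc_normcB.
Qed.

Lemma conjugate_exponents (p : R) : 1 < p ->
  [/\ 0 < p, 0 < p / (p - 1), p^-1 + (p / (p - 1))^-1 = 1, p / (p / (p - 1)) = p - 1 & (p / (p - 1)) / p = (p - 1)^-1].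
Proof.
move=> p1; have p0 : 0 < p by rewrite (lt_trans ltr01).
have p10 : 0 < p - 1 by rewrite subr_gt0.
split => //; [exact: divr_gt0| | |]; field; rewrite ?(gt_eqF p0) ?(gt_eqF p10)//.
Qed.

(** Schur's test with constant weights: rows and columns are both dominated by the integral of
    $|w-x|^{-1}$ over the disc. *)
Lemma Lp_absK (p : R) : 1 < p -> exists2 C : R, 0 <= C & forall F : mC R -> R,
  measurable_fun setT F -> (forall x, 0 <= F x) ->
  (\int[muC]_w (\int[muC]_x (absK (w, x) * F x)%:E) `^ p <= C%:E * \int[muC]_x (F x `^ p)%:E)%E.
Proof.
move=> p1; have [p0 q0 pq e1 e2] := conjugate_exponents p1.
pose K : R := (2 * (2 `^ (1 - 1 / 2) / (1 - 1 / 2))) ^+ 2.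
have K0 : 0 <= K by rewrite sqr_ge0.
have K40 : 0 <= 4 * K by exact: mulr_ge0.
have bnd w : (\int[muC]_x (absK (w, x))%:E <= (4 * K)%:E)%E.
  have [wd|wd] := boolP (disc w); last first.
    rewrite (eq_integral (cst 0%E)) ?integral0 ?lee_fin// => x _.
    by rewrite /absK/= (negbTE wd).
  rewrite EFinM; apply: le_trans (lee_wpmul2l _ (integral_disc_riesz ltr01 _ wd)); last 2 first.
  - by rewrite lee_fin.
  - by rewrite ltr1n.
  have mn : measurable_fun setT (fun x : mC R => if disc x then normc (cplx w - cplx x) `^ (-1) else 0).
    apply: measurable_fun_ifT; [exact: measurable_disc| |exact: measurable_cst].
    by apply: (measurableT_comp (measurable_powR _)); exact: measurable_normcB.
  rewrite -integralZl_ge0//; last by move=> x; case: ifP => // _; exact: powR_ge0.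
  apply: ge0_le_integral => //.
  - by move=> x _; rewrite lee_fin /absK; case: ifP => _; [exact: normc_ge0|exact: lexx].
  - by apply/measurable_EFinP; exact: (measurable_fun_pair2 _ measurable_absK).
  - by apply/measurable_EFinP; apply: measurable_funM => //; exact: measurable_cst.
  - move=> x _; rewrite lee_fin /absK/= wd/=; case: ifP => xd; last by rewrite mulr0.
    exact: normc_kerK_le.
have bnd2 x : (\int[muC]_w (absK (w, x))%:E <= (4 * K)%:E)%E.
  have [wd|wd] := boolP (disc x); last first.
    rewrite (eq_integral (cst 0%E)) ?integral0 ?lee_fin// => w _.
    by rewrite /absK/= (negbTE wd) andbF.
  rewrite EFinM; apply: le_trans (lee_wpmul2l _ (integral_disc_riesz ltr01 _ wd)); last 2 first.
  - by rewrite lee_fin.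
  - by rewrite ltr1n.
  have mn : measurable_fun setT (fun w : mC R => if disc w then normc (cplx x - cplx w) `^ (-1) else 0).
    apply: measurable_fun_ifT; [exact: measurable_disc| |exact: measurable_cst].
    by apply: (measurableT_comp (measurable_powR _)); exact: measurable_normcB.
  rewrite -integralZl_ge0//; last by move=> w; case: ifP => // _; exact: powR_ge0.
  apply: ge0_le_integral => //.
  - by move=> w _; rewrite lee_fin /absK; case: ifP => _; [exact: normc_ge0|exact: lexx].
  - by apply/measurable_EFinP; exact: (measurable_fun_pair1 _ measurable_absK).
  - by apply/measurable_EFinP; apply: measurable_funM => //; exact: measurable_cst.
  - move=> w _; rewrite lee_fin /absK/= wd/= andbT; case: ifP => xd; last by rewrite mulr0.
    by rewrite [X in 4 * X `^ _]normcB; exact: normc_kerK_le.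
exists ((4 * K) `^ (p - 1) * (4 * K)); first by rewrite mulr_ge0 ?powR_ge0.
move=> F mF F0.
apply: (@schur_test _ _ _ _ _ muC muC p (p / (p - 1)) _ _ absK (fun=> 1) (fun=> 1) F) => //.
- exact: powR_ge0.
- exact: measurable_absK.
- by move=> z; rewrite /absK; case: ifP => _; [exact: normc_ge0|exact: lexx].
- move=> w; rewrite e1 powR1 mulr1 -poweR_EFin; under eq_integral do rewrite mulr1.
  apply: gt0_ler_poweR; rewrite ?subr_ge0 ?(ltW p1)// ?in_itv/= ?leey ?andbT ?lee_fin//.
  by apply: integral_ge0 => x _; rewrite lee_fin /absK; case: ifP => _; [exact: normc_ge0|exact: lexx].
- by move=> x; rewrite mul1e; under eq_integral do rewrite mul1r.
Qed.

Lemma half_powRN (r : R) : h `^ (- r) = 2 `^ r.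
Proof. by rewrite -(powR_inv1 (ler0n R 2)) -powRrM mulN1r opprK. Qed.

(** With $m=|1-w\bar x|$, one uses $(1-|x|^2)^{1-g}\le 2m^{1-g}$, leaving $m^{-(2+g)}$; then
    $2m\ge(1-|w|)+|w-x|$ reduces to the planar tail. The condition [g < 1] keeps the exponent of the
    first bound positive. *)
Lemma integral_absP_row (g : R) (w : R * R) : 0 < g -> g < 1 -> disc w ->
  (\int[muC]_x (absP (w, x) * dist1 x `^ (- g))%:E <= (32 * (16 / g ^+ 2) * (1 - normc (cplx w)) `^ (- g))%:E)%E.
Proof.
move=> g0 g1 wd; have d0 : 0 < 1 - normc (cplx w) by rewrite subr_gt0.
have mt : measurable_fun setT (fun x : mC R => (1 - normc (cplx w) + normc (cplx w - cplx x)) `^ (- (2 + g))).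
  apply: (measurableT_comp (measurable_powR _)).
  by apply: measurable_funD; [exact: measurable_cst|exact: measurable_normcB].
apply: (@le_trans _ _ (\int[muC]_x (32 * (1 - normc (cplx w) + normc (cplx w - cplx x)) `^ (- (2 + g)))%:E)%E); last first.
  rewrite integralZl_ge0//; last by move=> x; exact: powR_ge0.
  rewrite -mulrA EFinM; apply: lee_wpmul2l; first by rewrite lee_fin.
  exact: (integral_tail2 w g0 d0).
apply: ge0_le_integral => //.
- by move=> x _; rewrite lee_fin /absP mulr_ge0 ?powR_ge0//; case: ifP => _; [exact: normc_ge0|exact: lexx].
- apply/measurable_EFinP; apply: measurable_funM; first exact: (measurable_fun_pair2 _ measurable_absP).
  by apply: (measurableT_comp (measurable_powR _)); exact: measurable_dist1.
- by apply/measurable_EFinP; apply: measurable_funM => //; exact: measurable_cst.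
move=> x _; rewrite lee_fin /absP/= wd/=; case: ifP => xd; last by rewrite mul0r mulr_ge0 ?powR_ge0.
have [-> [m0 sm]] := normc_kerP_le wd xd; have s0 := dist1_gt0 xd.
have [n1 n2] := normc_1subMJ wd xd.
set m := normc (1 - _) in m0 sm n1 n2 *; set s := dist1 x in s0 sm *.
set t := 1 - normc (cplx w) + normc (cplx w - cplx x).
have t0 : 0 < t by rewrite /t ltr_wpDr// normc_ge0.
have tm : t / 2 <= m by rewrite ler_pdivrMr// mulrC /t addrC.
have e1 : s * s `^ (- g) = s `^ (1 - g).
  by rewrite powRD ?(gt_eqF s0) ?implybT// powRr1// ltW.
have e2 : s `^ (1 - g) <= 2 * m `^ (1 - g).
  apply: (@le_trans _ _ ((2 * m) `^ (1 - g))).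
    by apply: ge0_ler_powR; rewrite ?nnegrE//; [rewrite subr_ge0 ltW|exact: ltW|rewrite mulr_ge0// ltW].
  rewrite powRM// ?(ltW m0)// ler_wpM2r ?powR_ge0// -[leRHS]powRr1//.
  by apply: ler_powR; rewrite ?ler1n// gerBl ltW.
have e3 : m `^ (1 - g) * m `^ (- 3) = m `^ (- (2 + g)).
  by rewrite -powRD ?(gt_eqF m0) ?implybT//; congr powR; ring.
apply: (@le_trans _ _ (4 * m `^ (- (2 + g)))).
  rewrite (_ : 2 * s * _ * _ = 2 * (s * s `^ (- g)) * m `^ (- 3)); last by ring.
  rewrite e1 -e3 mulrA ler_wpM2r ?powR_ge0// (_ : 4 = 2 * 2); last by rewrite -natrM.
  by rewrite -mulrA ler_wpM2l.
rewrite (_ : 32 = 4 * 8); last by rewrite -natrM.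
rewrite -mulrA ler_wpM2l//.
have g20 : 0 <= 2 + g by rewrite addr_ge0// ltW.
apply: (@le_trans _ _ ((t / 2) `^ (- (2 + g)))); first by apply: le_powRN => //; exact: divr_gt0.
rewrite powRM ?invr_ge0 ?(ltW t0)// mulrC ler_wpM2r ?powR_ge0//.
rewrite half_powRN (_ : 8 = 2 `^ 3%:R); last first.
  by rewrite powR_mulrn// -natrX.
by apply: ler_powR; rewrite ?ler1n//; lra.
Qed.

(** The kernel supplies a factor $1-|x|^2$ and the boundary estimate with $d=1-|x|$ a factor
    $d^{-3/2}$; together they return the weight $(1-|x|^2)^{-1/2}$. The constant is $16\cdot
    256\cdot 4=128^2$. *)
Lemma integral_absP_col (x : R * R) : disc x ->
  (\int[muC]_w ((if disc w then dist1 w `^ (- h) else 0) * absP (w, x))%:E <= (128 ^+ 2 * dist1 x `^ (- h))%:E)%E.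
Proof.
move=> xd; have d0 : 0 < 1 - normc (cplx x) by rewrite subr_gt0.
have s0 := dist1_gt0 xd; have /andP[_ d2] := dist1_le xd.
pose G w := if disc w then dist1 w `^ (- h) * (1 - normc (cplx x) + normc (cplx w - cplx x)) `^ (- 3) else 0.
have mG : measurable_fun setT (G : mC R -> R).
  apply: measurable_fun_ifT; [exact: measurable_disc| |exact: measurable_cst].
  apply: measurable_funM; apply: (measurableT_comp (measurable_powR _)); first exact: measurable_dist1.
  apply: measurable_funD; first exact: measurable_cst.
  by apply: measurable_normc; apply: cmeasB; [exact: cmeas_cplx|exact: cmeas_cst].
have G0 w : 0 <= G w by rewrite /G; case: ifP => // _; rewrite mulr_ge0 ?powR_ge0.
apply: (@le_trans _ _ (\int[muC]_w (16 * dist1 x * G w)%:E)%E).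
  apply: ge0_le_integral => //.
  - move=> w _; rewrite lee_fin /absP mulr_ge0//; first by case: ifP => // _; exact: powR_ge0.
    by case: ifP => _; [exact: normc_ge0|exact: lexx].
  - apply/measurable_EFinP; apply: measurable_funM; last exact: (measurable_fun_pair1 _ measurable_absP).
    apply: measurable_fun_ifT; [exact: measurable_disc| |exact: measurable_cst].
    by apply: (measurableT_comp (measurable_powR _)); exact: measurable_dist1.
  - by apply/measurable_EFinP; apply: measurable_funM => //; exact: measurable_cst.
  move=> w _; rewrite lee_fin /absP/= xd andbT /G; case: ifP => wd; last by rewrite mul0r mulr0.
  have [-> [m0 sm]] := normc_kerP_le wd xd.
  have [n1 n2] := normc_1subMJ wd xd.
  set m := normc (1 - _) in m0 sm n1 n2 *.
  set t := 1 - normc (cplx x) + normc (cplx w - cplx x).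
  have t0 : 0 < t by rewrite /t ltr_wpDr// normc_ge0.
  have tm : t / 2 <= m by rewrite ler_pdivrMr// mulrC /t addrC.
  rewrite [leRHS](_ : _ = dist1 w `^ (- h) * (2 * dist1 x * (8 * t `^ (- 3)))); last by ring.
  rewrite ler_wpM2l ?powR_ge0// ler_wpM2l ?mulr_ge0 ?(ltW s0)//.
  apply: (@le_trans _ _ ((t / 2) `^ (- 3))); first by apply: le_powRN => //; exact: divr_gt0.
  rewrite powRM ?invr_ge0 ?(ltW t0)// mulrC ler_wpM2r ?powR_ge0//.
  by rewrite half_powRN powR_mulrn// -natrX.
have c0 : 0 <= 16 * dist1 x by rewrite mulr_ge0// ltW.
rewrite (integralZl_ge0 _ c0 mG G0).
apply: le_trans (lee_wpmul2l _ (integral_boundary_weight x d0)) _; first by rewrite lee_fin.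
rewrite -EFinM lee_fin.
have k1 : (1 - normc (cplx x)) `^ (- (h + 1)) <= (dist1 x / 2) `^ (- (h + 1)).
  by apply: le_powRN; rewrite ?divr_gt0// ler_pdivrMr// mulrC.
apply: (@le_trans _ _ (16 * dist1 x * (256 * (4 * (dist1 x `^ (- h) / dist1 x))))); last first.
  by rewrite le_eqVlt; apply/orP; left; apply/eqP; field; rewrite gt_eqF.
apply: ler_wpM2l; first exact: c0.
apply: ler_wpM2l; first exact: ler0n.
apply: (le_trans k1).
rewrite powRM ?invr_ge0 ?(ltW s0)// mulrC; apply: ler_pM; rewrite ?powR_ge0//.
  rewrite half_powRN (_ : 4 = 2 `^ 2%:R); last by rewrite powR_mulrn// -natrX.
  by apply: ler_powR; [rewrite ler1n|lra].
by rewrite opprD powRD ?(gt_eqF s0) ?implybT// powR_inv1// ltW.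
Qed.

(** Here the rows of the kernel are not integrable uniformly, so the weights are powers of the
    boundary distance: exponent $-1/2$ for [a] and $1/2$ for [b]. The row estimate is used with
    $g=1/(2(p-1))$, whose power $p-1$ is again the exponent $-1/2$. *)
Lemma Lp_absP (p : R) : 4 <= p -> exists2 C : R, 0 <= C & forall F : mC R -> R,
  measurable_fun setT F -> (forall x, 0 <= F x) ->
  (\int[muC]_w (\int[muC]_x (absP (w, x) * F x)%:E) `^ p <= C%:E * \int[muC]_x (F x `^ p)%:E)%E.
Proof.
move=> p4; have p1 : 1 < p by rewrite (lt_le_trans _ p4)// ltr1n.
have [p0 q0 pq e1 e2] := conjugate_exponents p1.
have p10 : 0 < p - 1 by rewrite subr_gt0.
pose g := h * (p - 1)^-1.
have g0 : 0 < g by rewrite mulr_gt0 ?invr_gt0.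
have g1 : g < 1.
  rewrite /g -invfM invf_lt1; last by rewrite mulr_gt0.
  by move: p4; lra.
pose B : R := 32 * (16 / g ^+ 2).
have B0 : 0 <= B by rewrite mulr_ge0// divr_ge0// sqr_ge0.
exists (B `^ (p - 1) * 2 * 128 ^+ 2); first by rewrite !mulr_ge0 ?powR_ge0 ?sqr_ge0.
move=> F mF F0.
pose a w : R := if disc w then dist1 w `^ (- h) else 0.
have a0 w : 0 <= a w by rewrite /a; case: ifP => // _; exact: powR_ge0.
have aP0 z : 0 <= absP z by rewrite /absP; case: ifP => _; [exact: normc_ge0|exact: lexx].
apply: (@schur_test _ _ _ _ _ muC muC p (p / (p - 1)) _ _ absP a (fun x => dist1 x `^ h) F) => //.
- by rewrite !mulr_ge0 ?powR_ge0.
- exact: measurable_absP.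
- apply: measurable_fun_ifT; [exact: measurable_disc| |exact: measurable_cst].
  by apply: (measurableT_comp (measurable_powR _)); exact: measurable_dist1.
- by apply: (measurableT_comp (measurable_powR _)); exact: measurable_dist1.
- by move=> x; exact: powR_ge0.
- move=> w x; rewrite /absP; case: ifP; rewrite ?eqxx// => /andP[_ xd] _.
  by rewrite gt_eqF// powR_gt0// dist1_gt0.
- move=> w; rewrite e1.
  have [wd|wd] := boolP (disc w); last first.
    rewrite (eq_integral (cst 0%E)) ?integral0 => [|x _]; last by rewrite /absP/= (negbTE wd) mul0r.
    by rewrite poweR0r ?gt_eqF// lee_fin mulr_ge0// mulr_ge0 ?powR_ge0.
  have -> : (\int[muC]_y (absP (w, y) * (dist1 y `^ h) `^ (- (p / (p - 1) / p)))%:E =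
      \int[muC]_y (absP (w, y) * dist1 y `^ (- g))%:E)%E.
    by apply: eq_integral => y _; rewrite -powRrM e2 mulrN.
  have d0 : 0 < 1 - normc (cplx w) by rewrite subr_gt0.
  apply: (@le_trans _ _ ((B * (1 - normc (cplx w)) `^ (- g))%:E `^ (p - 1))%E).
    apply: gt0_ler_poweR; rewrite ?(ltW p10)// ?in_itv/= ?leey ?andbT ?lee_fin ?(mulr_ge0 B0 (powR_ge0 _ _))//.
      by apply: integral_ge0 => x _; rewrite lee_fin mulr_ge0 ?powR_ge0.
    exact: (integral_absP_row g0 g1 wd).
  rewrite poweR_EFin lee_fin powRM ?powR_ge0// -mulrA ler_wpM2l ?powR_ge0//.
  rewrite -powRrM /a wd (_ : - g * (p - 1) = - h); last by rewrite /g; field; rewrite gt_eqF.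
  have /andP[_ d2] := dist1_le wd; have s0 := dist1_gt0 wd.
  apply: (@le_trans _ _ ((dist1 w / 2) `^ (- h))).
    by apply: le_powRN; rewrite ?divr_gt0 ?invr_ge0// ler_pdivrMr// mulrC.
  rewrite powRM ?invr_ge0 ?(ltW s0)// mulrC ler_wpM2r ?powR_ge0//.
  rewrite half_powRN -[leRHS]powRr1//.
  by apply: ler_powR; [rewrite ler1n|lra].
- move=> x; have [xd|xd] := boolP (disc x); last first.
    rewrite (eq_integral (cst 0%E)) ?integral0 ?mule0// => w _.
    by rewrite /absP/= (negbTE xd) andbF mulr0.
  have s0 := dist1_gt0 xd.
  apply: le_trans (lee_wpmul2l _ (integral_absP_col xd)) _; first by rewrite lee_fin powR_ge0.
  rewrite -EFinM lee_fin mulrCA -powRD ?(gt_eqF s0) ?implybT// subrr powRr0 mulr1//.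
Qed.

Definition absW (p : R) (z : C2 R) : R := if disc z.1 && disc z.2 then
  normc (cplx z.1) `^ (2 / p) * normc (cplx z.2) `^ (- (2 / p)) * normc (cplx z.1 - cplx z.2) `^ (-1) else 0.

Lemma measurable_absW p : measurable_fun setT (absW p : mC2 R -> R).
Proof.
apply: (measurable_if_disc2 (k := fun w x => normc (cplx w) `^ (2 / p) * normc (cplx x) `^ (- (2 / p)) * normc (cplx w - cplx x) `^ (-1))).
apply: measurable_funM; last by apply: (measurableT_comp (measurable_powR _)); apply: measurable_normc; apply: cmeasB; exact: cmeas_cplx.
by apply: measurable_funM; apply: (measurableT_comp (measurable_powR _)); apply: measurable_normc; exact: cmeas_cplx.
Qed.

(** The smaller of [u] and [v] carries the whole exponent. If one of them is 0, the left side is 0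
    by the convention on powers of 0. *)
Lemma powRN_mul_le (u v m : R) : 0 <= u -> 0 <= v -> 0 < m ->
  u `^ (- m) * v `^ (-1) <= u `^ (- (m + 1)) + v `^ (- (m + 1)).
Proof.
move=> u0 v0 m0; have [->|un0] := eqVneq u 0.
  by rewrite powR0 ?oppr_eq0 ?(gt_eqF m0)// mul0r addr_ge0 ?powR_ge0.
have [->|vn0] := eqVneq v 0.
  by rewrite (@powR0 _ (-1)) ?oppr_eq0 ?oner_eq0// mulr0 addr_ge0 ?powR_ge0.
have pu : 0 < u by rewrite lt_def un0. have pv : 0 < v by rewrite lt_def vn0.
rewrite opprD !powRD ?un0 ?vn0 ?implybT//; have [uv|vu] := leP u v.
  rewrite (le_trans (y := u `^ (- m) * u `^ (-1)))//; last by rewrite lerDl mulr_ge0 ?powR_ge0.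
  by rewrite ler_wpM2l ?powR_ge0// le_powRN.
rewrite (le_trans (y := v `^ (- m) * v `^ (-1)))//; last by rewrite lerDr mulr_ge0 ?powR_ge0.
by rewrite ler_wpM2r ?powR_ge0// le_powRN ?ltW.
Qed.

(** The weights are 1 and $|x|^{2/p}$. In the row integral the powers of $|x|$ combine to
    $-2/p-2/(p(p-1))=-m$ with $m=2/(p-1)$, and $|x|^{-m}|w-x|^{-1}$ is split into singularities at 0
    and at [w] of order [m + 1]. This is below 2 because $p>3$. The positive power of $|w|$ is
    bounded by 1. *)
Lemma Lp_absW (p : R) : 4 <= p -> exists2 C : R, 0 <= C & forall F : mC R -> R,
  measurable_fun setT F -> (forall x, 0 <= F x) ->
  (\int[muC]_w (\int[muC]_x (absW p (w, x) * F x)%:E) `^ p <= C%:E * \int[muC]_x (F x `^ p)%:E)%E.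
Proof.
move=> p4; have p1 : 1 < p by rewrite (lt_le_trans _ p4)// ltr1n.
have [p0 q0 pq e1 e2] := conjugate_exponents p1.
have p10 : 0 < p - 1 by rewrite subr_gt0.
pose m := 2 / (p - 1).
have m0 : 0 < m by rewrite divr_gt0.
have m1 : m + 1 < 2 by rewrite /m -ltrBrDr ltr_pdivrMr//; lra.
have m10 : 0 < m + 1 by rewrite addr_gt0.
pose K (a : R) : R := (2 * (2 `^ (1 - a / 2) / (1 - a / 2))) ^+ 2.
have K0 a : 0 <= K a by rewrite sqr_ge0.
pose A := K (m + 1) + K (m + 1).
have A0 : 0 <= A by rewrite addr_ge0.
have w0 z : 0 <= absW p z by rewrite /absW; case: ifP => // _; rewrite !mulr_ge0 ?powR_ge0.
exists (A `^ (p - 1) * K 1); first exact: (mulr_ge0 (powR_ge0 _ _) (K0 _)).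
have mp0 : 0 < 2 / p by rewrite divr_gt0.
have le1 w : disc w -> normc (cplx w) `^ (2 / p) <= 1.
  move=> wd; have e : 1 = 1 `^ (2 / p) :> R by rewrite powR1.
  rewrite [leRHS]e.
  by apply: ge0_ler_powR; rewrite ?nnegrE ?normc_ge0//; exact: ltW.
have mn1 (r : R) (c : R[i]) : measurable_fun setT (fun x : mC R => if disc x then normc (c - cplx x) `^ r else 0).
  apply: measurable_fun_ifT; [exact: measurable_disc| |exact: measurable_cst].
  by apply: (measurableT_comp (measurable_powR _)); apply: measurable_normc; apply: cmeasB; [exact: cmeas_cst|exact: cmeas_cplx].
have n10 (r : R) (c : R[i]) x : 0 <= (if disc x then normc (c - cplx x) `^ r else 0) by case: ifP => // _; exact: powR_ge0.
move=> F mF F0.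
apply: (@schur_test _ _ _ _ _ muC muC p (p / (p - 1)) _ _ (absW p) (fun=> 1) (fun x => normc (cplx x) `^ (2 / p)) F) => //.
- exact: powR_ge0.
- exact: measurable_absW.
- by apply: (measurableT_comp (measurable_powR _)); apply: measurable_normc; exact: cmeas_cplx.
- by move=> x; exact: powR_ge0.
- move=> w x; rewrite /absW; case: ifP; rewrite ?eqxx// => _; apply: contra_neq => /eqP.
  rewrite powR_eq0 => /andP[/eqP ->] _ /=.
  by rewrite powR0 ?oppr_eq0 ?(gt_eqF mp0)// mulr0 mul0r.
- move=> w; rewrite e1 mulr1 -poweR_EFin.
  apply: gt0_ler_poweR; rewrite ?(ltW p10)// ?in_itv/= ?leey ?andbT ?lee_fin//.
    by apply: integral_ge0 => x _; rewrite lee_fin mulr_ge0 ?powR_ge0.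
  have [wd|wd] := boolP (disc w); last first.
    rewrite (eq_integral (cst 0%E)) ?integral0 ?lee_fin// => x _.
    by rewrite /absW/= (negbTE wd) mul0r.
  have d00 : @disc R 0 by rewrite /disc (_ : cplx 0 = 0)// normc0 ltr01.
  rewrite /A EFinD; apply: le_trans (leeD (integral_disc_riesz m10 m1 d00) (integral_disc_riesz m10 m1 wd)).
  rewrite -ge0_integralD//; last 4 first.
  + by move=> x _; rewrite lee_fin.
  + exact/measurable_EFinP.
  + by move=> x _; rewrite lee_fin.
  + exact/measurable_EFinP.
  apply: ge0_le_integral => //.
  + by move=> x _; rewrite lee_fin mulr_ge0 ?powR_ge0.
  + apply/measurable_EFinP; apply: measurable_funM; first exact: (measurable_fun_pair2 _ (measurable_absW p)).
    by do 2! apply: (measurableT_comp (measurable_powR _)); apply: measurable_normc; exact: cmeas_cplx.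
  + by apply: emeasurable_funD; exact/measurable_EFinP.
  move=> x _; rewrite -EFinD lee_fin /absW/= wd/=; case: ifP => xd; last by rewrite mul0r addr0.
  rewrite (_ : cplx 0 = 0)// sub0r normcN.
  apply: (le_trans _ (powRN_mul_le (normc_ge0 _) (normc_ge0 _) m0)).
  rewrite -powRrM e2; have [x0|xn0] := eqVneq (normc (cplx x)) 0.
    by rewrite x0 (@powR0 _ (- (2 / p))) ?oppr_eq0 ?(gt_eqF mp0)// mulr0 !mul0r mulr_ge0 ?powR_ge0.
  rewrite (_ : _ * _ * _ * _ = normc (cplx w) `^ (2 / p) * (normc (cplx x) `^ (- (2 / p)) * normc (cplx x) `^ (2 / p * - (p - 1)^-1) * normc (cplx w - cplx x) `^ (-1))); last by rewrite -!mulrA; congr (_ * (_ * _)); exact: mulrC.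
  rewrite -powRD ?xn0 ?implybT// (_ : - (2 / p) + _ = - m); last first.
    by rewrite /m; field; rewrite (gt_eqF p0) (gt_eqF p10).
  by rewrite ler_piMl ?mulr_ge0 ?powR_ge0// le1.
- move=> x; have [xd|xd] := boolP (disc x); last first.
    rewrite (eq_integral (cst 0%E)) ?integral0 ?mule0 ?lee_fin// => w _.
    by rewrite /absW/= (negbTE xd) andbF mulr0.
  have [x0|xn0] := eqVneq (normc (cplx x)) 0.
    by rewrite x0 powR0 ?(gt_eqF mp0)// mul0e lee_fin.
  apply: (@le_trans _ _ ((normc (cplx x) `^ (2 / p))%:E * (normc (cplx x) `^ (- (2 / p)) * K 1)%:E)%E); last first.
    rewrite -EFinM lee_fin mulrA -powRD ?xn0 ?implybT// subrr powRr0 mul1r//.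
  apply: lee_wpmul2l; first by rewrite lee_fin powR_ge0.
  rewrite EFinM; apply: le_trans (lee_wpmul2l _ (integral_disc_riesz ltr01 _ xd)); last 2 first.
  + by rewrite lee_fin powR_ge0.
  + by rewrite ltr1n.
  rewrite -integralZl_ge0 ?powR_ge0//.
  apply: ge0_le_integral => //.
  + by move=> w _; rewrite lee_fin mulr_ge0.
  + by apply/measurable_EFinP; apply: measurable_funM; [exact: measurable_cst|exact: (measurable_fun_pair1 _ (measurable_absW p))].
  + by apply/measurable_EFinP; apply: measurable_funM => //; exact: measurable_cst.
  move=> w _; rewrite lee_fin mul1r /absW/= xd andbT; case: ifP => wd; last by rewrite mulr0.
  by rewrite normcB ler_wpM2r ?powR_ge0// ler_piMl ?powR_ge0// le1.
Qed.
End kernels_Lp.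

(** * The Cauchy-Pompeiu formula *)

Definition ccont {R : realType} (T : topologicalType) (f : T -> R[i]) :=
  continuous (fun x => complex.Re (f x)) /\ continuous (fun x => complex.Im (f x)).

Definition cderiv {R : realType} (f : R -> R[i]) (t : R) (d : R[i]) :=
  is_derive t (1 : R) (fun t => complex.Re (f t)) (complex.Re d) /\
  is_derive t (1 : R) (fun t => complex.Im (f t)) (complex.Im d).

Section ccont_theory.
Context {R : realType} (T : topologicalType).
Implicit Types f g : T -> R[i].

Lemma ccont_cst (c : R[i]) : ccont (fun _ : T => c).
Proof. by split=> x; exact: cvg_cst. Qed.
Lemma ccontD f g : ccont f -> ccont g -> ccont (fun x => f x + g x).
Proof.
move=> [f1 f2] [g1 g2]; split=> x.
  by under eq_fun do rewrite ReD; apply: cvgD; [exact: f1|exact: g1].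
by under eq_fun do rewrite ImD; apply: cvgD; [exact: f2|exact: g2].
Qed.
Lemma ccontN f : ccont f -> ccont (fun x => - f x).
Proof.
move=> [f1 f2]; split=> x.
  by under eq_fun do rewrite ReN; apply: cvgN; exact: f1.
by under eq_fun do rewrite ImN; apply: cvgN; exact: f2.
Qed.
Lemma ccontB f g : ccont f -> ccont g -> ccont (fun x => f x - g x).
Proof. by move=> cf cg; apply: ccontD => //; exact: ccontN. Qed.
Lemma ccontM f g : ccont f -> ccont g -> ccont (fun x => f x * g x).
Proof.
move=> [f1 f2] [g1 g2]; split=> x.
  by under eq_fun do rewrite ReM; apply: cvgB; apply: cvgM; by [exact: f1|exact: f2|exact: g1|exact: g2].
by under eq_fun do rewrite ImM; apply: cvgD; apply: cvgM; by [exact: f1|exact: f2|exact: g1|exact: g2].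
Qed.
Lemma ccontX f n : ccont f -> ccont (fun x => f x ^+ n).
Proof.
move=> cf; elim: n => [|n IH]; first exact: ccont_cst.
by under eq_fun do rewrite exprS; exact: ccontM.
Qed.
Lemma ccontJ f : ccont f -> ccont (fun x => (f x)^*).
Proof.
move=> [f1 f2]; split; first by under eq_fun do rewrite ReJ.
by move=> x; under eq_fun do rewrite ImJ; apply: cvgN; exact: f2.
Qed.
Lemma ccont_real (h : T -> R) : continuous h -> ccont (fun x => (h x)%:C).
Proof. by move=> ch; split => //= x; exact: cvg_cst. Qed.
Lemma continuous_normc2 f : ccont f -> continuous (fun x => normc (f x) ^+ 2).
Proof.
move=> [f1 f2] x; under eq_fun do rewrite sqr_normcE.
by apply: cvgD; apply: cvgM; by [exact: f1|exact: f2].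
Qed.
Lemma continuous_normc f : ccont f -> continuous (fun x => normc (f x)).
Proof.
move=> cf x; under eq_fun do rewrite normcE2.
apply: (@continuous_comp _ _ _ (fun x => complex.Re (f x) ^+ 2 + complex.Im (f x) ^+ 2) (@Num.sqrt R)).
  by have := continuous_normc2 cf (x := x); under eq_fun do rewrite sqr_normcE.
exact: sqrt_continuous.
Qed.

(* [a / b] stays continuous across the zeros of [b] because [a] vanishes near them. *)
Lemma ccont_div (a b : T -> R[i]) (ep : R) : 0 < ep -> ccont a -> ccont b ->
  (forall x, normc (b x) < ep -> a x = 0) -> ccont (fun x => a x / b x).
Proof.
move=> ep0 ca cb ab.
have [cva1 cva2] := ca; have [cvb1 cvb2] := cb.
have main x : continuous_at x (fun x => complex.Re (a x / b x)) /\ continuous_at x (fun x => complex.Im (a x / b x)).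
  have [bx0|bx0] := eqVneq (b x) 0.
    have nz : \forall y \near x, a y = 0.
      have cn := continuous_normc cb (x := x).
      have : \forall y \near x, normc (b y) < ep.
        by apply: (cvgr_lt (normc (b x)) cn); rewrite bx0 normc0.
      by apply: filterS => y; exact: ab.
    have ax0 : a x = 0 by apply: ab; rewrite bx0 normc0.
    by split; apply/cvgrPdist_lt => e e0; apply: filterS nz => y ya; rewrite /= ax0 ya !mul0r subrr normr0.
  have nx : complex.Re (b x) ^+ 2 + complex.Im (b x) ^+ 2 != 0.
    by rewrite -sqr_normcE sqrf_eq0 normc_eq0.
  have cn : continuous_at x (fun x => (complex.Re (b x) ^+ 2 + complex.Im (b x) ^+ 2)^-1).
    apply: cvgV => //; apply: cvgD; apply: cvgM; by [exact: cvb1|exact: cvb2].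
  split.
    under eq_fun do rewrite ReM ReV ImV mulNr mulrN opprK.
    apply: cvgD; apply: cvgM; [exact: cva1|apply: cvgM; [exact: cvb1|exact: cn]|exact: cva2|apply: cvgM; [exact: cvb2|exact: cn]].
  under eq_fun do rewrite ImM ReV ImV mulNr mulrN.
  apply: cvgD; last by apply: cvgM; [exact: cva2|apply: cvgM; [exact: cvb1|exact: cn]].
  by apply: cvgN; apply: cvgM; [exact: cva1|apply: cvgM; [exact: cvb2|exact: cn]].
by split=> x; have [] := main x.
Qed.
End ccont_theory.

Lemma ccont_comp {R : realType} (S T : topologicalType) (f : T -> R[i]) (h : S -> T) :
  ccont f -> continuous h -> ccont (fun x => f (h x)).
Proof. by move=> [f1 f2] ch; split; [exact: (continuous_compT ch f1)|exact: (continuous_compT ch f2)]. Qed.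

Lemma ccont_cplx {R : realType} : ccont (@cplx R : R * R -> R[i]).
Proof. by split=> x; [exact: cvg_fst|exact: cvg_snd]. Qed.

Lemma ccont_cmeas {R : realType} (f : R * R -> R[i]) : ccont f -> cmeas (f : mC R -> R[i]).
Proof. by move=> [f1 f2]; split; exact: measurable_continuousC. Qed.
Lemma ccont_cmeas2 {R : realType} (f : C2 R -> R[i]) : ccont f -> cmeas (f : mC2 R -> R[i]).
Proof. by move=> [f1 f2]; split; exact: measurable_continuousC2. Qed.

Section cderiv_theory.
Context {R : realType}.
Implicit Types (f g : R -> R[i]) (t : R).

Lemma cderiv_cst (c : R[i]) t : cderiv (fun _ => c) t 0.
Proof. by split; exact: is_derive_cst. Qed.
Lemma cderivD f g t df dg : cderiv f t df -> cderiv g t dg -> cderiv (fun t => f t + g t) t (df + dg).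
Proof.
move=> [f1 f2] [g1 g2]; split.
  by under eq_fun do rewrite ReD; rewrite ReD; exact: is_deriveD.
by under eq_fun do rewrite ImD; rewrite ImD; exact: is_deriveD.
Qed.
Lemma cderivM f g t df dg : cderiv f t df -> cderiv g t dg ->
  cderiv (fun t => f t * g t) t (df * g t + f t * dg).
Proof.
move=> [f1 f2] [g1 g2]; split.
  under eq_fun do rewrite ReM.
  apply: (@is_derive_eq _ _ _ _ _ _ _ _ (is_deriveB (is_deriveM f1 g1) (is_deriveM f2 g2))).
  by rewrite ReD !ReM /GRing.scale/=; ring.
under eq_fun do rewrite ImM.
apply: (@is_derive_eq _ _ _ _ _ _ _ _ (is_deriveD (is_deriveM f1 g2) (is_deriveM f2 g1))).
by rewrite ImD !ImM /GRing.scale/=; ring.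
Qed.
Lemma cderivJ f t df : cderiv f t df -> cderiv (fun t => (f t)^*) t (df^*).
Proof.
move=> [f1 f2]; split; first by under eq_fun do rewrite ReJ; rewrite ReJ.
by under eq_fun do rewrite ImJ; rewrite ImJ; exact: is_deriveN.
Qed.
Lemma cderiv_real (h : R -> R) t dh : is_derive t (1 : R) h dh -> cderiv (fun t => (h t)%:C) t dh%:C.
Proof. by move=> hh; split => //; exact: is_derive_cst. Qed.

Lemma cderivV f t df : cderiv f t df -> f t != 0 -> cderiv (fun t => (f t)^-1) t (- df / f t ^+ 2).
Proof.
move=> [f1 f2] f0.
pose n s := complex.Re (f s) ^+ 2 + complex.Im (f s) ^+ 2.
have n0 : n t != 0 by rewrite /n -sqr_normcE sqrf_eq0 normc_eq0.
pose dn := 2 * (complex.Re (f t) * complex.Re df + complex.Im (f t) * complex.Im df).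
have hn : is_derive t (1 : R) n dn.
  apply: (@is_derive_eq _ _ _ _ _ _ _ _ (is_deriveD (is_deriveM f1 f1) (is_deriveM f2 f2))).
  by rewrite /dn /GRing.scale/=; ring.
have hi := is_deriveV n0 hn.
have dE : - df / f t ^+ 2 = - df * (((f t)^*) ^+ 2) * ((n t) ^- 2)%:C.
  have nE : (n t)%:C = f t * (f t)^* by rewrite mulcJ sqr_normcE.
  have nC0 : (n t)%:C != 0 :> R[i] by apply/negP => /eqP[]/eqP; rewrite (negPf n0).
  have -> : ((n t) ^- 2)%:C = ((n t)%:C ^+ 2)^-1 by rewrite fmorphV rmorphXn.
  rewrite nE exprMn in nC0 *; rewrite -mulrA; congr (_ * _).
  have fJ0 : (f t)^* != 0 by rewrite conjc_eq0.
  by field; rewrite fJ0 f0.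
rewrite dE; split.
  under eq_fun do rewrite ReV.
  apply: (@is_derive_eq _ _ _ _ _ _ _ _ (is_deriveM f1 hi)).
  rewrite !(ReM, ImM, ReN, ImN, ReJ, ImJ, expr2 ((f t)^*))/= /GRing.scale/= /dn.
  move: n0; rewrite /n; set a := complex.Re (f t); set b := complex.Im (f t) => n0.
  by field.
under eq_fun do rewrite ImV.
apply: (@is_derive_eq _ _ _ _ _ _ _ _ (is_deriveM (is_deriveN f2) hi)).
rewrite !(ReM, ImM, ReN, ImN, ReJ, ImJ, expr2 ((f t)^*))/= /GRing.scale/= /dn.
move: n0; rewrite /n; set a := complex.Re (f t); set b := complex.Im (f t) => n0.
have -> : (- (fun t0 => complex.Im (f t0))) t = - b by [].
by field.
Qed.

Lemma near_eq_cderiv f g t d : (\forall s \near t, f s = g s) -> cderiv f t d -> cderiv g t d.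
Proof.
move=> fg [f1 f2]; split.
  by apply: (@near_eq_is_derive _ _ _ (fun s => complex.Re (f s))) f1; apply: filterS fg => s ->.
by apply: (@near_eq_is_derive _ _ _ (fun s => complex.Im (f s))) f2; apply: filterS fg => s ->.
Qed.

Lemma cderiv_unique f t d d' : cderiv f t d -> cderiv f t d' -> d = d'.
Proof.
move=> [[_ h1] [_ h2]] [[_ h3] [_ h4]].
by apply: complexRI; [rewrite -h1 -h3|rewrite -h2 -h4].
Qed.

End cderiv_theory.

(* [Gb] is the classical derivative of [G] with respect to the conjugate variable. *)
Definition wirt {R : realType} (G Gb : R * R -> R[i]) := exists Gx Gy : R * R -> R[i],
  [/\ ccont G, ccont Gx, ccont Gy,
    (forall x y, cderiv (fun s => G (s, y)) x (Gx (x, y)) /\ cderiv (fun s => G (x, s)) y (Gy (x, y))) &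
    forall w, Gb w = (Gx w + 'i * Gy w) / 2].

Section wirt_theory.
Context {R : realType}.
Implicit Types G H Gb Hb : R * R -> R[i].

Lemma wirt_ccont G Gb : wirt G Gb -> ccont G.
Proof. by move=> [? [? []]]. Qed.
Lemma wirt_ccontb G Gb : wirt G Gb -> ccont Gb.
Proof.
move=> [Gx [Gy [cG cx cy _ Gbe]]]; rewrite (_ : Gb = fun w => (Gx w + 'i * Gy w) * 2^-1); last exact/funext.
by apply: ccontM; [apply: ccontD => //; apply: ccontM => //; exact: ccont_cst|exact: ccont_cst].
Qed.

Lemma wirt_eq G Gb Gb' : wirt G Gb -> (forall w, Gb w = Gb' w) -> wirt G Gb'.
Proof. by move=> h e; rewrite (_ : Gb' = Gb)//; apply/funext => w. Qed.

Lemma wirt_cst (c : R[i]) : wirt (fun _ => c) (fun _ => 0).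
Proof.
exists (fun _ => 0), (fun _ => 0); split; do ?exact: ccont_cst.
  by move=> x y; split; exact: cderiv_cst.
by move=> w; rewrite mulr0 addr0 mul0r.
Qed.

Lemma wirt_cplx : wirt (@cplx R) (fun _ => 0).
Proof.
exists (fun _ => 1), (fun _ => 'i); split; do ?exact: ccont_cst; first exact: ccont_cplx.
  by move=> x y; split; split; rewrite /cplx/=; by [exact: is_derive_id|exact: is_derive_cst].
by move=> w; rewrite -expr2 sqr_i subrr mul0r.
Qed.

Lemma wirt_conj : wirt (fun w => (@cplx R w)^*) (fun _ => 1).
Proof.
exists (fun _ => 1), (fun _ => - 'i); split; do ?exact: ccont_cst; first by apply: ccontJ; exact: ccont_cplx.
  move=> x y; split.
    have [] := cderivJ (conj (@is_derive_id _ _ x 1) (is_derive_cst y x 1) : cderiv (fun s => cplx (s, y)) x 1).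
    by rewrite conjc1.
  have := cderivJ (conj (is_derive_cst x y 1) (@is_derive_id _ _ y 1) : cderiv (fun s => cplx (x, s)) y 'i).
  by congr cderiv; apply: complexRI; rewrite ?ReJ ?ImJ ?ReN ?ImN/= ?oppr0.
by move=> w; rewrite mulrN -expr2 sqr_i opprK -mulr2n divff// pnatr_eq0.
Qed.

Lemma wirtD G Gb H Hb : wirt G Gb -> wirt H Hb -> wirt (fun w => G w + H w) (fun w => Gb w + Hb w).
Proof.
move=> [Gx [Gy [cG cGx cGy dG eG]]] [Hx [Hy [cH cHx cHy dH eH]]].
exists (fun w => Gx w + Hx w), (fun w => Gy w + Hy w); split; do ?exact: ccontD.
  by move=> x y; have [? ?] := dG x y; have [? ?] := dH x y; split; exact: cderivD.
by move=> w; rewrite eG eH; ring.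
Qed.

Lemma wirtM G Gb H Hb : wirt G Gb -> wirt H Hb ->
  wirt (fun w => G w * H w) (fun w => Gb w * H w + G w * Hb w).
Proof.
move=> [Gx [Gy [cG cGx cGy dG eG]]] [Hx [Hy [cH cHx cHy dH eH]]].
exists (fun w => Gx w * H w + G w * Hx w), (fun w => Gy w * H w + G w * Hy w); split.
- exact: ccontM.
- by apply: ccontD; exact: ccontM.
- by apply: ccontD; exact: ccontM.
-
  by move=> x y; have [? ?] := dG x y; have [? ?] := dH x y; split; exact: cderivM.
by move=> w; rewrite eG eH; ring.
Qed.

Lemma wirtN G Gb : wirt G Gb -> wirt (fun w => - G w) (fun w => - Gb w).
Proof.
move=> h; have := wirtM (wirt_cst (-1)) h; rewrite (_ : (fun w => -1 * G w) = fun w => - G w); last first.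
  by apply/funext => w; rewrite mulN1r.
by move=> h'; apply: (wirt_eq h') => w; rewrite mul0r add0r mulN1r.
Qed.

(** Where [|H| < ep] the numerator vanishes along both coordinate lines near the point, so its
    partial derivatives vanish and the quotient is locally 0; elsewhere the usual quotient rule
    applies. *)
Lemma wirt_div (G Gb H Hb : R * R -> R[i]) (ep : R) : 0 < ep -> wirt G Gb -> wirt H Hb ->
  (forall w, normc (H w) < ep -> G w = 0) ->
  wirt (fun w => G w / H w) (fun w => (Gb w * H w - G w * Hb w) / H w ^+ 2).
Proof.
move=> ep0 [Gx [Gy [cG cGx cGy dG eG]]] [Hx [Hy [cH cHx cHy dH eH]]] GH.
have near0 (w : R * R) : normc (H w) < ep ->
    (\forall s \near w.1, G (s, w.2) = 0) /\ (\forall s \near w.2, G (w.1, s) = 0).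
  move=> hw; have cn := continuous_normc cH (x := w).
  have [c1 c2] : (\forall s \near w.1, normc (H (s, w.2)) < ep) /\ (\forall s \near w.2, normc (H (w.1, s)) < ep).
    have e12 : (w.1, w.2) = w by case: (w).
    split.
      have c : continuous_at w.1 (fun s => normc (H (s, w.2))).
        apply: (@continuous_compT R (R * R)%type R (fun s => (s, w.2)) (fun w => normc (H w))); last exact: continuous_normc.
        by apply: continuous_pair => x; [exact: cvg_id|exact: cvg_cst].
      by apply: (cvgr_lt _ c); rewrite e12.
    have c : continuous_at w.2 (fun s => normc (H (w.1, s))).
      apply: (@continuous_compT R (R * R)%type R (fun s => (w.1, s)) (fun w => normc (H w))); last exact: continuous_normc.
      by apply: continuous_pair => x; [exact: cvg_cst|exact: cvg_id].
    by apply: (cvgr_lt _ c); rewrite e12.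
  by split; [apply: filterS c1 => s; exact: GH|apply: filterS c2 => s; exact: GH].
have d0 (w : R * R) : normc (H w) < ep -> Gx w = 0 /\ Gy w = 0.
  move=> hw; have [n1 n2] := near0 w hw.
  have := dG w.1 w.2; rewrite -surjective_pairing => -[D1 D2].
  have e1 : forall f, (\forall s \near w.1, f s = 0) -> cderiv f w.1 (0 : R[i]).
    by move=> f h; apply: (near_eq_cderiv _ (cderiv_cst 0 w.1)); apply: filterS h => s ->.
  have e2 : forall f, (\forall s \near w.2, f s = 0) -> cderiv f w.2 (0 : R[i]).
    by move=> f h; apply: (near_eq_cderiv _ (cderiv_cst 0 w.2)); apply: filterS h => s ->.
  by split; [exact: (cderiv_unique D1 (e1 _ n1))|exact: (cderiv_unique D2 (e2 _ n2))].
have cq (K Kb : R * R -> R[i]) : ccont K -> ccont Kb -> (forall w, normc (H w) < ep -> K w = 0) ->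
    ccont (fun w => (K w * H w - G w * Kb w) / H w ^+ 2).
  move=> cK cKb K0; apply: (@ccont_div _ _ _ _ (ep ^+ 2)); first by rewrite exprn_gt0.
  - by apply: ccontB; exact: ccontM.
  - exact: ccontX.
  - move=> w; rewrite normcX ltr_pXn2r// ?nnegrE ?normc_ge0 ?(ltW ep0)// => hw.
    by rewrite K0// GH// !mul0r subrr.
exists (fun w => (Gx w * H w - G w * Hx w) / H w ^+ 2), (fun w => (Gy w * H w - G w * Hy w) / H w ^+ 2).
split.
- exact: (ccont_div ep0).
- by apply: cq => // w /d0[].
- by apply: cq => // w /d0[].
- move=> x y; have [G1 G2] := dG x y; have [H1 H2] := dH x y.
  have [hw|hw] := ltP (normc (H (x, y))) ep.
    have [n1 n2] := near0 (x, y) hw; have [-> ->] := d0 _ hw; rewrite (GH _ hw) !mul0r subrr mul0r.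
    split.
      apply: (near_eq_cderiv _ (cderiv_cst 0 x)); apply: filterS n1 => s /= ->; by rewrite mul0r.
    by apply: (near_eq_cderiv _ (cderiv_cst 0 y)); apply: filterS n2 => s /= ->; rewrite mul0r.
  have Hn0 : H (x, y) != 0 by rewrite -normc_gt0 (lt_le_trans ep0).
  split.
    have := cderivM G1 (cderivV H1 Hn0); congr cderiv.
    by field; rewrite Hn0.
  have := cderivM G2 (cderivV H2 Hn0); congr cderiv.
  by field; rewrite Hn0.
move=> w; rewrite eG eH; ring.
Qed.

Lemma wirt_comp_real (h h' : R -> R) (q : R * R -> R) Qb : continuous h' ->
  (forall s, is_derive s (1 : R) h (h' s)) -> wirt (fun w => (q w)%:C) Qb ->
  wirt (fun w => (h (q w))%:C) (fun w => (h' (q w))%:C * Qb w).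
Proof.
move=> ch' dh [Qx [Qy [[cq _] cQx cQy dQ eQ]]].
have ch : continuous h by move=> s; apply/differentiable_continuous/derivable1_diffP; have [] := dh s.
have ch'q : ccont (fun w => (h' (q w))%:C) by apply: ccont_real; exact: (continuous_compT cq ch').
have dreal (f : R -> R) t d : cderiv (fun s => (f s)%:C) t d ->
    cderiv (fun s => (h (f s))%:C) t ((h' (f t))%:C * d).
  move=> [/= d1 d2]; have d0 : complex.Im d = 0.
    by case: d2 => _ <-; case: (@is_derive_cst R R R (0 : R) t 1).
  have -> : (h' (f t))%:C * d = (h' (f t) * complex.Re d)%:C.
    by apply: complexRI; rewrite ?ReM ?ImM/= d0 ?(mulr0, mul0r) ?subr0 ?addr0.
  by apply: cderiv_real; rewrite mulrC; exact: (is_derive1_comp (f := h)).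
exists (fun w => (h' (q w))%:C * Qx w), (fun w => (h' (q w))%:C * Qy w); split.
- by apply: ccont_real; exact: (continuous_compT cq ch).
- exact: ccontM.
- exact: ccontM.
- by move=> x y; have [d1 d2] := dQ x y; split; exact: dreal.
- by move=> w; rewrite eQ; ring.
Qed.
End wirt_theory.

(** Settles the junction point 0 of [Num.max 0 s ^+ 2] and of the flat exponential, where the two
    one-sided formulas meet. *)
Lemma is_derive0_quadratic {R : realType} (f : R -> R) (s C : R) : f s = 0 ->
  (forall t, `|f t| <= C * (t - s) ^+ 2) -> is_derive s (1 : R) f 0.
Proof.
move=> fs fb.
have C0 : 0 <= C.
  by have := fb (s + 1); rewrite addrAC subrr add0r expr1n mulr1; apply: le_trans.
have lim0 : (h^-1 *: (f (h *: (1 : R) + s) - f s)) @[h --> 0^'] --> (0 : R).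
  apply/cvgrPdist_le => e e0.
  near=> h.
  have h0 : h != 0 by near: h; exact: nbhs_dnbhs_neq.
  rewrite fs subr0 sub0r normrN normrZ normfV.
  rewrite ler_pdivrMl ?normr_gt0// (le_trans (fb _))//.
  rewrite /GRing.scale/= mulr1 addrK -real_normK ?num_real// expr2 mulrCA ler_wpM2l//.
  have : `|h| <= e / (C + 1).
    near: h; apply: dnbhs0_le.
    by rewrite divr_gt0// ltr_wpDl.
  move=> /(ler_wpM2l C0)/le_trans; apply.
  by rewrite mulrA ler_pdivrMr ?ltr_wpDl// mulrDr mulr1 [e * C]mulrC lerDl ltW.
split; first by apply/cvg_ex; exists 0.
exact: cvg_lim.
Unshelve. all: by end_near.
Qed.

(** The square of the positive part is of class $C^1$, while the positive part itself is not: this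
    is why the cutoff enters the kernel squared. *)
Lemma is_derive_pos2 {R : realType} (s : R) :
  is_derive s (1 : R) (fun s => Num.max 0 s ^+ 2) (2 * Num.max 0 s).
Proof.
case: (ltgtP s 0) => s0.
- rewrite mulr0.
  have h : \forall t \near s, (fun=> 0) t = Num.max 0 t ^+ 2 :> R.
    near=> t; rewrite max_l ?expr0n//; apply: ltW; near: t.
    exact: lt_nbhsl.
  exact: (@near_eq_is_derive R R R (fun=> 0) _ s 1 0 h (is_derive_cst _ _ _)).
- have h : \forall t \near s, (id * id) t = Num.max 0 t ^+ 2 :> R.
    near=> t; rewrite max_r//; apply: ltW; near: t.
    exact: lt_nbhsr.
  apply: (@near_eq_is_derive R R R (id * id) _ s 1 _ h).
  by apply: (is_derive_eq (is_deriveM (@is_derive_id _ _ s 1) (@is_derive_id _ _ s 1))); rewrite /GRing.scale/= mulr1 -mulr2n mulr_natl.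
- rewrite s0 mulr0; apply: (@is_derive0_quadratic _ _ _ 1); first by rewrite maxxx expr0n.
  move=> t; rewrite subr0 mul1r ger0_norm ?sqr_ge0//.
  have [t0|t0] := leP 0 t; first exact: lexx.
  by rewrite expr0n sqr_ge0.
Unshelve. all: by end_near.
Qed.

Lemma cintegrable_bounded {R : realType} d (T : measurableType d) (mu : {measure set T -> \bar R})
    (f : T -> R[i]) (A : set T) (M : R) : measurable A -> (mu A < +oo)%E -> cmeas f ->
  (forall x, A x -> normc (f x) <= M) -> (forall x, ~ A x -> f x = 0) -> cintegrable mu f.
Proof.
move=> mA Aoo mf fM f0; apply: (@cintegrable_le _ _ _ _ _ (fun x => M * \1_A x)) => //.
  move=> x; rewrite indicE; case: (boolP (x \in A)) => [/set_mem Ax|/negP nA].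
    by rewrite mulr1 fM.
  by rewrite mulr0 f0 ?normc0// => Ax; apply: nA; exact: mem_set.
have -> : EFin \o (fun x => M * \1_A x) = fun x => (M%:E * (\1_A x)%:E)%E by apply/funext.
apply: (integrableZl measurableT M); apply/integrableP; split; first by apply/measurable_EFinP.
under eq_integral do rewrite gee0_abs ?lee_fin//.
by rewrite integral_indic// setIT.
Qed.

Lemma lebesgueC_box_lty {R : realType} (a b : R) :
  (@lebesgueC R (`[a, b] `*` `[a, b]) < +oo)%E.
Proof.
rewrite /lebesgueC product_measure1E//= !lebesgue_measure_itv/=.
by case: ifP => _; rewrite -?EFinM ?mule0 ltry.
Qed.

Lemma ler_coord_normc {R : realType} (w : R * R) :
  `|w.1| <= normc (cplx w) /\ `|w.2| <= normc (cplx w).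
Proof. by split; [exact: (ler_Re_normc (cplx w))|exact: (ler_Im_normc (cplx w))]. Qed.

Lemma normc_le_box {R : realType} (w : R * R) (B : R) : normc (cplx w) <= B -> (`[- B, B] `*` `[- B, B]) w.
Proof.
move=> wB; have [h1 h2] := ler_coord_normc w.
by split; rewrite /= in_itv/= -ler_norml; [exact: le_trans h1 wB|exact: le_trans h2 wB].
Qed.

Lemma cintegrable_compact_support {R : realType} (f : mC R -> R[i]) (B M : R) : cmeas f ->
  (forall x, normc (f x) <= M) -> (forall x : R * R, B < normc (cplx x) -> f x = 0) ->
  cintegrable (@lebesgueC R) f.
Proof.
move=> mf fM f0; apply: (@cintegrable_bounded _ _ _ (@lebesgueC R) f (`[- B, B] `*` `[- B, B] : set (mC R)) M) => //.
- exact: measurableX.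
- exact: lebesgueC_box_lty.
- move=> x nx; apply: f0; rewrite ltNge; apply/negP => xB; apply: nx; exact: normc_le_box.
Qed.

Lemma ccont_bounded {R : realType} (T : topologicalType) (G : T -> R[i]) (A : set T) : ccont G -> compact A ->
  exists2 M, 0 <= M & forall w, A w -> normc (G w) <= M.
Proof.
move=> cG cA; have cn := continuous_normc cG.
have /compact_bounded : compact ((fun w => normc (G w)) @` A).
  by apply: continuous_compact => //; exact: continuous_subspaceT.
move=> [M [_ MH]]; exists (`|M| + 1); first by rewrite addr_ge0.
move=> w Aw; have M1 : M < `|M| + 1 by rewrite (le_lt_trans (ler_norm _))// ltrDl.
have := MH _ M1 (normc (G w)).
by rewrite /= ger0_norm ?normc_ge0//; apply; exists w.
Qed.

Lemma compact_box {R : realType} (a b : R) : compact (`[a, b] `*` `[a, b] : set (R * R)).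
Proof. by apply: compact_setX; exact: segment_compact. Qed.

Lemma ccont_compact_support {R : realType} (G : R * R -> R[i]) (B : R) : ccont G ->
  (forall x, B < normc (cplx x) -> G x = 0) -> exists2 M, 0 <= M & forall w, normc (G w) <= M.
Proof.
move=> cG G0; have [M M0 MH] := ccont_bounded cG (@compact_box R (- B) B).
exists M => // w; have [wB|wB] := leP (normc (cplx w)) B; first by apply: MH; exact: normc_le_box.
by rewrite G0// normc0.
Qed.

Lemma cintegrable_ccont {R : realType} (G : R * R -> R[i]) (B : R) : ccont G ->
  (forall x, B < normc (cplx x) -> G x = 0) -> cintegrable (@lebesgueC R) (G : mC R -> R[i]).
Proof.
move=> cG G0; have [M _ MH] := ccont_compact_support cG G0.
exact: (cintegrable_compact_support (ccont_cmeas cG) MH G0).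
Qed.

Lemma Rintegral_derive0 {R : realType} (h h' : R -> R) (B : R) : continuous h' ->
  (forall s, is_derive s (1 : R) h (h' s)) -> (forall s, B < `|s| -> h s = 0) ->
  \int[@lebesgue_measure R]_x h' x = 0.
Proof.
move=> ch' dh h0; pose B' : R := `|B| + 1.
have BB' : B < B' by rewrite (le_lt_trans (ler_norm _))// ltrDl.
have B'0 : 0 < B' by rewrite ltr_wpDl.
have h'0 s : B < `|s| -> h' s = 0.
  move=> Bs; have [_ <-] := dh s.
  have : \forall t \near s, (fun=> 0) t = h t.
    have c : continuous_at s (fun t : R => `|t|) by exact: norm_continuous.
    have : \forall t \near s, B < `|t| by apply: (cvgr_gt _ c).
    by apply: filterS => t /h0 ->.
  move=> /(@near_eq_is_derive R R R (fun=> 0) _ s 1 0)/(_ (is_derive_cst _ _ _)).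
  by case.
have ch : continuous h by move=> s; apply/differentiable_continuous/derivable1_diffP; have [] := dh s.
have -> : \int[@lebesgue_measure R]_x h' x = \int[@lebesgue_measure R]_(x in `[- B', B']) h' x.
  rewrite /Rintegral; congr fine.
  rewrite [RHS]integral_mkcond; apply: eq_integral => x _.
  rewrite patchE; case: ifPn => //; rewrite notin_setE/= in_itv/= -ler_norml => /negP.
  by rewrite -ltNge => Bx; rewrite h'0// (lt_trans BB').
rewrite /Rintegral (@continuous_FTC2 _ h' h).
- have -> : h B' = 0 by apply: h0; rewrite gtr0_norm.
  have -> : h (- B') = 0 by apply: h0; rewrite normrN gtr0_norm.
  by rewrite -EFinB subrr.
- by rewrite gt0_cp.
- exact: continuous_subspaceT.
- split.
  + by move=> x _; have [] := dh x.
  + exact/cvg_at_right_filter/ch.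
  + exact/cvg_at_left_filter/ch.
- by move=> x _; rewrite derive1E; have [] := dh x.
Qed.

Lemma cint_derive0 {R : realType} (h h' : R -> R[i]) (B : R) : ccont h' ->
  (forall s, cderiv h s (h' s)) -> (forall s, B < `|s| -> h s = 0) ->
  cint (@lebesgue_measure R) (h' : measurableTypeR R -> R[i]) = 0.
Proof.
move=> [c1 c2] dh h0; apply: complexRI.
- apply: (@Rintegral_derive0 _ (fun s => complex.Re (h s)) _ B) => // s; first by case: (dh s).
  by move=> /h0 ->.
- apply: (@Rintegral_derive0 _ (fun s => complex.Im (h s)) _ B) => // s; first by case: (dh s).
  by move=> /h0 ->.
Qed.

(** The map [k] inserts the running variable in either coordinate, so that one argument serves both
    partial derivatives. *)
Lemma wirt_partial0 {R : realType} (G Gx : R * R -> R[i]) (B : R) (k : R -> R -> R * R) :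
  (forall y, continuous (fun s => k s y)) ->
  (forall x y, cderiv (fun s => G (k s y)) x (Gx (k x y))) ->
  (forall w, B < normc (cplx w) -> G w = 0) ->
  forall x y, B < normc (cplx (k x y)) -> Gx (k x y) = 0.
Proof.
move=> ck dG G0 x y Bx; apply: (cderiv_unique (dG x y)).
apply: (near_eq_cderiv _ (cderiv_cst 0 x)).
have c : continuous_at x (fun s => normc (cplx (k s y))).
  exact: (continuous_compT (ck y) (continuous_normc ccont_cplx)).
have : \forall s \near x, B < normc (cplx (k s y)) by apply: (cvgr_gt _ c).
by apply: filterS => s /= /G0 ->.
Qed.

(** Each real partial derivative is integrated first in its own variable, where the fundamental
    theorem of calculus gives 0 by compactness of the support. *)
Lemma stokes {R : realType} (G Gb : R * R -> R[i]) (B : R) : wirt G Gb ->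
  (forall w, B < normc (cplx w) -> G w = 0) -> cint (@lebesgueC R) (Gb : mC R -> R[i]) = 0.
Proof.
move=> [Gx [Gy [cG cx cy dG eG]]] G0.
have Gx0 w : B < normc (cplx w) -> Gx w = 0.
  case: w => x y; apply: (@wirt_partial0 _ G Gx B (fun s y => (s, y))) => // [y'|x' y'].
    by apply: continuous_pair => z; [exact: cvg_id|exact: cvg_cst].
  by case: (dG x' y').
have Gy0 w : B < normc (cplx w) -> Gy w = 0.
  case: w => x y; apply: (@wirt_partial0 _ G Gy B (fun s x => (x, s))) => // [y'|x' y'].
    by apply: continuous_pair => z; [exact: cvg_cst|exact: cvg_id].
  by case: (dG y' x').
have ix := cintegrable_ccont cx Gx0; have iy := cintegrable_ccont cy Gy0.
have slice1 (y : R) : continuous (fun s : R => (s, y)) by apply: continuous_pair => z; [exact: cvg_id|exact: cvg_cst].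
have slice2 (x : R) : continuous (fun s : R => (x, s)) by apply: continuous_pair => z; [exact: cvg_cst|exact: cvg_id].
have zx : cint (@lebesgueC R) (Gx : mC R -> R[i]) = 0.
  rewrite (@cint_prod2 _ _ _ _ _ (@lebesgue_measure R) (@lebesgue_measure R) (Gx : mC R -> R[i]) ix).
  rewrite (_ : (fun y => _) = fun _ => 0) ?cint0//; apply/funext => y.
  apply: (@cint_derive0 _ (fun s => G (s, y)) _ B).
  - exact: (ccont_comp cx (slice1 y)).
  - by move=> s; case: (dG s y).
  - by move=> s Bs; rewrite G0//; exact: lt_le_trans Bs (ler_coord_normc (s, y)).1.
have zy : cint (@lebesgueC R) (Gy : mC R -> R[i]) = 0.
  rewrite (@cint_prod _ _ _ _ _ (@lebesgue_measure R) (@lebesgue_measure R) (Gy : mC R -> R[i]) iy).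
  rewrite (_ : (fun x => _) = fun _ => 0) ?cint0//; apply/funext => x.
  apply: (@cint_derive0 _ (fun s => G (x, s)) _ B).
  - exact: (ccont_comp cy (slice2 x)).
  - by move=> s; case: (dG x s).
  - by move=> s Bs; rewrite G0//; exact: lt_le_trans Bs (ler_coord_normc (x, s)).2.
rewrite (_ : Gb = fun w => 2^-1 * (Gx w + 'i * Gy w)); last by apply/funext => w; rewrite eG mulrC.
have iyi := @cintegrableZ _ _ _ _ 'i _ iy.
rewrite (@cintZ _ _ _ _ 2^-1 (fun w : mC R => Gx w + 'i * Gy w)); last exact: cintegrableD.
by rewrite cintD// cintZ// zx zy mulr0 addr0 mulr0.
Qed.

Lemma ccont_cvg {R : realType} (T : topologicalType) (f : T -> R[i]) (u : nat -> T) (x : T) : ccont f ->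
  u n @[n --> \oo] --> x -> normc (f (u n) - f x) @[n --> \oo] --> (0 : R).
Proof.
move=> cf ux.
have c : continuous_at x (fun y => normc (f y - f x)).
  by apply: continuous_normc; apply: ccontB => //; exact: ccont_cst.
have := cvg_comp _ _ ux c; by rewrite /= subrr normc0.
Qed.

Lemma continuous_ofc {R : realType} (T : topologicalType) (f : T -> R[i]) : ccont f ->
  continuous (fun x => ofc (f x)).
Proof. by move=> [f1 f2]; exact: continuous_pair. Qed.

Section pompeiu.
Context {R : realType}.
Local Notation muC := (@lebesgueC R).

Definition riesz (w : R * R) (B : R) (x : mC R) : R :=
  if normc (cplx w - cplx x) <= B then normc (cplx w - cplx x) `^ (-1) else 0.

Lemma riesz_ge0 w B x : 0 <= riesz w B x.
Proof. by rewrite /riesz; case: ifP => // _; exact: powR_ge0. Qed.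

Lemma measurable_riesz w B : measurable_fun setT (riesz w B).
Proof.
apply: measurable_fun_ifT; last exact: measurable_cst.
  by apply: measurable_fun_ler; [exact: measurable_normcB|exact: measurable_cst].
exact: (measurableT_comp (measurable_powR _) (measurable_normcB w)).
Qed.

Lemma integral_riesz_lty w B : 0 < B -> (\int[muC]_x (riesz w B x)%:E < +oo)%E.
Proof. by move=> B0; apply: (le_lt_trans (integral_riesz w ltr01 (ltr1n R 2) B0)); exact: ltry. Qed.

Lemma integrable_riesz w B : 0 < B -> muC.-integrable setT (EFin \o riesz w B).
Proof.
move=> B0; apply/integrableP; split; first by apply/measurable_EFinP; exact: measurable_riesz.
under eq_integral do rewrite /= ger0_norm ?riesz_ge0//.
exact: integral_riesz_lty.
Qed.

Lemma le_riesz w B x : normc (cplx x) <= B -> normc (cplx w - cplx x)^-1 <= riesz w (normc (cplx w) + B) x.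
Proof.
move=> xB; rewrite /riesz ifT; first by rewrite normcV powR_inv1 ?normc_ge0.
by rewrite (le_trans (le_normcD _ _))// normcN lerD2l.
Qed.

(* The value is pi, but only its positivity matters. *)
Definition pompC : R := \int[muC]_x ((1 + normc (cplx x) ^+ 2) ^- 2).

Let den_gt0 (t : R) : 0 < 1 + t ^+ 2. Proof. by rewrite ltr_pwDl// sqr_ge0. Qed.
Let bell (x : mC R) : R := (1 + normc (cplx x) ^+ 2) ^- 2.

Let measurable_bell : measurable_fun setT bell.
Proof.
apply: measurable_funVr; apply: measurable_funX; apply: measurable_funD; first exact: measurable_cst.
by apply: measurable_funX; apply: measurable_normc; exact: cmeas_cplx.
Qed.

Let bell_gt0 x : 0 < bell x.
Proof. by rewrite invr_gt0 exprn_gt0. Qed.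

Let integrable_bell : muC.-integrable setT (EFin \o bell).
Proof.
have b0 x : 0 <= bell x by exact: ltW.
apply/integrableP; split; first exact/measurable_EFinP.
under eq_integral do rewrite /= ger0_norm//.
have := integral_tail2 (0 : R * R) (ltr0Sn R 1) (ltr0Sn R 0).
rewrite mulr1n => /(fun h => le_lt_trans h (ltry _)) h.
apply: (@le_lt_trans _ _ (\int[muC]_z (16 * (1 + normc (cplx (0 : R * R) - cplx z)) `^ (- (2 + 2)))%:E)%E).
  apply: ge0_le_integral => //.
  - by move=> x _; rewrite lee_fin.
  - exact/measurable_EFinP.
  - apply/measurable_EFinP; apply: measurable_funM; first exact: measurable_cst.
    apply: (measurableT_comp (measurable_powR _)); apply: measurable_funD; first exact: measurable_cst.
    exact: measurable_normcB.
  - move=> x _; rewrite lee_fin; set t := normc _.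
    have t0 : 0 <= t by exact: normc_ge0.
    have tE : normc (cplx x) = t by rewrite /t (_ : cplx 0 = 0) ?sub0r ?normcN.
    rewrite /bell tE (_ : - (2 + 2) = - 4%:R :> R); last by rewrite -natrD.
    rewrite powR_invn; last by rewrite addr_ge0.
    rewrite -[leLHS]mul1r -[_ ^- 4]mul1r mulrA mulr1 ler_pdivlMr ?exprn_gt0 ?ltr_pwDl//.
    rewrite mul1r mulrC ler_pdivrMr ?exprn_gt0//.
    rewrite (exprM _ 2 2) (_ : 16 = 4 ^+ 2); last by rewrite -natrX.
    have hh : (1 + t) ^+ 2 <= 4 * (1 + t ^+ 2) by have := sqr_ge0 (t - 1); rewrite !expr2; nra.
    rewrite -exprMn; apply: lerXn2r => //; rewrite nnegrE; [exact: sqr_ge0|exact: le_trans (sqr_ge0 _) hh].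
under eq_integral do rewrite EFinM.
rewrite ge0_integralZl//; last 2 first.
- apply/measurable_EFinP; apply: (measurableT_comp (measurable_powR _)); apply: measurable_funD; first exact: measurable_cst.
  exact: measurable_normcB.
- by move=> x _; rewrite lee_fin powR_ge0.
by rewrite lte_mul_pinfty// ?lee_fin//.
Qed.

Lemma pompC_gt0 : 0 < pompC.
Proof.
rewrite /pompC /Rintegral fine_gt0//; apply/andP; split; last first.
  by have /integrable_lty := integrable_bell => /(_ measurableT).
pose Q : set (mC R) := `[0, 1] `*` `[0, 1].
have mQ : measurable Q by exact: measurableX.
apply: (@lt_le_trans _ _ (\int[muC]_x (9^-1%:E * (\1_Q x)%:E))%E).
  rewrite ge0_integralZl//; last by apply/measurable_EFinP.
  rewrite integral_indic// setIT.
  have LQ : muC Q = 1%E.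
    by rewrite /lebesgueC product_measure1E//= !lebesgue_measure_itv/= lte_fin ltr01 sube0 mule1.
  by rewrite [X in (_ * X)%E](_ : _ = 1%E) ?mule1 ?lte_fin ?invr_gt0.
apply: ge0_le_integral => //.
- by apply: measurable_funeM; exact/measurable_EFinP.
- exact/measurable_EFinP.
- move=> x _; rewrite -EFinM lee_fin indicE; case: (boolP (x \in Q)) => [|_]; last by rewrite mulr0; exact: (ltW (bell_gt0 x)).
  rewrite inE => -[]; rewrite /= !in_itv/= => /andP[h1 h2] /andP[h3 h4].
  have n3 : 1 + normc (cplx x) ^+ 2 <= 3.
    rewrite sqr_normcE/=; have := ler_pM h1 h1 h2 h2; have := ler_pM h3 h3 h4 h4; rewrite !expr2; lra.
  rewrite mulr1 /bell lef_pV2 ?posrE ?exprn_gt0// (_ : 9 = 3 ^+ 2); last by rewrite -natrX.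
  by apply: lerXn2r => //; rewrite nnegrE ltW.
Qed.

Lemma wirt_supp (G Gb : R * R -> R[i]) (B : R) : wirt G Gb ->
  (forall x, B < normc (cplx x) -> G x = 0) -> forall x, B < normc (cplx x) -> Gb x = 0.
Proof.
move=> [Gx [Gy [_ _ _ dG eG]]] G0 [x y] Bx.
rewrite eG (@wirt_partial0 _ G Gx B (fun s y => (s, y)) _ _ _ x y)//.
- rewrite (@wirt_partial0 _ G Gy B (fun s x => (x, s)) _ _ _ y x)// ?mulr0 ?addr0 ?mul0r//.
    by move=> y'; apply: continuous_pair => z; [exact: cvg_cst|exact: cvg_id].
  by move=> x' y'; case: (dG y' x').
- by move=> y'; apply: continuous_pair => z; [exact: cvg_id|exact: cvg_cst].
- by move=> x' y'; case: (dG x' y').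
Qed.

(* Stokes applied to [G] times the smooth regularization
   [conj (w - x) / (|w - x|^2 + r^2)] of the Cauchy kernel. *)
Lemma pompeiu_regularized (G Gb : R * R -> R[i]) (B : R) (w : R * R) (r : R) : 0 < r -> wirt G Gb ->
  (forall x, B < normc (cplx x) -> G x = 0) ->
  cint muC (fun x => (cplx w - cplx x)^* / (normc (cplx w - cplx x) ^+ 2 + r ^+ 2)%:C * Gb x) =
  cint muC (fun x => (bell x)%:C * G (ofc (cplx w + r%:C * cplx x))).
Proof.
move=> r0 wG G0.
have r20 : 0 < r ^+ 2 by rewrite exprn_gt0.
pose D (x : R * R) : R[i] := (normc (cplx w - cplx x) ^+ 2 + r ^+ 2)%:C.
pose A (x : R * R) : R[i] := (cplx w - cplx x)^*.
have D0 x : r ^+ 2 <= normc (D x).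
  by rewrite normc_real ger0_norm ?addr_ge0 ?sqr_ge0// lerDr sqr_ge0.
have Dn0 x : D x != 0 by rewrite -normc_gt0 (lt_le_trans r20).
have wA : wirt A (fun _ => -1).
  apply: (wirt_eq (Gb := fun w => 0 - 1)); last by move=> x; rewrite sub0r.
  rewrite (_ : A = fun x => (cplx w)^* + - (cplx x)^*); last by apply/funext => x; rewrite /A rmorphB.
  by apply: wirtD; [exact: wirt_cst|apply: wirtN; exact: wirt_conj].
have DE x : D x = (cplx w - cplx x) * A x + (r ^+ 2)%:C.
  by rewrite /A mulcJ /D rmorphD.
have wD : wirt D (fun x => - (cplx w - cplx x)).
  rewrite (_ : D = fun x => (cplx w + - cplx x) * A x + (r ^+ 2)%:C); last by apply/funext.
  have w1 : wirt (fun x => cplx w + - cplx x) (fun x => 0 + - 0) by apply: wirtD; [exact: wirt_cst|apply: wirtN; exact: wirt_cplx].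
  apply: (wirt_eq (wirtD (wirtM w1 wA) (wirt_cst _))) => x; ring.
have wAD : wirt (fun x => A x / D x) (fun x => - (r ^+ 2)%:C / D x ^+ 2).
  apply: (wirt_eq (wirt_div r20 wA wD _)) => [x|x]; first by rewrite ltNge D0.
  by rewrite DE; congr (_ / _); ring.
have := stokes (wirtM wAD wG) (B := B).
have Gb0 := wirt_supp wG G0.
have c1 : ccont (fun x => A x / D x * Gb x) by apply: ccontM; [exact: wirt_ccont wAD|exact: wirt_ccontb wG].
have c2 : ccont (fun x => - (r ^+ 2)%:C / D x ^+ 2 * G x) by apply: ccontM; [exact: wirt_ccontb wAD|exact: wirt_ccont wG].
have i1 : cintegrable muC (fun x : mC R => A x / D x * Gb x).
  by apply: (@cintegrable_ccont _ _ B) => // x /Gb0 ->; rewrite mulr0.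
have i2 : cintegrable muC (fun x : mC R => - (r ^+ 2)%:C / D x ^+ 2 * G x).
  by apply: (@cintegrable_ccont _ _ B) => // x /G0 ->; rewrite mulr0.
have AG0 : forall x : R * R, B < normc (cplx x) -> A x / D x * G x = 0 by move=> x /G0 ->; rewrite mulr0.
move=> /(_ AG0); rewrite cintD// => /eqP; rewrite addrC addr_eq0 => /eqP ->.
rewrite -cintN//.
have i3 := cintegrableN i2.
(* The substitution of [w + r x] for [x] has Jacobian $r^2$ and turns $r^2/(|w-x|^2+r^2)^2$ into the
   fixed profile [bell]. *)
have [i4 ->] := cint_translation w i3.
have rC0 : r%:C != 0 :> R[i] by rewrite -normc_gt0 normc_real normr_gt0 gt_eqF.
have [i5 ->] := cint_mulC rC0 i4.
rewrite -cintZ//; congr cint; apply/funext => x /=.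
have -> : ((ofc (r%:C * cplx x)).1 + w.1, (ofc (r%:C * cplx x)).2 + w.2) = ofc (cplx w + r%:C * cplx x).
  by rewrite [RHS]/ofc ReD ImD; congr pair; exact: addrC.
rewrite /D ofcK opprD addNKr normcN normcM !normc_real gtr0_norm// /bell.
rewrite mulNr mulNr opprK mulrA; congr (_ * _).
rewrite -[X in _ / X]rmorphXn -fmorphV -!rmorphM; congr (_%:C).
have := den_gt0 (normc (cplx x)); set t := normc (cplx x) => t0.
have -> : (r * t) ^+ 2 + r ^+ 2 = r ^+ 2 * (1 + t ^+ 2) by ring.
have h1 : r != 0 by rewrite gt_eqF.
have h2 : 1 + t ^+ 2 != 0 by rewrite gt_eqF.
by field; rewrite h1 h2.
Qed.

Lemma cintegrable_cauchy (f : mC R -> R[i]) (B M : R) (w : R * R) : 0 < B -> cmeas f ->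
  (forall x, normc (f x) <= M) -> (forall x, B < normc (cplx x) -> f x = 0) ->
  cintegrable muC (fun x => f x / (cplx w - cplx x)).
Proof.
move=> B0 mf fM f0.
have iM := integrableZl measurableT M (integrable_riesz w (ltr_wpDl (normc_ge0 (cplx w)) B0)).
apply: (cintegrable_le _ _ iM) => [|x].
  by apply: cmeasM => //; apply: cmeasV; apply: cmeasB; [exact: cmeas_cst|exact: cmeas_cplx].
have M0 : 0 <= M := le_trans (normc_ge0 _) (fM (0, 0)).
have [xB|xB] := leP (normc (cplx x)) B; last by rewrite f0// mul0r normc0 mulr_ge0// riesz_ge0.
by rewrite normcM; apply: ler_pM; [exact: normc_ge0|exact: normc_ge0|exact: fM|exact: le_riesz].
Qed.

Lemma cauchy_regularized_bound (z : R[i]) (r : R) : normc (z^* / (normc z ^+ 2 + r ^+ 2)%:C) <= normc z^-1.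
Proof.
have [->|z0] := eqVneq z 0; first by rewrite rmorph0 mul0r normc0 normc_ge0.
have n0 : 0 < normc z by rewrite normc_gt0.
have d0 : 0 < normc z ^+ 2 + r ^+ 2 by rewrite ltr_pwDl ?exprn_gt0// sqr_ge0.
rewrite normcM !normcV normcJE normc_real gtr0_norm// ler_pdivrMr//.
by rewrite mulrDr expr2 mulKf ?gt_eqF// lerDl mulr_ge0 ?invr_ge0 ?normc_ge0 ?sqr_ge0.
Qed.

Lemma cauchy_regularized_error (z : R[i]) (r : R) : z != 0 -> 0 < r -> r <= 1 ->
  normc (z^* / (normc z ^+ 2 + r ^+ 2)%:C - z^-1) <= normc z ^- 3 * r.
Proof.
move=> z0 r0 r1; have n0 : 0 < normc z by rewrite normc_gt0.
set n := normc z in n0 *; have d0 : 0 < n ^+ 2 + r ^+ 2 by rewrite ltr_pwDl ?exprn_gt0// sqr_ge0.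
have -> : z^* / (n ^+ 2 + r ^+ 2)%:C - z^-1 = - (z^-1 * (r ^+ 2 / (n ^+ 2 + r ^+ 2))%:C).
  have -> : (z^*)%R = z^-1 * (n ^+ 2)%:C by rewrite -mulcJ mulKf.
  have -> : (r ^+ 2 / (n ^+ 2 + r ^+ 2))%:C = 1 - (n ^+ 2 / (n ^+ 2 + r ^+ 2))%:C :> R[i].
    rewrite -(rmorph1 (real_complex R)) -rmorphB; congr (_%:C); field; exact: lt0r_neq0.
  by rewrite [(n ^+ 2 / _)%:C]rmorphM fmorphV; ring.
rewrite normcN normcM normcV normc_real -/n gtr0_norm; last by rewrite divr_gt0// exprn_gt0.
have -> : n ^- 3 * r = n^-1 * (n ^- 2 * r) by rewrite (exprS n 2) invfM mulrA.
rewrite ler_wpM2l ?invr_ge0 ?(ltW n0)// ler_pdivrMr//.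
rewrite -mulrA ler_pdivlMl ?exprn_gt0// mulrC.
by apply: ler_pM; rewrite ?sqr_ge0//; [rewrite expr2 ler_piMr// ltW|rewrite lerDl sqr_ge0].
Qed.

Lemma invn_cvg0 : (n.+1%:R : R)^-1 @[n --> \oo] --> (0 : R).
Proof. exact: cvg_harmonic. Qed.

(** Both sides of the regularized identity converge as [r] tends to 0: the left one dominated by the
    Cauchy kernel itself, the right one by a multiple of [bell], with [G] continuous at [w]. *)
Lemma pompeiu (G Gb : R * R -> R[i]) (B : R) (w : R * R) : wirt G Gb ->
  (forall x, B < normc (cplx x) -> G x = 0) ->
  cint muC (fun x => Gb x / (cplx w - cplx x)) = pompC%:C * G w.
Proof.
(* The radius is enlarged to be positive, as the integrability of the truncated Cauchy kernel
   requires. *)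
move=> wG G0'; pose B' := Num.max B 1; have B'0 : 0 < B' by rewrite lt_max ltr01 orbT.
have G0 x : B' < normc (cplx x) -> G x = 0 by rewrite gt_max => /andP[? _]; exact: G0'.
have Gb0 := wirt_supp wG G0.
have cG := wirt_ccont wG; have cGb := wirt_ccontb wG.
have [M M0 GM] := ccont_compact_support cG G0; have [N N0 GN] := ccont_compact_support cGb Gb0.
pose r (n : nat) : R := n.+1%:R^-1; have r0 n : 0 < r n by rewrite invr_gt0.
apply: (@normc_cvg_unique _ (fun n => cint muC (fun x => (bell x)%:C * G (ofc (cplx w + (r n)%:C * cplx x))))).
- under eq_fun => n do rewrite -(pompeiu_regularized w (r0 n) wG G0).
  have iM := integrableZl measurableT N (integrable_riesz w (ltr_wpDl (normc_ge0 (cplx w)) B'0)).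
  have mC1 : cmeas (fun x : mC R => cplx w - cplx x) by apply: cmeasB; [exact: cmeas_cst|exact: cmeas_cplx].
  apply: (cint_dominated _ _ iM) => [n||n x|].
  + apply: cmeasM; last exact: ccont_cmeas.
    apply: cmeasM; first exact: cmeasJ.
    apply: cmeasV; apply: cmeas_real; apply: measurable_funD; last exact: measurable_cst.
    by apply: measurable_funX; exact: measurable_normc.
  + by apply: cmeasM; [exact: ccont_cmeas|exact: cmeasV].
  + have [xB|xB] := leP (normc (cplx x)) B'; last by rewrite Gb0// mulr0 normc0 mulr_ge0// riesz_ge0.
    rewrite mulrC normcM; apply: ler_pM; [exact: normc_ge0|exact: normc_ge0|exact: GN|].
    exact: le_trans (cauchy_regularized_bound _ _) (le_riesz _ xB).
  + apply: (ae_impl _ (ae_coord_neq w)) => x /andP[xw _].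
    have d0 : cplx w - cplx x != 0.
      by apply: contra xw; rewrite subr_eq0 => /eqP/(congr1 ofc); rewrite !cplxK => ->.
    set z := cplx w - cplx x in d0 *.
    have h n : 0 <= normc (z^* / (normc z ^+ 2 + r n ^+ 2)%:C * Gb x - Gb x / z) <= normc (Gb x) * normc z ^- 3 * r n.
      rewrite normc_ge0/= [X in normc (X - _)]mulrC -mulrBr normcM -mulrA ler_wpM2l ?normc_ge0//.
      by apply: cauchy_regularized_error => //; rewrite invf_le1// ler1n.
    apply: (squeeze_cvg0 h); rewrite -[X in _ --> X](mulr0 (normc (Gb x) * normc z ^- 3)).
    by apply: cvgM; [exact: cvg_cst|exact: invn_cvg0].
- have mb : cmeas (fun x => (bell x)%:C) by exact: cmeas_real.
  have ib : cintegrable muC (fun x => (bell x)%:C).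
    apply: (cintegrable_le mb _ integrable_bell) => x.
    by rewrite normc_real gtr0_norm.
  rewrite (_ : pompC%:C * G w = cint muC (fun x => (bell x)%:C * G w)); last first.
    under eq_fun do rewrite mulrC.
    rewrite cintZ// mulrC; congr (_ * _); apply: complexRI => //.
    by rewrite /= Rintegral_cst// mul0r.
  have iM := integrableZl measurableT M integrable_bell.
  have mG n : cmeas (fun x : mC R => G (ofc (cplx w + (r n)%:C * cplx x))).
    apply: (cmeas_comp (ccont_cmeas cG)); apply: measurable_ofc; apply: cmeasD; first exact: cmeas_cst.
    by apply: cmeasM; [exact: cmeas_cst|exact: cmeas_cplx].
  apply: (cint_dominated _ _ iM) => [n||n x|].
  + exact: cmeasM.
  + by apply: cmeasM => //; exact: cmeas_cst.
  + by rewrite normcM normc_real gtr0_norm// mulrC; apply: ler_wpM2r; [exact: ltW|exact: GM].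
  + apply: aeW => x; apply: normc_cvgM; first exact: normc_cvg_cst.
    have c0 : ccont (fun t : R => G (ofc (cplx w + t%:C * cplx x))).
      apply: (ccont_comp cG); apply: continuous_ofc; apply: ccontD; first exact: ccont_cst.
      by apply: ccontM; [apply: ccont_real => t; exact: cvg_id|exact: ccont_cst].
    by have := ccont_cvg c0 invn_cvg0; rewrite mul0r addr0 cplxK.
Qed.
End pompeiu.

(** * Directional derivatives *)

Section directional.
Context {R : realType} (V : normedModType R).
Implicit Types (g : V -> R) (z u v : V).

Lemma is_derive_lineP g z u (s d : R) :
  is_derive s (1 : R) (fun t => g (z + t *: u)) d <-> is_derive (z + s *: u) u g d.
Proof.
have e : (fun h : R => h^-1 *: (((fun t => g (z + t *: u)) \o shift s) (h *: (1 : R)) - g (z + s *: u))) =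
    (fun h : R => h^-1 *: ((g \o shift (z + s *: u)) (h *: u) - g (z + s *: u))).
  apply/funext => h /=; congr (_ *: (g _ - _)).
  by rewrite [h%:A]mulr1 scalerDl addrCA.
split=> -[h1 h2]; split.
- by move: h1; rewrite /derivable e.
- by move: h2; rewrite /derive e.
- by move: h1; rewrite /derivable e.
- by move: h2; rewrite /derive e.
Qed.

Lemma is_derive_line0 g z u (d : R) :
  is_derive (0 : R) (1 : R) (fun t => g (z + t *: u)) d <-> is_derive z u g d.
Proof. by have := is_derive_lineP g z u 0 d; rewrite scale0r addr0. Qed.

Lemma is_derive_dirZ g z u (c d : R) : is_derive z u g d -> is_derive z (c *: u) g (c * d).
Proof.
move=> /is_derive_line0 h; apply/is_derive_line0.
have h1 : is_derive (0 : R) (1 : R) (fun t : R => t * c) c.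
  have := is_deriveM (@is_derive_id _ _ (0 : R) 1) (is_derive_cst c (0 : R) 1).
  by move=> /is_derive_eq; apply; rewrite /GRing.scale/= mulr0 add0r mulr1.
have h2 : is_derive ((fun t : R => t * c) 0) (1 : R) (fun t => g (z + t *: u)) d by rewrite mul0r.
have := @is_derive1_comp R (fun t => g (z + t *: u)) (fun t => t * c) 0 d c h2 h1.
rewrite (_ : _ \o _ = fun t => g (z + t *: (c *: u))); first by rewrite mulrC.
by apply/funext => t /=; rewrite scalerA.
Qed.

(** Additivity in the direction is obtained from continuity of one directional derivative only. The
    increment is broken at [h u + z]; the mean value theorem writes the second piece as [gv] at a
    point of the segment, which tends to [z]. *)
Lemma is_derive_dirD g u v (gu gv : V -> R) : (forall z, is_derive z u g (gu z)) ->
  (forall z, is_derive z v g (gv z)) -> continuous gv ->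
  forall z, is_derive z (u + v) g (gu z + gv z).
Proof.
move=> du dv cv z.
have [/cvg_ex[l cu] lu] := du z.
have {}cu : h^-1 *: (g (h *: u + z) - g z) @[h --> 0^'] --> gu z.
  by have -> : gu z = l by rewrite -lu; apply: (cvg_lim _ cu); exact: norm_hausdorff.
have cvv : h^-1 *: (g (h *: (u + v) + z) - g (h *: u + z)) @[h --> 0^'] --> gv z.
  apply/cvgrPdist_le => e e0.
  have cj : continuous_at ((0, 0) : R * R) (fun p => gv (p.1 *: u + z + p.2 *: v)).
    apply: continuous_comp; last exact: cv.
    apply: cvgD; last by apply: cvgZr_tmp; exact: cvg_snd.
    by apply: cvgD; [apply: cvgZr_tmp; exact: cvg_fst|exact: cvg_cst].
  have /nbhs_ballP[r /= r0 rH] : \forall p \near ((0, 0) : R * R), `|gv z - gv (p.1 *: u + z + p.2 *: v)| <= e.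
    have /cvgrPdist_le/(_ e e0) := cj.
    by rewrite !scale0r add0r addr0.
  near=> h.
  have h0 : h != 0 by near: h; exact: nbhs_dnbhs_neq.
  have hr : `|h| < r by near: h; exact: dnbhs0_lt.
  pose f (t : R) := g (h *: u + z + t *: (h *: v)).
  have df t : is_derive t (1 : R) f (h * gv (h *: u + z + t *: (h *: v))).
    by apply/is_derive_lineP; exact: is_derive_dirZ.
  have cf : continuous f by move=> t; apply/differentiable_continuous/derivable1_diffP; have [] := df t.
  have [c] := @MVT _ f _ 0 1 ltr01 (fun t _ => df t) (continuous_subspaceT cf).
  rewrite in_itv/= => /andP[c0 c1]; rewrite subr0 mulr1 /f scale1r scale0r addr0.
  have -> : h *: (u + v) + z = h *: u + z + h *: v by rewrite scalerDr addrAC.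
  move=> ->; rewrite [_ *: _]mulKf// scalerA.
  apply: (rH (h, c * h)); split; rewrite /ball/= /ball_ sub0r normrN//=.
  by rewrite normrM (gtr0_norm c0) (le_lt_trans _ hr)// ler_piMl// ltW.
have c : h^-1 *: (g (h *: (u + v) + z) - g z) @[h --> 0^'] --> gu z + gv z.
  have e : (fun h : R => h^-1 *: (g (h *: (u + v) + z) - g z)) = (fun h : R => h^-1 *: (g (h *: (u + v) + z) - g (h *: u + z)) +
     h^-1 *: (g (h *: u + z) - g z)) by apply/funext => h /=; rewrite -scalerDr addrA subrK.
  by rewrite [gu z + _]addrC e; exact: (cvgD cvv cu).
split; first by apply/cvg_ex; exists (gu z + gv z).
by apply: (cvg_lim _ c); exact: norm_hausdorff.
Unshelve. all: by end_near.
Qed.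

Lemma is_derive_dir4 g a b c d (ga gb gc gd : V -> R) (x1 x2 x3 x4 : R) :
  (forall z, is_derive z a g (ga z)) -> (forall z, is_derive z b g (gb z)) ->
  (forall z, is_derive z c g (gc z)) -> (forall z, is_derive z d g (gd z)) ->
  continuous gb -> continuous gc -> continuous gd ->
  forall z, is_derive z (x1 *: a + x2 *: b + (x3 *: c + x4 *: d)) g (x1 * ga z + x2 * gb z + (x3 * gc z + x4 * gd z)).
Proof.
move=> da db dc dd cb cc cd.
have cZ (x : R) (h : V -> R) : continuous h -> continuous (fun z => x * h z).
  by move=> ch z; apply: cvgM; [exact: cvg_cst|exact: ch].
have dZ v (x : R) (h : V -> R) : (forall z, is_derive z v g (h z)) -> forall z, is_derive z (x *: v) g (x * h z).
  by move=> dh z; exact: is_derive_dirZ.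
apply: (is_derive_dirD (is_derive_dirD (dZ _ x1 _ da) (dZ _ x2 _ db) _) (is_derive_dirD (dZ _ x3 _ dc) (dZ _ x4 _ dd) _)).
- exact: cZ.
- exact: cZ.
- by move=> z; apply: cvgD; exact: cZ.
Qed.
End directional.

Lemma Re_comb {R : realType} (a b c d : R) (x y z w : R[i]) :
  complex.Re (a%:C * x + b%:C * y + (c%:C * z + d%:C * w)) =
  a * complex.Re x + b * complex.Re y + (c * complex.Re z + d * complex.Re w).
Proof. by rewrite !ReD !ReM /= !mul0r !subr0. Qed.
Lemma Im_comb {R : realType} (a b c d : R) (x y z w : R[i]) :
  complex.Im (a%:C * x + b%:C * y + (c%:C * z + d%:C * w)) =
  a * complex.Im x + b * complex.Im y + (c * complex.Im z + d * complex.Im w).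
Proof. by rewrite !ImD !ImM /= !mul0r !addr0. Qed.

Lemma comb0 {R : realType} (a b : R) (x y z w : R[i]) :
  a%:C * x + b%:C * y + ((0 : R)%:C * z + (0 : R)%:C * w) = a%:C * x + b%:C * y.
Proof. by rewrite !mul0r !addr0. Qed.
Lemma comb1 {R : realType} (a b : R) (x y z w : R[i]) :
  a%:C * x + b%:C * y + ((1 : R)%:C * z + (0 : R)%:C * w) = a%:C * x + b%:C * y + z.
Proof. by rewrite mul1r mul0r addr0. Qed.
Lemma comb2 {R : realType} (a b : R) (x y z w : R[i]) :
  a%:C * x + b%:C * y + ((0 : R)%:C * z + (1 : R)%:C * w) = a%:C * x + b%:C * y + w.
Proof. by rewrite mul1r mul0r add0r. Qed.

Lemma conj_comb {R : realType} (w : R * R) (x y : R[i]) : ((cplx w)^* * (x + 'i * y))%R =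
  (w.1)%:C * x + (w.2)%:C * y + 'i * ((- w.2)%:C * x + (w.1)%:C * y).
Proof. by apply: complexRI; rewrite !(ReM, ImM, ReD, ImD, ReJ, ImJ) /=; ring. Qed.

Lemma C2_eq (T : Type) (z w : (T * T) * (T * T)) : z.1.1 = w.1.1 -> z.1.2 = w.1.2 ->
  z.2.1 = w.2.1 -> z.2.2 = w.2.2 -> z = w.
Proof. by case: z w => [[a b] [c d]] [[a' b'] [c' d']] /= -> -> -> ->. Qed.

(** * Functions of class $C^1$ in shear coordinates *)

Section Ck1.
Context {R : realType}.
Implicit Types (g : C2 R -> R) (z u : C2 R).

Lemma Ck1_partial g j : Ck 1 g ->
  [/\ forall z, is_derive z (xdir R j) g ('D_(xdir R j) g z), forall z, is_derive z (ydir R j) g ('D_(ydir R j) g z),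
      continuous (fun z => 'D_(xdir R j) g z) & continuous (fun z => 'D_(ydir R j) g z)].
Proof.
move=> [_ /(_ j)[d1 d2 c1 c2]]; split.
- by move=> z; apply: derivableP; exact: d1.
- by move=> z; apply: derivableP; exact: d2.
- exact: c1.
- exact: c2.
Qed.

Lemma Ck1_direction g u : Ck 1 g -> forall z, is_derive z u g
  (u.1.1 * 'D_(xdir R 0) g z + u.1.2 * 'D_(ydir R 0) g z +
   (u.2.1 * 'D_(xdir R 1) g z + u.2.2 * 'D_(ydir R 1) g z)).
Proof.
move=> c1 z; have [dx0 dy0 _ cy0] := Ck1_partial 0 c1; have [dx1 dy1 cx1 cy1] := Ck1_partial 1 c1.
have := @is_derive_dir4 R (C2 R) g _ _ _ _ _ _ _ _ (u.1.1) (u.1.2) (u.2.1) (u.2.2) dx0 dy0 dx1 dy1 cy0 cx1 cy1 z.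
rewrite (_ : u.1.1 *: xdir R 0 + u.1.2 *: ydir R 0 + (u.2.1 *: xdir R 1 + u.2.2 *: ydir R 1) = u) //.
case: u => [[a b] [c d]]; rewrite /xdir /ydir /=.
by congr (_, _); congr (_, _); rewrite /= /GRing.scale/=; ring.
Qed.

Lemma Ck1_line g z u (s : R) : Ck 1 g -> is_derive s (1 : R) (fun t => g (z + t *: u))
  (u.1.1 * 'D_(xdir R 0) g (z + s *: u) + u.1.2 * 'D_(ydir R 0) g (z + s *: u) +
   (u.2.1 * 'D_(xdir R 1) g (z + s *: u) + u.2.2 * 'D_(ydir R 1) g (z + s *: u))).
Proof. by move=> c1; have := Ck1_direction u c1 (z + s *: u) => /(@is_derive_lineP R (C2 R)). Qed.

Definition Ck1c (phi : C2 R -> R[i]) := Ck 1 (fun z => complex.Re (phi z)) /\ Ck 1 (fun z => complex.Im (phi z)).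

Lemma Ck1c_line (phi : C2 R -> R[i]) z (a b c d s : R) (D : R[i]) : Ck1c phi ->
  a%:C * cderive (xdir R 0) phi (z + s *: (((a, b), (c, d)) : C2 R)) + b%:C * cderive (ydir R 0) phi (z + s *: (((a, b), (c, d)) : C2 R)) +
    (c%:C * cderive (xdir R 1) phi (z + s *: (((a, b), (c, d)) : C2 R)) + d%:C * cderive (ydir R 1) phi (z + s *: (((a, b), (c, d)) : C2 R))) = D ->
  cderiv (fun t => phi (z + t *: (((a, b), (c, d)) : C2 R))) s D.
Proof.
move=> [c1 c2] <-; split.
  by rewrite Re_comb; exact: (Ck1_line z ((a, b), (c, d)) s c1).
by rewrite Im_comb; exact: (Ck1_line z ((a, b), (c, d)) s c2).
Qed.

Lemma Ck1c_ccont phi : Ck1c phi -> ccont phi.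
Proof. by move=> [[c1 _] [c2 _]]; split; [exact: c1|exact: c2]. Qed.

Lemma Ck1c_ccont_x phi j : Ck1c phi -> ccont (cderive (xdir R j) phi).
Proof.
move=> [c1 c2]; split; first by case: (Ck1_partial j c1) => _ _ c _; exact: c.
by case: (Ck1_partial j c2) => _ _ c _; exact: c.
Qed.
Lemma Ck1c_ccont_y phi j : Ck1c phi -> ccont (cderive (ydir R j) phi).
Proof.
move=> [c1 c2]; split; first by case: (Ck1_partial j c1) => _ _ _ c; exact: c.
by case: (Ck1_partial j c2) => _ _ _ c; exact: c.
Qed.

Lemma ccont_dzbar phi j : Ck1c phi -> ccont (dzbar j phi).
Proof.
move=> h; rewrite /dzbar; apply: ccontM; last exact: ccont_cst.
by apply: ccontD; [exact: Ck1c_ccont_x|apply: ccontM; [exact: ccont_cst|exact: Ck1c_ccont_y]].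
Qed.

Lemma continuous_slice1 (T U : topologicalType) (b : U) : continuous (fun x : T => (x, b)).
Proof. by apply: continuous_pair => x; [exact: cvg_id|exact: cvg_cst]. Qed.
Lemma continuous_slice2 (T U : topologicalType) (a : T) : continuous (fun y : U => (a, y)).
Proof. by apply: continuous_pair => x; [exact: cvg_cst|exact: cvg_id]. Qed.

Lemma ccont_fst : ccont (fun z : C2 R => cplx z.1).
Proof. by apply: (ccont_comp ccont_cplx) => w; exact: cvg_fst. Qed.
Lemma ccont_snd : ccont (fun z : C2 R => cplx z.2).
Proof. by apply: (ccont_comp ccont_cplx) => w; exact: cvg_snd. Qed.

Lemma continuous_shear : continuous (@shear R).
Proof.
apply: continuous_pair; last by move=> w; exact: cvg_snd.
apply: continuous_ofc; exact: (ccontM ccont_fst ccont_snd).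
Qed.

(** Along the real coordinate lines of [w1] the shear is affine, with directions $(w_2,0)$ and
    $(iw_2,0)$. The chain rule is therefore a directional derivative along a straight line. The same
    holds for [w2], with directions $(w_1,1)$ and $(iw_1,i)$. *)
Lemma wirt_shear1 phi (w2 : R * R) : Ck1c phi ->
  wirt (fun w1 => phi (shear (w1, w2))) (fun w1 => (cplx w2)^* * dzbar 0 phi (shear (w1, w2))).
Proof.
move=> c1; pose X := cderive (xdir R 0) phi; pose Y := cderive (ydir R 0) phi.
have cs (f : C2 R -> R[i]) : ccont f -> ccont (fun w1 => f (shear (w1, w2))).
  by move=> cf; exact: (ccont_comp (ccont_comp cf continuous_shear) (@continuous_slice1 (R * R)%type (R * R)%type w2)).
exists (fun w1 => (w2.1)%:C * X (shear (w1, w2)) + (w2.2)%:C * Y (shear (w1, w2))),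
  (fun w1 => (- w2.2)%:C * X (shear (w1, w2)) + (w2.1)%:C * Y (shear (w1, w2))); split.
- exact: cs (Ck1c_ccont c1).
- by apply: ccontD; apply: ccontM; [exact: ccont_cst|exact: cs (Ck1c_ccont_x _ c1)|exact: ccont_cst|exact: cs (Ck1c_ccont_y _ c1)].
- by apply: ccontD; apply: ccontM; [exact: ccont_cst|exact: cs (Ck1c_ccont_x _ c1)|exact: ccont_cst|exact: cs (Ck1c_ccont_y _ c1)].
- move=> x y; split.
    have e s : shear ((s, y), w2) = shear ((0, y), w2) + s *: ((w2, 0) : C2 R).
      apply: C2_eq; rewrite ?ReM ?ImM /= /GRing.scale/=; ring.
    have := @Ck1c_line phi (shear ((0, y), w2)) w2.1 w2.2 0 0 x _ c1 erefl.
    by rewrite -surjective_pairing -e comb0 (_ : (fun t => _) = fun s => phi (shear ((s, y), w2))); last by apply/funext => t; rewrite e.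
  have e s : shear ((x, s), w2) = shear ((x, 0), w2) + s *: (((- w2.2, w2.1), 0) : C2 R).
    apply: C2_eq; rewrite ?ReM ?ImM /= /GRing.scale/=; ring.
  have := @Ck1c_line phi (shear ((x, 0), w2)) (- w2.2) w2.1 0 0 y _ c1 erefl.
  by rewrite -e comb0 (_ : (fun t => _) = fun s => phi (shear ((x, s), w2))); last by apply/funext => t; rewrite e.
- move=> w1; rewrite /dzbar -/X -/Y mulrA; congr (_ / _).
  exact: conj_comb.
Qed.

Lemma wirt_shear2 phi (w1 : R * R) : Ck1c phi ->
  wirt (fun w2 => phi (shear (w1, w2)))
    (fun w2 => (cplx w1)^* * dzbar 0 phi (shear (w1, w2)) + dzbar 1 phi (shear (w1, w2))).
Proof.
move=> c1; pose X := cderive (xdir R 0) phi; pose Y := cderive (ydir R 0) phi.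
pose X' := cderive (xdir R 1) phi; pose Y' := cderive (ydir R 1) phi.
have cs (f : C2 R -> R[i]) : ccont f -> ccont (fun w2 => f (shear (w1, w2))).
  by move=> cf; exact: (ccont_comp (ccont_comp cf continuous_shear) (@continuous_slice2 (R * R)%type (R * R)%type w1)).
exists (fun w2 => (w1.1)%:C * X (shear (w1, w2)) + (w1.2)%:C * Y (shear (w1, w2)) + X' (shear (w1, w2))),
  (fun w2 => (- w1.2)%:C * X (shear (w1, w2)) + (w1.1)%:C * Y (shear (w1, w2)) + Y' (shear (w1, w2))); split.
- exact: cs (Ck1c_ccont c1).
- apply: ccontD; last exact: cs (Ck1c_ccont_x _ c1).
  by apply: ccontD; apply: ccontM; [exact: ccont_cst|exact: cs (Ck1c_ccont_x _ c1)|exact: ccont_cst|exact: cs (Ck1c_ccont_y _ c1)].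
- apply: ccontD; last exact: cs (Ck1c_ccont_y _ c1).
  by apply: ccontD; apply: ccontM; [exact: ccont_cst|exact: cs (Ck1c_ccont_x _ c1)|exact: ccont_cst|exact: cs (Ck1c_ccont_y _ c1)].
- move=> x y; split.
    have e s : shear (w1, (s, y)) = shear (w1, (0, y)) + s *: ((w1, (1, 0)) : C2 R).
      apply: C2_eq; rewrite ?ReM ?ImM /= /GRing.scale/=; ring.
    have := @Ck1c_line phi (shear (w1, (0, y))) w1.1 w1.2 1 0 x _ c1 erefl.
    by rewrite -surjective_pairing -e comb1 (_ : (fun t => _) = fun s => phi (shear (w1, (s, y)))); last by apply/funext => t; rewrite e.
  have e s : shear (w1, (x, s)) = shear (w1, (x, 0)) + s *: (((- w1.2, w1.1), (0, 1)) : C2 R).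
    apply: C2_eq; rewrite ?ReM ?ImM /= /GRing.scale/=; ring.
  have := @Ck1c_line phi (shear (w1, (x, 0))) (- w1.2) w1.1 0 1 y _ c1 erefl.
  by rewrite -e comb2 (_ : (fun t => _) = fun s => phi (shear (w1, (x, s)))); last by apply/funext => t; rewrite e.
- move=> w2; rewrite /dzbar -/X -/Y -/X' -/Y' mulrA -mulrDl; congr (_ / _).
  by rewrite conj_comb; ring.
Qed.
End Ck1.

(** * Adjoint kernels on test functions *)

Lemma cplx0 {R : realType} : cplx (0 : R * R) = 0. Proof. by []. Qed.

Section wirt2.
Context {R : realType}.
Implicit Types b : C2 R -> R[i].

(* [b1] and [b2] are the derivatives of [b] in the conjugates of the two complex variables. *)
Definition wirt2 b b1 b2 := [/\ ccont b, ccont b1, ccont b2,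
  forall v, wirt (fun u => b (u, v)) (fun u => b1 (u, v)) &
  forall u, wirt (fun v => b (u, v)) (fun v => b2 (u, v))].

Lemma wirt2_eq b b1 b2 b1' b2' : wirt2 b b1 b2 -> b1 =1 b1' -> b2 =1 b2' -> wirt2 b b1' b2'.
Proof. by move=> h /funext <- /funext <-. Qed.

Lemma wirt2_cst (c : R[i]) : wirt2 (fun=> c) (fun=> 0) (fun=> 0).
Proof. by split=> *; [exact: ccont_cst|exact: ccont_cst|exact: ccont_cst|exact: wirt_cst|exact: wirt_cst]. Qed.

Lemma wirt2D b b1 b2 d d1 d2 : wirt2 b b1 b2 -> wirt2 d d1 d2 ->
  wirt2 (fun w => b w + d w) (fun w => b1 w + d1 w) (fun w => b2 w + d2 w).
Proof.
move=> [cb cb1 cb2 wb1 wb2] [cd cd1 cd2 wd1 wd2]; split.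
- exact: ccontD.
- exact: ccontD.
- exact: ccontD.
- by move=> v; exact: (wirtD (wb1 v) (wd1 v)).
- by move=> u; exact: (wirtD (wb2 u) (wd2 u)).
Qed.

Lemma wirt2M b b1 b2 d d1 d2 : wirt2 b b1 b2 -> wirt2 d d1 d2 ->
  wirt2 (fun w => b w * d w) (fun w => b1 w * d w + b w * d1 w) (fun w => b2 w * d w + b w * d2 w).
Proof.
move=> [cb cb1 cb2 wb1 wb2] [cd cd1 cd2 wd1 wd2]; split.
- exact: ccontM.
- by apply: ccontD; exact: ccontM.
- by apply: ccontD; exact: ccontM.
- by move=> v; exact: (wirtM (wb1 v) (wd1 v)).
- by move=> u; exact: (wirtM (wb2 u) (wd2 u)).
Qed.

Lemma wirt2_fst : wirt2 (fun w => cplx w.1) (fun=> 0) (fun=> 0).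
Proof.
split; [exact: ccont_fst|exact: ccont_cst|exact: ccont_cst|move=> v; exact: wirt_cplx|move=> u; exact: (wirt_cst (cplx u))].
Qed.
Lemma wirt2_snd : wirt2 (fun w => cplx w.2) (fun=> 0) (fun=> 0).
Proof.
split; [exact: ccont_snd|exact: ccont_cst|exact: ccont_cst|move=> v; exact: (wirt_cst (cplx v))|move=> u; exact: wirt_cplx].
Qed.
Lemma wirt2_fstJ : wirt2 (fun w => (cplx w.1)^*) (fun=> 1) (fun=> 0).
Proof.
split; [exact: ccontJ ccont_fst|exact: ccont_cst|exact: ccont_cst|move=> v; exact: wirt_conj|move=> u; exact: (wirt_cst ((cplx u)^*)%R)].
Qed.
Lemma wirt2_sndJ : wirt2 (fun w => (cplx w.2)^*) (fun=> 0) (fun=> 1).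
Proof.
split; [exact: ccontJ ccont_snd|exact: ccont_cst|exact: ccont_cst|move=> v; exact: (wirt_cst ((cplx v)^*)%R)|move=> u; exact: wirt_conj].
Qed.

Lemma wirt2_comp_real (h h' : R -> R) (q : C2 R -> R) q1 q2 : continuous h' ->
  (forall s, is_derive s (1 : R) h (h' s)) -> wirt2 (fun w => (q w)%:C) q1 q2 ->
  wirt2 (fun w => (h (q w))%:C) (fun w => (h' (q w))%:C * q1 w) (fun w => (h' (q w))%:C * q2 w).
Proof.
move=> ch' dh [[cq _] cq1 cq2 w1 w2].
have ch : continuous h by move=> s; apply/differentiable_continuous/derivable1_diffP; have [] := dh s.
split.
- by apply: ccont_real; exact: (continuous_compT cq ch).
- by apply: ccontM => //; apply: ccont_real; exact: (continuous_compT cq ch').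
- by apply: ccontM => //; apply: ccont_real; exact: (continuous_compT cq ch').
- by move=> v; exact: (wirt_comp_real ch' dh (w1 v)).
- by move=> u; exact: (wirt_comp_real ch' dh (w2 u)).
Qed.

Lemma wirt2_shear phi : Ck1c phi -> wirt2 (fun w => phi (shear w))
  (fun w => (cplx w.2)^* * dzbar 0 phi (shear w))
  (fun w => (cplx w.1)^* * dzbar 0 phi (shear w) + dzbar 1 phi (shear w)).
Proof.
move=> c1; have cc j : ccont (fun w => dzbar j phi (shear w)) by exact: (ccont_comp (ccont_dzbar j c1) continuous_shear).
split.
- exact: (ccont_comp (Ck1c_ccont c1) continuous_shear).
- exact: (ccontM (ccontJ ccont_snd) (cc 0)).
- exact: (ccontD (ccontM (ccontJ ccont_fst) (cc 0)) (cc 1)).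
- by move=> v; exact: wirt_shear1.
- by move=> u; exact: wirt_shear2.
Qed.

(* [core m] is the compact part of the product of the disc and the punctured
   disc on which the test functions live. *)
Definition core (m : R) (w : C2 R) : bool :=
  [&& normc (cplx w.1) <= 1 - m, m <= normc (cplx w.2) & normc (cplx w.2) <= 1 - m].

(** The derivatives travel with the function so that products with coordinates and their conjugates
    stay in the class. The margin [m] keeps the support away from both unit circles and from
    [w2 = 0]. *)
Definition tst (m : R) b b1 b2 := [/\ 0 < m, m < 1, wirt2 b b1 b2 &
  forall w, ~~ core m w -> [/\ b w = 0, b1 w = 0 & b2 w = 0]].

Lemma tstM m b b1 b2 d d1 d2 : wirt2 d d1 d2 -> tst m b b1 b2 ->
  tst m (fun w => d w * b w) (fun w => d1 w * b w + d w * b1 w) (fun w => d2 w * b w + d w * b2 w).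
Proof.
move=> wd [m0 m1 wb b0]; split => // [|w /b0[-> -> ->]]; first exact: wirt2M.
by split; rewrite ?mulr0 ?addr0.
Qed.

Lemma ccont_bounded_core (f : C2 R -> R[i]) m : 0 < m -> ccont f ->
  (forall w, ~~ core m w -> f w = 0) -> exists2 M, 0 <= M & forall w, normc (f w) <= M.
Proof.
move=> m0 cf f0.
have cK : compact ((`[-1, 1] `*` `[-1, 1]) `*` (`[-1, 1] `*` `[-1, 1]) : set (C2 R)).
  by apply: compact_setX; exact: compact_box.
have [M M0 MH] := ccont_bounded cf cK; exists M => // w.
have [wc|wc] := boolP (core m w); last by rewrite f0// normc0.
apply: MH; have /and3P[h1 _ h3] := wc.
by split; apply: normc_le_box; [apply: le_trans h1 _|apply: le_trans h3 _]; rewrite gerBl ltW.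
Qed.

Lemma cmeas_cplx1 : cmeas (fun w : mC2 R => cplx w.1).
Proof. by apply: cmeas_cplx. Qed.
Lemma cmeas_cplx2 : cmeas (fun w : mC2 R => cplx w.2).
Proof. by apply: cmeas_cplx. Qed.
End wirt2.

(** * Truncated kernels *)

Section cutoff_kernels.
Context {R : realType}.
Implicit Types (e m : R) (w x : R[i]).

(* For [e < 1] the kernels [Xk e w x] and [Pk e w x] vanish for [|x|^2 >= e]. *)
Definition gap e x : R := Num.max 0 (e - normc x ^+ 2).
Definition Xk e w x : R[i] := ((gap e x)%:C / (e%:C - w * (x^*)%R)) ^+ 2.
Definition Pk e w x : R[i] := (2 * e * gap e x)%:C / (e%:C - w * (x^*)%R) ^+ 3.

Lemma gap_ge0 e x : 0 <= gap e x. Proof. by rewrite /gap le_max lexx. Qed.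
Lemma gap_le1 e x : e <= 1 -> gap e x <= 1.
Proof. by move=> e1; rewrite /gap ge_max ler01 lerBlDr (le_trans e1)// lerDl sqr_ge0. Qed.
Lemma gap_eq0 e x : e <= 1 -> 1 <= normc x -> gap e x = 0.
Proof.
by move=> e1 x1; apply: max_l; rewrite subr_le0 (le_trans e1)// expr_ge1// normc_ge0.
Qed.

(** On the core $|w\bar x|\le 1-m$. The threshold [1 - m / 2] for [e] leaves half of the margin, so
    all estimates below are uniform in [e] up to and including 1. *)
Lemma den_ge m e w x : 1 - m / 2 <= e -> normc w <= 1 - m -> normc x <= 1 -> m / 2 <= normc (e%:C - w * (x^*)%R).
Proof.
move=> em wm x1; have w0 : 0 <= 1 - m := le_trans (normc_ge0 _) wm.
have h : normc (w * (x^*)%R) <= 1 - m.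
  by rewrite normcM normcJE -[leRHS]mulr1 ler_pM ?normc_ge0.
have := ler_normcB e%:C (w * (x^*)%R); rewrite normc_real; have := ler_norm e; lra.
Qed.

Lemma normc_Xk m e w x : 0 < m -> 1 - m / 2 <= e -> e <= 1 -> normc w <= 1 - m ->
  normc (Xk e w x) <= (2 / m) ^+ 2 /\ normc (Pk e w x) <= 2 * (2 / m) ^+ 3.
Proof.
move=> m0 em e1 wm; have m20 : 0 < m / 2 by rewrite divr_gt0.
have wm0 : 0 <= 1 - m := le_trans (normc_ge0 _) wm.
have e0 : 0 <= e by lra.
have k0 : 0 <= 2 / m by rewrite divr_ge0// ltW.
have [x1|x1] := leP 1 (normc x).
  by rewrite /Xk /Pk gap_eq0// mulr0 !mul0r expr0n normc0 exprn_ge0// mulr_ge0// exprn_ge0.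
have d := den_ge em wm (ltW x1).
have dV : (normc (e%:C - w * (x^*)%R))^-1 <= 2 / m by rewrite -(invf_div m 2) lef_pV2 ?posrE// (lt_le_trans m20).
have [g0 g1] := (gap_ge0 e x, gap_le1 x e1).
split.
  rewrite /Xk normcX lerXn2r ?nnegrE ?normc_ge0// normcM normc_real ger0_norm// normcV.
  by rewrite -[leRHS]mul1r ler_pM// invr_ge0 normc_ge0.
rewrite /Pk normcM normcV normcX normc_real ger0_norm; last by rewrite !mulr_ge0.
rewrite ler_pM ?mulr_ge0 ?invr_ge0 ?exprn_ge0 ?normc_ge0//.
  by rewrite -mulrA ler_piMr// -[leRHS]mulr1 ler_pM.
by rewrite -exprVn lerXn2r ?nnegrE ?invr_ge0 ?normc_ge0.
Qed.

Lemma Xk_diag m e w : 0 < m -> 1 - m / 2 <= e -> normc w <= 1 - m -> Xk e w w = 1.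
Proof.
move=> m0 em wm.
have w0 : 0 <= normc w := normc_ge0 _.
have g : 0 < e - normc w ^+ 2.
  rewrite subr_gt0; have h : normc w * normc w <= (1 - m) * 1 by rewrite ler_pM//; lra.
  by rewrite expr2; lra.
rewrite /Xk mulcJ /gap max_r ?(ltW g)// -rmorphB divff ?expr1n//.
by rewrite -normc_gt0 normc_real normr_gt0 gt_eqF.
Qed.

Lemma cmeas_gap d (T : measurableType d) e (g : T -> R[i]) : cmeas g -> measurable_fun setT (fun t => gap e (g t)).
Proof.
move=> mg; apply: measurable_maxr; first exact: measurable_cst.
apply: measurable_funB; first exact: measurable_cst.
by apply: measurable_funX; exact: measurable_normc.
Qed.
Lemma cmeas_Xk d (T : measurableType d) e (f g : T -> R[i]) : cmeas f -> cmeas g -> cmeas (fun t => Xk e (f t) (g t)).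
Proof.
move=> mf mg; apply: cmeasX; apply: cmeasM; first by apply: cmeas_real; exact: cmeas_gap.
by apply: cmeasV; apply: cmeasB; [exact: cmeas_cst|apply: cmeasM => //; exact: cmeasJ].
Qed.
Lemma cmeas_Pk d (T : measurableType d) e (f g : T -> R[i]) : cmeas f -> cmeas g -> cmeas (fun t => Pk e (f t) (g t)).
Proof.
move=> mf mg; apply: cmeasM.
  by apply: cmeas_real; apply: measurable_funM; [exact: measurable_cst|exact: cmeas_gap].
apply: cmeasV; apply: cmeasX; apply: cmeasB; first exact: cmeas_cst.
by apply: cmeasM => //; exact: cmeasJ.
Qed.

(** With $q=e-x\bar x$ and $b=e-w\bar x$, the derivative of $q^2/b^2$ in $\bar x$ is
    $2q(qw-xb)/b^3$, and $qw-xb=e(w-x)$. The factor $w-x$ later cancels the Cauchy singularity and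
    leaves the kernel [Pk]. *)
Lemma wirt_Xk m e (w : R * R) : 0 < m -> 1 - m / 2 <= e -> e <= 1 -> normc (cplx w) <= 1 - m ->
  wirt (fun x : R * R => Xk e (cplx w) (cplx x)) (fun x : R * R => (cplx w - cplx x) * Pk e (cplx w) (cplx x)).
Proof.
move=> m0 em e1 wm; have m20 : 0 < m / 2 by rewrite divr_gt0.
pose q (x : R * R) := e - normc (cplx x) ^+ 2.
have wq : wirt (fun x : R * R => (q x)%:C) (fun x : R * R => - cplx x).
  rewrite (_ : (fun x : R * R => _) = fun x : R * R => e%:C + - (cplx x * (cplx x)^*)); last first.
    by apply/funext => x; rewrite /q mulcJ rmorphB.
  apply: (wirt_eq (wirtD (wirt_cst _) (wirtN (wirtM wirt_cplx wirt_conj)))) => x.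
  by rewrite mul0r !add0r mulr1.
have wN := wirt_comp_real (h := fun s => Num.max 0 s ^+ 2) (h' := fun s => 2 * Num.max 0 s) _ is_derive_pos2 wq.
pose b (x : R * R) := e%:C - cplx w * (cplx x)^*.
have wb : wirt b (fun x : R * R => - cplx w).
  apply: (wirt_eq (wirtD (wirt_cst e%:C) (wirtN (wirtM (wirt_cst (cplx w)) wirt_conj)))) => x.
  by rewrite mul0r !add0r mulr1.
have wb2 := wirtM wb wb.
rewrite (_ : (fun x : R * R => Xk e (cplx w) (cplx x)) = fun x : R * R => (gap e (cplx x) ^+ 2)%:C / (b x * b x)); last first.
  by apply/funext => x; rewrite /Xk /b expr_div_n rmorphXn -!expr2.
have cont : continuous (fun s : R => 2 * Num.max 0 s).
  move=> s; apply: cvgM; first exact: cvg_cst.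
  by apply: continuous_max; [exact: cvg_cst|exact: cvg_id].
have h (x : R * R) : normc (b x * b x) < (m / 2) ^+ 2 -> (gap e (cplx x) ^+ 2)%:C = 0 :> R[i].
  rewrite -expr2 normcX => h; rewrite gap_eq0// ?expr0n// leNgt; apply/negP => x1.
  by move: h; rewrite ltNge lerXn2r// ?nnegrE ?(ltW m20) ?normc_ge0// den_ge// ltW.
apply: (wirt_eq (wirt_div (exprn_gt0 2 m20) (wN cont) wb2 h)) => x.
have [x1|x1] := leP 1 (normc (cplx x)).
  by rewrite /Pk -/(gap e (cplx x)) gap_eq0// !(mulr0, mul0r, expr0n, subrr).
have bn0 : b x != 0 by rewrite -normc_gt0 (lt_le_trans m20)// den_ge// ltW.
rewrite /Pk -/(gap e (cplx x)) -/(b x).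
have [g0|g0] := leP (q x) 0.
  by rewrite /gap -/(q x) max_l// !(mulr0, mul0r, expr0n, subrr).
have gE : gap e (cplx x) = q x by rewrite /gap -/(q x) max_r// ltW.
have -> : (2 * gap e (cplx x))%:C = 2 * (q x)%:C :> R[i] by rewrite gE rmorphM rmorph_nat.
have -> : (gap e (cplx x) ^+ 2)%:C = (q x)%:C ^+ 2 :> R[i] by rewrite gE rmorphXn.
have -> : (2 * e * gap e (cplx x))%:C = 2 * e%:C * (q x)%:C :> R[i] by rewrite gE !rmorphM rmorph_nat.
have qE : (q x)%:C = e%:C - cplx x * (cplx x)^* :> R[i] by rewrite /q mulcJ rmorphB.
rewrite qE /b in bn0 *; field; rewrite bn0//.
Qed.
End cutoff_kernels.

Lemma ccont_slice1 {R : realType} (f : C2 R -> R[i]) (v : R * R) : ccont f -> ccont (fun x : R * R => f (x, v)).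
Proof. by move=> cf; exact: (ccont_comp cf (@continuous_slice1 (R * R)%type (R * R)%type v)). Qed.
Lemma ccont_slice2 {R : realType} (f : C2 R -> R[i]) (u : R * R) : ccont f -> ccont (fun x : R * R => f (u, x)).
Proof. by move=> cf; exact: (ccont_comp cf (@continuous_slice2 (R * R)%type (R * R)%type u)). Qed.

(** * Transposed operators with truncated kernels *)

Section cutoff_operators.
Context {R : realType}.
Local Notation muC := (@lebesgueC R).
Local Notation muC2 := (@lebesgueC2 R).

(** Transposes of [K] and [P] acting in the first variable: the integration runs over the first
    argument of the kernel, on which the test function lives, and the second variable is a
    parameter. *)
Definition opA (e : R) (psi : C2 R -> R[i]) (q : mC2 R) : R[i] :=
  cint muC (fun w : mC R => Xk e (cplx w) (cplx q.1) / (cplx w - cplx q.1) * psi (w, q.2)).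
Definition opB (e : R) (psi : C2 R -> R[i]) (q : mC2 R) : R[i] :=
  cint muC (fun w : mC R => Pk e (cplx w) (cplx q.1) * psi (w, q.2)).

(** The centre of the singularity may move with the outer variable, because the Riesz integral is
    bounded independently of its centre. *)
Lemma cintegrable_riesz2 (F : mC2 R -> R[i]) (b : R * R -> R * R) (M : R) : cmeas F ->
  (forall u v, normc (F (u, v)) <= M * riesz (b u) 3 v) ->
  (forall u v : R * R, 1 < normc (cplx u) -> F (u, v) = 0) -> cintegrable muC2 F.
Proof.
move=> mF Fb F0; apply: (@cintegrable_prod _ _ _ _ _ muC muC F mF).
pose N : R := (2 * (3 `^ (1 - 1 / 2) / (1 - 1 / 2))) ^+ 2.
pose Q : set (mC R) := `[-1, 1] `*` `[-1, 1].
have mQ : measurable Q by exact: measurableX.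
have mn : measurable_fun setT (fun x => (normc (F x))%:E) by exact/measurable_EFinP/measurable_normc.
apply: (@le_lt_trans _ _ (\int[muC]_u ((`|M| * N)%:E * (\1_Q u)%:E))%E).
  apply: ge0_le_integral => //.
  - by move=> u _; apply: integral_ge0 => v _; rewrite lee_fin normc_ge0.
  - by apply: (measurable_int1 muC mn) => x; rewrite lee_fin normc_ge0.
  - by apply: measurable_funeM; exact/measurable_EFinP.
  - move=> u _; have [u1|u1] := leP (normc (cplx u)) 1; last first.
      under eq_integral do rewrite F0// normc0.
      by rewrite integral0 -EFinM lee_fin mulr_ge0// mulr_ge0// exprn_ge0// mulr_ge0// divr_ge0 ?powR_ge0//; lra.
    rewrite indicE mem_set ?mule1; last exact: normc_le_box.
    apply: (@le_trans _ _ (\int[muC]_v (`|M|%:E * (riesz (b u) 3 v)%:E))%E).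
      apply: ge0_le_integral => //.
      - by move=> v _; rewrite lee_fin normc_ge0.
      - by apply/measurable_EFinP/measurable_normc; exact: cmeas_pair1.
      - by apply: measurable_funeM; apply/measurable_EFinP; exact: measurable_riesz.
      - by move=> v _; rewrite -EFinM lee_fin (le_trans (Fb u v))// ler_wpM2r ?riesz_ge0// ler_norm.
    rewrite ge0_integralZl//; last 2 first.
    - by apply/measurable_EFinP; exact: measurable_riesz.
    - by move=> v _; rewrite lee_fin riesz_ge0.
    rewrite EFinM lee_wpmul2l ?lee_fin//.
    exact: (integral_riesz (b u) ltr01 (ltr1n R 2) (ltr0Sn R 2)).
rewrite ge0_integralZl//.
- rewrite integral_indic// setIT lte_mul_pinfty// ?lebesgueC_box_lty//.
  by rewrite lee_fin mulr_ge0// exprn_ge0// mulr_ge0// divr_ge0 ?powR_ge0//; lra.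
- by apply/measurable_EFinP.
- by rewrite lee_fin mulr_ge0// exprn_ge0// mulr_ge0// divr_ge0 ?powR_ge0//; lra.
Qed.

Lemma cintegrable_bounded2 (F : mC2 R -> R[i]) (M : R) : cmeas F -> (forall q, normc (F q) <= M) ->
  (forall q : C2 R, 1 < normc (cplx q.1) \/ 1 < normc (cplx q.2) -> F q = 0) -> cintegrable muC2 F.
Proof.
move=> mF FM F0; pose Q : set (mC R) := `[-1, 1] `*` `[-1, 1].
have mQ : measurable Q by exact: measurableX.
apply: (@cintegrable_bounded _ _ _ muC2 F (Q `*` Q) M) => //.
- exact: measurableX.
- rewrite [ltLHS](_ : _ = (muC Q * muC Q)%E); last exact: product_measure1E.
  apply: lte_mul_pinfty => //.
  + by rewrite ge0_fin_numE//; exact: lebesgueC_box_lty.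
  + exact: lebesgueC_box_lty.
- move=> q nq; apply: F0; have [h1|h1] := ltP 1 (normc (cplx q.1)); first by left.
  have [h2|h2] := ltP 1 (normc (cplx q.2)); first by right.
  by exfalso; apply: nq; split; exact: normc_le_box.
Qed.

Lemma ccont_bounded_bidisc (f : C2 R -> R[i]) : ccont f ->
  exists2 M, 0 <= M & forall u v, normc (cplx u) <= 1 -> normc (cplx v) <= 1 -> normc (f (u, v)) <= M.
Proof.
move=> cf.
have cK : compact ((`[-1, 1] `*` `[-1, 1]) `*` (`[-1, 1] `*` `[-1, 1]) : set (C2 R)).
  by apply: compact_setX; exact: compact_box.
have [M M0 MH] := ccont_bounded cf cK; exists M => // u v u1 v1.
by apply: MH; split; exact: normc_le_box.
Qed.

Variables (m e : R) (m0 : 0 < m) (m1 : m < 1) (em : 1 - m / 2 <= e) (e1 : e <= 1).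

Let k2_ge0 : 0 <= (2 / m) ^+ 2.
Proof. by rewrite exprn_ge0// divr_ge0// ltW. Qed.
Let k3_ge0 : 0 <= 2 * (2 / m) ^+ 3.
Proof. by rewrite mulr_ge0// exprn_ge0// divr_ge0// ltW. Qed.

Lemma normc_cauchy_Xk (w x : R * R) : normc (cplx w) <= 1 - m ->
  normc (Xk e (cplx w) (cplx x) / (cplx w - cplx x)) <= (2 / m) ^+ 2 * riesz x 3 w.
Proof.
move=> wm; have k0 : 0 <= (2 / m) ^+ 2 by rewrite exprn_ge0// divr_ge0// ltW.
have [x1|x1] := leP 1 (normc (cplx x)).
  by rewrite /Xk gap_eq0// !mul0r expr0n mul0r normc0 mulr_ge0 ?riesz_ge0.
rewrite normcM; apply: ler_pM; [exact: normc_ge0|exact: normc_ge0|by case: (normc_Xk (cplx x) m0 em e1 wm)|].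
rewrite /riesz ifT; first by rewrite normcV powR_inv1 ?normc_ge0// normcB.
apply: le_trans (le_normcD _ _) _; rewrite normcN.
by apply: le_trans (lerD (ltW x1) wm) _; move: m0; lra.
Qed.

Lemma normc_cauchy_Xk_core (psi : C2 R -> R[i]) M (w x v : R * R) :
  (forall w, ~~ core m w -> psi w = 0) -> (forall w, normc (psi w) <= M) ->
  normc (Xk e (cplx w) (cplx x) / (cplx w - cplx x) * psi (w, v)) <= (2 / m) ^+ 2 * M * riesz x 3 w.
Proof.
move=> p0 pM; have M0 : 0 <= M := le_trans (normc_ge0 _) (pM (0, 0)).
have k0 : 0 <= (2 / m) ^+ 2 by rewrite exprn_ge0// divr_ge0// ltW.
have [wc|wc] := boolP (core m (w, v)); last by rewrite p0// mulr0 normc0; exact: mulr_ge0 (mulr_ge0 k0 M0) (riesz_ge0 _ _ _).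
have /and3P[wm _ _] := wc.
have h := ler_pM (normc_ge0 _) (normc_ge0 _) (normc_cauchy_Xk x wm) (pM (w, v)).
by rewrite normcM [leRHS]mulrAC; exact: h.
Qed.

Lemma normc_Pk_core (psi : C2 R -> R[i]) M (w x v : R * R) :
  (forall w, ~~ core m w -> psi w = 0) -> (forall w, normc (psi w) <= M) ->
  normc (Pk e (cplx w) (cplx x) * psi (w, v)) <= 2 * (2 / m) ^+ 3 * M.
Proof.
move=> p0 pM; have M0 : 0 <= M := le_trans (normc_ge0 _) (pM (0, 0)).
have k0 : 0 <= 2 * (2 / m) ^+ 3 by rewrite mulr_ge0// exprn_ge0// divr_ge0// ltW.
have [wc|wc] := boolP (core m (w, v)); last by rewrite p0// mulr0 normc0; exact: mulr_ge0.
have /and3P[wm _ _] := wc.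
have [_ k1] := normc_Xk (cplx x) m0 em e1 wm.
have h := ler_pM (normc_ge0 _) (normc_ge0 _) k1 (pM (w, v)).
by rewrite normcM; exact: h.
Qed.

Lemma kernel_eq0 (w x : R[i]) : 1 <= normc x -> Xk e w x = 0 /\ Pk e w x = 0.
Proof. by move=> x1; rewrite /Xk /Pk gap_eq0// mulr0 !mul0r expr0n. Qed.

Lemma cmeas_swap (psi : C2 R -> R[i]) d (T : measurableType d) (f g : T -> mC R) : ccont psi ->
  measurable_fun setT f -> measurable_fun setT g -> cmeas (fun t => psi (f t, g t)).
Proof.
move=> cp mf mg; apply: (@cmeas_comp _ _ _ _ _ (psi : mC2 R -> R[i]) (fun t => (f t, g t) : mC2 R)).
  exact: ccont_cmeas2.
exact: measurable_fun_pair.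
Qed.

Let cmeas_XC d (T : measurableType d) (f g : T -> mC R) : measurable_fun setT f -> measurable_fun setT g ->
  cmeas (fun t => Xk e (cplx (f t)) (cplx (g t)) / (cplx (f t) - cplx (g t))).
Proof.
move=> mf mg; apply: cmeasM; first by apply: cmeas_Xk; exact: cmeas_cplx.
by apply: cmeasV; apply: cmeasB; exact: cmeas_cplx.
Qed.

Let cmeas_PC d (T : measurableType d) (f g : T -> mC R) : measurable_fun setT f -> measurable_fun setT g ->
  cmeas (fun t => Pk e (cplx (f t)) (cplx (g t))).
Proof. by move=> mf mg; apply: cmeas_Pk; exact: cmeas_cplx. Qed.

Let mfst d1 d2 (T1 : measurableType d1) (T2 : measurableType d2) : measurable_fun setT (fun z : T1 * T2 => z.1).
Proof. exact: measurable_fst. Qed.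
Let msnd d1 d2 (T1 : measurableType d1) (T2 : measurableType d2) : measurable_fun setT (fun z : T1 * T2 => z.2).
Proof. exact: measurable_snd. Qed.

Section bounded_symbol.
Variables (psi : C2 R -> R[i]) (M : R) (cp : ccont psi).
Hypotheses (p0 : forall w, ~~ core m w -> psi w = 0) (pM : forall w, normc (psi w) <= M).

Let M0 : 0 <= M. Proof. exact: le_trans (normc_ge0 _) (pM (0, 0)). Qed.

Lemma core_eq0r (w v : R * R) : 1 < normc (cplx v) -> psi (w, v) = 0.
Proof.
move=> v1; apply: p0; apply/negP => /and3P[_ _ /= h].
by move: v1; rewrite ltNge (le_trans h)// gerBl ltW.
Qed.
Lemma core_eq0l (w v : R * R) : 1 < normc (cplx w) -> psi (w, v) = 0.
Proof.
move=> v1; apply: p0; apply/negP => /and3P[/= h _ _].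
by move: v1; rewrite ltNge (le_trans h)// gerBl ltW.
Qed.

Lemma cmeas_opA : cmeas (opA e psi).
Proof.
apply: (@cmeas_cint _ _ _ (mC2 R) (mC R) muC (fun z : mC2 R * mC R => Xk e (cplx z.2) (cplx z.1.1) / (cplx z.2 - cplx z.1.1) * psi (z.2, z.1.2))).
apply: cmeasM; first by apply: cmeas_XC; [exact: msnd|exact: (measurableT_comp measurable_fst measurable_fst)].
by apply: cmeas_swap; [by []|exact: msnd|exact: (measurableT_comp measurable_snd measurable_fst)].
Qed.

Lemma cmeas_opB : cmeas (opB e psi).
Proof.
apply: (@cmeas_cint _ _ _ (mC2 R) (mC R) muC (fun z : mC2 R * mC R => Pk e (cplx z.2) (cplx z.1.1) * psi (z.2, z.1.2))).
apply: cmeasM; first by apply: cmeas_PC; [exact: msnd|exact: (measurableT_comp measurable_fst measurable_fst)].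
by apply: cmeas_swap; [by []|exact: msnd|exact: (measurableT_comp measurable_snd measurable_fst)].
Qed.

Lemma opA_eq0 (q : C2 R) : 1 <= normc (cplx q.1) \/ ~~ (m <= normc (cplx q.2) <= 1 - m) -> opA e psi q = 0.
Proof.
move=> h; rewrite /opA (_ : (fun w : mC R => _) = fun=> 0) ?cint0//; apply/funext => w.
case: h => [x1|v1]; first by have [-> _] := kernel_eq0 (cplx w) x1; rewrite !mul0r.
by rewrite p0 ?mulr0//; apply: contra v1 => /and3P[_ -> ->].
Qed.
Lemma opB_eq0 (q : C2 R) : 1 <= normc (cplx q.1) \/ ~~ (m <= normc (cplx q.2) <= 1 - m) -> opB e psi q = 0.
Proof.
move=> h; rewrite /opB (_ : (fun w : mC R => _) = fun=> 0) ?cint0//; apply/funext => w.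
case: h => [x1|v1]; first by have [_ ->] := kernel_eq0 (cplx w) x1; rewrite !mul0r.
by rewrite p0 ?mulr0//; apply: contra v1 => /and3P[_ -> ->].
Qed.

Lemma op_out (q : C2 R) : 1 < normc (cplx q.1) \/ 1 < normc (cplx q.2) -> opA e psi q = 0 /\ opB e psi q = 0.
Proof.
move=> [x1|v1]; first by rewrite opA_eq0 ?opB_eq0//; left; exact: ltW.
have nv : ~~ (m <= normc (cplx q.2) <= 1 - m).
  by rewrite negb_and -!ltNge (lt_trans _ v1) ?orbT// gtrBl.
by rewrite opA_eq0 ?opB_eq0//; right.
Qed.

(** The kernel does not involve [v], so the integration in [v] passes inside; this prepares an
    integration by parts in the second variable alone. *)
Lemma fubiniA (b : C2 R -> R[i]) (x : R * R) : ccont b ->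
  cint muC (fun v : mC R => b (x, v) * opA e psi (x, v)) =
  cint muC (fun w : mC R => Xk e (cplx w) (cplx x) / (cplx w - cplx x) * cint muC (fun v : mC R => b (x, v) * psi (w, v))).
Proof.
move=> cb; have [x1|x1] := leP 1 (normc (cplx x)).
  rewrite (_ : (fun v : mC R => _) = fun=> 0) ?cint0; last first.
    by apply/funext => v; rewrite opA_eq0 ?mulr0//; left.
  rewrite (_ : (fun w : mC R => _) = fun=> 0) ?cint0//.
  by apply/funext => w; have [-> _] := kernel_eq0 (cplx w) x1; rewrite !mul0r.
have [N N0 bN] := ccont_bounded_bidisc cb.
pose F (z : mC2 R) : R[i] := b (x, z.1) * (Xk e (cplx z.2) (cplx x) / (cplx z.2 - cplx x) * psi (z.2, z.1)).
have mF : cmeas F.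
  apply: cmeasM; first by apply: cmeas_swap; [by []|exact: measurable_cst|exact: mfst].
  by apply: cmeasM; [apply: cmeas_XC; [exact: msnd|exact: measurable_cst]|apply: cmeas_swap; [by []|exact: msnd|exact: mfst]].
have iF : cintegrable muC2 F.
  apply: (@cintegrable_riesz2 F (fun=> x) (N * ((2 / m) ^+ 2 * M)) mF) => [u v|u v u1]; last first.
    by rewrite /F/= core_eq0r ?mulr0.
  have [u1|u1] := leP (normc (cplx u)) 1; last first.
    by rewrite /F/= core_eq0r// !mulr0 normc0; exact: mulr_ge0 (mulr_ge0 N0 (mulr_ge0 k2_ge0 M0)) (riesz_ge0 _ _ _).
  have h := ler_pM (normc_ge0 _) (normc_ge0 _) (bN x u (ltW x1) u1) (normc_cauchy_Xk_core v x u p0 pM).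
  by rewrite /F/= normcM -[leRHS]mulrA; exact: h.
have s (v : mC R) : cintegrable muC (fun w : mC R => Xk e (cplx w) (cplx x) / (cplx w - cplx x) * psi (w, v)).
  apply: (cintegrable_le _ _ (integrableZl measurableT ((2 / m) ^+ 2 * M) (integrable_riesz x (ltr0Sn R 2)))) => [|w].
    by apply: cmeasM; [apply: cmeas_XC; [exact: measurable_id|exact: measurable_cst]|apply: cmeas_swap; [by []|exact: measurable_id|exact: measurable_cst]].
  exact: normc_cauchy_Xk_core.
transitivity (cint muC (fun v : mC R => cint muC (fun w : mC R => F (v, w)))).
  by congr cint; apply/funext => v; rewrite /opA -cintZ.
rewrite -(@cint_prod _ _ _ _ _ muC muC F iF) (@cint_prod2 _ _ _ _ _ muC muC F iF).
congr cint; apply/funext => w; rewrite -cintZ; first by congr cint; apply/funext => v; rewrite /F mulrCA.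
apply: (@cintegrable_ccont _ (fun v => b (x, v) * psi (w, v)) 1) => [|v v1]; last by rewrite core_eq0r ?mulr0.
by apply: ccontM; [exact: (ccont_slice2 _ cb)|exact: (ccont_slice2 _ cp)].
Qed.

(** The inner integrability in [x] is required only for [w] in the core slice, since [psi]
    annihilates the other values of [w]. *)
Let fubini_kernel (k : R * R -> R * R -> R[i]) (b : C2 R -> R[i]) (v : R * R) :
  cintegrable muC2 (fun z : mC2 R => b (z.1, v) * (k z.2 z.1 * psi (z.2, v))) ->
  (forall x, cintegrable muC (fun w : mC R => k w x * psi (w, v))) ->
  (forall w, core m (w, v) -> cintegrable muC (fun x : mC R => k w x * b (x, v))) ->
  cint muC (fun x : mC R => b (x, v) * cint muC (fun w : mC R => k w x * psi (w, v))) =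
  cint muC (fun w : mC R => psi (w, v) * cint muC (fun x : mC R => k w x * b (x, v))).
Proof.
move=> iF i1 i2; pose F (z : mC2 R) := b (z.1, v) * (k z.2 z.1 * psi (z.2, v)).
transitivity (cint muC (fun x : mC R => cint muC (fun w : mC R => F (x, w)))).
  by congr cint; apply/funext => x; rewrite -cintZ.
rewrite -(@cint_prod _ _ _ _ _ muC muC F iF) (@cint_prod2 _ _ _ _ _ muC muC F iF).
congr cint; apply/funext => w; have [wc|wc] := boolP (core m (w, v)).
  rewrite -cintZ; last exact: i2.
  by congr cint; apply/funext => x; rewrite /F/=; ring.
by rewrite (p0 wc) mul0r -[RHS](cint0 muC); congr cint; apply/funext => x; rewrite /F/= p0// !mulr0.
Qed.

Lemma cintegrable_XC (f : C2 R -> R[i]) (w v : R * R) : ccont f -> normc (cplx w) <= 1 - m ->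
  cintegrable muC (fun x : mC R => Xk e (cplx w) (cplx x) / (cplx w - cplx x) * f (x, v)).
Proof.
move=> cf wm.
have mf : cmeas (fun x : mC R => Xk e (cplx w) (cplx x) * f (x, v)).
  apply: cmeasM; last by apply: cmeas_swap; [by []|exact: measurable_id|exact: measurable_cst].
  by apply: cmeas_Xk; [exact: cmeas_cst|exact: cmeas_cplx].
have cfv : ccont (fun x => f (x, v)) by exact: (ccont_slice1 _ cf).
have [N N0 fN] := ccont_bounded cfv (@compact_box R (-1) 1).
under eq_fun do rewrite mulrAC.
apply: (@cintegrable_cauchy _ _ 1 ((2 / m) ^+ 2 * N) w ltr01 mf) => x => [|x1]; last first.
  by have [-> _] := kernel_eq0 (cplx w) (ltW x1); rewrite mul0r.
have [x1|x1] := leP 1 (normc (cplx x)).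
  by have [-> _] := kernel_eq0 (cplx w) x1; rewrite mul0r normc0; exact: mulr_ge0.
have [k1 k2] := normc_Xk (cplx x) m0 em e1 wm; have fx := fN x (normc_le_box (ltW x1)).
by rewrite normcM; apply: ler_pM; [exact: normc_ge0|exact: normc_ge0|by []|exact: fx].
Qed.

Lemma cintegrable_PC (f : C2 R -> R[i]) (w v : R * R) : ccont f -> normc (cplx w) <= 1 - m ->
  cintegrable muC (fun x : mC R => Pk e (cplx w) (cplx x) * f (x, v)).
Proof.
move=> cf wm.
have mf : cmeas (fun x : mC R => Pk e (cplx w) (cplx x) * f (x, v)).
  apply: cmeasM; last by apply: cmeas_swap; [by []|exact: measurable_id|exact: measurable_cst].
  by apply: cmeas_Pk; [exact: cmeas_cst|exact: cmeas_cplx].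
have cfv : ccont (fun x => f (x, v)) by exact: (ccont_slice1 _ cf).
have [N N0 fN] := ccont_bounded cfv (@compact_box R (-1) 1).
apply: (@cintegrable_compact_support _ _ 1 (2 * (2 / m) ^+ 3 * N) mf) => x => [|x1]; last first.
  by have [_ ->] := kernel_eq0 (cplx w) (ltW x1); rewrite mul0r.
have [x1|x1] := leP 1 (normc (cplx x)).
  by have [_ ->] := kernel_eq0 (cplx w) x1; rewrite mul0r normc0; exact: mulr_ge0.
have [k1 k2] := normc_Xk (cplx x) m0 em e1 wm; have fx := fN x (normc_le_box (ltW x1)).
by rewrite normcM; apply: ler_pM; [exact: normc_ge0|exact: normc_ge0|by []|exact: fx].
Qed.

Lemma cintegrable_XC_psi (x v : R * R) :
  cintegrable muC (fun w : mC R => Xk e (cplx w) (cplx x) / (cplx w - cplx x) * psi (w, v)).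
Proof.
apply: (cintegrable_le _ _ (integrableZl measurableT ((2 / m) ^+ 2 * M) (integrable_riesz x (ltr0Sn R 2)))) => [|w].
  by apply: cmeasM; [apply: cmeas_XC; [exact: measurable_id|exact: measurable_cst]|apply: cmeas_swap; [by []|exact: measurable_id|exact: measurable_cst]].
exact: normc_cauchy_Xk_core.
Qed.

Lemma cintegrable_PC_psi (x v : R * R) :
  cintegrable muC (fun w : mC R => Pk e (cplx w) (cplx x) * psi (w, v)).
Proof.
apply: (@cintegrable_compact_support _ _ 1 (2 * (2 / m) ^+ 3 * M)) => [|w|w w1].
- by apply: cmeasM; [apply: cmeas_PC; [exact: measurable_id|exact: measurable_cst]|apply: cmeas_swap; [by []|exact: measurable_id|exact: measurable_cst]].
- exact: normc_Pk_core.
- by rewrite core_eq0l ?mulr0.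
Qed.

Lemma fubini_opA (b : C2 R -> R[i]) (v : R * R) : ccont b ->
  cint muC (fun x : mC R => b (x, v) * opA e psi (x, v)) =
  cint muC (fun w : mC R => psi (w, v) * cint muC (fun x : mC R => Xk e (cplx w) (cplx x) / (cplx w - cplx x) * b (x, v))).
Proof.
move=> cb; apply: (fubini_kernel (k := fun w x => Xk e (cplx w) (cplx x) / (cplx w - cplx x))).
- have [N N0 bN] := ccont_bounded_bidisc cb.
  apply: (@cintegrable_riesz2 _ id (N * ((2 / m) ^+ 2 * M))) => [|x w|x w x1].
  + apply: cmeasM; first by apply: cmeas_swap; [by []|exact: mfst|exact: measurable_cst].
    by apply: cmeasM; [apply: cmeas_XC; [exact: msnd|exact: mfst]|apply: cmeas_swap; [by []|exact: msnd|exact: measurable_cst]].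
  + have k0 : 0 <= N * ((2 / m) ^+ 2 * M) * riesz x 3 w.
      exact: mulr_ge0 (mulr_ge0 N0 (mulr_ge0 k2_ge0 M0)) (riesz_ge0 _ _ _).
    rewrite /=; have [x1|x1] := leP 1 (normc (cplx x)).
      by have [-> _] := kernel_eq0 (cplx w) x1; rewrite !mul0r mulr0 normc0.
    have [v1|v1] := ltP 1 (normc (cplx v)); first by rewrite core_eq0r// !mulr0 normc0.
    have h := ler_pM (normc_ge0 _) (normc_ge0 _) (bN x v (ltW x1) v1) (normc_cauchy_Xk_core w x v p0 pM).
    by rewrite normcM -[leRHS]mulrA; exact: h.
  + by have [/= -> _] := kernel_eq0 (cplx w) (ltW x1); rewrite !mul0r mulr0.
- by move=> x; exact: cintegrable_XC_psi.
- by move=> w /and3P[/= wm _ _]; exact: cintegrable_XC.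
Qed.

Lemma fubini_opB (b : C2 R -> R[i]) (v : R * R) : ccont b ->
  cint muC (fun x : mC R => b (x, v) * opB e psi (x, v)) =
  cint muC (fun w : mC R => psi (w, v) * cint muC (fun x : mC R => Pk e (cplx w) (cplx x) * b (x, v))).
Proof.
move=> cb; apply: (fubini_kernel (k := fun w x => Pk e (cplx w) (cplx x))).
- have [N N0 bN] := ccont_bounded_bidisc cb.
  apply: (@cintegrable_bounded2 _ (N * (2 * (2 / m) ^+ 3 * M))) => [|[x w]|[x w]].
  + apply: cmeasM; first by apply: cmeas_swap; [by []|exact: mfst|exact: measurable_cst].
    by apply: cmeasM; [apply: cmeas_PC; [exact: msnd|exact: mfst]|apply: cmeas_swap; [by []|exact: msnd|exact: measurable_cst]].
  + have k0 : 0 <= N * (2 * (2 / m) ^+ 3 * M).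
      exact: mulr_ge0 N0 (mulr_ge0 k3_ge0 M0).
    rewrite /=; have [x1|x1] := leP 1 (normc (cplx x)).
      by have [_ ->] := kernel_eq0 (cplx w) x1; rewrite !mul0r mulr0 normc0.
    have [v1|v1] := ltP 1 (normc (cplx v)); first by rewrite core_eq0r// !mulr0 normc0.
    have h := ler_pM (normc_ge0 _) (normc_ge0 _) (bN x v (ltW x1) v1) (normc_Pk_core w x v p0 pM).
    by rewrite normcM; exact: h.
  + by move=> /= [x1|w1]; [have [_ ->] := kernel_eq0 (cplx w) (ltW x1); rewrite !mul0r mulr0|rewrite core_eq0l ?mulr0].
- by move=> x; exact: cintegrable_PC_psi.
- by move=> w /and3P[/= wm _ _]; exact: cintegrable_PC.
Qed.

Lemma cintegrable_opB_adjoint (b : C2 R -> R[i]) (v : R * R) : ccont b ->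
  cintegrable muC (fun w : mC R => psi (w, v) * cint muC (fun x : mC R => Pk e (cplx w) (cplx x) * b (x, v))).
Proof.
move=> cb; have [N N0 bN] := ccont_bounded_bidisc cb.
pose F (z : mC2 R) := b (z.2, v) * (Pk e (cplx z.1) (cplx z.2) * psi (z.1, v)).
have iF : cintegrable muC2 F.
  apply: (@cintegrable_bounded2 _ (N * (2 * (2 / m) ^+ 3 * M))) => [|[w x]|[w x]].
  + apply: cmeasM; first by apply: cmeas_swap; [by []|exact: msnd|exact: measurable_cst].
    by apply: cmeasM; [apply: cmeas_PC; [exact: mfst|exact: msnd]|apply: cmeas_swap; [by []|exact: mfst|exact: measurable_cst]].
  + have k0 : 0 <= N * (2 * (2 / m) ^+ 3 * M).
      exact: mulr_ge0 N0 (mulr_ge0 k3_ge0 M0).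
    rewrite /F/=; have [x1|x1] := leP 1 (normc (cplx x)).
      by have [_ ->] := kernel_eq0 (cplx w) x1; rewrite !mul0r mulr0 normc0.
    have [v1|v1] := ltP 1 (normc (cplx v)); first by rewrite core_eq0r// !mulr0 normc0.
    have h := ler_pM (normc_ge0 _) (normc_ge0 _) (bN x v (ltW x1) v1) (normc_Pk_core w x v p0 pM).
    by rewrite normcM; exact: h.
  + by rewrite /F/= => -[w1|x1]; [rewrite core_eq0l ?mulr0|have [_ ->] := kernel_eq0 (cplx w) (ltW x1); rewrite !mul0r mulr0].
have := @cintegrable_cint _ _ _ _ _ muC muC F iF.
congr cintegrable; apply/funext => w; have [wc|wc] := boolP (core m (w, v)).
  rewrite -cintZ; last by have /and3P[/= wm _ _] := wc; exact: cintegrable_PC.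
  by congr cint; apply/funext => x; rewrite /F/=; ring.
by rewrite (p0 wc) mul0r -[RHS](cint0 muC); congr cint; apply/funext => x; rewrite /F/= p0// !mulr0.
Qed.

Definition opA_bound : R := (2 / m) ^+ 2 * M * (2 * (3 `^ (1 - 1 / 2) / (1 - 1 / 2))) ^+ 2.

Lemma integral_XC_le (x v : R * R) :
  (\int[muC]_w (normc (Xk e (cplx w) (cplx x) / (cplx w - cplx x) * psi (w, v)))%:E <= opA_bound%:E)%E.
Proof.
apply: (@le_trans _ _ (\int[muC]_w (((2 / m) ^+ 2 * M)%:E * (riesz x 3 w)%:E))%E).
  apply: ge0_le_integral => //.
  - by move=> w _; rewrite lee_fin normc_ge0.
  - by apply/measurable_EFinP/measurable_normc; exact: cintegrable_cmeas (cintegrable_XC_psi x v).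
  - by apply: measurable_funeM; apply/measurable_EFinP; exact: measurable_riesz.
  - by move=> w _; rewrite -EFinM lee_fin; exact: normc_cauchy_Xk_core.
have k0 : 0 <= (2 / m) ^+ 2 * M by exact: mulr_ge0.
rewrite ge0_integralZl//; last 2 first.
- by apply/measurable_EFinP; exact: measurable_riesz.
- by move=> w _; rewrite lee_fin riesz_ge0.
rewrite [leRHS]EFinM; apply: lee_wpmul2l; first by rewrite lee_fin.
exact: (integral_riesz x ltr01 (ltr1n R 2) (ltr0Sn R 2)).
Qed.

Lemma normc_opA (q : C2 R) : normc (opA e psi q) <= 2 * opA_bound.
Proof.
have h : ((normc (opA e psi q))%:E <= 2%:E * \int[muC]_w (normc (Xk e (cplx w) (cplx q.1) / (cplx w - cplx q.1) * psi (w, q.2)))%:E)%E.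
  by apply: ler_normc_cint; exact: cintegrable_cmeas (cintegrable_XC_psi q.1 q.2).
rewrite -lee_fin; apply: (le_trans h).
rewrite EFinM lee_wpmul2l//; exact: integral_XC_le.
Qed.

Lemma integral_PC_le (x v : R * R) :
  (\int[muC]_w (normc (Pk e (cplx w) (cplx x) * psi (w, v)))%:E <= (2 * (2 / m) ^+ 3 * M * 4)%:E)%E.
Proof.
have k0 : 0 <= 2 * (2 / m) ^+ 3 * M by exact: mulr_ge0.
pose Q : set (mC R) := `[-1, 1] `*` `[-1, 1].
have mQ : measurable Q by exact: measurableX.
apply: (@le_trans _ _ (\int[muC]_w ((2 * (2 / m) ^+ 3 * M)%:E * (\1_Q w)%:E))%E).
  apply: ge0_le_integral => //.
  - by move=> w _; rewrite lee_fin normc_ge0.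
  - by apply/measurable_EFinP/measurable_normc; exact: cintegrable_cmeas (cintegrable_PC_psi x v).
  - by apply: measurable_funeM; exact/measurable_EFinP.
  - move=> w _; rewrite -EFinM lee_fin indicE; have [w1|w1] := leP (normc (cplx w)) 1.
      by rewrite mem_set ?mulr1; [exact: normc_Pk_core|exact: normc_le_box].
    by rewrite core_eq0l// mulr0 normc0 mulr_ge0.
rewrite ge0_integralZl//; last by apply/measurable_EFinP.
rewrite integral_indic// setIT [leRHS]EFinM; apply: lee_wpmul2l; first by rewrite lee_fin.
have LQ : muC Q = ((1 - -1) * (1 - -1))%:E.
  by rewrite /lebesgueC product_measure1E//= !lebesgue_measure_itv/= lte_fin ifT -?EFinM//; lra.
rewrite [leLHS](_ : _ = ((1 - -1) * (1 - -1))%:E); last exact: LQ.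
by rewrite lee_fin; lra.
Qed.

Lemma normc_opB (q : C2 R) : normc (opB e psi q) <= 2 * (2 * (2 / m) ^+ 3 * M * 4).
Proof.
have h : ((normc (opB e psi q))%:E <= 2%:E * \int[muC]_w (normc (Pk e (cplx w) (cplx q.1) * psi (w, q.2)))%:E)%E.
  by apply: ler_normc_cint; exact: cintegrable_cmeas (cintegrable_PC_psi q.1 q.2).
rewrite -lee_fin; apply: (le_trans h).
rewrite EFinM lee_wpmul2l//; exact: integral_PC_le.
Qed.

Lemma cintegrable_opA (b : C2 R -> R[i]) : ccont b -> cintegrable muC2 (fun q => b q * opA e psi q).
Proof.
move=> cb; have [N N0 bN] := ccont_bounded_bidisc cb.
apply: (@cintegrable_bounded2 _ (N * (2 * opA_bound))) => [|[x v]|[x v] /= [x1|v1]].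
- by apply: cmeasM; [exact: ccont_cmeas2|exact: cmeas_opA].
- have o0 : 0 <= 2 * opA_bound := le_trans (normc_ge0 _) (normc_opA 0).
  have n0 : 0 <= N * (2 * opA_bound) by exact: mulr_ge0.
  have [x1|x1] := ltP 1 (normc (cplx x)); first by have [-> _] := op_out (q := (x, v)) (or_introl x1); rewrite mulr0 normc0.
  have [v1|v1] := ltP 1 (normc (cplx v)); first by have [-> _] := op_out (q := (x, v)) (or_intror v1); rewrite mulr0 normc0.
  by rewrite normcM; apply: ler_pM; [exact: normc_ge0|exact: normc_ge0|exact: bN|exact: normc_opA].
- by have [-> _] := op_out (q := (x, v)) (or_introl x1); rewrite mulr0.
- by have [-> _] := op_out (q := (x, v)) (or_intror v1); rewrite mulr0.
Qed.

Lemma cintegrable_opB (b : C2 R -> R[i]) : ccont b -> cintegrable muC2 (fun q => b q * opB e psi q).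
Proof.
move=> cb; have [N N0 bN] := ccont_bounded_bidisc cb.
apply: (@cintegrable_bounded2 _ (N * (2 * (2 * (2 / m) ^+ 3 * M * 4)))) => [|[x v]|[x v] /= [x1|v1]].
- by apply: cmeasM; [exact: ccont_cmeas2|exact: cmeas_opB].
- have o0 : 0 <= 2 * (2 * (2 / m) ^+ 3 * M * 4) := le_trans (normc_ge0 _) (normc_opB 0).
  have n0 : 0 <= N * (2 * (2 * (2 / m) ^+ 3 * M * 4)) by exact: mulr_ge0.
  have [x1|x1] := ltP 1 (normc (cplx x)); first by have [_ ->] := op_out (q := (x, v)) (or_introl x1); rewrite mulr0 normc0.
  have [v1|v1] := ltP 1 (normc (cplx v)); first by have [_ ->] := op_out (q := (x, v)) (or_intror v1); rewrite mulr0 normc0.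
  by rewrite normcM; apply: ler_pM; [exact: normc_ge0|exact: normc_ge0|exact: bN|exact: normc_opB].
- by have [_ ->] := op_out (q := (x, v)) (or_introl x1); rewrite mulr0.
- by have [_ ->] := op_out (q := (x, v)) (or_intror v1); rewrite mulr0.
Qed.
End bounded_symbol.

Section identities.
Variables (Psi Psi1 Psi2 b b1 b2 : C2 R -> R[i]).
Hypotheses (tP : tst m Psi Psi1 Psi2) (wb : wirt2 b b1 b2).

(** Integration by parts in the second variable, for each pair of first variables: the kernel acts
    in the first variable only and commutes with the derivative. *)
Lemma opA_stokes : cint muC2 (fun q => b q * opA e Psi2 q) = - cint muC2 (fun q => b2 q * opA e Psi q).
Proof.
have [_ _ [cP cP1 cP2 wP1 wP2] P0] := tP; have [cb cb1 cb2 wb1 wb2] := wb.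
have PP w : ~~ core m w -> Psi w = 0 by case/P0.
have PP2 w : ~~ core m w -> Psi2 w = 0 by case/P0.
have [M _ PM] := ccont_bounded_core m0 cP PP; have [M2 _ PM2] := ccont_bounded_core m0 cP2 PP2.
have i1 := cintegrable_opA cP2 PP2 PM2 cb; have i2 := cintegrable_opA cP PP PM cb2.
rewrite -cintN// (@cint_prod _ _ _ _ _ muC muC _ i1) (@cint_prod _ _ _ _ _ muC muC _ (cintegrableN i2)).
congr cint; apply/funext => x.
rewrite (fubiniA cP2 PP2 PM2 x cb).
under [in RHS]eq_fun do rewrite -mulNr.
rewrite (fubiniA cP PP PM x (ccontN cb2)).
congr cint; apply/funext => w; congr (_ * _).
have wp := wirtM (wb2 x) (wP2 w).
have z0 (f g : C2 R -> R[i]) : (forall w, ~~ core m w -> g w = 0) -> forall v : R * R, 1 < normc (cplx v) -> f (x, v) * g (w, v) = 0.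
  by move=> g0 v v1; rewrite (core_eq0r g0)// mulr0.
have ii (f g : C2 R -> R[i]) : ccont f -> ccont g -> (forall w, ~~ core m w -> g w = 0) ->
    cintegrable muC (fun v : mC R => f (x, v) * g (w, v)).
  move=> cf cg g0; apply: (@cintegrable_ccont _ (fun v => f (x, v) * g (w, v)) 1); last exact: z0.
  by apply: ccontM; [exact: (ccont_slice2 _ cf)|exact: (ccont_slice2 _ cg)].
have := stokes wp (z0 b Psi PP).
rewrite cintD; [|exact: ii|exact: ii].
move=> /eqP; rewrite addrC addr_eq0 => /eqP ->.
by rewrite -cintN; [congr cint; apply/funext => v; rewrite mulNr|exact: ii].
Qed.

(** Transposed form of $K\partial_1 b=\pi b-Pb$. For [w] in the core, the Cauchy-Pompeiu formula is
    applied to [Xk e w x * b (x, v)] in [x]: the product vanishes beyond the disc, equals [b (w, v)]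
    at [x = w], and its derivative splits into the kernels of [P] and [K]. *)
Lemma opB_pompeiu : cint muC2 (fun q => b q * (- pompC%:C * Psi q + opB e Psi q)) =
  - cint muC2 (fun q => b1 q * opA e Psi q).
Proof.
have [_ _ [cP cP1 cP2 wP1 wP2] P0] := tP; have [cb cb1 cb2 wb1 wb2] := wb.
have PP w : ~~ core m w -> Psi w = 0 by case/P0.
have [M M0 PM] := ccont_bounded_core m0 cP PP.
have i1 := cintegrable_opB cP PP PM cb; have i2 := cintegrable_opA cP PP PM cb1.
have c3 : ccont (fun q : C2 R => - pompC%:C * b q * Psi q).
  by apply: ccontM => //; apply: ccontM => //; exact: ccont_cst.
have i0 : cintegrable muC2 (fun q => - pompC%:C * b q * Psi q).
  have [N N0 bN] := ccont_bounded_bidisc c3.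
  apply: (@cintegrable_bounded2 _ N) => [|[x v]|[x v] /= [x1|v1]].
  - exact: ccont_cmeas2 c3.
  - have [x1|x1] := ltP 1 (normc (cplx x)); first by rewrite (core_eq0l PP)// mulr0 normc0.
    have [v1|v1] := ltP 1 (normc (cplx v)); first by rewrite (core_eq0r PP)// mulr0 normc0.
    exact: bN.
  - by rewrite (core_eq0l PP)// mulr0.
  - by rewrite (core_eq0r PP)// mulr0.
have -> : (fun q => b q * (- pompC%:C * Psi q + opB e Psi q)) = (fun q => - pompC%:C * b q * Psi q + b q * opB e Psi q).
  by apply/funext => q; ring.
rewrite -cintN// (@cint_prod2 _ _ _ _ _ muC muC _ (cintegrableD i0 i1)) (@cint_prod2 _ _ _ _ _ muC muC _ (cintegrableN i2)).
congr cint; apply/funext => v.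
have ib : cintegrable muC (fun x : mC R => - pompC%:C * b (x, v) * Psi (x, v)).
  apply: (@cintegrable_ccont _ (fun x => - pompC%:C * b (x, v) * Psi (x, v)) 1) => [|x x1]; last by rewrite (core_eq0l PP) ?mulr0.
  exact: (ccont_slice1 v c3).
have iB : cintegrable muC (fun x : mC R => b (x, v) * opB e Psi (x, v)).
  have [N N0 bN] := ccont_bounded_bidisc cb.
  have o0 : 0 <= 2 * (2 * (2 / m) ^+ 3 * M * 4) := le_trans (normc_ge0 _) (normc_opB cP PP PM 0).
  have n0 : 0 <= N * (2 * (2 * (2 / m) ^+ 3 * M * 4)) by exact: mulr_ge0.
  apply: (@cintegrable_compact_support _ _ 1 (N * (2 * (2 * (2 / m) ^+ 3 * M * 4)))) => [|x|x x1].
  - exact: (cmeas_pair2 v (cintegrable_cmeas i1)).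
  - have [x1|x1] := ltP 1 (normc (cplx x)); first by have [_ ->] := op_out PP (q := (x, v)) (or_introl x1); rewrite mulr0 normc0.
    have [v1|v1] := ltP 1 (normc (cplx v)); first by have [_ ->] := op_out PP (q := (x, v)) (or_intror v1); rewrite mulr0 normc0.
    by rewrite normcM; apply: ler_pM; [exact: normc_ge0|exact: normc_ge0|exact: bN|exact: (normc_opB cP PP PM)].
  - by have [_ ->] := op_out PP (q := (x, v)) (or_introl x1); rewrite mulr0.
rewrite cintD// (fubini_opB cP PP PM v cb).
under [in RHS]eq_fun do rewrite -mulNr.
rewrite (fubini_opA cP PP PM v (ccontN cb1)) -cintD//; last exact: (cintegrable_opB_adjoint cP PP PM v cb).
congr cint; apply/funext => w; have [wc|wc] := boolP (core m (w, v)); last by rewrite (PP _ wc) mulr0 !mul0r addr0.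
have /and3P[/= wm _ _] := wc.
have wX := wirtM (wirt_Xk m0 em e1 wm) (wb1 v).
have X0 (x : R * R) : 1 < normc (cplx x) -> Xk e (cplx w) (cplx x) * b (x, v) = 0.
  by move=> x1; have [-> _] := kernel_eq0 (cplx w) (ltW x1); rewrite mul0r.
have := pompeiu w wX X0.
rewrite (Xk_diag m0 em wm) mul1r => pw.
have i3 := cintegrable_PC v cb wm; have i4 := cintegrable_XC v cb1 wm.
have {pw} pw : cint muC (fun x : mC R => Pk e (cplx w) (cplx x) * b (x, v)) +
    cint muC (fun x : mC R => Xk e (cplx w) (cplx x) / (cplx w - cplx x) * b1 (x, v)) = pompC%:C * b (w, v).
  rewrite -cintD// -pw; apply: cint_ae_eq.
  - exact: cintegrable_cmeas (cintegrableD i3 i4).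
  - apply: cmeasM; last by apply: cmeasV; apply: cmeasB; [exact: cmeas_cst|exact: cmeas_cplx].
    exact: (ccont_cmeas (wirt_ccontb wX)).
  - apply: ae_eqT; apply: (ae_impl _ (ae_coord_neq w)) => x /andP[xw _].
    have d0 : cplx w - cplx x != 0.
      by apply: contra xw; rewrite subr_eq0 => /eqP/(congr1 ofc); rewrite !cplxK => ->.
    by field.
have -> : cint muC (fun x : mC R => Xk e (cplx w) (cplx x) / (cplx w - cplx x) * - b1 (x, v)) =
    - cint muC (fun x : mC R => Xk e (cplx w) (cplx x) / (cplx w - cplx x) * b1 (x, v)).
  by rewrite -cintN//; congr cint; apply/funext => x; rewrite mulrN.
have -> : - pompC%:C * b (w, v) = - (pompC%:C * b (w, v)) by rewrite mulNr.
by rewrite -pw; ring.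
Qed.
End identities.
End cutoff_operators.

(** * Mollification *)

Section smooth_exponential.
Context {R : realType}.

(** The functions $s^{-k}e^{-1/s}$, continued by 0, form a family whose derivatives are combinations
    of its members, so smoothness becomes an induction. *)
Definition bexp (k : nat) (s : R) : R := if 0 < s then s^-1 ^+ k * expR (- s^-1) else 0.

(** With $n=k+2$, the inequality $e^{1/(ns)}\ge 1/(ns)$ gives $e^{-1/s}\le(ns)^n$, and two powers of
    $s$ survive the division by $s^k$. The quadratic bound yields the derivative 0 at the origin. *)
Lemma bexp_le (k : nat) (s : R) : `|bexp k s| <= (k.+2%:R ^+ k.+2) * s ^+ 2.
Proof.
rewrite /bexp; case: ifPn => [s0|_]; last by rewrite normr0 mulr_ge0// ?sqr_ge0// exprn_ge0.
have si0 : 0 < s^-1 by rewrite invr_gt0.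
rewrite ger0_norm; last by rewrite mulr_ge0 ?expR_ge0// exprn_ge0// ltW.
set n : R := k.+2%:R; have n0 : 0 < n by rewrite ltr0n.
have h : expR (- s^-1) <= (n * s) ^+ k.+2.
  have -> : - s^-1 = k.+2%:R * - (n^-1 / s) by rewrite mulrN mulrA divff ?mul1r// gt_eqF.
  rewrite expRM_natl; apply: lerXn2r; rewrite ?nnegrE ?expR_ge0//; first by rewrite mulr_ge0// ltW.
  rewrite expRN invf_ple ?posrE ?expR_gt0 ?mulr_gt0//.
  by rewrite invfM; apply: le_trans (expR_ge1Dx _); rewrite lerDr.
apply: (le_trans (ler_wpM2l _ h)); first by rewrite exprn_ge0// ltW.
rewrite exprMn mulrCA ler_wpM2l ?exprn_ge0 ?(ltW n0)//.
rewrite -[k.+2]addn2 exprD mulrA -exprMn mulVf ?gt_eqF// expr1n mul1r//.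
Qed.

Lemma is_derive_bexp (k : nat) (s : R) : is_derive s (1 : R) (bexp k) (- k%:R * bexp k.+1 s + bexp k.+2 s).
Proof.
have [s0|s0|s0] := ltgtP s 0.
- have h : \forall t \near s, (fun=> 0) t = bexp k t.
    near=> t; rewrite /bexp ltNge ltW//; near: t; exact: lt_nbhsl.
  rewrite /bexp !(ltNge 0 s) (ltW s0) /= mulr0 addr0.
  exact: (@near_eq_is_derive R R R (fun=> 0) _ s 1 0 h (is_derive_cst _ _ _)).
- have h : \forall t \near s, (fun t => t^-1 ^+ k * expR (- t^-1)) t = bexp k t.
    near=> t; rewrite /bexp ifT//; near: t; exact: lt_nbhsr.
  apply: (@near_eq_is_derive R R R (fun t => t^-1 ^+ k * expR (- t^-1)) _ s 1 _ h).
  have sn0 : s != 0 by rewrite gt_eqF.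
  have dV : is_derive s (1 : R) (fun t : R => t^-1) (- s ^- 2).
    by apply: (is_derive_eq (is_deriveV sn0 (@is_derive_id _ _ s 1))); rewrite /GRing.scale/= mulr1.
  have dX n : is_derive s (1 : R) (fun t : R => t^-1 ^+ n) (- n%:R * s^-1 ^+ n.+1).
    elim: n => [|n IH]; first by rewrite oppr0 mul0r; exact: is_derive_cst.
    rewrite (_ : (fun t : R => _) = (fun t => t^-1) * (fun t => t^-1 ^+ n)); last by apply/funext => t; rewrite exprS.
    apply: (is_derive_eq (is_deriveM dV IH)); rewrite /GRing.scale/= -(exprVn s 2) !exprS expr0 mulr1 -natr1; ring.
  have dE : is_derive s (1 : R) (fun t : R => expR (- t^-1)) (expR (- s^-1) * s ^- 2).
    have dN : is_derive s (1 : R) (fun t : R => - t^-1) (s ^- 2).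
      by apply: (is_derive_eq (is_deriveN dV)); rewrite opprK.
    exact: (@is_derive1_comp R expR (fun t => - t^-1) s _ _ (is_derive_expR (- s^-1)) dN).
  apply: (is_derive_eq (is_deriveM (dX k) dE)); rewrite /GRing.scale/= /bexp s0 -(exprVn s 2) !exprS expr0 mulr1; ring.
- rewrite s0 /bexp ltxx mulr0 addr0.
  apply: (is_derive0_quadratic (C := k.+2%:R ^+ k.+2)); first by rewrite ltxx.
  by move=> t; rewrite subr0; exact: bexp_le.
Unshelve. all: by end_near.
Qed.

Lemma continuous_bexp (k : nat) : continuous (bexp k).
Proof. by move=> s; apply/differentiable_continuous/derivable1_diffP; have [] := is_derive_bexp k s. Qed.

Lemma bexp_ge0 k s : 0 <= bexp k s.
Proof. by rewrite /bexp; case: ifP => // s0; rewrite mulr_ge0 ?expR_ge0// exprn_ge0// invr_ge0 ltW. Qed.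
Lemma bexp0_gt0 s : 0 < s -> 0 < bexp 0 s.
Proof. by move=> s0; rewrite /bexp s0 expr0 mul1r expR_gt0. Qed.
Lemma bexp_eq0 k s : s <= 0 -> bexp k s = 0.
Proof. by move=> s0; rewrite /bexp ltNge s0. Qed.
Lemma bexp_derive0 (s : R) : is_derive s (1 : R) (bexp 0) (bexp 2 s).
Proof. by apply: (is_derive_eq (is_derive_bexp 0 s)); rewrite oppr0 mul0r add0r. Qed.
End smooth_exponential.

(** * Closure properties of the classes $C^k$ *)

Section Ck_closure.
Context {R : realType}.
Implicit Types (f g : C2 R -> R).

Lemma Ck_continuous k g : Ck k g -> continuous g.
Proof. by case: k => [|k] // []. Qed.

Lemma Ck_intro k g (gx gy : 'I_2 -> C2 R -> R) : continuous g ->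
  (forall j z, is_derive z (xdir R j) g (gx j z)) -> (forall j z, is_derive z (ydir R j) g (gy j z)) ->
  (forall j, Ck k (gx j)) -> (forall j, Ck k (gy j)) -> Ck k.+1 g.
Proof.
move=> cg dx dy kx ky; split; first exact: cg.
move=> j; split.
- by move=> z; case: (dx j z).
- by move=> z; case: (dy j z).
- rewrite (_ : (fun z => _) = gx j); first exact: kx.
  by apply/funext => z; case: (dx j z).
- rewrite (_ : (fun z => _) = gy j); first exact: ky.
  by apply/funext => z; case: (dy j z).
Qed.

Lemma Ck_elim k g : Ck k.+1 g -> forall j,
  [/\ forall z, is_derive z (xdir R j) g ('D_(xdir R j) g z), forall z, is_derive z (ydir R j) g ('D_(ydir R j) g z),
    Ck k (fun z => 'D_(xdir R j) g z) & Ck k (fun z => 'D_(ydir R j) g z)].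
Proof.
move=> [_ h] j; have [d1 d2 c1 c2] := h j; split.
- by move=> z; apply: derivableP; exact: d1.
- by move=> z; apply: derivableP; exact: d2.
- exact: c1.
- exact: c2.
Qed.

Lemma Ck_le k g : Ck k.+1 g -> Ck k g.
Proof.
elim: k g => [|k IH] g; first by case.
move=> h; have [cg _] := h; apply: (Ck_intro cg).
- by move=> j; case: (Ck_elim h j) => d _ _ _; exact: d.
- by move=> j; case: (Ck_elim h j) => _ d _ _; exact: d.
- by move=> j; case: (Ck_elim h j) => _ _ c _; apply: IH; exact: c.
- by move=> j; case: (Ck_elim h j) => _ _ _ c; apply: IH; exact: c.
Qed.

Lemma Ck_cst k (c : R) : Ck k (fun _ : C2 R => c).
Proof.
elim: k c => [|k IH] c; first by move=> z; exact: cvg_cst.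
refine (@Ck_intro k (fun=> c) (fun _ _ => 0) (fun _ _ => 0) _ (fun j z => is_derive_cst _ _ _) (fun j z => is_derive_cst _ _ _) (fun j => IH 0) (fun j => IH 0)).
by move=> z; exact: cvg_cst.
Qed.

Lemma CkD k f g : Ck k f -> Ck k g -> Ck k (fun z => f z + g z).
Proof.
elim: k f g => [|k IH] f g hf hg; first by move=> z; apply: cvgD; [exact: hf|exact: hg].
apply: (@Ck_intro _ _ (fun j z => 'D_(xdir R j) f z + 'D_(xdir R j) g z) (fun j z => 'D_(ydir R j) f z + 'D_(ydir R j) g z)).
- by move=> z; apply: cvgD; [exact: (Ck_continuous hf)|exact: (Ck_continuous hg)].
- by move=> j z; case: (Ck_elim hf j) => d _ _ _; case: (Ck_elim hg j) => d' _ _ _; exact: (is_deriveD (d z) (d' z)).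
- by move=> j z; case: (Ck_elim hf j) => _ d _ _; case: (Ck_elim hg j) => _ d' _ _; exact: (is_deriveD (d z) (d' z)).
- by move=> j; case: (Ck_elim hf j) => _ _ c _; case: (Ck_elim hg j) => _ _ c' _; exact: IH.
- by move=> j; case: (Ck_elim hf j) => _ _ _ c; case: (Ck_elim hg j) => _ _ _ c'; exact: IH.
Qed.

Lemma CkM k f g : Ck k f -> Ck k g -> Ck k (fun z => f z * g z).
Proof.
elim: k f g => [|k IH] f g hf hg; first by move=> z; apply: cvgM; [exact: hf|exact: hg].
have lf := Ck_le hf; have lg := Ck_le hg.
apply: (@Ck_intro _ _ (fun j z => f z * 'D_(xdir R j) g z + g z * 'D_(xdir R j) f z)
  (fun j z => f z * 'D_(ydir R j) g z + g z * 'D_(ydir R j) f z)).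
- by move=> z; apply: cvgM; [exact: (Ck_continuous hf)|exact: (Ck_continuous hg)].
- by move=> j z; case: (Ck_elim hf j) => d _ _ _; case: (Ck_elim hg j) => d' _ _ _; exact: (is_deriveM (d z) (d' z)).
- by move=> j z; case: (Ck_elim hf j) => _ d _ _; case: (Ck_elim hg j) => _ d' _ _; exact: (is_deriveM (d z) (d' z)).
- by move=> j; case: (Ck_elim hf j) => _ _ c _; case: (Ck_elim hg j) => _ _ c' _; apply: CkD; exact: IH.
- by move=> j; case: (Ck_elim hf j) => _ _ _ c; case: (Ck_elim hg j) => _ _ _ c'; apply: CkD; exact: IH.
Qed.

Definition ipr (u v : C2 R) : R := u.1.1 * v.1.1 + u.1.2 * v.1.2 + (u.2.1 * v.2.1 + u.2.2 * v.2.2).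

Lemma iprE (u y v : C2 R) (t : R) : ipr u (y + t *: v) = ipr u y + t * ipr u v.
Proof. by rewrite /ipr /= /GRing.scale/=; ring. Qed.

Lemma continuous_ipr (u : C2 R) : continuous (ipr u).
Proof.
move=> z; rewrite /ipr; apply: cvgD; apply: cvgD; apply: cvgM; do ?exact: cvg_cst.
- exact: (cvg_comp _ _ (@cvg_fst _ _ _ _ _) (@cvg_fst _ _ _ _ _)).
- exact: (cvg_comp _ _ (@cvg_fst _ _ _ _ _) (@cvg_snd _ _ _ _ _)).
- exact: (cvg_comp _ _ (@cvg_snd _ _ _ _ _) (@cvg_fst _ _ _ _ _)).
- exact: (cvg_comp _ _ (@cvg_snd _ _ _ _ _) (@cvg_snd _ _ _ _ _)).
Qed.

Lemma is_derive_ipr (u z v : C2 R) : is_derive z v (ipr u) (ipr u v).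
Proof.
apply/(@is_derive_line0 R (C2 R)); under eq_fun do rewrite iprE.
apply: (is_derive_eq (is_deriveD (is_derive_cst (ipr u z) (0 : R) 1) (is_deriveM (@is_derive_id _ _ (0 : R) 1) (is_derive_cst (ipr u v) (0 : R) 1)))).
by rewrite /GRing.scale/= mulr0 !add0r mulr1.
Qed.

Lemma Ck_ipr k u : Ck k (ipr u).
Proof.
case: k => [|k]; first exact: continuous_ipr.
apply: (@Ck_intro _ _ (fun j _ => ipr u (xdir R j)) (fun j _ => ipr u (ydir R j))).
- exact: continuous_ipr.
- by move=> j z; exact: is_derive_ipr.
- by move=> j z; exact: is_derive_ipr.
- by move=> j; exact: Ck_cst.
- by move=> j; exact: Ck_cst.
Qed.

(** The derivative involves members of the family with larger index, so the induction on [k] runs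
    over all [j] at once. *)
Lemma Ck_bexp k (j : nat) (q : C2 R -> R) (qd : C2 R -> C2 R -> R) : continuous q ->
  (forall z v, is_derive z v q (qd v z)) -> (forall v n, Ck n (qd v)) -> Ck k (fun z => bexp j (q z)).
Proof.
move=> cq dq kq.
have cb i : continuous (fun z => bexp i (q z)).
  by move=> z; apply: (@continuous_comp _ _ _ q (bexp i)); [exact: cq|exact: continuous_bexp].
elim: k j => [|k IH] j; first exact: cb.
have d v z : is_derive z v (fun z => bexp j (q z)) ((- j%:R * bexp j.+1 (q z) + bexp j.+2 (q z)) * qd v z).
  apply/(@is_derive_line0 R (C2 R)).
  have h1 : is_derive (0 : R) (1 : R) (fun t : R => q (z + t *: v)) (qd v z) by apply/(@is_derive_line0 R (C2 R)); exact: dq.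
  apply: (@is_derive1_comp R (bexp j) (fun t : R => q (z + t *: v)) 0 _ _ _ h1).
  by rewrite scale0r addr0; exact: is_derive_bexp.
have kd v : Ck k (fun z => (- j%:R * bexp j.+1 (q z) + bexp j.+2 (q z)) * qd v z).
  by apply: CkM; [apply: CkD; [apply: CkM; [exact: Ck_cst|exact: IH]|exact: IH]|exact: kq].
exact: (@Ck_intro k _ (fun i z => (- j%:R * bexp j.+1 (q z) + bexp j.+2 (q z)) * qd (xdir R i) z)
  (fun i z => (- j%:R * bexp j.+1 (q z) + bexp j.+2 (q z)) * qd (ydir R i) z) (cb j)
  (fun i z => d (xdir R i) z) (fun i z => d (ydir R i) z) (fun i => kd (xdir R i)) (fun i => kd (ydir R i))).
Qed.
End Ck_closure.

(** * Bump functions *)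

Section bump.
Context {R : realType}.
Implicit Types (z y v w : C2 R).

Definition dist2 z y : R := ipr (z - y) (z - y).

Lemma dist2E z y : dist2 z y = normc (cplx z.1 - cplx y.1) ^+ 2 + normc (cplx z.2 - cplx y.2) ^+ 2.
Proof. by rewrite !sqr_normcE !ReD !ImD !ReN !ImN /dist2 /ipr /= !expr2. Qed.

Lemma is_derive_dist2 z y v : is_derive y v (dist2 z) (2 * ipr v (y - z)).
Proof.
apply/(@is_derive_line0 R (C2 R)).
rewrite (_ : (fun t => _) = (fun t : R => dist2 z y + t * (2 * ipr v (y - z) + t * ipr v v))); last first.
  by apply/funext => t; rewrite /dist2 /ipr /= /GRing.scale/=; ring.
have d1 := is_deriveM (@is_derive_id _ _ (0 : R) 1) (is_derive_cst (ipr v v) (0 : R) 1).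
have d2 := is_deriveD (is_derive_cst (2 * ipr v (y - z)) (0 : R) 1) d1.
have d3 := is_deriveM (@is_derive_id _ _ (0 : R) 1) d2.
apply: (is_derive_eq (is_deriveD (is_derive_cst (dist2 z y) (0 : R) 1) d3)).
by rewrite !fctE /GRing.scale/= /cst/=; ring.
Qed.

Lemma ccont_sub1 z : ccont (fun y : C2 R => cplx z.1 - cplx y.1).
Proof. by apply: ccontB; [exact: ccont_cst|exact: ccont_fst]. Qed.
Lemma ccont_sub2 z : ccont (fun y : C2 R => cplx z.2 - cplx y.2).
Proof. by apply: ccontB; [exact: ccont_cst|exact: ccont_snd]. Qed.

Lemma continuous_dist2 z : continuous (dist2 z).
Proof.
rewrite (_ : dist2 z = fun y => normc (cplx z.1 - cplx y.1) ^+ 2 + normc (cplx z.2 - cplx y.2) ^+ 2); last first.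
  by apply/funext => y; exact: dist2E.
by move=> y; apply: cvgD; [exact: (continuous_normc2 (ccont_sub1 z))|exact: (continuous_normc2 (ccont_sub2 z))].
Qed.

(** Left unnormalized; the total mass is divided out in the averages. The factor [bumpd] comes from
    the derivative of [bexp 0], which is [bexp 2]. *)
Definition bump (r : R) z y : R := bexp 0 (r ^+ 2 - dist2 z y).
Definition bumpd (r : R) z y : R := bexp 2 (r ^+ 2 - dist2 z y).

Lemma is_derive_bump_arg (r : R) z y v : is_derive y v (fun y => r ^+ 2 - dist2 z y) (- 2 * ipr v (y - z)).
Proof.
apply: (is_derive_eq (is_deriveB (is_derive_cst (r ^+ 2) y v) (is_derive_dist2 z y v))).
by rewrite sub0r mulNr.
Qed.

Lemma is_derive_bump r z y v : is_derive y v (bump r z) (bumpd r z y * (- 2 * ipr v (y - z))).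
Proof.
apply/(@is_derive_line0 R (C2 R)).
have h1 : is_derive (0 : R) (1 : R) (fun t : R => r ^+ 2 - dist2 z (y + t *: v)) (- 2 * ipr v (y - z)).
  by apply/(@is_derive_line0 R (C2 R) (fun y => r ^+ 2 - dist2 z y)); exact: is_derive_bump_arg.
apply: (@is_derive1_comp R (bexp 0) (fun t : R => r ^+ 2 - dist2 z (y + t *: v)) 0 _ _ _ h1).
by rewrite scale0r addr0; exact: bexp_derive0.
Qed.

Lemma continuous_bump_arg r z : continuous (fun y => r ^+ 2 - dist2 z y).
Proof. by move=> y; apply: cvgB; [exact: cvg_cst|exact: continuous_dist2]. Qed.

Lemma Ck_bump k r z : Ck k (bump r z).
Proof.
apply: (@Ck_bexp R k 0 (fun y => r ^+ 2 - dist2 z y) (fun v y => - 2 * ipr v (y - z))).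
- exact: continuous_bump_arg.
- by move=> y v; exact: is_derive_bump_arg.
- move=> v n; rewrite (_ : (fun y => _) = fun y => - 2 * (ipr v y + - ipr v z)); last first.
    by apply/funext => y; rewrite /ipr /=; ring.
  by apply: CkM; [exact: Ck_cst|apply: CkD; [exact: Ck_ipr|exact: Ck_cst]].
Qed.

Lemma smooth_bump r z : smooth (fun y => (bump r z y)%:C).
Proof. by move=> k; split; [exact: Ck_bump|exact: Ck_cst]. Qed.

Lemma cderive_bump r z v y : cderive v (fun y => (bump r z y)%:C) y = (bumpd r z y * (- 2 * ipr v (y - z)))%:C.
Proof.
rewrite /cderive; apply: complexRI => /=; first by case: (is_derive_bump r z y v).
by case: (is_derive_cst (0 : R) y v).
Qed.

Lemma dzbar_bump r z y :
  dzbar 0 (fun y => (bump r z y)%:C) y = (bumpd r z y)%:C * (cplx z.1 - cplx y.1) /\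
  dzbar 1 (fun y => (bump r z y)%:C) y = (bumpd r z y)%:C * (cplx z.2 - cplx y.2).
Proof.
have i2 (a b : R) : (a%:C + 'i * b%:C) / 2 = (a / 2) +i* (b / 2) :> R[i].
  have -> : (2 : R[i])^-1 = (2^-1)%:C by rewrite fmorphV rmorph_nat.
  by apply: complexRI; rewrite !(ReM, ImM, ReD, ImD) /=; ring.
by rewrite /dzbar !cderive_bump !i2; split; apply: complexRI;
  rewrite !(ReM, ImM, ReD, ImD, ReN, ImN) /ipr /xdir /ydir /=; field.
Qed.

Lemma bump_neq0 (r : R) z y : 0 <= r -> bump r z y != 0 \/ bumpd r z y != 0 ->
  normc (cplx z.1 - cplx y.1) <= r /\ normc (cplx z.2 - cplx y.2) <= r.
Proof.
move=> r0 h; have d : dist2 z y < r ^+ 2.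
  rewrite -subr_gt0 ltNge; apply/negP => s0.
  by move: h; rewrite /bump /bumpd !bexp_eq0// eqxx; case.
move: d; rewrite dist2E => d.
by split; rewrite -(ler_pXn2r (n := 2))// ?nnegrE ?normc_ge0//; apply: le_trans (ltW d); rewrite ?lerDl ?lerDr sqr_ge0.
Qed.

(** The support lies in the box of half-side [r] around [z], where each modulus changes by at most
    [2 r]. Hence the margin [4 r] for comparing the two moduli and [2 r] for the bound by 1. *)
Lemma test_bump (r : R) z : 0 < r -> normc (cplx z.1) + 4 * r < normc (cplx z.2) -> normc (cplx z.2) + 2 * r < 1 ->
  test_funH (fun y => (bump r z y)%:C).
Proof.
move=> r0 z1 z2.
pose Q (a : R * R) : set (R * R) := `[a.1 - r, a.1 + r] `*` `[a.2 - r, a.2 + r].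
have cK : compact (Q z.1 `*` Q z.2) by apply: compact_setX; apply: compact_setX; exact: segment_compact.
have hK : hausdorff_space (C2 R) by exact: norm_hausdorff.
have sK : Defs.support (fun y : C2 R => (bump r z y)%:C : R[i]) `<=` Q z.1 `*` Q z.2.
  have clK := compact_closed hK cK.
  have -> : Q z.1 `*` Q z.2 = closure (Q z.1 `*` Q z.2) by exact/closure_id.
  apply: closure_subset => y /= by0.
  have b0 : bump r z y != 0 by apply: contra by0 => /eqP ->.
  have [h1 h2] := bump_neq0 (ltW r0) (or_introl b0).
  have [a1 a2] := normc_coord z.1 y.1; have [a3 a4] := normc_coord z.2 y.2.
  by split; split; rewrite /= in_itv/= -ler_distlC; [exact: le_trans a1 h1|exact: le_trans a2 h1|exact: le_trans a3 h2|exact: le_trans a4 h2].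
split.
- exact: smooth_bump.
- by apply: (subclosed_compact _ cK sK); exact: closed_closure.
- move=> y /sK [[h1 h2] [h3 h4]].
  move: h1 h2 h3 h4; rewrite /= !in_itv/= -!ler_distlC => h1 h2 h3 h4.
  have k1 : normc (cplx z.1 - cplx y.1) <= 2 * r.
    by apply: le_trans (ler_normc_ReIm _) _; rewrite !ReD !ImD !ReN !ImN /= mulr_natl mulr2n lerD.
  have k2 : normc (cplx z.2 - cplx y.2) <= 2 * r.
    by apply: le_trans (ler_normc_ReIm _) _; rewrite !ReD !ImD !ReN !ImN /= mulr_natl mulr2n lerD.
  have t1 := ler_normcB (cplx y.1) (cplx z.1); have t2 := ler_normcB (cplx z.2) (cplx y.2).
  have t3 := ler_normcB (cplx y.2) (cplx z.2).
  move: t1 t3; rewrite normcB => t1; rewrite normcB => t3.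
  by split=> /=; lra.
Qed.

(** The bump depends on the difference [shear w - y], so differentiating it in the centre gives, up
    to sign and the chain rule, its derivatives in [y]. This links integration by parts in [w] with
    closedness tested on a function of [y]. *)
Lemma wirt2_bump (r : R) y : wirt2 (fun w => (bump r (shear w) y)%:C)
  (fun w => - (((cplx w.2)^* * ((bumpd r (shear w) y)%:C * (cplx (shear w).1 - cplx y.1)))%R))
  (fun w => - (((cplx w.1)^* * ((bumpd r (shear w) y)%:C * (cplx (shear w).1 - cplx y.1)) +
     (bumpd r (shear w) y)%:C * (cplx (shear w).2 - cplx y.2))%R)).
Proof.
pose a : R[i] := cplx y.1; pose b : R[i] := cplx y.2.
have w0 := wirt2D (wirt2M wirt2_fst wirt2_snd) (wirt2_cst (- a)).
have fJ : wirt2 (fun w : C2 R => ((cplx w.1)^*)%R) (fun=> 1) (fun=> 0) := wirt2_fstJ.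
have sJ : wirt2 (fun w : C2 R => ((cplx w.2)^*)%R) (fun=> 0) (fun=> 1) := wirt2_sndJ.
have w0J := wirt2D (wirt2M fJ sJ) (wirt2_cst (- (a^*)%R)).
have w3 := wirt2D wirt2_snd (wirt2_cst (- b)).
have w3J := wirt2D sJ (wirt2_cst (- (b^*)%R)).
have wq := wirt2D (wirt2_cst (r ^+ 2)%:C) (wirt2M (wirt2_cst (-1)) (wirt2D (wirt2M w0 w0J) (wirt2M w3 w3J))).
have qE (w : C2 R) : (r ^+ 2)%:C + -1 * ((cplx w.1 * cplx w.2 + - a) * (((cplx w.1)^*)%R * ((cplx w.2)^*)%R + - (a^*)%R) +
    (cplx w.2 + - b) * (((cplx w.2)^*)%R + - (b^*)%R)) = (r ^+ 2 - dist2 (shear w) y)%:C :> R[i].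
  rewrite dist2E rmorphB rmorphD /= -!mulcJ /shear /= ofcK -/a -/b !rmorphB /= !rmorphM mulN1r //.
move: wq; rewrite [X in wirt2 X _ _](_ : _ = fun w => (r ^+ 2 - dist2 (shear w) y)%:C); last first.
  by apply/funext => w; exact: qE.
move=> wq.
apply: (wirt2_eq (wirt2_comp_real (@continuous_bexp R 2) (@bexp_derive0 R) wq)) => w /=;
  rewrite /bumpd ofcK -/a -/b; ring.
Qed.
End bump.

Lemma continuous_maxf {R : realType} (T : topologicalType) (f g : T -> R) : continuous f -> continuous g ->
  continuous (fun x => Num.max (f x) (g x)).
Proof. by move=> cf cg x; exact: (@continuous_max R T f g x (cf x) (cg x)). Qed.
Lemma continuous_minf {R : realType} (T : topologicalType) (f g : T -> R) : continuous f -> continuous g ->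
  continuous (fun x => Num.min (f x) (g x)).
Proof. by move=> cf cg x; exact: (@continuous_min R T f g x (cf x) (cg x)). Qed.

(** * Continuity of the transposed operators in the cutoff level and the point *)

Section operator_limits.
Context {R : realType}.
Local Notation muC := (@lebesgueC R).
Local Notation muC2 := (@lebesgueC2 R).
Variables (m : R) (m0 : 0 < m) (m1 : m < 1).
Variables (psi : C2 R -> R[i]) (M : R) (cp : ccont psi).
Hypotheses (p0 : forall w, ~~ core m w -> psi w = 0) (pM : forall w, normc (psi w) <= M).

(** Forces the level into [[1 - m / 2, 1]], so that the integrands are continuous on the whole
    product of the line and $\mathbb C^2$ and sequential limits follow by composition. *)
Let clip (s : R) : R := Num.max (1 - m / 2) (Num.min 1 s).
Let clip_ge s : 1 - m / 2 <= clip s. Proof. by rewrite /clip le_max lexx. Qed.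
Let clip_le s : clip s <= 1.
Proof. by rewrite /clip ge_max ge_min lexx andbT; move: m0; lra. Qed.
Let clipE s : 1 - m / 2 <= s -> s <= 1 -> clip s = s.
Proof. by move=> h1 h2; rewrite /clip min_r// max_r. Qed.
Let continuous_clip : continuous clip.
Proof.
apply: continuous_maxf => [s|]; first exact: cvg_cst.
by apply: continuous_minf => s; [exact: cvg_cst|exact: cvg_id].
Qed.

Let T : topologicalType := (R * C2 R)%type.
Let ce : continuous (fun p : T => clip p.1).
Proof. by move=> p; apply: continuous_comp; [exact: cvg_fst|exact: continuous_clip]. Qed.
Let cx : ccont (fun p : T => cplx p.2.1).
Proof. by apply: (ccont_comp ccont_fst) => p; exact: cvg_snd. Qed.
Let cgap : continuous (fun p : T => gap (clip p.1) (cplx p.2.1)).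
Proof.
apply: continuous_maxf => p; first exact: cvg_cst.
by apply: cvgB; [exact: ce|exact: (continuous_normc2 cx)].
Qed.

Let cden (f : T -> R[i]) : ccont f -> ccont (fun p : T => (clip p.1)%:C - f p * ((cplx p.2.1)^*)%R).
Proof. by move=> cf; apply: ccontB; [exact: ccont_real|apply: ccontM => //; exact: ccontJ]. Qed.

Let quotient (n : nat) (f : T -> R * R) (a : T -> R) : continuous f -> continuous a ->
  (forall p : T, 1 <= normc (cplx p.2.1) -> a p = 0) ->
  ccont (fun p : T => (a p)%:C * psi (f p, p.2.2) / ((clip p.1)%:C - cplx (f p) * ((cplx p.2.1)^*)%R) ^+ n.+1).
Proof.
move=> cf ca a0; have m20 : 0 < m / 2 by rewrite divr_gt0.
have cpf : ccont (fun p : T => psi (f p, p.2.2)).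
  apply: (ccont_comp cp); apply: continuous_pair; first exact: cf.
  by move=> p; apply: (cvg_comp _ _ (@cvg_snd _ _ _ _ _) (@cvg_snd _ _ _ _ _)).
apply: (@ccont_div _ _ _ _ ((m / 2) ^+ n.+1)); first exact: exprn_gt0.
- by apply: ccontM => //; exact: ccont_real.
- by apply: ccontX; apply: cden; exact: (ccont_comp ccont_cplx cf).
- move=> p; rewrite normcX => h; have [x1|x1] := leP 1 (normc (cplx p.2.1)); first by rewrite a0// mul0r.
  have [wc|wc] := boolP (core m (f p, p.2.2)); last by rewrite p0// mulr0.
  have /and3P[/= wm _ _] := wc.
  by move: h; rewrite ltNge lerXn2r// ?nnegrE ?(ltW m20) ?normc_ge0// den_ge// ltW.
Qed.

Variables (e_ : nat -> R) (e : R) (q_ : nat -> C2 R) (q : C2 R).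
Hypotheses (e_ge : forall n, 1 - m / 2 <= e_ n) (e_le : forall n, e_ n <= 1).
Hypotheses (em : 1 - m / 2 <= e) (e1 : e <= 1) (e_e : e_ n @[n --> \oo] --> e) (q_q : q_ n @[n --> \oo] --> q).

Let pq : (e_ n, q_ n) @[n --> \oo] --> ((e, q) : T).
Proof. exact: (cvg_pair e_e q_q). Qed.

(** The substitution [w = t + q.1] fixes the Cauchy singularity at [t = 0]; a single Riesz kernel
    then dominates the integrands for all [n], and the remaining factor is continuous in the level
    and the point. *)
Lemma opA_cvg : normc (opA (e_ n) psi (q_ n) - opA e psi q) @[n --> \oo] --> (0 : R).
Proof.
pose g (t : mC R) (p : T) : R[i] := (gap (clip p.1) (cplx p.2.1) ^+ 2)%:C * psi (ofc (cplx t + cplx p.2.1), p.2.2) /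
  ((clip p.1)%:C - cplx (ofc (cplx t + cplx p.2.1)) * ((cplx p.2.1)^*)%R) ^+ 2.
have cg t : ccont (g t).
  apply: quotient.
  - by apply: continuous_ofc; apply: ccontD => //; exact: ccont_cst.
  - by move=> p; apply: cvgM; exact: cgap.
  - by move=> p x1; rewrite gap_eq0 ?expr0n.
have M0 : 0 <= M := le_trans (normc_ge0 _) (pM (0, 0)).
have trE e' (q' : C2 R) : 1 - m / 2 <= e' -> e' <= 1 -> opA e' psi q' = cint muC (fun t => g t (e', q') / cplx t) /\
    (forall t, normc (g t (e', q') / cplx t) <= (2 / m) ^+ 2 * M * riesz 0 3 t) /\
    cmeas (fun t => g t (e', q') / cplx t).
  move=> h1 h2; have i0 := cintegrable_XC_psi m0 h1 h2 cp p0 pM q'.1 q'.2.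
  have [i1 eq1] := cint_translation q'.1 i0.
  have fE t : Xk e' (cplx (t.1 + q'.1.1, t.2 + q'.1.2)) (cplx q'.1) / (cplx (t.1 + q'.1.1, t.2 + q'.1.2) - cplx q'.1) *
      psi ((t.1 + q'.1.1, t.2 + q'.1.2), q'.2) = g t (e', q') / cplx t.
    have -> : (t.1 + q'.1.1, t.2 + q'.1.2) = ofc (cplx t + cplx q'.1) by rewrite /ofc ReD ImD.
    rewrite ofcK addrK /g /= clipE// ofcK /Xk expr_div_n rmorphXn /=; ring.
  rewrite /opA eq1; split; first by congr cint; apply/funext => t; rewrite -fE.
  split.
    move=> t; rewrite -fE; apply: le_trans (normc_cauchy_Xk_core m0 h1 h2 _ _ _ p0 pM) _.
    suff -> : riesz q'.1 3 (t.1 + q'.1.1, t.2 + q'.1.2) = riesz 0 3 t by [].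
    rewrite /riesz (_ : (t.1 + q'.1.1, t.2 + q'.1.2) = ofc (cplx t + cplx q'.1)); last by rewrite /ofc ReD ImD.
    by rewrite ofcK opprD addrCA subrr addr0 cplx0 sub0r.
  by move: (cintegrable_cmeas i1); congr cmeas; apply/funext => t; exact: fE.
have [-> [bq mq]] := trE e q em e1.
under eq_fun => n do rewrite (proj1 (trE (e_ n) (q_ n) (e_ge n) (e_le n))).
apply: (cint_dominated _ _ (integrableZl measurableT ((2 / m) ^+ 2 * M) (integrable_riesz (0 : R * R) (ltr0Sn R 2)))).
- by move=> n; have [_ []] := trE (e_ n) (q_ n) (e_ge n) (e_le n).
- by [].
- by move=> n t; have [_ [b _]] := trE (e_ n) (q_ n) (e_ge n) (e_le n); exact: b.
- by apply: aeW => t; apply: normc_cvgM; [exact: (ccont_cvg (cg t) pq)|exact: normc_cvg_cst].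
Qed.

Lemma opB_cvg : normc (opB (e_ n) psi (q_ n) - opB e psi q) @[n --> \oo] --> (0 : R).
Proof.
pose g (w : mC R) (p : T) : R[i] := (2 * clip p.1 * gap (clip p.1) (cplx p.2.1))%:C * psi (w, p.2.2) /
  ((clip p.1)%:C - cplx w * ((cplx p.2.1)^*)%R) ^+ 3.
have cg w : ccont (g w).
  apply: (quotient 2 (f := fun=> w)).
  - by move=> p; exact: cvg_cst.
  - by move=> p; apply: cvgM; [apply: cvgM; [exact: cvg_cst|exact: ce]|exact: cgap].
  - by move=> p x1; rewrite gap_eq0 ?mulr0.
have gE e' (q' : C2 R) w : 1 - m / 2 <= e' -> e' <= 1 -> Pk e' (cplx w) (cplx q'.1) * psi (w, q'.2) = g w (e', q').
  by move=> h1 h2; rewrite /g /= clipE// /Pk; ring.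
have M0 : 0 <= M := le_trans (normc_ge0 _) (pM (0, 0)).
have k0 : 0 <= 2 * (2 / m) ^+ 3 * M by rewrite mulr_ge0// mulr_ge0// exprn_ge0// divr_ge0// ltW.
pose Q : set (mC R) := `[-1, 1] `*` `[-1, 1].
have mQ : measurable Q by exact: measurableX.
have iQ : muC.-integrable setT (EFin \o (fun w => 2 * (2 / m) ^+ 3 * M * \1_Q w)).
  have -> : EFin \o (fun w : mC R => 2 * (2 / m) ^+ 3 * M * \1_Q w) = fun w => ((2 * (2 / m) ^+ 3 * M)%:E * (\1_Q w)%:E)%E by apply/funext.
  apply: (integrableZl measurableT (2 * (2 / m) ^+ 3 * M)); apply/integrableP; split; first by apply/measurable_EFinP.
  under eq_integral do rewrite gee0_abs ?lee_fin//.
  by rewrite integral_indic// setIT; exact: lebesgueC_box_lty.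
apply: (cint_dominated _ _ iQ).
- by move=> n; exact: (cintegrable_cmeas (cintegrable_PC_psi m0 (e_ge n) (e_le n) cp p0 pM (q_ n).1 (q_ n).2)).
- exact: (cintegrable_cmeas (cintegrable_PC_psi m0 em e1 cp p0 pM q.1 q.2)).
- move=> n w; rewrite indicE; have [w1|w1] := leP (normc (cplx w)) 1.
    by rewrite mem_set ?mulr1; [exact: (normc_Pk_core m0 (e_ge n) (e_le n) _ _ _ p0 pM)|exact: normc_le_box].
  by rewrite (core_eq0l m0 p0)// mulr0 normc0 mulr_ge0.
- by apply: aeW => w; rewrite gE//; under eq_fun => n do rewrite gE//; exact: (ccont_cvg (cg w) pq).
Qed.
End operator_limits.

(** * Averages against bump functions *)

Section mollification.
Context {R : realType}.
Local Notation muC := (@lebesgueC R).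
Local Notation muC2 := (@lebesgueC2 R).

Lemma cvg_of_dist (u : nat -> R) (l : R) (r : nat -> R) : (forall n, `|u n - l| <= r n) ->
  r n @[n --> \oo] --> (0 : R) -> u n @[n --> \oo] --> l.
Proof.
move=> ur r0; apply/subr_cvg0; apply: norm_cvg0; apply: (squeeze_cvg0 _ r0) => n.
by rewrite normr_ge0 ur.
Qed.

Lemma C2_cvg (z : nat -> C2 R) (y : C2 R) (r : nat -> R) :
  (forall n, normc (cplx (z n).1 - cplx y.1) <= r n /\ normc (cplx (z n).2 - cplx y.2) <= r n) ->
  r n @[n --> \oo] --> (0 : R) -> z n @[n --> \oo] --> y.
Proof.
move=> zr r0.
have h1 n := normc_coord (z n).1 y.1; have h2 n := normc_coord (z n).2 y.2.
have c11 : (z n).1.1 @[n --> \oo] --> y.1.1 by apply: (cvg_of_dist _ r0) => n; exact: le_trans (h1 n).1 (zr n).1.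
have c12 : (z n).1.2 @[n --> \oo] --> y.1.2 by apply: (cvg_of_dist _ r0) => n; exact: le_trans (h1 n).2 (zr n).1.
have c21 : (z n).2.1 @[n --> \oo] --> y.2.1 by apply: (cvg_of_dist _ r0) => n; exact: le_trans (h2 n).1 (zr n).2.
have c22 : (z n).2.2 @[n --> \oo] --> y.2.2 by apply: (cvg_of_dist _ r0) => n; exact: le_trans (h2 n).2 (zr n).2.
have c1 : ((z n).1.1, (z n).1.2) @[n --> \oo] --> ((y.1.1, y.1.2) : R * R) by exact: (cvg_pair c11 c12).
have c2 : ((z n).2.1, (z n).2.2) @[n --> \oo] --> ((y.2.1, y.2.2) : R * R) by exact: (cvg_pair c21 c22).
have c : (((z n).1.1, (z n).1.2), ((z n).2.1, (z n).2.2)) @[n --> \oo] --> ((y.1.1, y.1.2), (y.2.1, y.2.2) : R * R) by exact: (cvg_pair c1 c2).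
move: c; rewrite -!surjective_pairing (_ : (fun n => _) = z)//.
by apply/funext => n; rewrite -!surjective_pairing.
Qed.

Lemma measurable_dist2 d (T : measurableType d) (f g : T -> mC2 R) : measurable_fun setT f ->
  measurable_fun setT g -> measurable_fun setT (fun t => dist2 (f t) (g t)).
Proof.
move=> mf mg; under eq_fun do rewrite dist2E.
have h (h : mC2 R -> mC R) : measurable_fun setT h -> measurable_fun setT (fun t => normc (cplx (h (f t)) - cplx (h (g t))) ^+ 2).
  move=> mh; apply: measurable_funX; apply: measurable_normc; apply: cmeasB; apply: cmeas_cplx.
    exact: (measurableT_comp mh mf).
  exact: (measurableT_comp mh mg).
by apply: measurable_funD; [exact: (h fst measurable_fst)|exact: (h snd measurable_snd)].
Qed.

Lemma measurable_bexp d (T : measurableType d) k (r : R) (f g : T -> mC2 R) : measurable_fun setT f ->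
  measurable_fun setT g -> measurable_fun setT (fun t => bexp k (r ^+ 2 - dist2 (f t) (g t))).
Proof.
move=> mf mg; apply: (measurableT_comp (continuous_measurable_fun (@continuous_bexp R k))).
by apply: measurable_funB; [exact: measurable_cst|exact: measurable_dist2].
Qed.

Lemma bump_ge0 (r : R) (z y : C2 R) : 0 <= bump r z y. Proof. exact: bexp_ge0. Qed.

Lemma bexp_bound k (r : R) (z y : C2 R) : bexp k (r ^+ 2 - dist2 z y) <= k.+2%:R ^+ k.+2 * (r ^+ 2) ^+ 2.
Proof.
have k0 : 0 <= k.+2%:R ^+ k.+2 :> R by rewrite exprn_ge0.
have [s0|s0] := leP (r ^+ 2 - dist2 z y) 0.
  by rewrite bexp_eq0// mulr_ge0// sqr_ge0.
apply: le_trans (le_trans (ler_norm _) (bexp_le _ _)) _.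
rewrite ler_wpM2l// lerXn2r ?nnegrE ?(ltW s0) ?sqr_ge0// gerBl dist2E.
by rewrite addr_ge0// sqr_ge0.
Qed.

Lemma lebesgueC_itv (a b c d : R) : a <= b -> c <= d ->
  muC (`[a, b] `*` `[c, d]) = ((b - a) * (d - c))%:E.
Proof.
move=> ab cd; rewrite /lebesgueC product_measure1E//= !lebesgue_measure_itv/= !lte_fin.
have [ab'|ab'] := ltP a b; have [cd'|cd'] := ltP c d; rewrite -?EFinB -?EFinM ?mule0 ?mul0e//.
- by rewrite (le_anti (_ : c <= d <= c)) ?subrr ?mulr0// cd cd'.
- by rewrite (le_anti (_ : a <= b <= a)) ?subrr ?mul0r// ab ab'.
- by rewrite (le_anti (_ : a <= b <= a)) ?subrr ?mul0r// ab ab'.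
Qed.

Lemma lebesgueC2_X (A B : set (mC R)) : measurable A -> measurable B -> muC2 (A `*` B) = (muC A * muC B)%E.
Proof. by move=> mA mB; exact: product_measure1E. Qed.

(** The mass is independent of the centre by translating each complex variable in turn; it is finite
    by compact support and bounded below on a small cube. *)
Lemma bump_mass (r : R) : 0 < r -> exists2 N : R, 0 < N & forall y : C2 R, (\int[muC2]_z (bump r z y)%:E = N%:E)%E.
Proof.
move=> r0; pose z0 : C2 R := 0; pose I (y : C2 R) : \bar R := (\int[muC2]_z (bump r z y)%:E)%E.
have mb (y : C2 R) : measurable_fun setT (fun z : mC2 R => (bump r z y)%:E).
  by apply/measurable_EFinP; apply: measurable_bexp; [exact: measurable_id|exact: measurable_cst].
have b0 (y : C2 R) (z : mC2 R) : (0 <= (bump r z y)%:E)%E by rewrite lee_fin bump_ge0.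
have transl (y : C2 R) : I y = I z0.
  rewrite /I.
  have e1 : (\int[muC2]_z (bump r z y)%:E = \int[muC2]_z (bump r z (y.1, 0%R))%:E)%E.
    rewrite (@fubini_tonelli1 _ _ _ _ _ muC muC _ (mb y) (b0 y)) (@fubini_tonelli1 _ _ _ _ _ muC muC _ (mb (y.1, 0)) (b0 _)).
    apply: eq_integral => u _; rewrite /fubini_F /=.
    rewrite (integral_translationC y.2 (measurable_fun_pair2 u (mb y)) (fun v => b0 y (u, v))).
    apply: eq_integral => v _; congr (_%:E); rewrite /bump; congr (bexp 0 (_ - _)).
    by rewrite /dist2 /ipr /= !subr0 !addrK.
  have e2 : (\int[muC2]_z (bump r z (y.1, 0%R))%:E = \int[muC2]_z (bump r z (0%R : C2 R))%:E)%E.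
    rewrite (@fubini_tonelli2 _ _ _ _ _ muC muC _ (mb (y.1, 0)) (b0 _)) (@fubini_tonelli2 _ _ _ _ _ muC muC _ (mb 0) (b0 _)).
    apply: eq_integral => v _; rewrite /fubini_G /=.
    rewrite (integral_translationC y.1 (measurable_fun_pair1 v (mb (y.1, 0))) (fun u => b0 (y.1, 0) (u, v))).
    apply: eq_integral => u _; congr (_%:E); rewrite /bump; congr (bexp 0 (_ - _)).
    by rewrite /dist2 /ipr /= !subr0 !addrK.
  exact: (etrans e1 e2).
have I0 : (0 < I z0)%E.
  (* On the cube of side [r / 4] the squared distance is at most [4 r^2 / 16], so the argument of
     [bexp] stays above [r^2 / 2]. *)
  pose c := bexp 0 (r ^+ 2 / 2); have c0 : 0 < c by apply: bexp0_gt0; rewrite divr_gt0// exprn_gt0.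
  pose h := r / 4; have h0 : 0 <= h by rewrite divr_ge0// ltW.
  pose Q : set (mC R) := `[0, h] `*` `[0, h].
  have mQ : measurable Q by exact: measurableX.
  have LQ : muC Q = (h ^+ 2)%:E by rewrite /Q lebesgueC_itv// !subr0 expr2.
  apply: (@lt_le_trans _ _ (\int[muC2]_z (c%:E * (\1_(Q `*` Q) z)%:E))%E).
    have mQQ : measurable (Q `*` Q) by exact: measurableX.
    rewrite ge0_integralZl//; [|by apply/measurable_EFinP|exact: ltW].
    rewrite integral_indic// setIT [X in (_ * X)%E](_ : _ = (muC Q * muC Q)%E); last exact: lebesgueC2_X.
    by rewrite [X in (_ * (X * _))%E](_ : _ = (h ^+ 2)%:E)// [X in (_ * (_ * X))%E](_ : _ = (h ^+ 2)%:E)// lte_fin !mulr_gt0// exprn_gt0// divr_gt0.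
  apply: ge0_le_integral => //.
  - by move=> z _; apply: mule_ge0; rewrite lee_fin; [exact: ltW|rewrite indicE; exact: ler0n].
  - by apply: measurable_funeM; apply/measurable_EFinP; apply: measurable_indic; exact: measurableX.
  - move=> z _; rewrite -EFinM lee_fin indicE; case: (boolP (z \in Q `*` Q)) => [|_]; last by rewrite mulr0 bump_ge0.
    rewrite inE mulr1 => -[[]]; rewrite /= !in_itv/= => /andP[a1 a2] /andP[a3 a4] [] /andP[a5 a6] /andP[a7 a8].
    have d : dist2 z 0 <= r ^+ 2 / 4.
      have sq (t : R) : 0 <= t -> t <= h -> t ^+ 2 <= r ^+ 2 / 16.
        move=> t0 th; have -> : r ^+ 2 / 16 = h ^+ 2 by rewrite /h; field.
        by apply: lerXn2r; rewrite ?nnegrE.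
      have := sq _ a1 a2; have := sq _ a3 a4; have := sq _ a5 a6; have := sq _ a7 a8.
      by rewrite /dist2 /ipr /= !subr0 -!expr2; lra.
    have p1 : 0 < r ^+ 2 / 2 by rewrite divr_gt0// exprn_gt0.
    have p2 : r ^+ 2 / 2 <= r ^+ 2 - dist2 z 0 by have := exprn_gt0 2 r0; move: d; lra.
    rewrite /c /bump /bexp p1 (lt_le_trans p1 p2) !expr0 !mul1r ler_expR lerN2 lef_pV2 ?posrE//.
    exact: lt_le_trans p1 p2.
have Ioo : (I z0 < +oo)%E.
  pose Q : set (mC R) := `[- r, r] `*` `[- r, r].
  have mQ : measurable Q by exact: measurableX.
  have LQ : (muC2 (Q `*` Q) < +oo)%E.
    rewrite lebesgueC2_X//; apply: lte_mul_pinfty => //; last exact: lebesgueC_box_lty.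
    by rewrite ge0_fin_numE//; exact: lebesgueC_box_lty.
  have ib : cintegrable muC2 (fun z : mC2 R => (bump r z 0)%:C).
    apply: (@cintegrable_bounded _ _ _ muC2 _ (Q `*` Q) (2%:R ^+ 2 * (r ^+ 2) ^+ 2)) => //.
    - exact: measurableX.
    - by apply: cmeas_real; apply: measurable_bexp; [exact: measurable_id|exact: measurable_cst].
    - by move=> z _; rewrite normc_real ger0_norm ?bump_ge0//; exact: bexp_bound.
    - move=> z nz; apply/eqP; apply: contra_notT nz => bz.
      have b0' : bump r z 0 != 0 by apply: contra bz => /eqP ->.
      have [h1 h2] := bump_neq0 (ltW r0) (or_introl b0').
      by split; apply: normc_le_box; [move: h1|move: h2]; rewrite (_ : cplx 0 = 0)// subr0.
  have := cintegrable_normc_lty ib; rewrite /I.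
  by under eq_integral do rewrite normc_real ger0_norm ?bump_ge0//.
exists (fine (I z0)); first by rewrite fine_gt0// I0.
by move=> y; rewrite -/(I y) transl fineK// ge0_fin_numE// ltW.
Qed.

Section averages.
Variables (r N : R) (N0 : 0 < N) (NE : forall y : C2 R, (\int[muC2]_z (bump r z y)%:E = N%:E)%E).

Lemma cmeas_bump (y : mC2 R) : cmeas (fun z : mC2 R => (bump r z y)%:C).
Proof. by apply: cmeas_real; apply: measurable_bexp; [exact: measurable_id|exact: measurable_cst]. Qed.

Lemma cmeas_average (b : mC2 R -> R[i]) : cmeas b ->
  cmeas (fun y => N^-1%:C * cint muC2 (fun z => (bump r z y)%:C * b z)).
Proof.
move=> mb; apply: cmeasM; first exact: cmeas_cst.
apply: (@cmeas_cint _ _ _ (mC2 R) (mC2 R) muC2 (fun p : mC2 R * mC2 R => (bump r p.2 p.1)%:C * b p.2)).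
apply: cmeasM; last exact: (cmeas_comp mb measurable_snd).
by apply: cmeas_real; apply: measurable_bexp; [exact: measurable_snd|exact: measurable_fst].
Qed.

Lemma average_le (y : mC2 R) (b : mC2 R -> R[i]) (K : R) : 0 <= K -> cmeas b ->
  (forall z : mC2 R, bump r z y != 0 -> normc (b z) <= K) ->
  cintegrable muC2 (fun z => (bump r z y)%:C * b z) /\
  normc (N^-1%:C * cint muC2 (fun z => (bump r z y)%:C * b z)) <= 2 * K.
Proof.
move=> K0 mb bK; have mbb : cmeas (fun z : mC2 R => (bump r z y)%:C * b z) by exact: (cmeasM (cmeas_bump y) mb).
have le : (\int[muC2]_z (normc ((bump r z y)%:C * b z))%:E <= (K * N)%:E)%E.
  apply: (@le_trans _ _ (\int[muC2]_z (K%:E * (bump r z y)%:E))%E).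
    apply: ge0_le_integral => //.
    - by move=> z _; rewrite lee_fin normc_ge0.
    - by apply/measurable_EFinP/measurable_normc.
    - apply: measurable_funeM; apply/measurable_EFinP.
      by apply: measurable_bexp; [exact: measurable_id|exact: measurable_cst].
    - move=> z _; rewrite -EFinM lee_fin normcM normc_real ger0_norm ?bump_ge0// mulrC.
      have [->|bz] := eqVneq (bump r z y) 0; first by rewrite !mulr0.
      by apply: ler_wpM2r; [exact: bump_ge0|exact: bK].
  rewrite ge0_integralZl//; first by rewrite NE.
  - by apply/measurable_EFinP; apply: measurable_bexp; [exact: measurable_id|exact: measurable_cst].
  - by move=> z _; rewrite lee_fin bump_ge0.
split; first by apply: cintegrable_lty => //; exact: le_lt_trans le (ltry _).
rewrite normcM normc_real gtr0_norm ?invr_gt0// ler_pdivrMl//.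
have hn : ((normc (cint muC2 (fun z : mC2 R => (bump r z y)%:C * b z)))%:E <=
    2%:E * \int[muC2]_z (normc ((bump r z y)%:C * b z))%:E)%E by exact: ler_normc_cint.
rewrite -lee_fin; apply: (le_trans hn).
rewrite (_ : N * (2 * K) = 2 * (K * N)); last by ring.
by rewrite EFinM; apply: lee_wpmul2l.
Qed.
End averages.

(** Both the mollified functions and the radii vary with [n], and convergence is only known along
    convergent sequences of points. That already forces the supremum of [|a_ n z - a y|] over
    shrinking balls around [y] to tend to 0, after which dominated convergence applies. *)
Lemma mollify (f : mC2 R -> R[i]) (a_ : nat -> mC2 R -> R[i]) (a : mC2 R -> R[i]) (C : R) (r N : nat -> R) :
  cintegrable muC2 f -> (forall n, cmeas (a_ n)) -> cmeas a -> (forall n z, normc (a_ n z) <= C) ->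
  (forall (z : nat -> C2 R) (y : C2 R), z n @[n --> \oo] --> y -> normc (a_ n (z n) - a y) @[n --> \oo] --> (0 : R)) ->
  (forall n, 0 < r n) -> r n @[n --> \oo] --> (0 : R) ->
  (forall n, 0 < N n) -> (forall n (y : C2 R), (\int[muC2]_z (bump (r n) z y)%:E = (N n)%:E)%E) ->
  normc (cint muC2 (fun y => f y * ((N n)^-1%:C * cint muC2 (fun z => (bump (r n) z y)%:C * a_ n z))) -
    cint muC2 (fun y => f y * a y)) @[n --> \oo] --> (0 : R).
Proof.
move=> iF ma_ ma aC ac r0 rc N0 NE.
have C0 : 0 <= C := le_trans (normc_ge0 _) (aC 0%N (0 : C2 R)).
have avg n y b K := @average_le (r n) (N n) (N0 n) (NE n) y b K.
have iC := integrableZl measurableT (2 * C) (integrable_normc iF).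
apply: (cint_dominated _ _ iC) => [n||n y|].
- apply: cmeasM; first exact: cintegrable_cmeas iF.
  exact: cmeas_average.
- by apply: cmeasM => //; exact: cintegrable_cmeas iF.
- rewrite normcM mulrC; apply: ler_wpM2r; first exact: normc_ge0.
  by have [_] := avg n y (a_ n) C C0 (ma_ n) (fun z _ => aC n z).
apply: aeW => y; apply: normc_cvgM; first exact: normc_cvg_cst.
apply/cvgrPdist_le => e e0.
have e20 : 0 < e / 2 by rewrite divr_gt0.
pose bad n (z : C2 R) := [/\ normc (cplx z.1 - cplx y.1) <= r n, normc (cplx z.2 - cplx y.2) <= r n & e / 2 < normc (a_ n z - a y)].
(* [z n] is a point of the n-th ball where the estimate fails, or [y] if there is none. The sequence
   tends to [y], so eventually no such point exists. *)
pose z n : C2 R := if pselect (exists z, bad n z) is left h then projT1 (cid h) else y.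
have zP n : normc (cplx (z n).1 - cplx y.1) <= r n /\ normc (cplx (z n).2 - cplx y.2) <= r n.
  rewrite /z; case: pselect => [h|_]; first by case: (cid h) => /= ? [].
  by rewrite !subrr normc0 ltW.
have /cvgrPdist_lt/(_ _ e20) := ac z y (C2_cvg zP rc).
apply: filterS => n; rewrite !sub0r !normrN !ger0_norm ?normc_ge0// => zn.
have good (w : mC2 R) : bump (r n) w y != 0 -> normc (a_ n w - a y) <= e / 2.
  move=> bw; have [h1 h2] := bump_neq0 (ltW (r0 n)) (or_introl bw).
  rewrite leNgt; apply/negP => h3; have hb : exists z, bad n z by exists w.
  move: zn; rewrite /z; case: pselect => // h; case: (cid h) => /= v [_ _ v3] v4.
  by move: (lt_trans v3 v4); rewrite ltxx.
have maB : cmeas (fun z => a_ n z - a y) by apply: cmeasB => //; exact: cmeas_cst.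
have [i1 le1] := avg n y _ _ (ltW e20) maB good.
have [i2 _] := avg n y (a_ n) C C0 (ma_ n) (fun z _ => aC n z).
have i4 : cintegrable muC2 (fun z : mC2 R => (bump (r n) z y)%:C).
  apply: cintegrable_lty; first exact: cmeas_bump.
  under eq_integral do rewrite normc_real ger0_norm ?bump_ge0//.
  by rewrite NE ltry.
have NC : cint muC2 (fun z => (bump (r n) z y)%:C) = (N n)%:C.
  apply: complexRI; last by rewrite /= Rintegral_cst// mul0r.
  by rewrite /= /Rintegral NE.
have nC0 : (N n)%:C != 0 :> R[i] by rewrite -normc_gt0 normc_real normr_gt0 gt_eqF.
have -> : (N n)^-1%:C * cint muC2 (fun z => (bump (r n) z y)%:C * a_ n z) - a y =
    (N n)^-1%:C * cint muC2 (fun z => (bump (r n) z y)%:C * (a_ n z - a y)).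
  rewrite (_ : (fun z => (bump (r n) z y)%:C * (a_ n z - a y)) = fun z => (bump (r n) z y)%:C * a_ n z - a y * (bump (r n) z y)%:C); last first.
    by apply/funext => w; ring.
  rewrite cintB//; last exact: cintegrableZ.
  rewrite cintZ// NC mulrBr fmorphV mulrCA mulVf// mulr1//.
by apply: (le_trans le1); rewrite mulrC divfK.
Qed.
End mollification.

(** * Mollification carried through the shear *)

Section transport.
Context {R : realType}.
Local Notation muC := (@lebesgueC R).
Local Notation muC2 := (@lebesgueC2 R).
Variables (m : R) (m0 : 0 < m).

(* A continuous function on the whole of C^2 that agrees with [unshear] where [|z2| >= m]. *)
Definition kappa (z : C2 R) : C2 R :=
  (ofc (cplx z.1 * ((cplx z.2)^*)%R * ((Num.max m (normc (cplx z.2)) ^+ 2)^-1)%:C), z.2).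
(** The factor is the inverse Jacobian, kept bounded by the floor [m]; thus pairing with [tr H]
    amounts to pairing the sheared function with [H] as soon as [H] vanishes where $|w_2|<m$. *)
Definition tr (H : C2 R -> R[i]) (z : C2 R) : R[i] :=
  H (kappa z) * ((Num.max m (normc (cplx z.2)) ^+ 2)^-1)%:C.

Let wt : continuous (fun z : C2 R => (Num.max m (normc (cplx z.2)) ^+ 2)^-1).
Proof.
move=> z; apply: cvgV; first by rewrite expf_neq0// gt_eqF// lt_max m0.
have cm : continuous (fun z : C2 R => Num.max m (normc (cplx z.2))).
  by apply: continuous_maxf => [x|]; [exact: cvg_cst|exact: (continuous_normc ccont_snd)].
by apply: cvgM; exact: cm.
Qed.

Lemma continuous_kappa : continuous kappa.
Proof.
apply: continuous_pair; last by move=> z; exact: cvg_snd.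
apply: continuous_ofc; apply: ccontM; first by apply: ccontM; [exact: ccont_fst|exact: ccontJ ccont_snd].
exact: ccont_real.
Qed.

Lemma tr_shear (H : C2 R -> R[i]) (w : C2 R) : (forall q, normc (cplx q.2) < m -> H q = 0) ->
  (normc (cplx w.2) ^+ 2)%:C * tr H (shear w) = H w.
Proof.
move=> H0; rewrite /tr; have [wm|wm] := ltP (normc (cplx w.2)) m.
  by rewrite !H0// mul0r mulr0.
have n0 : normc (cplx w.2) != 0 by rewrite gt_eqF// (lt_le_trans m0).
have nC : (normc (cplx w.2) ^+ 2)%:C * ((normc (cplx w.2) ^+ 2)^-1)%:C = 1 :> R[i].
  by rewrite -rmorphM divff ?expf_neq0.
have -> : kappa (shear w) = w.
  rewrite /kappa /shear /= max_r// ofcK -[cplx w.1 * cplx w.2 * _]mulrA mulcJ -mulrA nC mulr1 cplxK.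
  by case: (w).
by rewrite mulrCA nC mulr1.
Qed.

Lemma cmeas_weight : cmeas (fun z : mC2 R => ((Num.max m (normc (cplx z.2)) ^+ 2)^-1)%:C).
Proof.
apply: cmeas_real; apply: measurable_funVr; apply: measurable_funX.
by apply: measurable_maxr; [exact: measurable_cst|apply: measurable_normc; exact: cmeas_cplx2].
Qed.

Lemma measurable_kappa : measurable_fun setT (kappa : mC2 R -> mC2 R).
Proof.
apply: (@measurable_fun_pair _ _ _ (mC2 R) (mC R) (mC R)); last exact: measurable_snd.
apply: measurable_ofc; apply: cmeasM; last exact: cmeas_weight.
by apply: cmeasM; [exact: cmeas_cplx1|apply: cmeasJ; exact: cmeas_cplx2].
Qed.

Lemma cmeas_tr (H : C2 R -> R[i]) : cmeas (H : mC2 R -> R[i]) -> cmeas (tr H : mC2 R -> R[i]).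
Proof.
move=> mH; apply: cmeasM; last exact: cmeas_weight.
exact: (cmeas_comp mH measurable_kappa).
Qed.

Lemma normc_tr (H : C2 R -> R[i]) (C : R) z : (forall q, normc (H q) <= C) -> normc (tr H z) <= C * (m ^+ 2)^-1.
Proof.
move=> HC; have mx : m <= Num.max m (normc (cplx z.2)) by rewrite le_max lexx.
have mx0 : 0 < Num.max m (normc (cplx z.2)) := lt_le_trans m0 mx.
rewrite normcM normc_real ger0_norm; last by rewrite invr_ge0 sqr_ge0.
apply: ler_pM; [exact: normc_ge0|by rewrite invr_ge0 sqr_ge0|exact: HC|].
by rewrite lef_pV2 ?posrE ?exprn_gt0// lerXn2r ?nnegrE// ltW.
Qed.

Lemma cint_tr (F H : C2 R -> R[i]) : (forall q, normc (cplx q.2) < m -> H q = 0) ->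
  cintegrable muC2 (fun z : mC2 R => F z * tr H z) ->
  cintegrable muC2 (fun w : mC2 R => F (shear w) * H w) /\
  cint muC2 (fun z : mC2 R => F z * tr H z) = cint muC2 (fun w : mC2 R => F (shear w) * H w).
Proof.
move=> H0 i0; have [i1 e1] := cint_shear i0.
have E : (fun w : mC2 R => (normc (cplx w.2) ^+ 2)%:C * (F (shear w) * tr H (shear w))) = (fun w : mC2 R => F (shear w) * H w).
  by apply/funext => w; rewrite mulrCA tr_shear.
by rewrite E in i1 e1.
Qed.

(** Continuous convergence, that is along all convergent sequences of points, with a common bound
    and common vanishing near [w2 = 0]. This is how [opA] and [opB] converge as the cutoff level
    tends to 1, and what the mollification argument consumes. *)
Definition fam (H_ : nat -> C2 R -> R[i]) (H : C2 R -> R[i]) (C : R) :=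
  [/\ forall n, cmeas (H_ n : mC2 R -> R[i]), cmeas (H : mC2 R -> R[i]), forall n q, normc (H_ n q) <= C,
    forall n q, normc (cplx q.2) < m -> H_ n q = 0 /\ H q = 0 &
    forall (q : nat -> C2 R) (y : C2 R), q n @[n --> \oo] --> y -> normc (H_ n (q n) - H y) @[n --> \oo] --> (0 : R)].

Variables (r N : nat -> R) (r0 : forall n, 0 < r n) (rc : r n @[n --> \oo] --> (0 : R)) (N0 : forall n, 0 < N n).
Hypothesis NE : forall n (y : C2 R), (\int[muC2]_z (bump (r n) z y)%:E = (N n)%:E)%E.

Definition avg (n : nat) (H : C2 R -> R[i]) (y : mC2 R) : R[i] :=
  (N n)^-1%:C * cint muC2 (fun w : mC2 R => (bump (r n) (shear w) y)%:C * H w).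

Let fam_avg H_ H C n (y : mC2 R) : fam H_ H C ->
  (N n)^-1%:C * cint muC2 (fun z => (bump (r n) z y)%:C * tr (H_ n) z) = avg n (H_ n) y /\
  normc (avg n (H_ n) y) <= 2 * (C * (m ^+ 2)^-1).
Proof.
move=> [mH _ HC Hz _]; have C0 : 0 <= C := le_trans (normc_ge0 _) (HC 0%N (0 : C2 R)).
have K0 : 0 <= C * (m ^+ 2)^-1 by rewrite mulr_ge0// invr_ge0 sqr_ge0.
have [i1 le1] := @average_le R (r n) (N n) (N0 n) (NE n) y (tr (H_ n)) _ K0 (cmeas_tr (mH n)) (fun z _ => normc_tr z (HC n)).
have [_ e1] := cint_tr (fun q qm => (Hz n q qm).1) i1.
have E : (N n)^-1%:C * cint muC2 (fun z => (bump (r n) z y)%:C * tr (H_ n) z) = avg n (H_ n) y by rewrite e1.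
by split => //; rewrite -E.
Qed.

Lemma cintegrable_fam_avg H_ H C n (f : mC2 R -> R[i]) : fam H_ H C -> cintegrable muC2 f ->
  cintegrable muC2 (fun y => f y * avg n (H_ n) y).
Proof.
move=> fH iF; have [mH _ _ _ _] := fH.
have e1 : avg n (H_ n) = fun y : mC2 R => (N n)^-1%:C * cint muC2 (fun z => (bump (r n) z y)%:C * tr (H_ n) z).
  by apply/funext => y; have [-> _] := fam_avg n y fH.
apply: (cintegrable_le _ _ (integrableZl measurableT (2 * (C * (m ^+ 2)^-1)) (integrable_normc iF))) => [|y].
  by apply: cmeasM; [exact: cintegrable_cmeas iF|rewrite e1; apply: cmeas_average; exact: cmeas_tr].
rewrite normcM mulrC; apply: ler_wpM2r; first exact: normc_ge0.
by have [_] := fam_avg n y fH.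
Qed.

(** Through [tr] the averages taken in shear coordinates become mollifications in the original ones,
    where the integrand [f] lives; the limit is then sheared back. *)
Lemma fam_limit H_ H C (f : C2 R -> R[i]) : fam H_ H C -> cintegrable muC2 (f : mC2 R -> R[i]) ->
  normc (cint muC2 (fun y : mC2 R => f y * avg n (H_ n) y) - cint muC2 (fun w : mC2 R => f (shear w) * H w))
    @[n --> \oo] --> (0 : R) /\
  cintegrable muC2 (fun w : mC2 R => f (shear w) * H w).
Proof.
move=> fH iF; have [mH mH' HC Hz Hs] := fH.
have HC' q : normc (H q) <= C.
  have c : normc (H_ n q - H q) @[n --> \oo] --> (0 : R) by exact: (Hs (fun=> q) q (cvg_cst q)).
  apply/ler_addgt0Pr => e e0.
  have /cvgrPdist_lt h := c; have [n0 _ /(_ n0 (leqnn n0))] := h e e0.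
  rewrite /= sub0r normrN ger0_norm ?normc_ge0// => d.
  have := ler_normcB (H q) (H_ n0 q); rewrite normcB => d2.
  by have := HC n0 q; move: d d2; lra.
have it : cintegrable muC2 (fun z : mC2 R => f z * tr H z).
  apply: (cintegrable_le _ _ (integrableZl measurableT (C * (m ^+ 2)^-1) (integrable_normc iF))) => [|y].
    by apply: cmeasM; [exact: cintegrable_cmeas iF|exact: cmeas_tr].
  by rewrite normcM mulrC; apply: ler_wpM2r; [exact: normc_ge0|exact: normc_tr].
have [i1 e1] := cint_tr (fun q qm => (Hz 0%N q qm).2) it.
split => //; rewrite -e1.
have seqh (z : nat -> C2 R) (y : C2 R) : z n @[n --> \oo] --> y -> normc (tr (H_ n) (z n) - tr H y) @[n --> \oo] --> (0 : R).
  move=> zy; apply: normc_cvgM; last exact: (ccont_cvg (ccont_real wt) zy).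
  apply: (Hs (fun n => kappa (z n)) (kappa y)).
  exact: (cvg_comp _ _ zy (@continuous_kappa y)).
have mol := @mollify R f (fun n => tr (H_ n)) (tr H) (C * (m ^+ 2)^-1) r N iF (fun n => cmeas_tr (mH n)) (cmeas_tr mH')
  (fun n z => normc_tr z (HC n)) seqh r0 rc N0 NE.
have E n : cint muC2 (fun y : mC2 R => f y * avg n (H_ n) y) =
    cint muC2 (fun y => f y * ((N n)^-1%:C * cint muC2 (fun z => (bump (r n) z y)%:C * tr (H_ n) z))).
  by congr cint; apply/funext => y; have [-> _] := fam_avg n y fH.
have -> : (fun n => normc (cint muC2 (fun y : mC2 R => f y * avg n (H_ n) y) - cint muC2 (fun z : mC2 R => f z * tr H z))) =
    (fun n => normc (cint muC2 (fun y => f y * ((N n)^-1%:C * cint muC2 (fun z => (bump (r n) z y)%:C * tr (H_ n) z))) -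
      cint muC2 (fun z : mC2 R => f z * tr H z))) by apply/funext => n; rewrite E.
exact: mol.
Qed.
End transport.

(** From $2a\le 1+a^2$ one gets $a\le(1+e)/2$, hence $(1-a)b\ge(1-e)m/2$, while $4r\le(1-e)m/8$. *)
Lemma bump_margin1 {R : realType} (a b e m r : R) : 0 <= a -> a ^+ 2 < e -> e < 1 -> 0 < m -> m <= b ->
  r <= (1 - e) * m / 32 -> a * b + 4 * r < b.
Proof.
move=> a0 ae e1 m0 mb re; have sq := sqr_ge0 (a - 1).
have h1 : a <= (1 + e) / 2 by move: sq ae; rewrite !expr2; lra.
have h0 : 0 <= (1 - e) / 2 by lra.
have h2 : (1 - e) / 2 * m <= (1 - a) * b by apply: ler_pM => //; [exact: ltW|lra].
have h3 : 0 < (1 - e) * m by rewrite mulr_gt0// subr_gt0.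
by move: h2 re h3; lra.
Qed.
Lemma bump_margin2 {R : realType} (b e m r : R) : 0 < m -> m < 1 -> 1 - m / 2 <= e -> e < 1 -> b <= 1 - m ->
  r <= (1 - e) * m / 32 -> b + 2 * r < 1.
Proof.
move=> m0 m1 em e1 bm re.
have h : (1 - e) * m <= 1 * m by rewrite ler_wpM2r ?ltW//; lra.
by move: re h; lra.
Qed.

(** * Closedness tested on the kernels of the solution *)

Section star.
Context {R : realType}.
Local Notation muC := (@lebesgueC R).
Local Notation muC2 := (@lebesgueC2 R).

Lemma cintegrable_tensor_le d1 d2 (T1 : measurableType d1) (T2 : measurableType d2)
    (m1 : {sigma_finite_measure set T1 -> \bar R}) (m2 : {sigma_finite_measure set T2 -> \bar R})
    (F : T1 * T2 -> R[i]) (g : T1 -> R) (h : T2 -> R) : cmeas F ->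
  (forall x y, normc (F (x, y)) <= g x * h y) -> (forall x, 0 <= g x) -> (forall y, 0 <= h y) ->
  m1.-integrable setT (EFin \o g) -> m2.-integrable setT (EFin \o h) -> cintegrable (m1 \x m2)%E F.
Proof.
move=> mF Fgh g0 h0 ig ih.
have mg : measurable_fun setT g by apply/measurable_EFinP; have /integrableP[] := ig.
have mh : measurable_fun setT h by apply/measurable_EFinP; have /integrableP[] := ih.
have gE : (\int[m1]_x (g x)%:E < +oo)%E.
  by have /integrableP[_] := ig; under eq_integral do rewrite /= ger0_norm//.
have hE : (\int[m2]_x (h x)%:E < +oo)%E.
  by have /integrableP[_] := ih; under eq_integral do rewrite /= ger0_norm//.
have mn : measurable_fun setT (fun z => (normc (F z))%:E) by exact/measurable_EFinP/measurable_normc.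
have hfin : (\int[m2]_y (h y)%:E)%E \is a fin_num by rewrite ge0_fin_numE//; apply: integral_ge0 => y _; rewrite lee_fin.
apply: cintegrable_prod => //.
apply: (@le_lt_trans _ _ (\int[m1]_x ((\int[m2]_y (h y)%:E) * (g x)%:E))%E).
  apply: ge0_le_integral => //.
  - by move=> x _; apply: integral_ge0 => y _; rewrite lee_fin normc_ge0.
  - by apply: (measurable_int1 m2 mn) => z; rewrite lee_fin normc_ge0.
  - by apply: measurable_funeM; exact/measurable_EFinP.
  - move=> x _; rewrite muleC -ge0_integralZl//; [|exact/measurable_EFinP|by move=> y _; rewrite lee_fin|by rewrite lee_fin].
    apply: ge0_le_integral => //.
    + by move=> y _; rewrite lee_fin normc_ge0.
    + by apply/measurable_EFinP/measurable_normc; exact: cmeas_pair1.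
    + by apply: measurable_funeM; exact/measurable_EFinP.
    + by move=> y _; rewrite -EFinM lee_fin.
rewrite ge0_integralZl//; [|exact/measurable_EFinP|by move=> x _; rewrite lee_fin|by apply: integral_ge0 => y _; rewrite lee_fin].
by apply: lte_mul_pinfty => //; apply: integral_ge0 => y _; rewrite lee_fin.
Qed.

Variables (f1 f2 : C2 R -> R[i]).
Hypotheses (if1 : cintegrable muC2 (f1 : mC2 R -> R[i])) (if2 : cintegrable muC2 (f2 : mC2 R -> R[i])).
Hypothesis closed12 : forall phi, test_funH phi ->
  cint muC2 (fun y : mC2 R => f2 y * dzbar 0 phi y) = cint muC2 (fun y : mC2 R => f1 y * dzbar 1 phi y).

Variables (m : R) (Psi Psi1 Psi2 : C2 R -> R[i]) (tP : tst m Psi Psi1 Psi2).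
Let m0 : 0 < m. Proof. by case: tP. Qed.
Let m1 : m < 1. Proof. by case: tP. Qed.
Let cP : ccont Psi. Proof. by case: tP => _ _ []. Qed.
Let cP2 : ccont Psi2. Proof. by case: tP => _ _ []. Qed.
Let PP w : ~~ core m w -> Psi w = 0. Proof. by case: tP => _ _ _ h /h[]. Qed.
Let PP2 w : ~~ core m w -> Psi2 w = 0. Proof. by case: tP => _ _ _ h /h[]. Qed.

(** In terms of the data $g_1,g_2$ in shear coordinates the aim is $\int g_1\,A\Psi_2=\int
    g_2\,(-\pi\Psi+B\Psi)$, with $A,B$ for [opA], [opB]. Expanding $g_1,g_2$ through the sheared
    $f_1,f_2$ produces the three symbols. *)
Definition symA e (w : C2 R) : R[i] := ((cplx w.2)^*)%R * opA e Psi2 w.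
Definition symD e (w : C2 R) : R[i] := - pompC%:C * Psi w + opB e Psi w.
Definition symB e (w : C2 R) : R[i] := ((cplx w.1)^*)%R * symD e w.

Section level.
Variables (e r : R) (em : 1 - m / 2 <= e) (e1 : e < 1) (r0 : 0 < r) (re : r <= (1 - e) * m / 32).

Let d0 (q y : C2 R) : R[i] := (bumpd r (shear q) y)%:C * (cplx (shear q).1 - cplx y.1).
Let d1 (q y : C2 R) : R[i] := (bumpd r (shear q) y)%:C * (cplx (shear q).2 - cplx y.2).
Let A0 (q : C2 R) : R[i] := opA e Psi q * ((cplx q.2)^*)%R.

Let e1' : e <= 1. Proof. exact: ltW. Qed.
Let dzE q y : d0 q y = dzbar 0 (fun y => (bump r (shear q) y)%:C) y /\ d1 q y = dzbar 1 (fun y => (bump r (shear q) y)%:C) y.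
Proof. by have [-> ->] := dzbar_bump r (shear q) y. Qed.

Let K : R := 4%:R ^+ 4 * (r ^+ 2) ^+ 2 * r.
Let K0 : 0 <= K. Proof. by apply: mulr_ge0 (ltW r0); apply: mulr_ge0; [exact: exprn_ge0|exact: sqr_ge0]. Qed.
Let normc_d q y : normc (d0 q y) <= K /\ normc (d1 q y) <= K.
Proof.
rewrite /d0 /d1 !normcM normc_real ger0_norm; last exact: bexp_ge0.
have [->|bn] := eqVneq (bumpd r (shear q) y) 0; first by rewrite !mul0r.
have [h1 h2] := bump_neq0 (ltW r0) (or_intror bn).
by split; apply: ler_pM => //; do ?[exact: bexp_ge0|exact: normc_ge0|exact: bexp_bound].
Qed.

Let cmeas_d d (T : measurableType d) (f g : T -> mC2 R) : measurable_fun setT f -> measurable_fun setT g ->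
  cmeas (fun t => d0 (f t) (g t)) /\ cmeas (fun t => d1 (f t) (g t)).
Proof.
move=> mf mg; have mb : cmeas (fun t => (bumpd r (shear (f t)) (g t))%:C).
  by apply: cmeas_real; apply: measurable_bexp => //; exact: (measurableT_comp measurable_shear mf).
have ms := measurableT_comp measurable_shear mf.
split; apply: (cmeasM mb); apply: cmeasB; apply: cmeas_cplx.
- exact: (measurableT_comp measurable_fst ms).
- exact: (measurableT_comp measurable_fst mg).
- exact: (measurableT_comp measurable_snd ms).
- exact: (measurableT_comp measurable_snd mg).
Qed.

Let cintegrable_fd (f : mC2 R -> R[i]) q : cintegrable muC2 f ->
  cintegrable muC2 (fun y => f y * d0 q y) /\ cintegrable muC2 (fun y => f y * d1 q y).
Proof.
move=> iF; have mc : measurable_fun setT (fun _ : mC2 R => q : mC2 R) by exact: measurable_cst.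
have mi : measurable_fun setT (fun y : mC2 R => y) by exact: measurable_id.
have [c0 c1] := cmeas_d mc mi.
have iK := integrableZl measurableT K (integrable_normc iF).
split.
- apply: (cintegrable_le _ _ iK) => [|y]; first exact: cmeasM (cintegrable_cmeas iF) c0.
  by rewrite normcM mulrC; apply: ler_wpM2r; [exact: normc_ge0|case: (normc_d q y)].
- apply: (cintegrable_le _ _ iK) => [|y]; first exact: cmeasM (cintegrable_cmeas iF) c1.
  by rewrite normcM mulrC; apply: ler_wpM2r; [exact: normc_ge0|case: (normc_d q y)].
Qed.

(** If [opA e Psi q] is nonzero then $|q_1|^2<e$ and $m\le|q_2|\le 1-m$. This puts [shear q] at a
    definite distance from the boundary of the Hartogs triangle, so that the bump around it is an
    admissible test function for closedness. Here [e < 1] is essential. *)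
Let inner0 (q : C2 R) : A0 q != 0 -> cint muC2 (fun y : mC2 R => f1 y * d1 q y - f2 y * d0 q y) = 0.
Proof.
move=> Aq.
have opAq : opA e Psi q != 0 by apply: contra Aq => /eqP h; rewrite /A0 h mul0r.
have q1 : normc (cplx q.1) ^+ 2 < e.
  rewrite ltNge; apply/negP => h; move: opAq; rewrite /opA (_ : (fun w : mC R => _) = fun=> 0) ?cint0 ?eqxx//.
  by apply/funext => w; rewrite /Xk /gap max_l ?subr_le0// mul0r expr0n !mul0r.
have /andP[q2 q3] : m <= normc (cplx q.2) <= 1 - m.
  by apply/negPn/negP => h; move: opAq; rewrite (opA_eq0 e1' PP) ?eqxx//; right.
have t : test_funH (fun y => (bump r (shear q) y)%:C).
  apply: test_bump => //=; rewrite ?ofcK ?normcM.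
    exact: (bump_margin1 (normc_ge0 _) q1 e1 m0 q2 re).
  exact: (bump_margin2 m0 m1 em e1 q3 re).
have c := closed12 t.
have c0 : (fun y : mC2 R => f2 y * d0 q y) = (fun y : mC2 R => f2 y * dzbar 0 (fun y0 : C2 R => (bump r (shear q) y0)%:C) y).
  by apply/funext => y; congr (_ * _); exact: (dzE q y).1.
have c1 : (fun y : mC2 R => f1 y * d1 q y) = (fun y : mC2 R => f1 y * dzbar 1 (fun y0 : C2 R => (bump r (shear q) y0)%:C) y).
  by apply/funext => y; congr (_ * _); exact: (dzE q y).2.
have [_ i1] := cintegrable_fd q if1; have [i0 _] := cintegrable_fd q if2.
have e10 := etrans (congr1 (cint muC2) c1) (etrans (esym c) (esym (congr1 (cint muC2) c0))).
clear c c0 c1; rewrite (cintB i1 i0) e10; exact: subrr.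
Qed.

Let F (z : mC2 R * mC2 R) : R[i] := A0 z.2 * (f1 z.1 * d1 z.2 z.1 - f2 z.1 * d0 z.2 z.1).

(** By Fubini's theorem the integration in [y] is done first, where closedness makes it vanish for
    every [q] that contributes. *)
Let total0 : cint muC2 (fun y : mC2 R => cint muC2 (fun q : mC2 R => F (y, q))) = 0.
Proof.
have [M M0 PM] := ccont_bounded_core m0 cP PP.
have iA : cintegrable muC2 (fun q : mC2 R => A0 q).
  have := cintegrable_opA m0 em e1' cP PP PM (ccontJ (@ccont_snd R)).
  by congr cintegrable; apply/funext => q; rewrite /A0 mulrC.
have [c0 c1] := @cmeas_d _ _ (fun z : mC2 R * mC2 R => z.2) (fun z => z.1) measurable_snd measurable_fst.
have mF : cmeas F.
  apply: cmeasM; first exact: (cmeas_comp (cintegrable_cmeas iA) measurable_snd).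
  apply: cmeasB; apply: cmeasM => //.
    exact: (cmeas_comp (cintegrable_cmeas if1) measurable_fst).
  exact: (cmeas_comp (cintegrable_cmeas if2) measurable_fst).
have iF : cintegrable (muC2 \x muC2)%E F.
  have ig : muC2.-integrable setT (EFin \o (fun y : mC2 R => K * (normc (f1 y) + normc (f2 y)))).
    have := integrableZl measurableT K (integrableD measurableT (integrable_normc if1) (integrable_normc if2)).
    by apply: eq_integrable => // y _; rewrite /= EFinM EFinD.
  apply: (@cintegrable_tensor_le _ _ _ _ muC2 muC2 F _ (fun q => normc (A0 q)) mF _ _ _ ig (integrable_normc iA)) => [y q|y|q].
  - have [n0 n1] := normc_d q y.
    have h : normc (f1 y * d1 q y - f2 y * d0 q y) <= K * (normc (f1 y) + normc (f2 y)).
      apply: le_trans (le_normcD _ _) _; rewrite normcN (normcM (f1 y)) (normcM (f2 y)) mulrDr.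
      have a1 := ler_wpM2r (normc_ge0 (f1 y)) n1; have a2 := ler_wpM2r (normc_ge0 (f2 y)) n0.
      by apply: lerD; rewrite [leLHS]mulrC; [exact: a1|exact: a2].
    have h2 := ler_wpM2r (normc_ge0 (A0 q)) h.
    by rewrite /F /= (normcM (A0 q)) [leLHS]mulrC; exact: h2.
  - by apply: mulr_ge0 => //; apply: addr_ge0; exact: normc_ge0.
  - exact: normc_ge0.
rewrite -(@cint_prod _ _ _ _ _ muC2 muC2 F iF) (@cint_prod2 _ _ _ _ _ muC2 muC2 F iF).
rewrite -[RHS](cint0 muC2); congr cint; apply/funext => q.
have [A0q|A0q] := eqVneq (A0 q) 0.
  by rewrite -[RHS](cint0 muC2); congr cint; apply/funext => y; rewrite /F /= A0q mul0r.
have [_ i1] := cintegrable_fd q if1; have [i0 _] := cintegrable_fd q if2.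
rewrite -[RHS](mulr0 (A0 q)) -(inner0 A0q) -cintZ//; exact: cintegrableB.
Qed.

Let S (H : C2 R -> R[i]) (y : mC2 R) : R[i] := cint muC2 (fun w : mC2 R => (bump r (shear w) y)%:C * H w).

(** The two adjoint identities are applied to the bump multiplied by $\bar w_2$, by $\bar w_1$ and
    by 1. In the difference of the first two, the undifferentiated bump and the mixed terms $\bar
    w_1\bar w_2$ cancel; what remains is the closedness defect of the bump, weighted by $\bar w_2$
    and [opA e Psi]. *)
Let pointwise (y : mC2 R) : f1 y * S (symA e) y - f1 y * S (symB e) y - f2 y * S (symD e) y =
  cint muC2 (fun q : mC2 R => F (y, q)).
Proof.
have [M M0 PM] := ccont_bounded_core m0 cP PP.
have wb := wirt2_bump r y; set b1 := (X in wirt2 _ X _) in wb; set b2 := (X in wirt2 _ _ X) in wb.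
pose b (w : C2 R) : R[i] := (bump r (shear w) y)%:C.
have wA := wirt2M wirt2_sndJ wb; have wB := wirt2M wirt2_fstJ wb.
have eA : S (symA e) y = - cint muC2 (fun q => (1 * b q + (cplx q.2)^* * b2 q) * opA e Psi q).
  rewrite -(opA_stokes m0 em e1' tP wA) /S; congr cint; apply/funext => w.
  by rewrite /symA mulrCA mulrA.
have eB : S (symB e) y = - cint muC2 (fun q => (1 * b q + (cplx q.1)^* * b1 q) * opA e Psi q).
  rewrite -(opB_pompeiu m0 em e1' tP wB) /S; congr cint; apply/funext => w.
  by rewrite /symB /symD mulrCA mulrA.
have eD : S (symD e) y = - cint muC2 (fun q => b1 q * opA e Psi q).
  by rewrite -(opB_pompeiu m0 em e1' tP wb).
have [_ _ cA2 _ _] := wA; have [_ cB1 _ _ _] := wB; have [_ cb1 _ _ _] := wb.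
have iA := cintegrable_opA m0 em e1' cP PP PM cA2.
have iB := cintegrable_opA m0 em e1' cP PP PM cB1.
have iD := cintegrable_opA m0 em e1' cP PP PM cb1.
rewrite eA eB eD !mulrN opprK opprK -!mulNr.
rewrite -!cintZ// -cintD; [|exact: cintegrableZ|exact: cintegrableZ].
rewrite -cintD; [|by apply: cintegrableD; exact: cintegrableZ|exact: cintegrableZ].
congr cint; apply/funext => q; rewrite /F /A0 /b1 /b2 /b /d0 /d1 /=; ring.
Qed.

Lemma level_identity (N : R) :
  cintegrable muC2 (fun y : mC2 R => f1 y * (N^-1%:C * S (symA e) y)) ->
  cintegrable muC2 (fun y : mC2 R => f1 y * (N^-1%:C * S (symB e) y)) ->
  cintegrable muC2 (fun y : mC2 R => f2 y * (N^-1%:C * S (symD e) y)) ->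
  cint muC2 (fun y : mC2 R => f1 y * (N^-1%:C * S (symA e) y)) =
  cint muC2 (fun y : mC2 R => f1 y * (N^-1%:C * S (symB e) y)) + cint muC2 (fun y : mC2 R => f2 y * (N^-1%:C * S (symD e) y)).
Proof.
move=> iA iB iD; apply/eqP; rewrite -subr_eq0 opprD addrA -cintB// -cintB//; last exact: cintegrableB.
rewrite (_ : (fun y : mC2 R => _) = fun y : mC2 R => N^-1%:C * cint muC2 (fun q : mC2 R => F (y, q))); last first.
  by apply/funext => y; rewrite -pointwise; ring.
have [N0|N0] := eqVneq N 0.
  by rewrite N0 invr0 (_ : (fun y : mC2 R => _) = fun=> 0) ?cint0//; apply/funext => y; rewrite mul0r.
have NC : N^-1%:C != 0 :> R[i] by rewrite -normc_gt0 normc_real normr_gt0 invr_neq0.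
have iF : cintegrable muC2 (fun y : mC2 R => cint muC2 (fun q : mC2 R => F (y, q))).
  have := @cintegrableZ _ _ _ _ (N^-1%:C)^-1 _ (cintegrableB (cintegrableB iA iB) iD).
  congr cintegrable; apply/funext => y; rewrite -pointwise -[RHS](mulKf NC); congr (_ * _).
  move: (S (symA e) y) (S (symB e) y) (S (symD e) y) (f1 y) (f2 y) => a b c u v; ring.
by rewrite cintZ// total0 mulr0.
Qed.
End level.

Let normc_symA e w : 1 - m / 2 <= e -> e <= 1 -> forall M, 0 <= M -> (forall w, normc (Psi2 w) <= M) ->
  normc (symA e w) <= 2 * opA_bound m M.
Proof.
move=> em e1 M M0 PM; have b := normc_opA m0 em e1 cP2 PP2 PM w.
rewrite /symA normcM normcJE; have [w1|w1] := leP (normc (cplx w.2)) 1.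
  by rewrite -[leRHS]mul1r; apply: ler_pM => //; exact: normc_ge0.
have [-> _] := op_out m0 e1 PP2 (or_intror w1); rewrite normc0 mulr0.
exact: le_trans (normc_ge0 _) b.
Qed.

Let symD_eq0 e (w : C2 R) : e <= 1 -> 1 < normc (cplx w.1) \/ 1 < normc (cplx w.2) -> symD e w = 0.
Proof.
move=> e1 w1; rewrite /symD; have [_ ->] := op_out m0 e1 PP w1.
case: w w1 => [u v] /= [w1|w1]; first by rewrite (core_eq0l m0 PP)// mulr0 addr0.
by rewrite (core_eq0r m0 PP)// mulr0 addr0.
Qed.

Let normc_symD e w : 1 - m / 2 <= e -> e <= 1 -> forall M, 0 <= M -> (forall w, normc (Psi w) <= M) ->
  normc (symD e w) <= pompC * M + 2 * (2 * (2 / m) ^+ 3 * M * 4) /\ normc (symB e w) <= pompC * M + 2 * (2 * (2 / m) ^+ 3 * M * 4).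
Proof.
move=> em e1 M M0 PM; have b := normc_opB m0 em e1 cP PP PM w.
have D : normc (symD e w) <= pompC * M + 2 * (2 * (2 / m) ^+ 3 * M * 4).
  rewrite /symD; apply: le_trans (le_normcD _ _) _; apply: lerD => //.
  rewrite mulNr normcN normcM normc_real gtr0_norm ?pompC_gt0//.
  by apply: ler_wpM2l; [exact: ltW pompC_gt0|exact: PM].
split => //; rewrite /symB normcM normcJE; have [w1|w1] := leP (normc (cplx w.1)) 1.
  by rewrite -[leRHS]mul1r; apply: ler_pM => //; exact: normc_ge0.
by rewrite symD_eq0 ?normc0 ?mulr0//; [exact: le_trans (normc_ge0 _) D|left].
Qed.

Let cut0 e (w : C2 R) : e <= 1 -> normc (cplx w.2) < m -> [/\ symA e w = 0, symB e w = 0 & symD e w = 0].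
Proof.
move=> e1 wm; have nv : ~~ (m <= normc (cplx w.2) <= 1 - m) by rewrite negb_and -ltNge wm.
have D : symD e w = 0.
  rewrite /symD (opB_eq0 e1 PP) ?PP ?mulr0 ?addr0//; last by right.
  by apply: contra nv => /and3P[_ -> ->].
by split; [rewrite /symA (opA_eq0 e1 PP2) ?mulr0//; right|rewrite /symB D mulr0|].
Qed.

(** Weak form of $K\partial_2 g_1=\pi g_2-Pg_2$. At each level [e < 1] the averaged identity is
    exact; the averages disappear and the level reaches 1 in the same limit, which avoids an
    iterated one. *)
Theorem closed_kernel_identity :
  cint muC2 (fun w : mC2 R => f1 (shear w) * symA 1 w) =
    cint muC2 (fun w : mC2 R => f1 (shear w) * symB 1 w) + cint muC2 (fun w : mC2 R => f2 (shear w) * symD 1 w) /\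
  [/\ cintegrable muC2 (fun w : mC2 R => f1 (shear w) * symA 1 w),
      cintegrable muC2 (fun w : mC2 R => f1 (shear w) * symB 1 w) &
      cintegrable muC2 (fun w : mC2 R => f2 (shear w) * symD 1 w)].
Proof.
have [M M0 PM] := ccont_bounded_core m0 cP PP; have [M2 M20 PM2] := ccont_bounded_core m0 cP2 PP2.
(* [e_ n] rises to 1 from the lowest admissible level [1 - m / 2], and [r n] is the radius bound
   under which bumps at that level stay inside the Hartogs triangle. *)
pose e_ (n : nat) : R := 1 - m / 2 * n.+1%:R^-1; pose r (n : nat) : R := (1 - e_ n) * m / 32.
have n1 (n : nat) : 0 < (n.+1%:R : R)^-1 <= 1 by rewrite invr_gt0 ltr0n /= invf_le1// ler1n.
have m2 : 0 < m / 2 by rewrite divr_gt0.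
have e_lt n : e_ n < 1 by have /andP[h _] := n1 n; rewrite /e_ gtrBl mulr_gt0.
have e_ge n : 1 - m / 2 <= e_ n by have /andP[_ h] := n1 n; rewrite /e_ lerD2l lerN2 ler_piMr// ltW.
have e_le n := ltW (e_lt n).
have ec : e_ n @[n --> \oo] --> (1 : R).
  rewrite -[X in _ --> X]subr0; apply: cvgB; first exact: cvg_cst.
  by rewrite -[X in _ --> X](mulr0 (m / 2)); apply: cvgM; [exact: cvg_cst|exact: invn_cvg0].
have r0 n : 0 < r n by rewrite /r divr_gt0// mulr_gt0// subr_gt0.
have rc : r n @[n --> \oo] --> (0 : R).
  have -> : (0 : R) = (1 - 1) * m / 32 by rewrite subrr !mul0r.
  by apply: cvgM; [apply: cvgM; [apply: cvgB; [exact: cvg_cst|exact: ec]|exact: cvg_cst]|exact: cvg_cst].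
pose N n := s2val (cid2 (bump_mass (r0 n))).
have N0 n : 0 < N n by exact: (s2valP (cid2 (bump_mass (r0 n)))).
have NE n := s2valP' (cid2 (bump_mass (r0 n))) : forall y : C2 R, (\int[muC2]_z (bump (r n) z y)%:E = (N n)%:E)%E.
have mid : 1 - m / 2 <= 1 by rewrite gerBl ltW.
have mA e : cmeas (symA e : mC2 R -> R[i]).
  by apply: cmeasM; [apply: cmeasJ; exact: cmeas_cplx2|exact: cmeas_opA].
have mD e : cmeas (symD e : mC2 R -> R[i]).
  apply: cmeasD; last exact: cmeas_opB.
  by apply: cmeasM; [exact: cmeas_cst|exact: ccont_cmeas2].
have mB e : cmeas (symB e : mC2 R -> R[i]).
  by apply: cmeasM; [apply: cmeasJ; exact: cmeas_cplx1|exact: mD].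
have sD (q : nat -> C2 R) (y : C2 R) : q n @[n --> \oo] --> y -> normc (symD (e_ n) (q n) - symD 1 y) @[n --> \oo] --> (0 : R).
  move=> qy; apply: normc_cvgD; last exact: (opB_cvg m0 cP PP PM e_ge e_le mid (lexx 1) ec qy).
  by apply: normc_cvgM; [exact: normc_cvg_cst|exact: (ccont_cvg cP qy)].
have FA : fam m (fun n => symA (e_ n)) (symA 1) (2 * opA_bound m M2).
  split => //.
  - by move=> n q; exact: normc_symA.
  - by move=> n q qm; split; [case: (cut0 (e_le n) qm)|case: (cut0 (lexx 1) qm)].
  - move=> q y qy; apply: normc_cvgM; first exact: (ccont_cvg (ccontJ ccont_snd) qy).
    exact: (opA_cvg m0 cP2 PP2 PM2 e_ge e_le mid (lexx 1) ec qy).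
have FD : fam m (fun n => symD (e_ n)) (symD 1) (pompC * M + 2 * (2 * (2 / m) ^+ 3 * M * 4)).
  split => //.
  - by move=> n q; case: (normc_symD q (e_ge n) (e_le n) M0 PM).
  - by move=> n q qm; split; [case: (cut0 (e_le n) qm)|case: (cut0 (lexx 1) qm)].
have FB : fam m (fun n => symB (e_ n)) (symB 1) (pompC * M + 2 * (2 * (2 / m) ^+ 3 * M * 4)).
  split => //.
  - by move=> n q; case: (normc_symD q (e_ge n) (e_le n) M0 PM).
  - by move=> n q qm; split; [case: (cut0 (e_le n) qm)|case: (cut0 (lexx 1) qm)].
  - by move=> q y qy; apply: normc_cvgM; [exact: (ccont_cvg (ccontJ ccont_fst) qy)|exact: sD].
have [lA iA] := fam_limit m0 r0 rc N0 NE FA if1.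
have [lB iB] := fam_limit m0 r0 rc N0 NE FB if1.
have [lD iD] := fam_limit m0 r0 rc N0 NE FD if2.
split => //; apply: (normc_cvg_unique lA).
have E n : cint muC2 (fun y : mC2 R => f1 y * avg r N n (symA (e_ n)) y) =
    cint muC2 (fun y : mC2 R => f1 y * avg r N n (symB (e_ n)) y) + cint muC2 (fun y : mC2 R => f2 y * avg r N n (symD (e_ n)) y).
  apply: (@level_identity (e_ n) (r n) (e_ge n) (e_lt n) (r0 n) (lexx _) (N n)).
  - exact: (cintegrable_fam_avg m0 N0 NE n FA if1).
  - exact: (cintegrable_fam_avg m0 N0 NE n FB if1).
  - exact: (cintegrable_fam_avg m0 N0 NE n FD if2).
under eq_fun => n do rewrite E.
exact: normc_cvgD.
Qed.
End star.

(** * Moving kernel operators onto the test function *)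

Section adjoint.
Context {R : realType}.
Local Notation muC := (@lebesgueC R).
Local Notation muC2 := (@lebesgueC2 R).

(** Fubini's theorem in the three variables [w], [x] and the spectator [v]. The uniform bound [kC]
    on the transposed side, together with integrability of [g], gives absolute convergence; [F] and
    [F'] are two orderings of one integrand. *)
Lemma kernel_adjoint (k : R * R -> R * R -> R[i]) (g psi : mC2 R -> R[i]) (C : R) : 0 <= C ->
  cmeas (fun z : mC2 R => k z.1 z.2) -> cintegrable muC2 g -> cmeas psi ->
  (forall x v, (\int[muC]_w (normc (k w x * psi (w, v)))%:E <= C%:E)%E) ->
  let V := fun w : mC2 R => cint muC (fun x : mC R => k w.1 x * g (x, w.2)) in
  let A := fun q : mC2 R => cint muC (fun w : mC R => k w q.1 * psi (w, q.2)) in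
  [/\ cintegrable muC2 (fun w => V w * psi w), cintegrable muC2 (fun q => g q * A q) &
    cint muC2 (fun w => V w * psi w) = cint muC2 (fun q => g q * A q)].
Proof.
move=> C0 mk ig mp kC V A; have mg := cintegrable_cmeas ig.
pose F (z : mC2 R * mC R) : R[i] := k z.1.1 z.2 * g (z.2, z.1.2) * psi z.1.
pose F' (z : mC R * mC2 R) : R[i] := F ((z.2.1, z.1), z.2.2).
have m11 d (T : measurableType d) : measurable_fun setT (fun z : mC2 R * T => z.1.1) := measurableT_comp measurable_fst measurable_fst.
have m12 d (T : measurableType d) : measurable_fun setT (fun z : mC2 R * T => z.1.2) := measurableT_comp measurable_snd measurable_fst.
have m21 : measurable_fun setT (fun z : mC R * mC2 R => z.2.1) := measurableT_comp measurable_fst measurable_snd.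
have m22 : measurable_fun setT (fun z : mC R * mC2 R => z.2.2) := measurableT_comp measurable_snd measurable_snd.
have mF : cmeas F.
  apply: cmeasM; last exact: (cmeas_comp mp measurable_fst).
  apply: cmeasM.
    exact: (cmeas_comp mk (measurable_fun_pair (m11 _ _) measurable_snd)).
  exact: (cmeas_comp mg (measurable_fun_pair measurable_snd (m12 _ _))).
have mF' : cmeas F'.
  apply: (cmeas_comp (h := fun z : mC R * mC2 R => (((z.2.1, z.1), z.2.2) : mC2 R * mC R)) mF).
  exact: (measurable_fun_pair (measurable_fun_pair m21 measurable_fst) m22).
have n0 d (T : measurableType d) (h : T -> R[i]) t : (0 <= (normc (h t))%:E)%E by rewrite lee_fin normc_ge0.
have mn d (T : measurableType d) (h : T -> R[i]) : cmeas h -> measurable_fun setT (fun t => (normc (h t))%:E).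
  by move=> mh; apply/measurable_EFinP; exact: measurable_normc.
(* With [w] integrated innermost the uniform bound [C] comes out and leaves the integral of
   [|g|]. *)
have Too : (\int[muC]_v \int[muC2]_z (normc (F' (v, z)))%:E < +oo)%E.
  have gE : (\int[muC2]_q (normc (g q))%:E < +oo)%E by exact: cintegrable_normc_lty.
  rewrite (@fubini_tonelli2 _ _ _ _ _ muC muC _ (mn _ _ _ mg) (n0 _ _ g)) in gE.
  apply: (@le_lt_trans _ _ (\int[muC]_v (C%:E * \int[muC]_x (normc (g (x, v)))%:E))%E); last first.
    rewrite ge0_integralZl//; first by apply: lte_mul_pinfty.
    - by apply: (measurable_int2 muC (mn _ _ _ mg)) => z; exact: n0.
    - by move=> v _; apply: integral_ge0 => x _; exact: n0.
  apply: ge0_le_integral => //.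
  - by move=> v _; apply: integral_ge0 => z _; exact: n0.
  - by apply: (measurable_int1 muC2 (mn _ _ _ mF')) => z; exact: n0.
  - by apply: measurable_funeM; apply: (measurable_int2 muC (mn _ _ _ mg)) => z; exact: n0.
  - move=> v _; have mFv := cmeas_pair1 v mF'.
    rewrite (@fubini_tonelli2 _ _ _ _ _ muC muC (fun z => (normc (F' (v, z)))%:E) (mn _ _ _ mFv) (n0 _ _ _)).
    have mgv : measurable_fun setT (fun x : mC R => (normc (g (x, v)))%:E) := mn _ _ _ (cmeas_pair2 v mg).
    have -> : (C%:E * \int[muC]_x (normc (g (x, v)))%:E = \int[muC]_x (C%:E * (normc (g (x, v)))%:E))%E.
      have nn : forall x : mC R, setT x -> (0 <= (normc (g (x, v)))%:E)%E by move=> x _; exact: n0.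
      have Ce : (0 <= C%:E)%E by rewrite lee_fin.
      by rewrite (@ge0_integralZl _ _ _ muC _ measurableT _ mgv C%:E nn Ce).
    apply: ge0_le_integral => //.
    - by move=> x _; apply: integral_ge0 => w _; exact: n0.
    - by apply: (measurable_int2 muC (mn _ _ _ mFv)) => z; exact: n0.
    - exact: measurable_funeM.
    - move=> x _; rewrite /fubini_G /F' /F /=.
      under eq_integral => w _.
        rewrite (_ : normc _ = normc (g (x, v)) * normc (k w x * psi (w, v))); last by rewrite !normcM; ring.
        rewrite EFinM; over.
      have mkp : cmeas (fun w : mC R => k w x * psi (w, v)) by apply: cmeasM; [exact: (cmeas_pair2 x mk)|exact: cmeas_pair2].
      rewrite (@ge0_integralZl _ _ _ muC _ measurableT _ (mn _ _ _ mkp) (normc (g (x, v)))%:E (fun w _ => n0 _ _ (fun w : mC R => k w x * psi (w, v)) w) (n0 _ _ g (x, v))).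
      by rewrite [leRHS]muleC; apply: lee_wpmul2l; [exact: n0|exact: kC].
have iF' : cintegrable (muC \x muC2)%E F' by exact: cintegrable_prod.
have iF : cintegrable (muC2 \x muC)%E F.
  apply: cintegrable_prod => //.
  have mI : measurable_fun setT (fun z : mC2 R => (\int[muC]_x (normc (F (z, x)))%:E)%E).
    by apply: (measurable_int1 muC (mn _ _ _ mF)) => z; exact: n0.
  rewrite (@fubini_tonelli2 _ _ _ _ _ muC muC _ mI); last by move=> z; apply: integral_ge0 => x _; exact: n0.
  move: Too; congr (_ < _)%E; apply: eq_integral => v _.
  by rewrite (@fubini_tonelli1 _ _ _ _ _ muC muC (fun z => (normc (F' (v, z)))%:E) (mn _ _ _ (cmeas_pair1 v mF')) (n0 _ _ _)).
have mV : cmeas V.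
  apply: (@cmeas_cint _ _ _ _ _ muC (fun z : mC2 R * mC R => k z.1.1 z.2 * g (z.2, z.1.2))).
  apply: cmeasM.
    exact: (cmeas_comp mk (measurable_fun_pair (m11 _ _) measurable_snd)).
  exact: (cmeas_comp mg (measurable_fun_pair measurable_snd (m12 _ _))).
have mA : cmeas A.
  apply: (@cmeas_cint _ _ _ _ _ muC (fun z : mC2 R * mC R => k z.2 z.1.1 * psi (z.2, z.1.2))).
  apply: cmeasM.
    exact: (cmeas_comp mk (measurable_fun_pair measurable_snd (m11 _ _))).
  exact: (cmeas_comp mp (measurable_fun_pair measurable_snd (m12 _ _))).
have iP := cintegrable_cint iF.
(* [V w] is a default value where its slice is not integrable. Where [psi w] is nonzero,
   integrability of the slice of [F] passes to that of [V]; where it is 0, both sides vanish. *)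
have ae1 : ae_eq muC2 setT (fun w => cint muC (fun x => F (w, x))) (fun w => V w * psi w).
  apply: ae_eqT; apply: (ae_impl _ (ae_cintegrable1 iF)) => w iw.
  have [p0|p0] := eqVneq (psi w) 0.
    by rewrite p0 mulr0 -[RHS](cint0 muC); congr cint; apply/funext => x; rewrite /F /= p0 mulr0.
  have ik : cintegrable muC (fun x : mC R => k w.1 x * g (x, w.2)).
    have := cintegrableZ (psi w)^-1 iw; congr cintegrable; apply/funext => x.
    by rewrite /F /= mulrC mulfK.
  by rewrite mulrC -cintZ//; congr cint; apply/funext => x; rewrite /F /= mulrC.
have mVp : cmeas (fun w => V w * psi w) by exact: cmeasM.
have iV := cintegrable_ae_eq mVp ae1 iP.
have AC q : normc (A q) <= 2 * C.
  rewrite -lee_fin; have mkp : cmeas (fun w : mC R => k w q.1 * psi (w, q.2)).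
    by apply: cmeasM; [exact: (cmeas_pair2 q.1 mk)|exact: cmeas_pair2].
  have h : ((normc (A q))%:E <= 2%:E * \int[muC]_w (normc (k w q.1 * psi (w, q.2)))%:E)%E by exact: ler_normc_cint.
  by apply: (le_trans h); rewrite EFinM; apply: lee_wpmul2l.
have iA : cintegrable muC2 (fun q => g q * A q).
  apply: (cintegrable_le _ _ (integrableZl measurableT (2 * C) (integrable_normc ig))) => [|q]; first exact: cmeasM.
  by rewrite normcM mulrC; apply: ler_wpM2r; [exact: normc_ge0|exact: AC].
split => //.
rewrite -(cint_ae_eq (cintegrable_cmeas iP) mVp ae1).
rewrite (@cint_prod2 _ _ _ _ _ muC muC _ iP) (@cint_prod2 _ _ _ _ _ muC muC _ iA).
apply: cint_ae_eq.
- exact: (@cmeas_cint2 _ _ _ _ _ muC _ (cintegrable_cmeas iP)).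
- exact: (@cmeas_cint2 _ _ _ _ _ muC _ (cintegrable_cmeas iA)).
apply: ae_eqT; apply: (ae_impl _ (ae_cintegrable1 iF')) => v iv.
transitivity (cint muC2 (fun z => F' (v, z))); first by rewrite (@cint_prod _ _ _ _ _ muC muC _ iv).
rewrite (@cint_prod2 _ _ _ _ _ muC muC _ iv); congr cint; apply/funext => x.
have ik : cintegrable muC (fun w : mC R => k w x * psi (w, v)).
  apply: cintegrable_lty; first by apply: cmeasM; [exact: (cmeas_pair2 x mk)|exact: cmeas_pair2].
  exact: le_lt_trans (kC x v) (ltry _).
by rewrite /A -cintZ//; congr cint; apply/funext => w; rewrite /F' /F /=; ring.
Qed.

Let swap (z : mC2 R) : mC2 R := (z.2, z.1).

Lemma cint_swap (f : mC2 R -> R[i]) : cintegrable muC2 f ->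
  cintegrable muC2 (fun z => f (z.2, z.1)) /\ cint muC2 (fun z => f (z.2, z.1)) = cint muC2 f.
Proof.
move=> iF; have mf := cintegrable_cmeas iF.
have ms : measurable_fun setT swap by exact: (measurable_fun_pair measurable_snd measurable_fst).
have mfs : cmeas (fun z : mC2 R => f (z.2, z.1)) by exact: (cmeas_comp mf ms).
have i2 : cintegrable muC2 (fun z : mC2 R => f (z.2, z.1)).
  apply: (@cintegrable_prod _ _ _ _ _ muC muC _ mfs).
  have := cintegrable_normc_lty iF.
  rewrite (@fubini_tonelli2 _ _ _ _ _ muC muC (fun z => (normc (f z))%:E))//.
    by apply/measurable_EFinP; exact: measurable_normc.
  by move=> z; rewrite lee_fin normc_ge0.
by split => //; rewrite (@cint_prod _ _ _ _ _ muC muC _ i2) (@cint_prod2 _ _ _ _ _ muC muC _ iF).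
Qed.
End adjoint.

(** * The weak equation in shear coordinates *)

Section weak_equation.
Context {R : realType}.
Local Notation muC := (@lebesgueC R).
Local Notation muC2 := (@lebesgueC2 R).
Variables (m : R) (Psi Psi1 Psi2 : C2 R -> R[i]) (tP : tst m Psi Psi1 Psi2).
Let m0 : 0 < m. Proof. by case: tP. Qed.
Let m1 : m < 1. Proof. by case: tP. Qed.
Let cP : ccont Psi. Proof. by case: tP => _ _ []. Qed.
Let cP1 : ccont Psi1. Proof. by case: tP => _ _ []. Qed.
Let cP2 : ccont Psi2. Proof. by case: tP => _ _ []. Qed.
Let PP w : ~~ core m w -> Psi w = 0. Proof. by case: tP => _ _ _ h /h[]. Qed.
Let PP1 w : ~~ core m w -> Psi1 w = 0. Proof. by case: tP => _ _ _ h /h[]. Qed.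
Let PP2 w : ~~ core m w -> Psi2 w = 0. Proof. by case: tP => _ _ _ h /h[]. Qed.
Let mid : 1 - m / 2 <= 1. Proof. by rewrite gerBl divr_ge0// ltW. Qed.

Lemma wirtX0 (H : R * R -> R[i]) n : wirt H (fun=> 0) -> wirt (fun w => H w ^+ n) (fun=> 0).
Proof.
move=> h; elim: n => [|n IH]; first exact: wirt_cst.
rewrite (_ : (fun w => _) = fun w => H w * H w ^+ n); last by apply/funext => w; rewrite exprS.
by apply: (wirt_eq (wirtM h IH)) => w; rewrite mul0r mulr0 addr0.
Qed.

(* The kernels are holomorphic in their first variable on the support of [Psi]. *)
Let wirt_hol (x v : R * R) (c : R[i]) n : normc (cplx x) < 1 ->
  wirt (fun w => c * Psi (w, v) / (1 - cplx w * ((cplx x)^*)%R) ^+ n)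
       (fun w => c * Psi1 (w, v) / (1 - cplx w * ((cplx x)^*)%R) ^+ n).
Proof.
move=> x1; have m20 : 0 < m / 2 by rewrite divr_gt0.
pose H (w : R * R) : R[i] := 1 - cplx w * ((cplx x)^*)%R.
have wH : wirt H (fun=> 0).
  apply: (wirt_eq (wirtD (wirt_cst 1) (wirtN (wirtM wirt_cplx (wirt_cst ((cplx x)^*)%R))))) => w.
  by rewrite mul0r mulr0 addr0 oppr0 addr0.
have [_ _ [_ _ _ w1 _] _] := tP.
have wN := wirtM (wirt_cst c) (w1 v).
have h w : normc (H w ^+ n) < (m / 2) ^+ n -> c * Psi (w, v) = 0.
  rewrite normcX => h; have [wc|wc] := boolP (core m (w, v)); last by rewrite PP// mulr0.
  have /and3P[/= wm _ _] := wc; move: h; rewrite ltNge lerXn2r// ?nnegrE ?(ltW m20) ?normc_ge0//.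
  exact: (den_ge mid wm (ltW x1)).
apply: (wirt_eq (wirt_div (exprn_gt0 n m20) wN (wirtX0 n wH) h)) => w; rewrite mul0r add0r mulr0 subr0.
have [->|Hn] := eqVneq (H w ^+ n) 0; first by rewrite mulr0 mul0r invr0 mulr0.
by rewrite -/(H w); field.
Qed.

Let cut (v w : R * R) : 1 < normc (cplx w) -> Psi (w, v) = 0.
Proof. exact: (core_eq0l m0 PP). Qed.

Let gap1 (x : R * R) : normc (cplx x) < 1 -> gap 1 (cplx x) = 1 - normc (cplx x) ^+ 2.
Proof. by move=> x1; rewrite /gap max_r// subr_ge0 expr_le1 ?normc_ge0// ltW. Qed.
(** Transposed form of $\partial_1 K=\pi$: the Cauchy-Pompeiu formula at [q.1] for [Psi] times the
    kernel factor, which is holomorphic in [w] and equal to 1 at [w = q.1]. *)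
Lemma opA_dbar1 (q : C2 R) : opA 1 Psi1 q = - pompC%:C * Psi q.
Proof.
have [x1|x1] := leP 1 (normc (cplx q.1)).
  rewrite (opA_eq0 (lexx 1) PP1); last by left.
  rewrite PP ?mulr0//; apply/negP => /and3P[h _ _].
  by move: h; rewrite leNgt => /negP; apply; apply: lt_le_trans x1; rewrite gtrBl.
pose c : R[i] := (gap 1 (cplx q.1) ^+ 2)%:C.
have XE w (F : R[i]) : Xk 1 w (cplx q.1) * F = c * F / (1 - w * ((cplx q.1)^*)%R) ^+ 2.
  by rewrite /Xk expr_div_n -rmorphXn mulrAC.
have := @pompeiu R _ _ 1 q.1 (wirt_hol q.2 c 2 x1).
have s (w : R * R) : 1 < normc (cplx w) -> c * Psi (w, q.2) / (1 - cplx w * ((cplx q.1)^*)%R) ^+ 2 = 0.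
  by move=> w1; rewrite cut// mulr0 mul0r.
move=> /(_ s); rewrite -XE => pE.
have -> : - pompC%:C * Psi q = - (pompC%:C * (Xk 1 (cplx q.1) (cplx q.1) * Psi (q.1, q.2))).
  rewrite -surjective_pairing; have [wc|wc] := boolP (core m q); last by rewrite PP// !mulr0 oppr0.
  by have /and3P[wm _ _] := wc; rewrite (Xk_diag m0 mid wm) mul1r mulNr.
have [M _ PM] := ccont_bounded_core m0 cP1 PP1.
rewrite -pE /opA; have i0 := cintegrable_XC_psi m0 mid (lexx 1) cP1 PP1 PM q.1 q.2.
have E : (fun w : mC R => c * Psi1 (w, q.2) / (1 - cplx w * ((cplx q.1)^*)%R) ^+ 2 / (cplx q.1 - cplx w)) =
    (fun w : mC R => - (Xk 1 (cplx w) (cplx q.1) / (cplx w - cplx q.1) * Psi1 (w, q.2))).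
  by apply/funext => w; rewrite -XE -(opprB (cplx w)) invrN mulrN mulrAC.
by rewrite E cintN// opprK.
Qed.

(** Transposed form of $\partial_1 P=0$: the kernel is holomorphic in [w], so the integrand is a
    conjugate derivative with compact support. *)
Lemma opB_dbar1 (q : C2 R) : opB 1 Psi1 q = 0.
Proof.
have [x1|x1] := leP 1 (normc (cplx q.1)); first by rewrite (opB_eq0 (lexx 1) PP1)//; left.
pose c : R[i] := (2 * 1 * gap 1 (cplx q.1))%:C.
have s (w : R * R) : 1 < normc (cplx w) -> c * Psi (w, q.2) / (1 - cplx w * ((cplx q.1)^*)%R) ^+ 3 = 0.
  by move=> w1; rewrite cut// mulr0 mul0r.
rewrite -(stokes (wirt_hol q.2 c 3 x1) s) /opB; congr cint; apply/funext => w.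
by rewrite /Pk mulrAC.
Qed.

Definition kC (v y : R * R) : R[i] := if disc v && disc y then (cplx v - cplx y)^-1 else 0.

Lemma cmeas_kC : cmeas (fun z : mC2 R => kC z.1 z.2).
Proof.
apply: cmeas_if.
- by apply: measurable_and; [exact: (measurableT_comp measurable_disc measurable_fst)|exact: (measurableT_comp measurable_disc measurable_snd)].
- by apply: cmeasV; apply: cmeasB; exact: cmeas_cplx.
- exact: cmeas_cst.
Qed.

Lemma normc_kC v y : normc (kC v y) <= riesz y 3 v.
Proof.
rewrite /kC; case: ifP => [/andP[dv dy]|_]; last by rewrite normc0 riesz_ge0.
rewrite /riesz ifT; first by rewrite normcV powR_inv1 ?normc_ge0// normcB.
by apply: le_trans (disc_normcB dy dv) _; rewrite ler_nat.
Qed.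

(** Transposed form of $\partial_2 W=1$, up to the normalization by $\pi$: after exchanging
    integrals, the Cauchy-Pompeiu formula is applied to [Psi] in its second variable. *)
Let opB_cauchy (x y : R * R) : disc y ->
  cint muC (fun v : mC R => kC v y * opB 1 Psi2 (x, v)) = - pompC%:C * opB 1 Psi (x, y).
Proof.
move=> dy; have [M M0 PM] := ccont_bounded_core m0 cP2 PP2.
pose F (z : mC2 R) : R[i] := Pk 1 (cplx z.1) (cplx x) * Psi2 (z.1, z.2) * kC z.2 y.
have mkC : cmeas (fun v : mC R => kC v y) by exact: (cmeas_pair2 y cmeas_kC).
have mPk : cmeas (fun w : mC R => Pk 1 (cplx w) (cplx x)).
  by apply: cmeas_Pk; [exact: cmeas_cplx|exact: cmeas_cst].
have mF : cmeas F.
  apply: cmeasM; last exact: (cmeas_comp mkC measurable_snd).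
  apply: cmeasM; first exact: (cmeas_comp mPk measurable_fst).
  by apply: (cmeas_swap cP2); [exact: measurable_fst|exact: measurable_snd].
have iF : cintegrable muC2 F.
  apply: (@cintegrable_riesz2 _ F (fun=> y) (2 * (2 / m) ^+ 3 * M) mF) => [w v|w v w1]; last first.
    by rewrite /F /= (core_eq0l m0 PP2)// mulr0 mul0r.
  have h := ler_pM (normc_ge0 _) (normc_ge0 _) (normc_Pk_core m0 mid (lexx 1) w x v PP2 PM) (normc_kC v y).
  by rewrite /F normcM; exact: h.
have slice v : cintegrable muC (fun w : mC R => Pk 1 (cplx w) (cplx x) * Psi2 (w, v)).
  exact: (cintegrable_PC_psi m0 mid (lexx 1) cP2 PP2 PM).
transitivity (cint muC (fun v : mC R => cint muC (fun w : mC R => F (w, v)))).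
  congr cint; apply/funext => v; rewrite /opB -cintZ//; congr cint; apply/funext => w.
  by rewrite /F /= mulrC.
rewrite -(@cint_prod2 _ _ _ _ _ muC muC F iF) (@cint_prod _ _ _ _ _ muC muC F iF).
have [MP _ PMP] := ccont_bounded_core m0 cP PP.
rewrite /opB -cintZ; last exact: (cintegrable_PC_psi m0 mid (lexx 1) cP PP PMP).
congr cint; apply/funext => w.
have [_ _ [_ _ _ _ w2] _] := tP.
have s (v : R * R) : 1 < normc (cplx v) -> Psi (w, v) = 0 by exact: (core_eq0r m0 PP).
have pE := pompeiu y (w2 w) s.
have i0 : cintegrable muC (fun v : mC R => Psi2 (w, v) / (cplx y - cplx v)).
  apply: (@cintegrable_cauchy _ _ 1 M y ltr01) => [|v|v v1].
  - exact: (ccont_cmeas (ccont_slice2 w cP2)).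
  - exact: PM.
  - exact: (core_eq0r m0 PP2).
rewrite [RHS]mulrCA mulNr -pE -cintN// -cintZ; last exact: cintegrableN.
congr cint; apply/funext => v; rewrite /F /= /kC dy andbT; case: ifPn => dv.
  by rewrite -(opprB (cplx y)) invrN mulrN -mulrA -mulrN.
rewrite (PP2 (w := (w, v))) ?mulr0 ?mul0r ?oppr0 ?mulr0//.
apply: contra dv => /and3P[_ _ /= h]; apply: le_lt_trans h _; by rewrite gtrBl.
Qed.

(** The factor $1/\pi$ is attached to the Cauchy transform, so that it inverts the derivative in
    $\bar w_2$ exactly; [solK] and [solP] stay unnormalized and share the outer factor of [sol]. *)
Definition solW (g : C2 R -> R[i]) (w : mC2 R) : R[i] :=
  pompC^-1%:C * cint muC (fun y : mC R => kC w.2 y * g (w.1, y)).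
Definition solK (g : C2 R -> R[i]) (w : mC2 R) : R[i] :=
  cint muC (fun x : mC R => Xk 1 (cplx w.1) (cplx x) / (cplx w.1 - cplx x) * g (x, w.2)).
Definition solP (g : C2 R -> R[i]) (w : mC2 R) : R[i] :=
  cint muC (fun x : mC R => Pk 1 (cplx w.1) (cplx x) * g (x, w.2)).
Definition sol (g1 g2 : C2 R -> R[i]) (w : mC2 R) : R[i] :=
  pompC^-1%:C * (solK g1 w + solP (solW g2) w).

Let pC0 : pompC%:C != 0 :> R[i].
Proof. by rewrite -normc_gt0 normc_real normr_gt0 gt_eqF// pompC_gt0. Qed.

Let pCV : pompC^-1%:C = (pompC%:C)^-1 :> R[i]. Proof. by rewrite fmorphV. Qed.

Let cN : R := (2 * (3 `^ (1 - 1 / 2) / (1 - 1 / 2))) ^+ 2.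

(** Exchanging the two complex variables brings the Cauchy transform into the form treated by
    [kernel_adjoint]. Bounded [psi] must be allowed, since [opB 1 Psi2] does not have its first
    variable confined to the core. *)
Lemma solW_adjoint (g psi : C2 R -> R[i]) (K : R) : cintegrable muC2 (g : mC2 R -> R[i]) -> 0 <= K ->
  cmeas (psi : mC2 R -> R[i]) -> (forall q, normc (psi q) <= K) ->
  cintegrable muC2 (fun w : mC2 R => solW g w * psi w) /\
  cint muC2 (fun w : mC2 R => solW g w * psi w) =
    pompC^-1%:C * cint muC2 (fun q : mC2 R => g q * cint muC (fun v : mC R => kC v q.2 * psi (q.1, v))).
Proof.
move=> ig K0 mpsi pK; have [igs egs] := cint_swap ig.
have N0 : 0 <= cN by exact: sqr_ge0.
have mps : cmeas (fun z : mC2 R => psi (z.2, z.1)).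
  by apply: (cmeas_comp mpsi); exact: (measurable_fun_pair measurable_snd measurable_fst).
have bound x v : (\int[muC]_w (normc (kC w x * psi (v, w)))%:E <= (K * cN)%:E)%E.
  apply: (@le_trans _ _ (\int[muC]_w (K%:E * (riesz x 3 w)%:E))%E).
    apply: ge0_le_integral => //.
    - by move=> w _; rewrite lee_fin normc_ge0.
    - by apply/measurable_EFinP/measurable_normc; apply: cmeasM; [exact: (cmeas_pair2 x cmeas_kC)|exact: cmeas_pair1].
    - by apply: measurable_funeM; apply/measurable_EFinP; exact: measurable_riesz.
    - move=> w _; rewrite -EFinM lee_fin normcM mulrC.
      by apply: ler_pM; [exact: normc_ge0|exact: normc_ge0|exact: pK|exact: normc_kC].
  rewrite ge0_integralZl//; last 2 first.
  - by apply/measurable_EFinP; exact: measurable_riesz.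
  - by move=> w _; rewrite lee_fin riesz_ge0.
  rewrite [leRHS]EFinM; apply: lee_wpmul2l; first by rewrite lee_fin.
  exact: (integral_riesz x ltr01 (ltr1n R 2) (ltr0Sn R 2)).
have [i1 i2 e1] := kernel_adjoint (mulr_ge0 K0 N0) cmeas_kC igs mps bound.
have [j1 f1] := cint_swap i1; have [j2 f2] := cint_swap i2.
have E : (fun w : mC2 R => solW g w * psi w) = (fun w : mC2 R =>
    pompC^-1%:C * (cint muC (fun y : mC R => kC w.2 y * g (w.1, y)) * psi (w.1, w.2))).
  by apply/funext => w; rewrite /solW mulrA -surjective_pairing.
rewrite E; split; first exact: cintegrableZ.
have E2 : (fun q : mC2 R => g q * cint muC (fun v : mC R => kC v q.2 * psi (q.1, v))) =
    (fun q : mC2 R => g (q.1, q.2) * cint muC (fun v : mC R => kC v q.2 * psi (q.1, v))).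
  by apply/funext => q; rewrite -surjective_pairing.
rewrite (cintZ _ j1) E2; congr (_ * _).
exact: (etrans f1 (etrans e1 (esym f2))).
Qed.

Variables (f1 f2 : C2 R -> R[i]).
Hypotheses (if1 : cintegrable muC2 (f1 : mC2 R -> R[i])) (if2 : cintegrable muC2 (f2 : mC2 R -> R[i])).
Hypothesis closed12 : forall phi, test_funH phi ->
  cint muC2 (fun y : mC2 R => f2 y * dzbar 0 phi y) = cint muC2 (fun y : mC2 R => f1 y * dzbar 1 phi y).
Let g1 (w : C2 R) : R[i] := ((cplx w.2)^*)%R * f1 (shear w).
Let g2 (w : C2 R) : R[i] := ((cplx w.1)^*)%R * f1 (shear w) + f2 (shear w).
Hypotheses (ig1 : cintegrable muC2 (g1 : mC2 R -> R[i])) (ig2 : cintegrable muC2 (g2 : mC2 R -> R[i])).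
Hypothesis g2_disc : forall q, ~~ disc q.2 -> g2 q = 0.

Let mfst' : measurable_fun setT (fun z : mC2 R => z.1) := measurable_fst.
Let msnd' : measurable_fun setT (fun z : mC2 R => z.2) := measurable_snd.
Let iW : cintegrable muC2 (solW g2).
Proof.
have n1 (q : C2 R) : normc (1 : R[i]) <= 1 by rewrite normc1.
have mc : cmeas (fun _ : mC2 R => 1 : R[i]) by exact: cmeas_cst.
have [+ _] := @solW_adjoint g2 (fun=> 1) 1 ig2 ler01 mc n1.
by congr cintegrable; apply/funext => w; rewrite mulr1.
Qed.

Let pairing (psi : C2 R -> R[i]) : ccont psi -> (forall w, ~~ core m w -> psi w = 0) ->
  [/\ cintegrable muC2 (fun w => sol g1 g2 w * psi w), cintegrable muC2 (fun q => g1 q * opA 1 psi q),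
      cintegrable muC2 (fun q => solW g2 q * opB 1 psi q) &
  cint muC2 (fun w => sol g1 g2 w * psi w) =
  pompC^-1%:C * (cint muC2 (fun q => g1 q * opA 1 psi q) + cint muC2 (fun q => solW g2 q * opB 1 psi q))].
Proof.
move=> cp p0; have [M M0 pM] := ccont_bounded_core m0 cp p0.
have mp := ccont_cmeas2 cp.
have mX : cmeas (fun z : mC2 R => Xk 1 (cplx z.1) (cplx z.2) / (cplx z.1 - cplx z.2)).
  apply: cmeasM; first by apply: cmeas_Xk; exact: cmeas_cplx.
  by apply: cmeasV; apply: cmeasB; exact: cmeas_cplx.
have mP : cmeas (fun z : mC2 R => Pk 1 (cplx z.1) (cplx z.2)) by apply: cmeas_Pk; exact: cmeas_cplx.
have bX x v := integral_XC_le m0 mid (lexx 1) cp p0 pM x v.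
have bP x v := integral_PC_le m0 mid (lexx 1) cp p0 pM x v.
have bX0 : 0 <= opA_bound m M by rewrite -lee_fin; apply: le_trans (bX 0 0); apply: integral_ge0 => w _; rewrite lee_fin normc_ge0.
have bP0 : 0 <= 2 * (2 / m) ^+ 3 * M * 4 by rewrite -lee_fin; apply: le_trans (bP 0 0); apply: integral_ge0 => w _; rewrite lee_fin normc_ge0.
have [i1 i2 e1] := kernel_adjoint (k := fun w x => Xk 1 (cplx w) (cplx x) / (cplx w - cplx x)) bX0 mX ig1 mp bX.
have [i3 i4 e2] := kernel_adjoint (k := fun w x => Pk 1 (cplx w) (cplx x)) bP0 mP iW mp bP.
have E : (fun w => sol g1 g2 w * psi w) = (fun w => pompC^-1%:C * (solK g1 w * psi w + solP (solW g2) w * psi w)).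
  by apply/funext => w; rewrite /sol -mulrDl mulrA.
split => //; first by rewrite E; apply: cintegrableZ; exact: cintegrableD.
rewrite E cintZ; last exact: cintegrableD.
by rewrite cintD// e1 e2.
Qed.

(** On the transposed side the term with [K] becomes $-\pi\int g_1\Psi$ and the term with [P]
    vanishes. *)
Lemma weak_dbar1 : cintegrable muC2 (fun w => sol g1 g2 w * Psi1 w) /\
  cint muC2 (fun w => sol g1 g2 w * Psi1 w) = - cint muC2 (fun w : mC2 R => g1 w * Psi w).
Proof.
have [i0 i1 i2 ->] := pairing cP1 PP1; split => //.
have e1 : (fun q : mC2 R => g1 q * opA 1 Psi1 q) = (fun q : mC2 R => - pompC%:C * (g1 q * Psi q)).
  by apply/funext => q; rewrite opA_dbar1 mulrCA.
have e2 : (fun q : mC2 R => solW g2 q * opB 1 Psi1 q) = (fun=> 0) by apply/funext => q; rewrite opB_dbar1 mulr0.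
have i3 : cintegrable muC2 (fun q : mC2 R => g1 q * Psi q).
  have [M M0 PM] := ccont_bounded_core m0 cP PP.
  apply: (cintegrable_le _ _ (integrableZl measurableT M (integrable_normc ig1))) => [|q].
    by apply: cmeasM; [exact: cintegrable_cmeas ig1|exact: ccont_cmeas2].
  by rewrite normcM mulrC; apply: ler_wpM2r; [exact: normc_ge0|exact: PM].
by rewrite e1 e2 cint0 addr0 cintZ// pCV mulNr mulrN mulKf.
Qed.

(** Closedness turns the term with [K] into $\int g_2(-\pi\Psi+B\Psi)$, with $B$ for [opB 1]; moving
    the Cauchy transform turns the other into $-\int g_2\,B\Psi$. The contributions of [P]
    cancel. *)
Lemma weak_dbar2 : cintegrable muC2 (fun w => sol g1 g2 w * Psi2 w) /\
  cint muC2 (fun w => sol g1 g2 w * Psi2 w) = - cint muC2 (fun w : mC2 R => g2 w * Psi w).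
Proof.
have [i0 i1 i2 ->] := pairing cP2 PP2; split => //.
have [st [iA iB iD]] := closed_kernel_identity if1 if2 closed12 tP.
have [M M0 PM] := ccont_bounded_core m0 cP PP; have [M2 M20 PM2] := ccont_bounded_core m0 cP2 PP2.
have eA : (fun q : mC2 R => g1 q * opA 1 Psi2 q) = (fun w : mC2 R => f1 (shear w) * symA Psi2 1 w).
  by apply/funext => q; rewrite /g1 /symA mulrAC mulrCA mulrA [RHS]mulrC mulrA; ring.
have eW := @solW_adjoint g2 (opB 1 Psi2) _ ig2 (le_trans (normc_ge0 _) (normc_opB m0 mid (lexx 1) cP2 PP2 PM2 0))
  (cmeas_opB 1 cP2) (normc_opB m0 mid (lexx 1) cP2 PP2 PM2).
have eT : (fun q : mC2 R => g2 q * cint muC (fun v : mC R => kC v q.2 * opB 1 Psi2 (q.1, v))) =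
    (fun q : mC2 R => - pompC%:C * (g2 q * opB 1 Psi q)).
  apply/funext => q; have [dq|dq] := boolP (disc q.2); last by rewrite g2_disc// !mul0r mulr0.
  by rewrite opB_cauchy// -surjective_pairing mulrCA.
have igb : cintegrable muC2 (fun q : mC2 R => g2 q * opB 1 Psi q).
  apply: (cintegrable_le _ _ (integrableZl measurableT (2 * (2 * (2 / m) ^+ 3 * M * 4)) (integrable_normc ig2))) => [|q].
    by apply: cmeasM; [exact: cintegrable_cmeas ig2|exact: cmeas_opB].
  by rewrite normcM mulrC; apply: ler_wpM2r; [exact: normc_ge0|exact: (normc_opB m0 mid (lexx 1) cP PP PM)].
have igp : cintegrable muC2 (fun q : mC2 R => g2 q * Psi q).
  apply: (cintegrable_le _ _ (integrableZl measurableT M (integrable_normc ig2))) => [|q].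
    by apply: cmeasM; [exact: cintegrable_cmeas ig2|exact: ccont_cmeas2].
  by rewrite normcM mulrC; apply: ler_wpM2r; [exact: normc_ge0|exact: PM].
rewrite (proj2 eW) eT cintZ// eA st -cintD//.
have -> : (fun w : mC2 R => f1 (shear w) * symB Psi 1 w + f2 (shear w) * symD Psi 1 w) =
    (fun q : mC2 R => - pompC%:C * (g2 q * Psi q) + g2 q * opB 1 Psi q).
  by apply/funext => q; rewrite /symB /symD /g2; ring.
rewrite cintD//; last exact: cintegrableZ.
rewrite cintZ// pCV; move: (cint _ _) (cint _ _) => a b; field.
exact: pC0.
Qed.
End weak_equation.

(** * The Lp estimate on the product *)

Section Lp_estimate.
Context {R : realType}.
Local Notation muC := (@lebesgueC R).
Local Notation muC2 := (@lebesgueC2 R).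

Lemma powR_add_le (p a b : R) : 0 <= p -> 0 <= a -> 0 <= b -> (a + b) `^ p <= 2 `^ p * (a `^ p + b `^ p).
Proof.
move=> p0 a0 b0; wlog ab : a b a0 b0 / a <= b => [W|].
  by case: (leP a b) => [|/ltW] ab; [exact: W|rewrite addrC [_ `^ p + _]addrC; exact: W].
apply: (@le_trans _ _ ((2 * b) `^ p)).
  by apply: ge0_ler_powR; rewrite ?nnegrE ?addr_ge0 ?mulr_ge0// mulr_natl mulr2n lerD2r.
by rewrite powRM// ler_wpM2l ?powR_ge0// lerDr powR_ge0.
Qed.

(** Passes from a Schur bound for the nonnegative kernel [A] to the complex operator with kernel [k]
    conjugated by the weight [s]. The kernel comparison is asked only where [h] is nonzero, because
    it fails where the weight degenerates. The factor $2^p$ comes from [ler_normc_cint]. *)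
Lemma cintegral_powR_le (p C : R) (A : mC2 R -> R) (k : mC R -> mC R -> R[i]) (s : mC R -> R) (h : mC R -> R[i]) :
  0 < p -> measurable_fun setT A -> (forall z, 0 <= A z) ->
  (forall F : mC R -> R, measurable_fun setT F -> (forall x, 0 <= F x) ->
    (\int[muC]_w (\int[muC]_x (A (w, x) * F x)%:E) `^ p <= C%:E * \int[muC]_x (F x `^ p)%:E)%E) ->
  cmeas (fun z : mC2 R => k z.1 z.2) -> measurable_fun setT s -> (forall x, 0 <= s x) -> cmeas h ->
  (forall w x, h x != 0 -> disc w -> s w * normc (k w x) <= A (w, x) * s x) ->
  (\int[muC]_w (if disc w then (s w * normc (cint muC (fun x : mC R => k w x * h x))) `^ p else 0)%:E <=
   (2 `^ p * C)%:E * \int[muC]_x ((s x * normc (h x)) `^ p)%:E)%E.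
Proof.
move=> p0 mA A0 bnd mk ms s0 mh skA; pose F x := s x * normc (h x).
have mF : measurable_fun setT F by apply: measurable_funM => //; exact: measurable_normc.
have F0 x : 0 <= F x by exact: (mulr_ge0 (s0 _) (normc_ge0 _)).
have mN : cmeas (fun w : mC R => cint muC (fun x : mC R => k w x * h x)).
  apply: (@cmeas_cint _ _ _ _ _ muC (fun z : mC2 R => k z.1 z.2 * h z.2)).
  by apply: cmeasM => //; exact: (cmeas_comp mh measurable_snd).
have mAF : measurable_fun setT (fun z : mC2 R => (A z * F z.2)%:E).
  by apply/measurable_EFinP; apply: measurable_funM => //; exact: (measurableT_comp mF measurable_snd).
have AF0 (z : mC2 R) : (0 <= (A z * F z.2)%:E)%E by rewrite lee_fin; exact: (mulr_ge0 (A0 _) (F0 _)).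
have mI : measurable_fun setT (fun w : mC R => \int[muC]_x (A (w, x) * F x)%:E)%E.
  exact: (measurable_int1 muC mAF AF0).
have I0 w : (0 <= \int[muC]_x (A (w, x) * F x)%:E)%E by apply: integral_ge0 => x _; exact: (AF0 (w, x)).
have mIp : measurable_fun setT (fun w : mC R => (\int[muC]_x (A (w, x) * F x)%:E) `^ p)%E.
  exact: (measurableT_comp (measurable_poweR p) mI).
apply: (@le_trans _ _ (\int[muC]_w ((2 `^ p)%:E * (\int[muC]_x (A (w, x) * F x)%:E) `^ p))%E).
  apply: ge0_le_integral; first exact: measurableT.
  - by move=> w _; rewrite lee_fin; case: ifP => // _; exact: powR_ge0.
  - apply/measurable_EFinP; apply: measurable_fun_ifT => //; first exact: measurable_disc.
    apply: (measurableT_comp (measurable_powR p)); apply: measurable_funM => //; exact: measurable_normc.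
  - exact: measurable_funeM.
  - move=> w _; case: ifPn => dw; last by apply: mule_ge0; [rewrite lee_fin powR_ge0|exact: poweR_ge0].
    have e2 : (2 `^ p)%:E = (2%:E `^ p)%E :> \bar R by rewrite poweR_EFin.
    rewrite e2 -poweR_EFin -poweRM//.
    apply: gt0_ler_poweR; first exact: ltW.
    + by rewrite in_itv/= leey lee_fin (mulr_ge0 (s0 _) (normc_ge0 _)).
    + by rewrite in_itv/= leey andbT; apply: mule_ge0.
    have mkh : cmeas (fun x : mC R => k w x * h x).
      by apply: cmeasM => //; exact: (cmeas_pair1 w mk).
    have l1 := ler_normc_cint muC mkh.
    have mkn : measurable_fun setT (fun x : mC R => normc (k w x * h x)) by exact: measurable_normc.
    rewrite EFinM; apply: (le_trans (lee_wpmul2l _ l1)); first by rewrite lee_fin.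
    rewrite muleCA; apply: lee_wpmul2l => //.
    rewrite -(@integralZl_ge0 _ _ _ muC _ _ (s0 w) mkn (fun x => normc_ge0 _)).
    apply: ge0_le_integral; first exact: measurableT.
    + by move=> x _; rewrite lee_fin; exact: (mulr_ge0 (s0 _) (normc_ge0 _)).
    + by apply/measurable_EFinP; apply: measurable_funM.
    + exact: (measurableT_comp mAF (@measurable_pair1 _ _ _ _ w)).
    + move=> x _; rewrite lee_fin /F; have [->|hx] := eqVneq (h x) 0.
        by rewrite mulr0 normc0 !mulr0.
      by rewrite normcM !mulrA; apply: ler_wpM2r; [exact: normc_ge0|exact: skA].
rewrite ge0_integralZl//; last by move=> w _; exact: poweR_ge0.
rewrite EFinM -muleA; apply: lee_wpmul2l; first by rewrite lee_fin powR_ge0.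
exact: bnd.
Qed.

Lemma cintegral_powR_le1 (p C : R) (A : mC2 R -> R) (k : mC R -> mC R -> R[i]) (h : mC R -> R[i]) :
  0 < p -> measurable_fun setT A -> (forall z, 0 <= A z) ->
  (forall F : mC R -> R, measurable_fun setT F -> (forall x, 0 <= F x) ->
    (\int[muC]_w (\int[muC]_x (A (w, x) * F x)%:E) `^ p <= C%:E * \int[muC]_x (F x `^ p)%:E)%E) ->
  cmeas (fun z : mC2 R => k z.1 z.2) -> cmeas h ->
  (forall w x, disc w -> normc (k w x) <= A (w, x)) ->
  (\int[muC]_w ((if disc w then (normc (cint muC (fun x : mC R => k w x * h x))) `^ p else 0)%R)%:E <=
   (2 `^ p * C)%:E * \int[muC]_x (normc (h x) `^ p)%:E)%E.
Proof.
move=> p0 mA A0 bnd mk mh kA.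
have ms : measurable_fun setT (fun _ : mC R => 1 : R) by exact: measurable_cst.
have H w x : h x != 0 -> disc w -> 1 * normc (k w x) <= A (w, x) * 1 by move=> _ dw; rewrite mul1r mulr1; exact: kA.
have := @cintegral_powR_le p C A k (fun=> 1) h p0 mA A0 bnd mk ms (fun _ => ler01) mh H.
have -> : (fun w : mC R => (if disc w then (1 * normc (cint muC (fun x : mC R => k w x * h x))) `^ p else 0)%:E) =
  (fun w : mC R => ((if disc w then (normc (cint muC (fun x : mC R => k w x * h x))) `^ p else 0)%R)%:E).
  by apply/funext => w; rewrite mul1r.
have -> : (fun x : mC R => ((1 * normc (h x)) `^ p)%:E) = (fun x : mC R => (normc (h x) `^ p)%:E).
  by apply/funext => x; rewrite mul1r.
by [].
Qed.

Lemma cmeas_slice_op (k : mC R -> mC R -> R[i]) (g : mC2 R -> R[i]) : cmeas (fun z : mC2 R => k z.1 z.2) -> cmeas g ->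
  cmeas (fun w : mC2 R => cint muC (fun x : mC R => k w.1 x * g (x, w.2))).
Proof.
move=> mk mg.
apply: (@cmeas_cint _ _ _ _ _ muC (fun z : mC2 R * mC R => k z.1.1 z.2 * g (z.2, z.1.2))).
apply: cmeasM.
  apply: (cmeas_comp (T' := mC2 R) (f := fun z : mC2 R => k z.1 z.2) (h := fun z : mC2 R * mC R => (z.1.1, z.2)) mk).
  by apply: measurable_fun_pair => //; exact: (measurableT_comp measurable_fst measurable_fst).
apply: (cmeas_comp mg (h := fun z : mC2 R * mC R => (z.2, z.1.2))).
by apply: measurable_fun_pair => //; exact: (measurableT_comp measurable_snd measurable_fst).
Qed.

(** The operator acts in the first variable while the weight $|w_2|^2$ depends on the second, so the
    weight is a constant on each slice. *)
Lemma cintegral_powR_le2 (p C : R) (k : mC R -> mC R -> R[i]) (g : mC2 R -> R[i]) :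
  0 < p -> 0 <= C -> cmeas (fun z : mC2 R => k z.1 z.2) -> cmeas g ->
  (forall h, cmeas h ->
   (\int[muC]_w ((if disc w then (normc (cint muC (fun x : mC R => k w x * h x))) `^ p else 0)%R)%:E <=
    C%:E * \int[muC]_x (normc (h x) `^ p)%:E)%E) ->
  (\int[muC2]_w ((if disc w.1 then
     normc (cplx w.2) ^+ 2 * normc (cint muC (fun x : mC R => k w.1 x * g (x, w.2))) `^ p else 0)%R)%:E <=
   C%:E * \int[muC2]_w (normc (cplx w.2) ^+ 2 * normc (g w) `^ p)%:E)%E.
Proof.
move=> p0 C0 mk mg bnd.
have mr : measurable_fun setT (fun w : mC2 R => normc (cplx w.2) ^+ 2).
  by apply: measurable_funX; apply: measurable_normc; exact: cmeas_cplx2.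
have mN := cmeas_slice_op mk mg.
have mL : measurable_fun setT (fun w : mC2 R => ((if disc w.1 then
     normc (cplx w.2) ^+ 2 * normc (cint muC (fun x : mC R => k w.1 x * g (x, w.2))) `^ p else 0)%R)%:E).
  apply/measurable_EFinP; apply: measurable_fun_ifT => //.
    exact: (measurableT_comp measurable_disc measurable_fst).
  by apply: measurable_funM => //; apply: (measurableT_comp (measurable_powR p)); exact: measurable_normc.
have mR : measurable_fun setT (fun w : mC2 R => (normc (cplx w.2) ^+ 2 * normc (g w) `^ p)%:E).
  apply/measurable_EFinP; apply: measurable_funM => //.
  by apply: (measurableT_comp (measurable_powR p)); exact: measurable_normc.
have R0 (w : mC2 R) : (0 <= (normc (cplx w.2) ^+ 2 * normc (g w) `^ p)%:E)%E.
  by rewrite lee_fin; exact: (mulr_ge0 (sqr_ge0 _) (powR_ge0 _ _)).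
have L0 (w : mC2 R) : (0 <= ((if disc w.1 then
     normc (cplx w.2) ^+ 2 * normc (cint muC (fun x : mC R => k w.1 x * g (x, w.2))) `^ p else 0)%R)%:E)%E.
  by rewrite lee_fin; case: ifP => // _; exact: (mulr_ge0 (sqr_ge0 _) (powR_ge0 _ _)).
rewrite (tonelliC2' mL L0) (tonelliC2' mR R0).
have mJ := measurable_int2 muC mR R0.
have J0 y : (0 <= \int[muC]_x (normc (cplx (x, y).2) ^+ 2 * normc (g (x, y)) `^ p)%:E)%E.
  by apply: integral_ge0 => x _; exact: (R0 (x, y)).
rewrite -(@ge0_integralZl _ _ _ muC _ measurableT _ mJ C%:E (fun y _ => J0 y)); last by rewrite lee_fin.
apply: ge0_le_integral; first exact: measurableT.
- by move=> y _; apply: integral_ge0 => x _; exact: (L0 (x, y)).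
- exact: (measurable_int2 muC mL L0).
- exact: measurable_funeM.
move=> y _ /=; have r0 : 0 <= normc (cplx y) ^+ 2 by exact: sqr_ge0.
have mgy : cmeas (fun x : mC R => g (x, y)) by exact: cmeas_pair2.
have mp : measurable_fun setT (fun x : mC R => normc (g (x, y)) `^ p).
  by apply: (measurableT_comp (measurable_powR p)); exact: measurable_normc.
have mNy : cmeas (fun w : mC R => cint muC (fun x : mC R => k w x * g (x, y))) by exact: (cmeas_pair2 y mN).
have ml : measurable_fun setT (fun w : mC R => (if disc w then normc (cint muC (fun x : mC R => k w x * g (x, y))) `^ p else 0)%R).
  apply: measurable_fun_ifT => //; first exact: measurable_disc.
  by apply: (measurableT_comp (measurable_powR p)); exact: measurable_normc.
rewrite (@integralZl_ge0 _ _ _ muC _ _ r0 mp (fun x => powR_ge0 _ _)).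
have -> : (fun x : mC R => ((if disc x then normc (cplx y) ^+ 2 *
    normc (cint muC (fun x0 : mC R => k x x0 * g (x0, y))) `^ p else 0)%R)%:E) =
  (fun x : mC R => (normc (cplx y) ^+ 2 * (if disc x then normc (cint muC (fun x0 : mC R => k x x0 * g (x0, y))) `^ p else 0)%R)%:E).
  by apply/funext => x; case: ifP; rewrite ?mulr0.
rewrite (integralZl_ge0 muC r0 ml); last by move=> x; case: ifP => // _; exact: powR_ge0.
by rewrite muleCA; apply: lee_wpmul2l; [rewrite lee_fin|exact: bnd].
Qed.

Lemma kernels_le (w x : mC R) : disc w ->
  normc (Xk 1 (cplx w) (cplx x) / (cplx w - cplx x)) <= absK (w, x) /\
  normc (Pk 1 (cplx w) (cplx x)) <= absP (w, x).
Proof.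
move=> dw; rewrite /absK /absP /= dw /=; case: ifPn => dx.
  have e : gap 1 (cplx x) = 1 - normc (cplx x) ^+ 2.
    by rewrite /gap max_r// subr_ge0 expr_le1 ?normc_ge0// ltW.
  by rewrite /kerK /kerP /chi /Xk /Pk e.
have x1 : 1 <= normc (cplx x) by rewrite leNgt.
by have [-> ->] := @kernel_eq0 R 1 (lexx 1) (cplx w) (cplx x) x1; rewrite mul0r normc0.
Qed.

(** For [y] in the disc this is an equality, [absW p] being the Cauchy kernel conjugated by the
    weight; at [y = 0] the right side would be 0. *)
Lemma kC_le (p : R) (v y : mC R) : 4 <= p -> cplx y != 0 -> disc v ->
  normc (cplx v) `^ (2 / p) * normc (kC v y) <= absW p (v, y) * normc (cplx y) `^ (2 / p).
Proof.
move=> p4 y0 dv; rewrite /kC /absW /= dv /=; case: ifPn => dy; last by rewrite normc0 mulr0 mul0r.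
have yn : 0 < normc (cplx y) by rewrite normc_gt0.
set N := normc (cplx v - cplx y); set a := normc (cplx v) `^ _.
have e1 : normc (cplx v - cplx y)^-1 = N `^ (-1) by rewrite normcV (powR_inv1 (normc_ge0 _)).
have e2 : normc (cplx y) `^ (- (2 / p)) * normc (cplx y) `^ (2 / p) = 1.
  by rewrite -powRD ?addNr ?powRr0//; apply/implyP => _; rewrite gt_eqF.
rewrite e1 le_eqVlt; apply/orP; left; apply/eqP.
by rewrite [RHS]mulrAC -(mulrA a) e2 mulr1.
Qed.

Lemma cmeas_solW (g : mC2 R -> R[i]) : cmeas g -> cmeas (solW g).
Proof.
move=> mg; apply: cmeasM; first exact: cmeas_cst.
apply: (@cmeas_cint _ _ _ _ _ muC (fun z : mC2 R * mC R => kC z.1.2 z.2 * g (z.1.1, z.2))).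
apply: cmeasM.
  apply: (cmeas_comp (T' := mC2 R) (h := fun z : mC2 R * mC R => (z.1.2, z.2)) cmeas_kC).
  by apply: measurable_fun_pair => //; exact: (measurableT_comp measurable_snd measurable_fst).
apply: (cmeas_comp mg (h := fun z : mC2 R * mC R => (z.1.1, z.2))).
by apply: measurable_fun_pair => //; exact: (measurableT_comp measurable_fst measurable_fst).
Qed.

Let kX (w x : mC R) : R[i] := Xk 1 (cplx w) (cplx x) / (cplx w - cplx x).
Let kP (w x : mC R) : R[i] := Pk 1 (cplx w) (cplx x).
Let mX : cmeas (fun z : mC2 R => Xk 1 (cplx z.1) (cplx z.2) / (cplx z.1 - cplx z.2)).
Proof.
apply: cmeasM; first by apply: cmeas_Xk; exact: cmeas_cplx.
by apply: cmeasV; apply: cmeasB; exact: cmeas_cplx.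
Qed.
Let mP : cmeas (fun z : mC2 R => Pk 1 (cplx z.1) (cplx z.2)).
Proof. by apply: cmeas_Pk; exact: cmeas_cplx. Qed.

Lemma cmeas_sol (g1 g2 : mC2 R -> R[i]) : cmeas g1 -> cmeas g2 -> cmeas (sol g1 g2).
Proof.
move=> m1 m2; apply: cmeasM; first exact: cmeas_cst.
apply: cmeasD; first exact: (@cmeas_slice_op kX g1 mX m1).
exact: (@cmeas_slice_op kP (solW g2) mP (cmeas_solW m2)).
Qed.

Let wLp (p : R) (g : mC2 R -> R[i]) : \bar R := (\int[muC2]_w (normc (cplx w.2) ^+ 2 * normc (g w) `^ p)%:E)%E.

Lemma Lp_solK (p : R) : 4 <= p -> exists2 C : R, 0 <= C & forall g, cmeas g ->
  (\int[muC2]_w ((if disc w.1 then normc (cplx w.2) ^+ 2 * normc (solK g w) `^ p else 0)%R)%:E <= C%:E * wLp p g)%E.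
Proof.
move=> p4; have p1 : 1 < p by rewrite (lt_le_trans _ p4)// ltr1n.
have p0 : 0 < p by exact: lt_trans p1.
have [C C0 h] := Lp_absK p1.
have C20 : 0 <= 2 `^ p * C by exact: (mulr_ge0 (powR_ge0 _ _) C0).
exists (2 `^ p * C) => // g mg; apply: (@cintegral_powR_le2 p _ kX g p0 C20 mX mg) => f mf.
have A0 (z : mC2 R) : 0 <= absK z by rewrite /absK; case: ifP => _; [exact: normc_ge0|exact: lexx].
by apply: (cintegral_powR_le1 p0 measurable_absK A0 h mX mf) => w x dw; have [] := kernels_le x dw.
Qed.

Lemma Lp_solP (p : R) : 4 <= p -> exists2 C : R, 0 <= C & forall g, cmeas g ->
  (\int[muC2]_w ((if disc w.1 then normc (cplx w.2) ^+ 2 * normc (solP g w) `^ p else 0)%R)%:E <= C%:E * wLp p g)%E.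
Proof.
move=> p4; have p0 : 0 < p by rewrite (lt_le_trans _ p4).
have [C C0 h] := Lp_absP p4.
have C20 : 0 <= 2 `^ p * C by exact: (mulr_ge0 (powR_ge0 _ _) C0).
exists (2 `^ p * C) => // g mg; apply: (@cintegral_powR_le2 p _ kP g p0 C20 mP mg) => f mf.
have A0 (z : mC2 R) : 0 <= absP z by rewrite /absP; case: ifP => _; [exact: normc_ge0|exact: lexx].
by apply: (cintegral_powR_le1 p0 measurable_absP A0 h mP mf) => w x dw; have [] := kernels_le x dw.
Qed.

Lemma Lp_solW (p : R) : 4 <= p -> exists2 C : R, 0 <= C & forall g, cmeas g -> (forall w, cplx w.2 = 0 -> g w = 0) ->
  (wLp p (solW g) <= C%:E * wLp p g)%E.
Proof.
move=> p4; have p0 : 0 < p by rewrite (lt_le_trans _ p4).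
have [C C0 h] := Lp_absW p4; pose s (v : mC R) : R := normc (cplx v) `^ (2 / p).
have s0 v : 0 <= s v by exact: powR_ge0.
(* The p-th power of the weight [s] is $|v|^2$: the weighted norm of a slice is the unweighted norm
   of its product with [s]. *)
have sp v N : 0 <= N -> (s v * N) `^ p = normc (cplx v) ^+ 2 * N `^ p.
  by move=> N0; rewrite powRM// /s -powRrM divfK ?gt_eqF// powR_mulrn ?normc_ge0.
have ms : measurable_fun setT s.
  by apply: (measurableT_comp (measurable_powR _)); apply: measurable_normc; exact: cmeas_cplx.
have c0 : 0 <= pompC^-1 :> R by rewrite invr_ge0 ltW// pompC_gt0.
pose D : R := pompC^-1 `^ p * (2 `^ p * C).
have D0 : 0 <= D by apply: mulr_ge0; [exact: powR_ge0|exact: (mulr_ge0 (powR_ge0 _ _) C0)].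
exists D => // g mg g0.
have A0 (z : mC2 R) : 0 <= absW p z.
  rewrite /absW; case: ifP => // _; apply: mulr_ge0; last exact: powR_ge0.
  by apply: mulr_ge0; exact: powR_ge0.
have mI (f : mC2 R -> R[i]) : cmeas f -> measurable_fun setT (fun w : mC2 R => (normc (cplx w.2) ^+ 2 * normc (f w) `^ p)%:E).
  move=> mf; apply/measurable_EFinP; apply: measurable_funM.
    by apply: measurable_funX; apply: measurable_normc; exact: cmeas_cplx2.
  by apply: (measurableT_comp (measurable_powR p)); exact: measurable_normc.
have I0 (f : mC2 R -> R[i]) (w : mC2 R) : (0 <= (normc (cplx w.2) ^+ 2 * normc (f w) `^ p)%:E)%E.
  by rewrite lee_fin; exact: (mulr_ge0 (sqr_ge0 _) (powR_ge0 _ _)).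
have mW := cmeas_solW mg.
rewrite /wLp (tonelliC2 (mI _ mW) (I0 _)) (tonelliC2 (mI _ mg) (I0 _)).
have mJ := measurable_int1 muC (mI _ mg) (I0 g).
have J0 x : (0 <= \int[muC]_y (normc (cplx (x, y).2) ^+ 2 * normc (g (x, y)) `^ p)%:E)%E.
  by apply: integral_ge0 => y _; exact: (I0 g (x, y)).
rewrite -(@ge0_integralZl _ _ _ muC _ measurableT _ mJ D%:E (fun y _ => J0 y)); last by rewrite lee_fin.
apply: ge0_le_integral; first exact: measurableT.
- by move=> x _; apply: integral_ge0 => y _; exact: (I0 (solW g) (x, y)).
- exact: (measurable_int1 muC (mI _ mW) (I0 (solW g))).
- exact: measurable_funeM.
move=> x _ /=; have mgx : cmeas (fun y : mC R => g (x, y)) by exact: cmeas_pair1.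
have H : forall w y, g (x, y) != 0 -> disc w -> s w * normc (kC w y) <= absW p (w, y) * s y.
  move=> w y gy dw; apply: kC_le => //; apply: contra gy => /eqP y0; apply/eqP; exact: g0.
have := @cintegral_powR_le p C (absW p) (@kC R) s (fun y => g (x, y)) p0 (measurable_absW p) A0 h cmeas_kC ms s0 mgx H.
have -> : (fun y : mC R => ((s y * normc (g (x, y))) `^ p)%:E) = (fun y : mC R => (normc (cplx y) ^+ 2 * normc (g (x, y)) `^ p)%:E).
  by apply/funext => y; rewrite sp// normc_ge0.
set I := (\int[muC]_y (normc (cplx y) ^+ 2 * normc (g (x, y)) `^ p)%:E)%E => le.
have mNy : cmeas (fun w : mC R => cint muC (fun y : mC R => kC w y * g (x, y))).
  apply: (@cmeas_cint _ _ _ _ _ muC (fun z : mC2 R => kC z.1 z.2 * g (x, z.2))).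
  by apply: cmeasM; [exact: cmeas_kC|exact: (cmeas_comp mgx measurable_snd)].
pose l (w : mC R) : R := if disc w then (s w * normc (cint muC (fun y : mC R => kC w y * g (x, y)))) `^ p else 0.
have ml : measurable_fun setT l.
  apply: measurable_fun_ifT => //; first exact: measurable_disc.
  by apply: (measurableT_comp (measurable_powR p)); apply: measurable_funM => //; exact: measurable_normc.
have l0 w : 0 <= l w by rewrite /l; case: ifP => // _; exact: powR_ge0.
have -> : (fun y : mC R => (normc (cplx y) ^+ 2 * normc (solW g (x, y)) `^ p)%:E) = (fun y : mC R => (pompC^-1 `^ p * l y)%:E).
  apply/funext => y; congr EFin; rewrite /l; case: ifPn => dy; last first.
    rewrite /solW /= (_ : (fun y0 : mC R => _) = fun=> 0) ?cint0 ?mulr0 ?normc0 ?powR0 ?mulr0 ?gt_eqF//.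
    by apply/funext => v; rewrite /kC (negbTE dy) mul0r.
  rewrite sp ?normc_ge0// /solW normcM normc_real (ger0_norm c0) powRM ?normc_ge0//= mulrCA.
  by [].
rewrite (integralZl_ge0 muC (powR_ge0 _ _) ml l0) /D EFinM -muleA.
by apply: lee_wpmul2l; [rewrite lee_fin powR_ge0|exact: le].
Qed.

Lemma Lp_sol (p : R) : 4 <= p -> exists2 C : R, 0 <= C & forall g1 g2, cmeas g1 -> cmeas g2 ->
  (forall w, cplx w.2 = 0 -> g2 w = 0) ->
  (\int[muC2]_w ((if disc w.1 then normc (cplx w.2) ^+ 2 * normc (sol g1 g2 w) `^ p else 0)%R)%:E <=
   C%:E * (wLp p g1 + wLp p g2))%E.
Proof.
move=> p4; have p0 : 0 < p by rewrite (lt_le_trans _ p4).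
have [CK CK0 hK] := Lp_solK p4; have [CP CP0 hP] := Lp_solP p4; have [CW CW0 hW] := Lp_solW p4.
have c0 : 0 <= pompC^-1 :> R by rewrite invr_ge0 ltW// pompC_gt0.
pose D : R := pompC^-1 `^ p * 2 `^ p.
have D0 : 0 <= D by apply: mulr_ge0; exact: powR_ge0.
have CM0 : 0 <= Num.max CK (CP * CW) by rewrite le_max CK0.
exists (D * Num.max CK (CP * CW)); first exact: mulr_ge0.
move=> g1 g2 m1 m2 g20.
have mW := cmeas_solW m2.
have mK : cmeas (solK g1) by exact: (@cmeas_slice_op kX g1 mX m1).
have mPW : cmeas (solP (solW g2)) by exact: (@cmeas_slice_op kP (solW g2) mP mW).
pose l (f : mC2 R -> R[i]) (w : mC2 R) : R := if disc w.1 then normc (cplx w.2) ^+ 2 * normc (f w) `^ p else 0.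
have ml f : cmeas f -> measurable_fun setT (l f).
  move=> mf; apply: measurable_fun_ifT => //; first exact: (measurableT_comp measurable_disc measurable_fst).
  apply: measurable_funM; first by apply: measurable_funX; apply: measurable_normc; exact: cmeas_cplx2.
  by apply: (measurableT_comp (measurable_powR p)); exact: measurable_normc.
have l0 f w : 0 <= l f w by rewrite /l; case: ifP => // _; exact: (mulr_ge0 (sqr_ge0 _) (powR_ge0 _ _)).
have mlE f (mf : cmeas f) := (measurable_EFinP _ _).2 (ml f mf).
apply: (@le_trans _ _ (\int[muC2]_w (D * (l (solK g1) w + l (solP (solW g2)) w))%:E)%E).
  apply: ge0_le_integral; first exact: measurableT.
  - by move=> w _; rewrite lee_fin; exact: l0.
  - by apply/measurable_EFinP; apply: ml; exact: cmeas_sol.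
  - by apply/measurable_EFinP; apply: measurable_funM => //; apply: measurable_funD; exact: ml.
  move=> w _; rewrite lee_fin /l; case: ifP => _; [|by rewrite addr0 mulr0; exact: lexx].
  rewrite -mulrDr mulrCA; apply: ler_wpM2l; first exact: sqr_ge0.
  rewrite /sol normcM normc_real (ger0_norm c0) (powRM _ c0 (normc_ge0 _)) -mulrA.
  apply: ler_wpM2l; first exact: powR_ge0.
  apply: le_trans (powR_add_le (ltW p0) (normc_ge0 _) (normc_ge0 _)).
  by apply: ge0_ler_powR; [exact: ltW|exact: normc_ge0|exact: addr_ge0 (normc_ge0 _) (normc_ge0 _)|exact: le_normcD].
rewrite (integralZl_ge0 muC2 D0); last 2 first.
- by apply: measurable_funD; exact: ml.
- by move=> w; exact: (addr_ge0 (l0 _ _) (l0 _ _)).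
have -> : (\int[muC2]_w (l (solK g1) w + l (solP (solW g2)) w)%:E = \int[muC2]_w (l (solK g1) w)%:E + \int[muC2]_w (l (solP (solW g2)) w)%:E)%E.
  rewrite -ge0_integralD//.
  - by move=> w _; rewrite lee_fin; exact: l0.
  - by apply/measurable_EFinP; exact: ml.
  - by move=> w _; rewrite lee_fin; exact: l0.
  - by apply/measurable_EFinP; exact: ml.
have wLp0 f : (0 <= wLp p f)%E.
  by apply: integral_ge0 => w _; rewrite lee_fin; exact: (mulr_ge0 (sqr_ge0 _) (powR_ge0 _ _)).
rewrite (EFinM D) -muleA; apply: lee_wpmul2l; first by rewrite lee_fin.
rewrite (ge0_muleDr _ (wLp0 _) (wLp0 _)); apply: leeD.
  by apply: le_trans (hK _ m1) _; apply: lee_wpmul2r => //; rewrite lee_fin le_max lexx.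
apply: le_trans (hP _ mW) _; apply: (@le_trans _ _ (CP%:E * (CW%:E * wLp p g2))%E).
  by apply: lee_wpmul2l; [rewrite lee_fin|exact: hW].
by rewrite muleA -EFinM; apply: lee_wpmul2r => //; rewrite lee_fin le_max lexx orbT.
Qed.
End Lp_estimate.

(** * Back to the Hartogs triangle *)

Section pullback_of_test_functions.
Context {R : realType}.

Lemma not_support0 (phi : C2 R -> R[i]) (z : C2 R) (j : 'I_2) : ~ Defs.support phi z -> phi z = 0 /\ dzbar j phi z = 0.
Proof.
move=> nz; have near0 : \forall y \near z, phi y = 0.
  have : nbhs z (~` Defs.support phi) by apply: open_nbhs_nbhs; split => //; apply: closed_openC; exact: closed_closure.
  apply: filterS => y ny; apply/eqP; apply/negPn/negP => py; apply: ny; exact: subset_closure.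
split; first exact: (nbhs_singleton near0).
have D v (h : R[i] -> R) : h 0 = 0 -> 'D_v (fun w => h (phi w)) z = 0.
  move=> h0; rewrite (near_eq_derive (g := fun=> 0) v) ?derive_cst//.
  by apply: filterS near0 => y ->.
have C v : cderive v phi z = 0 by rewrite /cderive !D.
by rewrite /dzbar !C mulr0 addr0 mul0r.
Qed.

Lemma tst_shear (phi : C2 R -> R[i]) : test_funH phi ->
  exists m, tst m (fun w => phi (shear w)) (fun w => ((cplx w.2)^*)%R * dzbar 0 phi (shear w))
    (fun w => ((cplx w.1)^*)%R * dzbar 0 phi (shear w) + dzbar 1 phi (shear w)).
Proof.
move=> [sm cK sK]; have c1 : Ck1c phi by exact: (sm 1%N).
have [m [m0 m1 mK]] : exists m, [/\ 0 < m, m < 1 & forall z, Defs.support phi z ->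
    normc (cplx z.1) <= normc (cplx z.2) - m /\ normc (cplx z.2) <= 1 - m].
  have [/eqP K0|/set0P K0] := boolP (Defs.support phi == set0).
    (* With empty support the minimum used below does not exist, and any margin between 0 and 1
       serves. *)
    exists (1 / 2); split; [by rewrite divr_gt0|by rewrite ltr_pdivrMr// mul1r ltr1n|].
    by move=> z; rewrite K0.
  (* The margin is the minimum over the compact support of the distance of the two moduli from
     violating the inequalities that define the Hartogs triangle. *)
  pose d (z : C2 R) : R := Num.min (normc (cplx z.2) - normc (cplx z.1)) (1 - normc (cplx z.2)).
  have cn1 : continuous (fun z : C2 R => normc (cplx z.1)) by apply: continuous_normc; exact: ccont_fst.
  have cn2 : continuous (fun z : C2 R => normc (cplx z.2)) by apply: continuous_normc; exact: ccont_snd.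
  have cd : continuous d.
    by apply: continuous_minf => z; apply: cvgB; [exact: cn2|exact: cn1|exact: cvg_cst|exact: cn2].
  have [c /set_mem Kc cmin] := compact_EVT_min K0 cK (continuous_subspaceT cd).
  have /= [h1 h2] := sK _ Kc.
  exists (d c); split.
  - by rewrite lt_min !subr_gt0 h1.
  - by rewrite gt_min [X in _ || X]gtrBl (le_lt_trans (normc_ge0 _) h1) orbT.
  - move=> z /mem_set/cmin; rewrite le_min => /andP[l1 l2].
    by split; rewrite lerBrDl -lerBrDr.
exists m; split => // [|w nc]; first exact: wirt2_shear.
have ns : ~ Defs.support phi (shear w).
  move=> /mK; rewrite /shear /= ofcK normcM => -[l1 l2]; move/negP: nc; apply.
  have s2 : m <= normc (cplx w.2).
    by rewrite -subr_ge0; apply: le_trans l1; exact: (mulr_ge0 (normc_ge0 _) (normc_ge0 _)).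
  have s0 : 0 < normc (cplx w.2) by exact: lt_le_trans s2.
  have s1 : normc (cplx w.2) <= 1 by apply: le_trans l2 _; rewrite gerBl ltW.
  apply/and3P; split => //; rewrite -(ler_pM2r s0); apply: le_trans l1 _.
  (* From $|w_1||w_2|\le|w_2|-m$ and $|w_2|\le 1$ it follows that $|w_1||w_2|\le(1-m)|w_2|$. *)
  rewrite mulrBl mul1r lerD2l lerN2; apply: ler_piMr => //; exact: ltW.
have [-> e0] := not_support0 0 ns; have [_ e1] := not_support0 1 ns.
by rewrite e0 e1 !mulr0 addr0.
Qed.
End pullback_of_test_functions.

(** * Functions on the Hartogs triangle extended by zero *)

Definition inH {R : realType} (z : C2 R) : bool := (normc (cplx z.1) < normc (cplx z.2)) && (normc (cplx z.2) < 1).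
Definition hat {R : realType} (u : C2 R -> R[i]) (z : mC2 R) : R[i] := if inH z then u z else 0.
Definition energy {R : realType} (p : R) (h : mC2 R -> R[i]) : \bar R := (\int[@lebesgueC2 R]_z (normc (h z) `^ p)%:E)%E.

Section hartogs_functions.
Context {R : realType}.
Local Notation muC := (@lebesgueC R).
Local Notation muC2 := (@lebesgueC2 R).
Implicit Types u v : C2 R -> R[i].

Lemma hartogsE : @hartogs R = [set z | inH z].
Proof. by apply/seteqP; split => z; rewrite /hartogs /inH /=; [move=> [-> ->]|move=> /andP[]]. Qed.

Lemma measurable_inH : measurable_fun setT (@inH R : mC2 R -> bool).
Proof.
apply: measurable_and.
  by apply: measurable_fun_ltr; apply: measurable_normc; [exact: cmeas_cplx1|exact: cmeas_cplx2].
by apply: measurable_fun_ltr; [apply: measurable_normc; exact: cmeas_cplx2|exact: measurable_cst].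
Qed.

Lemma measurable_hartogs : measurable (@hartogs R : set (mC2 R)).
Proof.
have h := measurable_inH measurableT (I : measurable [set true]); rewrite setTI in h.
by rewrite hartogsE.
Qed.

Lemma hatE (h : R[i] -> R) u : h 0 = 0 -> (fun z => h (u z)) \_ (@hartogs R) = fun z => h (hat u z).
Proof.
move=> h0; apply/funext => z; rewrite patchE /hat hartogsE; have -> : (z \in [set z | inH z]) = inH z.
  by apply/idP/idP; rewrite inE.
by case: ifP.
Qed.

Lemma cmeas_hat u : measurable_fun (@hartogs R : set (mC2 R)) (fun z => complex.Re (u z)) ->
  measurable_fun (@hartogs R : set (mC2 R)) (fun z => complex.Im (u z)) -> cmeas (hat u).
Proof.
move=> m1 m2; split.
  by rewrite -(hatE (h := @complex.Re R))//; apply/(measurable_restrictT _ measurable_hartogs).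
by rewrite -(hatE (h := @complex.Im R))//; apply/(measurable_restrictT _ measurable_hartogs).
Qed.

Lemma hat_cmeas u : cmeas (hat u) -> measurable_fun (@hartogs R : set (mC2 R)) (fun z => complex.Re (u z)) /\
  measurable_fun (@hartogs R : set (mC2 R)) (fun z => complex.Im (u z)).
Proof.
move=> [m1 m2]; split; apply/(measurable_restrictT _ measurable_hartogs).
  by rewrite (hatE (h := @complex.Re R)).
by rewrite (hatE (h := @complex.Im R)).
Qed.

Lemma integralH_hat u : integralH u = cint muC2 (hat u).
Proof.
rewrite /integralH /cint Rintegral_mkcond [in X in _ +i* X]Rintegral_mkcond.
by rewrite (hatE (h := @complex.Re R))// (hatE (h := @complex.Im R)).
Qed.

Lemma hatM u v : hat (fun z => u z * v z) = fun z => hat u z * v z.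
Proof. by apply/funext => z; rewrite /hat; case: ifP; rewrite ?mul0r. Qed.

Lemma energy_ge0 (p : R) (h : mC2 R -> R[i]) : (0 <= energy p h)%E.
Proof. by apply: integral_ge0 => z _; rewrite lee_fin powR_ge0. Qed.

Lemma LpnormH_energy (p : R) u : p != 0 -> (LpnormH p u `^ p)%E = energy p (hat u).
Proof.
move=> p0; rewrite /LpnormH poweR_Lnorm// /energy; apply: eq_integral => z _.
have e0 : (fun x : R[i] => (normc x)%:E) 0 = 0%E by rewrite normc0.
have -> : ((fun z => (normc (u z))%:E) \_ (@hartogs R)) z = (normc (hat u z))%:E.
  rewrite patchE /hat hartogsE; have -> : (z \in [set z | inH z]) = inH z by apply/idP/idP; rewrite inE.
  by case: ifP => // _; rewrite normc0.
by rewrite /= ger0_norm ?normc_ge0// poweR_EFin.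
Qed.

Lemma LpnormHE (p : R) u : 0 < p -> LpnormH p u = (energy p (hat u) `^ p^-1)%E.
Proof.
move=> p0; rewrite -LpnormH_energy ?gt_eqF// -poweRrM divff ?gt_eqF// poweRe1//.
exact: Lnorm_ge0.
Qed.

Lemma shear_inH (w : C2 R) : inH (shear w) -> [/\ disc w.1, disc w.2, cplx w.2 != 0 & 0 < normc (cplx w.2) < 1].
Proof.
rewrite /inH /shear /= ofcK normcM => /andP[h1 h2].
have s0 : 0 < normc (cplx w.2).
  by apply: le_lt_trans h1; exact: (mulr_ge0 (normc_ge0 _) (normc_ge0 _)).
have d1 : disc w.1 by move: h1; rewrite -[X in _ < X]mul1r ltr_pM2r.
by split; rewrite ?s0//; rewrite -normc_gt0.
Qed.

Lemma energy_shear (p : R) (h : mC2 R -> R[i]) : cmeas h ->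
  energy p h = (\int[muC2]_w (normc (cplx w.2) ^+ 2 * normc (h (shear w)) `^ p)%:E)%E.
Proof.
move=> mh; rewrite /energy integral_shear.
- by apply: eq_integral => w _; rewrite EFinM.
- by apply/measurable_EFinP; apply: (measurableT_comp (measurable_powR p)); exact: measurable_normc.
- by move=> z; rewrite lee_fin powR_ge0.
Qed.

Lemma cmeas_shear (h : mC2 R -> R[i]) : cmeas h -> cmeas (fun w : mC2 R => h (shear w)).
Proof. by move=> mh; exact: (cmeas_comp mh measurable_shear). Qed.

(* With s = |w2| < 1: a > s^-1 forces a <= a^4 s^2. *)
Let pointwise (p a s : R) : 4 <= p -> 0 <= a -> 0 < s < 1 -> a <= 2 * s^-1 + s ^+ 2 * a `^ p.
Proof.
move=> p4 a0 /andP[s0 s1]; have sV : 1 <= s^-1 by rewrite invf_ge1// ltW.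
have [as1|as1] := leP a s^-1.
  apply: (@le_trans _ _ (2 * s^-1)); last by rewrite lerDl mulr_ge0 ?sqr_ge0 ?powR_ge0.
  by apply: le_trans as1 _; rewrite ler_peMl ?invr_ge0 ?ler1n// ltW.
apply: (@le_trans _ _ (s ^+ 2 * a `^ p)); last by rewrite lerDr mulr_ge0 ?invr_ge0// ltW.
have a1 : 1 <= a by apply: le_trans sV (ltW as1).
have a4 : a ^+ 4 <= a `^ p by rewrite -powR_mulrn//; apply: ler_powR.
apply: (@le_trans _ _ (s ^+ 2 * a ^+ 4)); last by rewrite ler_wpM2l ?sqr_ge0.
have sn : s != 0 by rewrite gt_eqF.
have sa : 1 <= s * a by rewrite -(mulfV sn) ler_pM2l// ltW.
have e : s ^+ 2 * a ^+ 4 = (s * a) ^+ 2 * a ^+ 2 by ring.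
rewrite e; apply: (@le_trans _ _ (1 * a ^+ 2)).
  by rewrite mul1r expr2 ler_peMl.
by rewrite ler_wpM2r ?sqr_ge0// exprn_ege1.
Qed.

(** Integrability with respect to Lebesgue measure in shear coordinates, without the Jacobian
    $|w_2|^2$. The modulus is at most $2/|w_2|$ plus its p-th power times $|w_2|^2$; the first is
    integrable on the bidisc and the second integrates to the energy. *)
Lemma cintegrable_hat_shear (p : R) u : 4 <= p -> cmeas (hat u) -> (energy p (hat u) < +oo)%E ->
  cintegrable muC2 (fun w : mC2 R => hat u (shear w)).
Proof.
move=> p4 mu fin; have mus := cmeas_shear mu.
pose F (w : mC2 R) : R[i] := if disc w.1 && disc w.2 then (2 * (normc (cplx w.2))^-1)%:C else 0.
have mF : cmeas F.
  apply: cmeas_if.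
  - by apply: measurable_and; [exact: (measurableT_comp measurable_disc measurable_fst)|exact: (measurableT_comp measurable_disc measurable_snd)].
  - apply: cmeas_real; apply: measurable_funM; first exact: measurable_cst.
    by apply: measurable_funVr; apply: measurable_normc; exact: cmeas_cplx2.
  - exact: cmeas_cst.
have iF : cintegrable muC2 F.
  apply: (@cintegrable_riesz2 _ F (fun=> 0) 2 mF) => [a v|a v a1]; last first.
    by rewrite /F /= /disc ltNge (ltW a1).
  rewrite /F /=; case: ifP => [/andP[_ dv]|_]; last by rewrite normc0; exact: (mulr_ge0 (ler0n R 2) (riesz_ge0 _ _ _)).
  have V0 : 0 <= (normc (cplx v))^-1 by rewrite invr_ge0 normc_ge0.
  rewrite normc_real (ger0_norm (mulr_ge0 (ler0n R 2) V0)); apply: ler_wpM2l => //.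
  have E : normc (cplx (0 : R * R) - cplx v) = normc (cplx v) by rewrite cplx0 normcB subr0.
  rewrite /riesz E ifT; first by rewrite powR_inv1 ?normc_ge0.
  by apply: le_trans (ltW dv) _; rewrite ler1n.
pose G (w : mC2 R) : R := normc (F w) + normc (cplx w.2) ^+ 2 * normc (hat u (shear w)) `^ p.
apply: (@cintegrable_le _ _ _ muC2 _ G mus) => [w|].
  rewrite /G /hat; case: ifPn => [/shear_inH[d1 d2 _ s01]|_]; last first.
    by rewrite normc0; apply: addr_ge0; [exact: normc_ge0|exact: (mulr_ge0 (sqr_ge0 _) (powR_ge0 _ _))].
  have V0 : 0 <= 2 * (normc (cplx w.2))^-1 by rewrite mulr_ge0 ?invr_ge0 ?normc_ge0.
  rewrite /F d1 d2 /= normc_real (ger0_norm V0); exact: (pointwise p4 (normc_ge0 _) s01).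
have mg : measurable_fun setT (fun w : mC2 R => (normc (cplx w.2) ^+ 2 * normc (hat u (shear w)) `^ p)%:E).
  apply/measurable_EFinP; apply: measurable_funM.
    by apply: measurable_funX; apply: measurable_normc; exact: cmeas_cplx2.
  by apply: (measurableT_comp (measurable_powR p)); exact: measurable_normc.
have ig : muC2.-integrable setT (fun w : mC2 R => (normc (cplx w.2) ^+ 2 * normc (hat u (shear w)) `^ p)%:E).
  apply/integrableP; split => //; rewrite (_ : (\int[_]_(_ in _) _)%E = energy p (hat u))//.
  rewrite (energy_shear p mu); apply: eq_integral => w _.
  by rewrite /= ger0_norm//; exact: (mulr_ge0 (sqr_ge0 _) (powR_ge0 _ _)).
exact: (integrableD measurableT (integrable_normc iF) ig).
Qed.

Lemma cintegrable_unshear (h : mC2 R -> R[i]) : cmeas h ->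
  cintegrable muC2 (fun w : mC2 R => (normc (cplx w.2) ^+ 2)%:C * h (shear w)) -> cintegrable muC2 h.
Proof.
move=> mh ih; apply: (cintegrable_lty mh).
have mn : measurable_fun setT (fun z : mC2 R => (normc (h z))%:E) by apply/measurable_EFinP; exact: measurable_normc.
rewrite (integral_shear mn); last by move=> z; rewrite lee_fin normc_ge0.
apply: le_lt_trans (cintegrable_normc_lty ih); rewrite le_eqVlt; apply/orP; left; apply/eqP.
apply: eq_integral => w _; rewrite -EFinM normcM normc_real ger0_norm//; exact: sqr_ge0.
Qed.

Lemma cintegrableM_bounded (h b : mC2 R -> R[i]) (M : R) : cintegrable muC2 h -> cmeas b ->
  (forall w, normc (b w) <= M) -> cintegrable muC2 (fun w : mC2 R => h w * b w).
Proof.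
move=> ih mb bM; apply: (cintegrable_le _ _ (integrableZl measurableT M (integrable_normc ih))) => [|q].
  by apply: cmeasM => //; exact: (cintegrable_cmeas ih).
by rewrite normcM mulrC; apply: ler_wpM2r; [exact: normc_ge0|exact: bM].
Qed.

Lemma cintegrable_tst m b b1 b2 (h : mC2 R -> R[i]) : tst m b b1 b2 -> cintegrable muC2 h ->
  [/\ cintegrable muC2 (fun w : mC2 R => h w * b w), cintegrable muC2 (fun w : mC2 R => h w * b1 w) &
      cintegrable muC2 (fun w : mC2 R => h w * b2 w)].
Proof.
move=> [m0 m1 [c0 c1 c2 _ _] z] ih.
have B f : ccont f -> (forall w : C2 R, ~~ core m w -> f w = 0) -> cintegrable muC2 (fun w : mC2 R => h w * f w).
  move=> cf f0; have [M _ fM] := ccont_bounded_core m0 cf f0.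
  exact: (cintegrableM_bounded ih (ccont_cmeas2 cf) fM).
by split; apply: B => // w /z[].
Qed.

End hartogs_functions.

(** * The solution on the Hartogs triangle *)

Definition pull1 {R : realType} (f : form01 R) (w : C2 R) : R[i] := ((cplx w.2)^*)%R * hat (f 0) (shear w).
Definition pull2 {R : realType} (f : form01 R) (w : C2 R) : R[i] :=
  ((cplx w.1)^*)%R * hat (f 0) (shear w) + hat (f 1) (shear w).
Definition solH {R : realType} (f : form01 R) (z : C2 R) : R[i] := sol (pull1 f) (pull2 f) (unshear z).

Section solution_on_hartogs.
Context {R : realType}.
Local Notation muC := (@lebesgueC R).
Local Notation muC2 := (@lebesgueC2 R).
Implicit Types f : form01 R.

Lemma inLpH_hat (p : R) u : 4 <= p -> inLpH p u -> cmeas (hat u) /\ (energy p (hat u) < +oo)%E.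
Proof.
move=> p4 [m1 m2 fin]; have p0 : p != 0 by rewrite gt_eqF// (lt_le_trans _ p4).
by split; [exact: cmeas_hat|rewrite -LpnormH_energy//; exact: poweR_lty].
Qed.

Lemma cintegrable_hat (p : R) (u : C2 R -> R[i]) : 4 <= p -> inLpH p u -> cintegrable muC2 (hat u).
Proof.
move=> p4 /(inLpH_hat p4)[mu fin]; have ih := cintegrable_hat_shear p4 mu fin.
apply: (cintegrable_unshear mu); apply: (cintegrable_le _ _ (integrable_normc ih)) => [|w].
  apply: cmeasM; last exact: cmeas_shear.
  by apply: cmeas_real; apply: measurable_funX; apply: measurable_normc; exact: cmeas_cplx2.
rewrite normcM normc_real ger0_norm ?sqr_ge0// /hat; case: ifPn => [/shear_inH[_ _ _ /andP[s0 s1]]|_]; last by rewrite normc0 mulr0.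
rewrite -[leRHS]mul1r; apply: ler_wpM2r; first exact: normc_ge0.
by rewrite exprn_ile1// ltW.
Qed.

Lemma cmeas_pull f : cmeas (hat (f 0)) -> cmeas (hat (f 1)) -> cmeas (pull1 f : mC2 R -> R[i]) /\ cmeas (pull2 f : mC2 R -> R[i]).
Proof.
move=> m0 m1; split.
  by apply: cmeasM; [apply: cmeasJ; exact: cmeas_cplx2|exact: cmeas_shear].
apply: cmeasD; last exact: cmeas_shear.
by apply: cmeasM; [apply: cmeasJ; exact: cmeas_cplx1|exact: cmeas_shear].
Qed.

Lemma normc_pull f (w : mC2 R) : normc (pull1 f w) <= normc (hat (f 0) (shear w)) /\
  normc (pull2 f w) <= normc (hat (f 0) (shear w)) + normc (hat (f 1) (shear w)).
Proof.
rewrite /pull1 /pull2 /hat; case: ifPn => [/shear_inH[d1 d2 _ _]|_]; last first.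
  by rewrite !mulr0 addr0 normc0 addr0.
split; first by rewrite normcM normcJE; apply: ler_piMl; [exact: normc_ge0|exact: ltW].
apply: le_trans (le_normcD _ _) _; rewrite lerD2r normcM normcJE.
by apply: ler_piMl; [exact: normc_ge0|exact: ltW].
Qed.

Lemma pull2_eq0 f (w : C2 R) : ~~ inH (shear w) -> pull2 f w = 0.
Proof. by rewrite /pull2 /hat => /negbTE ->; rewrite mulr0 addr0. Qed.

Lemma cmeas_solH f : cmeas (hat (f 0)) -> cmeas (hat (f 1)) -> cmeas (hat (solH f)).
Proof.
move=> m0 m1; have [mp1 mp2] := cmeas_pull m0 m1.
apply: cmeas_if; [exact: measurable_inH| |exact: cmeas_cst].
exact: (cmeas_comp (cmeas_sol mp1 mp2) measurable_unshear).
Qed.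

Lemma hat_solH_shear f (w : mC2 R) : hat (solH f) (shear w) = if inH (shear w) then sol (pull1 f) (pull2 f) w else 0.
Proof.
by rewrite /hat /solH; case: ifPn => [/shear_inH[_ _ w0 _]|_]; [rewrite unshearK|exact: erefl].
Qed.

(** The Jacobian of the shear is exactly the weight in the product estimate. On the region concerned
    $|w_1|,|w_2|<1$, so the pulled-back data are bounded by the coefficients of the form. *)
Lemma energy_solH (p : R) : 4 <= p -> exists2 C : R, 0 <= C & forall f, cmeas (hat (f 0)) -> cmeas (hat (f 1)) ->
  (energy p (hat (solH f)) <= C%:E * (energy p (hat (f 0%R)) + energy p (hat (f 1%R))))%E.
Proof.
move=> p4; have p0 : 0 < p by rewrite (lt_le_trans _ p4).
have [C C0 h] := Lp_sol p4; pose D : R := 1 + 2 `^ p.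
have D0 : 0 <= D by rewrite addr_ge0// powR_ge0.
exists (C * D); first exact: mulr_ge0.
move=> f m0 m1; have [mp1 mp2] := cmeas_pull m0 m1.
pose l (k : mC2 R -> R[i]) (w : mC2 R) : R := normc (cplx w.2) ^+ 2 * normc (k w) `^ p.
have l0 k w : 0 <= l k w by exact: (mulr_ge0 (sqr_ge0 _) (powR_ge0 _ _)).
have ml k : cmeas k -> measurable_fun setT (l k).
  move=> mk; apply: measurable_funM.
    by apply: measurable_funX; apply: measurable_normc; exact: cmeas_cplx2.
  by apply: (measurableT_comp (measurable_powR p)); exact: measurable_normc.
have mlE k (mk : cmeas k) := (measurable_EFinP _ _).2 (ml k mk).
pose k0 (w : mC2 R) := hat (f 0) (shear w); pose k1 (w : mC2 R) := hat (f 1) (shear w).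
have mk0 : cmeas k0 by exact: cmeas_shear.
have mk1 : cmeas k1 by exact: cmeas_shear.
have E0 : (\int[muC2]_w (l k0 w)%:E)%E = energy p (hat (f 0%R)) by rewrite energy_shear.
have E1 : (\int[muC2]_w (l k1 w)%:E)%E = energy p (hat (f 1%R)) by rewrite energy_shear.
have mS := cmeas_sol mp1 mp2.
rewrite (energy_shear p (cmeas_solH m0 m1)).
apply: (@le_trans _ _ (\int[muC2]_w ((if disc w.1 then normc (cplx w.2) ^+ 2 * normc (sol (pull1 f) (pull2 f) w) `^ p else 0)%R)%:E)%E).
  apply: ge0_le_integral; first exact: measurableT.
  - by move=> w _; rewrite lee_fin; exact: (l0 (fun w => hat (solH f) (shear w)) w).
  - apply: (mlE (fun w : mC2 R => hat (solH f) (shear w))); apply: cmeas_shear; exact: cmeas_solH.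
  - apply/measurable_EFinP; apply: measurable_fun_ifT; first exact: (measurableT_comp measurable_disc measurable_fst).
      exact: (ml _ mS).
    exact: measurable_cst.
  - move=> w _; rewrite lee_fin hat_solH_shear; case: (boolP (inH _)) => [/shear_inH[-> _ _ _]//|_].
    rewrite normc0 powR0 ?gt_eqF// mulr0; case: ifP => // _; exact: (l0 (sol (pull1 f) (pull2 f)) w).
have v2 (w : mC2 R) : cplx w.2 = 0 -> pull2 f w = 0.
  move=> w0; apply: pull2_eq0; apply/negP => /shear_inH[_ _]; by rewrite w0 eqxx.
apply: le_trans (h _ _ mp1 mp2 v2) _.
rewrite EFinM -muleA; apply: lee_wpmul2l; first by rewrite lee_fin.
have Z0 := energy_ge0 p (hat (f 0)); have Z1 := energy_ge0 p (hat (f 1)).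
have b1 : (\int[muC2]_w (l (pull1 f) w)%:E <= energy p (hat (f 0%R)))%E.
  rewrite -E0; apply: ge0_le_integral; first exact: measurableT.
  - by move=> w _; rewrite lee_fin; exact: l0.
  - exact: (mlE _ mp1).
  - exact: (mlE _ mk0).
  - move=> w _; rewrite lee_fin; apply: ler_wpM2l; first exact: sqr_ge0.
    by apply: ge0_ler_powR; [exact: ltW|exact: normc_ge0|exact: normc_ge0|have [] := normc_pull f w].
have b2 : (\int[muC2]_w (l (pull2 f) w)%:E <= (2 `^ p)%:E * (energy p (hat (f 0%R)) + energy p (hat (f 1%R))))%E.
  rewrite -E0 -E1 -ge0_integralD; last 5 first.
  - exact: measurableT.
  - by move=> w _; rewrite lee_fin; exact: l0.
  - exact: (mlE _ mk0).
  - by move=> w _; rewrite lee_fin; exact: l0.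
  - exact: (mlE _ mk1).
  rewrite -(@integralZl_ge0 _ _ _ muC2 _ (fun w => l k0 w + l k1 w) (powR_ge0 _ _)); last 2 first.
  - by apply: measurable_funD; exact: ml.
  - by move=> w; exact: (addr_ge0 (l0 _ _) (l0 _ _)).
  apply: ge0_le_integral; first exact: measurableT.
  - by move=> w _; rewrite lee_fin; exact: l0.
  - exact: (mlE _ mp2).
  - apply/measurable_EFinP; apply: measurable_funM; first exact: measurable_cst.
    by apply: measurable_funD; exact: ml.
  - move=> w _; rewrite lee_fin /l -mulrDr mulrCA; apply: ler_wpM2l; first exact: sqr_ge0.
    apply: le_trans (powR_add_le (ltW p0) (normc_ge0 _) (normc_ge0 _)).
    by apply: ge0_ler_powR; [exact: ltW|exact: normc_ge0|exact: (addr_ge0 (normc_ge0 _) (normc_ge0 _))|have [] := normc_pull f w].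
apply: le_trans (leeD b1 b2) _; rewrite /D EFinD ge0_muleDl ?lee_fin ?powR_ge0// mul1e.
by apply: leeD => //; rewrite leeDl.
Qed.

(** Writing the Jacobian as $w_2\bar w_2$ makes its product with the sheared test function again of
    class [tst], so it remains bounded with support in the core. *)
Lemma cint_hat_test (p : R) (u phi : C2 R -> R[i]) : 4 <= p -> inLpH p u -> test_funH phi ->
  integralH (fun z => u z * phi z) =
  cint muC2 (fun w : mC2 R => hat u (shear w) * ((normc (cplx w.2) ^+ 2)%:C * phi (shear w))).
Proof.
move=> p4 ul tp; have [m0 fin] := inLpH_hat p4 ul; have iu := cintegrable_hat_shear p4 m0 fin.
have [m tm] := tst_shear tp; have cphi : ccont phi by have [/(_ 0%N) s _ _] := tp; exact: s.
have := tstM wirt2_snd (tstM wirt2_sndJ tm) => /cintegrable_tst/(_ iu)[i0 _ _].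
have e : (fun w : mC2 R => (normc (cplx w.2) ^+ 2)%:C * (hat u (shear w) * phi (shear w))) =
    (fun w : mC2 R => hat u (shear w) * (cplx w.2 * (((cplx w.2)^*)%R * phi (shear w)))).
  by apply/funext => w; rewrite -mulcJ; ring.
have mh : cmeas (fun z : mC2 R => hat u z * phi z) by apply: cmeasM => //; exact: ccont_cmeas2.
have ih : cintegrable muC2 (fun z : mC2 R => hat u z * phi z) by apply: (cintegrable_unshear mh); rewrite e.
rewrite integralH_hat hatM; have [_ ->] := cint_shear ih.
by congr cint; apply/funext => w; ring.
Qed.

Lemma cint_solH_test f (j : 'I_2) (phi : C2 R -> R[i]) : cmeas (hat (f 0)) -> cmeas (hat (f 1)) -> Ck1c phi -> test_funH phi ->
  cintegrable muC2 (fun w : mC2 R => sol (pull1 f) (pull2 f) w * ((normc (cplx w.2) ^+ 2)%:C * dzbar j phi (shear w))) ->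
  integralH (fun z => solH f z * dzbar j phi z) =
  cint muC2 (fun w : mC2 R => sol (pull1 f) (pull2 f) w * ((normc (cplx w.2) ^+ 2)%:C * dzbar j phi (shear w))).
Proof.
move=> m0 m1 cp [_ _ sK] i0.
have e : (fun w : mC2 R => (normc (cplx w.2) ^+ 2)%:C * (hat (solH f) (shear w) * dzbar j phi (shear w))) =
    (fun w : mC2 R => sol (pull1 f) (pull2 f) w * ((normc (cplx w.2) ^+ 2)%:C * dzbar j phi (shear w))).
  apply/funext => w; rewrite hat_solH_shear; case: ifPn => [_|nH]; first by rewrite mulrCA.
  have ns : ~ Defs.support phi (shear w) by move=> /sK; rewrite hartogsE /= (negbTE nH).
  by have [_ ->] := not_support0 j ns; rewrite !mulr0.
have mh : cmeas (fun z : mC2 R => hat (solH f) z * dzbar j phi z).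
  by apply: cmeasM; [exact: cmeas_solH|apply: ccont_cmeas2; exact: ccont_dzbar].
have ih : cintegrable muC2 (fun z : mC2 R => hat (solH f) z * dzbar j phi z) by apply: (cintegrable_unshear mh); rewrite e.
by rewrite integralH_hat hatM; have [_ ->] := cint_shear ih; rewrite e.
Qed.
End solution_on_hartogs.

(** * Verification of the equation and choice of representatives *)

Section solution_operator.
Context {R : realType}.
Local Notation muC := (@lebesgueC R).
Local Notation muC2 := (@lebesgueC2 R).
Implicit Types f g : form01 R.

Lemma integralH_hatM (u v : C2 R -> R[i]) : integralH (fun z => u z * v z) = cint muC2 (fun z : mC2 R => hat u z * v z).
Proof. by rewrite integralH_hat hatM. Qed.

(** With $\Phi=\varphi\circ\mathrm{shear}$, the second Wirtinger derivative of $\varphi$ satisfies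
    $|w_2|^2(\partial\varphi/\partial\bar z_2)\circ\mathrm{shear}=\partial_2(w_2\bar
    w_2\Phi)-\partial_1(w_2\bar w_1\Phi)$. The second equation on the Hartogs triangle therefore
    follows from both equations in shear coordinates. *)
Let combine_dbar (s z zc yc d0 d1 ph : R[i]) :
  s * (z * zc * d1) = s * (0 * (zc * ph) + z * (1 * ph + zc * (yc * d0 + d1))) - s * (0 * (yc * ph) + z * (1 * ph + yc * (zc * d0))).
Proof. by ring. Qed.
(** The data side of the same combination: $g_2w_2\bar w_2-g_1w_2\bar w_1=|w_2|^2f_2$ after shearing
    $f_2$. *)
Let combine_data (z zc yc h0 h1 ph : R[i]) :
  (yc * h0 + h1) * (z * (zc * ph)) - zc * h0 * (z * (yc * ph)) = h1 * (z * zc * ph).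
Proof. by ring. Qed.

Lemma dbar_solution_solH (p : R) f : 4 <= p -> closedLpH_form p f -> dbar_solution (solH f) f.
Proof.
move=> p4 [fL fC].
have [m0 e0] := inLpH_hat p4 (fL 0); have [m1 e1] := inLpH_hat p4 (fL 1).
have s0 := cintegrable_hat_shear p4 m0 e0; have s1 := cintegrable_hat_shear p4 m1 e1.
have [mp1 mp2] := cmeas_pull m0 m1.
have i1 : cintegrable muC2 (pull1 f : mC2 R -> R[i]).
  by apply: (cintegrable_le mp1 _ (integrable_normc s0)) => w; have [] := normc_pull f w.
have i2 : cintegrable muC2 (pull2 f : mC2 R -> R[i]).
  apply: (cintegrable_le mp2 _ (integrableD measurableT (integrable_normc s0) (integrable_normc s1))) => w.
  by have [] := normc_pull f w.
have closed phi : test_funH phi ->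
    cint muC2 (fun y : mC2 R => hat (f 1) y * dzbar 0 phi y) = cint muC2 (fun y : mC2 R => hat (f 0) y * dzbar 1 phi y).
  move=> tp; have := fC phi tp; rewrite /distr_dzbar /distr_of => /oppr_inj h.
  exact: (etrans (esym (integralH_hatM (f 1) (dzbar 0 phi))) (etrans h (integralH_hatM (f 0) (dzbar 1 phi)))).
have disc2 (q : C2 R) : ~~ disc q.2 -> pull2 f q = 0.
  by move=> dq; apply: pull2_eq0; apply/negP => /shear_inH[_ h _ _]; rewrite h in dq.
have ih0 := cintegrable_hat p4 (fL 0); have ih1 := cintegrable_hat p4 (fL 1).
have W1 m b b1 b2 (t : tst m b b1 b2) := weak_dbar1 t i1 i2.
have W2 m b b1 b2 (t : tst m b b1 b2) := weak_dbar2 t ih0 ih1 closed i1 i2 disc2.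
rewrite -/(pull1 f) -/(pull2 f) in W1 W2.
move=> j phi tp; have c1 : Ck1c phi by have [s _ _] := tp; exact: (s 1%N).
have [m tm] := tst_shear tp; rewrite /distr_dzbar /distr_of.
have mJ (w : C2 R) : (normc (cplx w.2) ^+ 2)%:C = cplx w.2 * ((cplx w.2)^*)%R :> R[i] by rewrite -mulcJ.
have [->|->] : j = 0 \/ j = 1.
  by case: j => -[|[|//]] h; [left|right]; apply: val_inj.
(* The first component is tested against $w_2\Phi$, with $\Phi$ the sheared test function: its
   derivative in $\bar w_1$ is $w_2\bar w_2$ times the sheared first Wirtinger derivative. *)
- have [k1 k2] := W1 _ _ _ _ (tstM wirt2_snd tm).
  have E : (fun w : mC2 R => sol (pull1 f) (pull2 f) w * ((normc (cplx w.2) ^+ 2)%:C * dzbar 0 phi (shear w))) =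
      (fun w : mC2 R => sol (pull1 f) (pull2 f) w * (0 * phi (shear w) + cplx w.2 * (((cplx w.2)^*)%R * dzbar 0 phi (shear w)))).
    by apply/funext => w; rewrite mJ mul0r add0r -(mulrA (cplx w.2)).
  rewrite (cint_solH_test m0 m1 c1 tp) E; last exact: k1.
  rewrite k2 opprK (cint_hat_test p4 (fL 0) tp); congr cint; apply/funext => w.
  by rewrite /pull1 mJ; ring.
have tA := tstM wirt2_snd (tstM wirt2_sndJ tm); have tB := tstM wirt2_snd (tstM wirt2_fstJ tm).
have [k1 k2] := W2 _ _ _ _ tA; have [l1 l2] := W1 _ _ _ _ tB.
have [n1 _ _] := cintegrable_tst tA i2; have [n2 _ _] := cintegrable_tst tB i1.
pose S := sol (pull1 f) (pull2 f).
have E : (fun w : mC2 R => S w * ((normc (cplx w.2) ^+ 2)%:C * dzbar 1 phi (shear w))) =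
    (fun w : mC2 R => S w * (0 * (conjc (cplx w.2) * phi (shear w)) + cplx w.2 * (1 * phi (shear w) +
        conjc (cplx w.2) * (((cplx w.1)^*)%R * dzbar 0 phi (shear w) + dzbar 1 phi (shear w)))) -
      S w * (0 * (conjc (cplx w.1) * phi (shear w)) + cplx w.2 * (1 * phi (shear w) +
        conjc (cplx w.1) * (((cplx w.2)^*)%R * dzbar 0 phi (shear w))))).
  by apply/funext => w; rewrite mJ; exact: combine_dbar.
rewrite (cint_solH_test m0 m1 c1 tp) E; last exact: (cintegrableB k1 l1).
rewrite (cintB k1 l1) k2 l2 opprD !opprK.
have L := cintB n1 n2; apply: (etrans (esym L)).
rewrite (cint_hat_test p4 (fL 1) tp).
by congr cint; apply/funext => w; rewrite mJ; exact: combine_data.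
Qed.

Lemma ae_eqH_hat (u v : C2 R -> R[i]) : ae_eqH u v -> ae_eq muC2 setT (hat u) (hat v).
Proof.
apply: filterS => z h _; rewrite /hat; case: ifPn => // zH; apply: h.
by rewrite hartogsE.
Qed.

Lemma energy_ae_eq (p : R) (h k : mC2 R -> R[i]) : cmeas h -> cmeas k -> ae_eq muC2 setT h k -> energy p h = energy p k.
Proof.
move=> mh mk hk.
have M (g : mC2 R -> R[i]) : cmeas g -> measurable_fun setT (fun z : mC2 R => (normc (g z) `^ p)%:E).
  move=> mg; apply/measurable_EFinP; apply: (measurableT_comp (measurable_powR p)); exact: measurable_normc.
apply: ae_eq_integral; [exact: measurableT|exact: M|exact: M|].
by apply: filterS hk => z h' _; rewrite h'.
Qed.

(** A representative chosen in the class of [f] is only known to lie in some $L^q$. Almost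
    everywhere equality gives it the same energy of order [p], so the estimates for [p] apply to
    it. *)
Lemma closedLpH_form_ae_eq (p q : R) f g : 4 <= p -> 4 <= q -> closedLpH_form p f -> closedLpH_form q g ->
  ae_eqH_form f g -> closedLpH_form p g /\ forall j, energy p (hat (f j)) = energy p (hat (g j)).
Proof.
move=> p4 q4 [fL _] [gL gC] fg; have p0 : 0 < p by rewrite (lt_le_trans _ p4).
have E j : energy p (hat (f j)) = energy p (hat (g j)).
  have [mf _] := inLpH_hat p4 (fL j); have [mg _] := inLpH_hat q4 (gL j).
  by apply: (energy_ae_eq _ mf mg); apply: ae_eqH_hat; exact: fg.
split => //; split => // j; have [m1 m2 _] := gL j; split => //.
have [_ _] := fL j; by rewrite (LpnormHE _ p0) (LpnormHE (g j) p0) E.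
Qed.

(** Needed because the operator solves the equation for the chosen representative, while the claim
    concerns the original form. *)
Lemma distr_of_ae_eq (p : R) (u v : C2 R -> R[i]) : 4 <= p -> inLpH p u -> inLpH p v -> ae_eqH u v ->
  distr_eq (distr_of u) (distr_of v).
Proof.
move=> p4 ul vl uv phi [s _ _]; have cphi : ccont phi by exact: (s 0%N).
have [mu _] := inLpH_hat p4 ul; have [mv _] := inLpH_hat p4 vl.
rewrite /distr_of !integralH_hat !hatM; apply: cint_ae_eq.
- by apply: cmeasM => //; exact: ccont_cmeas2.
- by apply: cmeasM => //; exact: ccont_cmeas2.
- by apply: filterS (ae_eqH_hat uv) => z h _; rewrite h.
Qed.

(* The solution only depends on the class of the form for almost everywhere
   equality because it is computed from a representative chosen in that class. *)
Definition ae_class f : set (form01 R) :=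
  [set g | ae_eqH_form f g /\ exists2 p : R, 4 <= p & closedLpH_form p g].
Definition choice_in (P : set (form01 R)) : form01 R :=
  match pselect (exists g, P g) with
  | left h => projT1 (cid h)
  | right _ => fun _ _ => 0
  end.
Definition dbar_op f : C2 R -> R[i] := solH (choice_in (ae_class f)).

Lemma ae_class_choice (p : R) f : 4 <= p -> closedLpH_form p f -> ae_class f (choice_in (ae_class f)).
Proof.
move=> p4 fL; rewrite /choice_in; case: pselect => [h|[]]; first exact: (projT2 (cid h)).
(* The class is never empty on the domain of the operator, so the default form of [choice_in] is not
   reached there. *)
by exists f; split; [move=> j; apply: aeW|exists p].
Qed.

Lemma ae_class_eq f g : ae_eqH_form f g -> ae_class f = ae_class g.
Proof.
move=> fg; apply/seteqP; split => h [e he]; split => // j.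
- by apply: (ae_impl2 _ (fg j) (e j)) => z h1 h2 zH; rewrite -h1// h2.
- by apply: (ae_impl2 _ (fg j) (e j)) => z h1 h2 zH; rewrite h1// h2.
Qed.

Lemma dbar_op_correct (p : R) f : 4 <= p -> closedLpH_form p f ->
  [/\ cmeas (hat (dbar_op f)), dbar_solution (dbar_op f) f & exists g, [/\ dbar_op f = solH g, cmeas (hat (g 0)), cmeas (hat (g 1)) &
    forall j, energy p (hat (f j)) = energy p (hat (g j))]].
Proof.
move=> p4 fL; have := ae_class_choice p4 fL; rewrite /dbar_op; set g := choice_in _ => -[fg [q q4 gL]].
have [gLp E] := closedLpH_form_ae_eq p4 q4 fL gL fg.
have [m0 _] := inLpH_hat p4 (gLp.1 0); have [m1 _] := inLpH_hat p4 (gLp.1 1).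
split; first exact: cmeas_solH.
- move=> j phi tp; rewrite (dbar_solution_solH p4 gLp j tp).
  by rewrite (distr_of_ae_eq p4 (fL.1 j) (gLp.1 j) (fg j) tp).
- by exists g.
Qed.
End solution_operator.

Theorem theorem1p2 (R : realType) :
  exists T : form01 R -> (C2 R -> R[i]),
    (forall (p : R) (f g : form01 R), 4 <= p ->
       closedLpH_form p f -> closedLpH_form p g -> ae_eqH_form f g ->
       ae_eqH (T f) (T g)) /\
    (forall p : R, 4 <= p -> forall f : form01 R, closedLpH_form p f ->
       inLpH p (T f) /\ dbar_solution (T f) f) /\
    (forall p : R, 4 <= p -> exists C : R,
       forall f : form01 R, closedLpH_form p f ->
         (LpnormH p (T f) <= C%:E * LpnormH_form p f)%E).
Proof.
have bound (p : R) : 4 <= p -> exists2 C : R, 0 <= C & forall f : form01 R, closedLpH_form p f ->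
    (LpnormH p (dbar_op f) <= C%:E * LpnormH_form p f)%E.
  move=> p4; have p0 : 0 < p by rewrite (lt_le_trans _ p4).
  have [C C0 h] := @energy_solH R p p4; exists (C `^ p^-1) => [|f fL]; first exact: powR_ge0.
  have [_ _ [g [-> m0 m1 E]]] := dbar_op_correct p4 fL.
  rewrite /LpnormH_form big_ord_recl big_ord1 !LpnormH_energy ?gt_eqF// (LpnormHE _ p0) -poweR_EFin -poweRM; last 2 first.
  - by rewrite lee_fin.
  - by apply: adde_ge0; exact: energy_ge0.
  have -> : lift ord0 ord0 = 1 :> 'I_2 by exact: val_inj.
  apply: gt0_ler_poweR; first by rewrite invr_ge0 ltW.
  - by rewrite in_itv/= leey energy_ge0.
  - rewrite in_itv/= leey andbT; apply: mule_ge0; first by rewrite lee_fin.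
    by apply: adde_ge0; exact: energy_ge0.
  by rewrite !E; exact: h.
exists (@dbar_op R); split; [|split].
- move=> p f g p4 _ _ fg; rewrite /dbar_op (ae_class_eq fg); exact: aeW.
- move=> p p4 f fL; have [mf sf _] := dbar_op_correct p4 fL; split => //.
  have [m1 m2] := hat_cmeas mf; split => //.
  have [C C0 h] := bound p p4; apply: le_lt_trans (h f fL) _.
  (* Membership in $L^p$ is read off from the norm bound, which needs the norm of the form to be
     finite. *)
  have F : (LpnormH_form p f < +oo)%E.
    apply: poweR_lty; rewrite big_ord_recl big_ord1; apply: lte_add_pinfty; apply: poweR_lty.
      by have [] := fL.1 ord0.
    by have [] := fL.1 (lift ord0 ord0).
  have [->|C1] := eqVneq C 0; first by rewrite mul0e.
  by apply: lte_mul_pinfty; rewrite ?lee_fin.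
- by move=> p p4; have [C _ h] := bound p p4; exists C.
Qed.
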